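(* Let $n\ge 1$, $m,l\ge 0$ and let $\mathbf A$ be an $(n,m,l)$-exceptional algebra over an algebraically closed field $\mathbbm k$. Then $\mathbf A$ is (1) representation finite if (a) $m=l=0$; or (b) $l=0$, $m=1$, $n\le 3$; or (c) $l=0$, $2\le m\le 3$, $n=1$; or (d) $m=0$, $l=1$, $n\le 2$; (2) tame if (a) $l=0$, $m=1$, $n=4$; or (b) $l=0$, $m=2$, $n=2$; or (c) $l=0$, $m=4$, $n=1$; or (d) $m=0$, $l=1$, $n=3$; (3) wild in all other cases.
   Context: All algebras are finite-dimensional over the algebraically closed field $\mathbbm k$; for arrows, $\alpha\beta$ denotes the path ''first $\beta$, then $\alpha$''. Gluing two distinct vertices $i,j$ of a quiver with relations $(\Gamma,R)$: identify $i$ and $j$ into one vertex $(ij)$, keeping all arrows, and add to $R$ all products $\alpha\beta$ where either $\alpha$ starts at $i$ and $\beta$ ends at $j$, or $\alpha$ starts at $j$ and $\beta$ ends at $i$. Let $Q$ be a connected quiver of type $\mathrm A$ whose underlying graph is the line $x_m - \dots - x_1 - b - i - a_1 - \dots - a_{n-1} - j - c - y_1 - \dots - y_l$ (for $n=1$ there are no vertices $a_k$, and $i$ is adjacent to $j$). Denote by $\beta$ the arrow between $b$ and $i$, by $\alpha_1$ the arrow between $i$ and $a_1$ (between $i$ and $j$ if $n=1$), by $\alpha_n$ the arrow between $a_{n-1}$ and $j$, by $\gamma$ the arrow between $j$ and $c$. Assume either $\beta:b\to i$, $\alpha_1:a_1\to i$, $\alpha_n:j\to a_{n-1}$, $\gamma:c\to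 j$ (for $n=1$: $\alpha_1:j\to i$), or all of these four arrows are reversed; all other arrows are oriented arbitrarily. The $(n,m,l)$-exceptional algebra is the algebra obtained from the path algebra $\mathbbm k Q$ by gluing the vertices $i$ and $j$ (so $m$ is the number of vertices beyond $b$ on the side of $i$, and $l$ the number beyond $c$ on the side of $j$). *)

(* Defs.v *)
From HB Require Import structures.
From mathcomp Require Import all_boot all_order all_algebra.
Set Implicit Arguments. Unset Strict Implicit. Unset Printing Implicit Defensive.
Import Order.TTheory GRing.Theory Num.Theory.
Local Open Scope ring_scope.

(* qrel a b  means: the path "first b, then a" (written a b) is a relation.  *)
Record bquiver := BQuiver {
  qV : finType;
  qA : finType;
  qs : qA -> qV;
  qt : qA -> qV;
  qrel : qA -> qA -> bool   (* zero relations a*b (first b then a) *)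
}.

Definition lineQ (N : nat) (o : 'I_N -> bool) : bquiver :=
  @BQuiver 'I_N.+1 'I_N
    (fun k => if o k then inord k else inord k.+1)
    (fun k => if o k then inord k.+1 else inord k)
    (fun _ _ => false).

(* Gluing two vertices i, j: the glued vertex is None, all other vertices   *)
(* are kept; all arrows kept; add a*b as relation whenever a starts at i and *)
(* b ends at j, or a starts at j and b ends at i.                            *)
Definition glue_map (Q : bquiver) (i j : qV Q) (v : qV Q)
  : option {x : qV Q | (x != i) && (x != j)} := insub v.

Definition glue (Q : bquiver) (i j : qV Q) : bquiver :=
  @BQuiver (option {x : qV Q | (x != i) && (x != j)}) (qA Q)
    (fun a => glue_map i j (qs a))
    (fun a => glue_map i j (qt a))
    (fun a b => [|| qrel a b,
                    (qs a == i) && (qt b == j) |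
                    (qs a == j) && (qt b == i)]).

(* (n,m,l)-exceptional data.  Line x_m..x_1 b i a_1..a_{n-1} j c y_1..y_l is *)
(* numbered 0..m+n+l+2: x_k = m-k, b = m, i = m+1, a_k = m+1+k, j = m+n+1,   *)
(* c = m+n+2, y_k = m+n+2+k.  Arrows: beta = m, alpha_1 = m+1, alpha_n = m+n,*)
(* gamma = m+n+1.                                                            *)
Definition exc_orientation (n m l : nat) (o : 'I_(m + n + l).+2 -> bool) : Prop :=
  let ob := o (inord m) in
  let oa1 := o (inord m.+1) in
  let oan := o (inord (m + n)) in
  let oc := o (inord (m + n).+1) in
  (* beta: b->i, alpha_1: a_1->i (j->i if n=1), alpha_n: j->a_{n-1}, gamma: c->j *)
  (ob && ~~ oa1 && ~~ oan && ~~ oc) \/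
  (~~ ob && oa1 && oan && oc).

Definition exc_alg (n m l : nat) (o : 'I_(m + n + l).+2 -> bool) : bquiver :=
  glue (Q := lineQ o) (inord m.+1) (inord (m + n).+1).

(* Finite-dimensional representations of a bound quiver (equivalently,       *)
(* finite-dimensional modules over kQ/I), given on R^N by orthogonal         *)
(* idempotents e v (projections on the vertex spaces) and arrow maps X a     *)
(* (row-vector convention: x |-> x *m X a).                                  *)
Definition rep_ax (Q : bquiver) (R : nzRingType) (N : nat)
  (e : qV Q -> 'M[R]_N) (X : qA Q -> 'M[R]_N) : Prop :=
  [/\ forall v, e v *m e v = e v,
      forall v w, v != w -> e v *m e w = 0,
      \sum_(v : qV Q) e v = 1%:M,
      forall a, X a = e (qs a) *m X a *m e (qt a)
    & forall a b, qrel a b -> X b *m X a = 0].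

Record rep (Q : bquiver) (K : fieldType) := Rep {
  rdim : nat;
  re : qV Q -> 'M[K]_rdim;
  rX : qA Q -> 'M[K]_rdim
}.

Definition is_rep (Q : bquiver) (K : fieldType) (M : rep Q K) : Prop :=
  rep_ax (re M) (rX M).

Definition is_hom (Q : bquiver) (K : fieldType) (M M' : rep Q K)
  (P : 'M[K]_(rdim M, rdim M')) : Prop :=
  (forall v, re M v *m P = P *m re M' v) /\
  (forall a, rX M a *m P = P *m rX M' a).

Definition rep_iso (Q : bquiver) (K : fieldType) (M M' : rep Q K) : Prop :=
  exists (P : 'M[K]_(rdim M, rdim M')) (P' : 'M[K]_(rdim M', rdim M)),
    [/\ is_hom P, P *m P' = 1%:M & P' *m P = 1%:M].

Definition indec (Q : bquiver) (K : fieldType) (M : rep Q K) : Prop :=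
  (0 < rdim M)%N /\
  forall P : 'M[K]_(rdim M, rdim M), is_hom P -> P *m P = P ->
    P = 0 \/ P = 1%:M.

Definition rep_finite (K : fieldType) (Q : bquiver) : Prop :=
  exists (k : nat) (F : 'I_k -> rep Q K),
    (forall i, is_rep (F i)) /\
    forall M : rep Q K, is_rep M -> indec M -> exists i, rep_iso M (F i).

(* specialization K[x]/(x - lam) (x)_{K[x]} - of a K[x]-A-bimodule, free of  *)
(* rank d over K[x], given by polynomial matrices *)
Definition spec_rep (Q : bquiver) (K : fieldType) (d : nat)
  (Pe : qV Q -> 'M[{poly K}]_d) (PX : qA Q -> 'M[{poly K}]_d) (lam : K)
  : rep Q K :=
  @Rep Q K d (fun v => map_mx (fun p => p.[lam]) (Pe v))
             (fun a => map_mx (fun p => p.[lam]) (PX a)).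

(* Drozd / Crawley-Boevey tameness: for each dimension d, all but finitely   *)
(* many isoclasses of indecomposables of dimension d lie in finitely many    *)
(* one-parameter families given by K[x]-A-bimodules free of finite rank      *)
Definition tame (K : fieldType) (Q : bquiver) : Prop :=
  forall d : nat,
  exists (k : nat) (Pe : 'I_k -> qV Q -> 'M[{poly K}]_d)
         (PX : 'I_k -> qA Q -> 'M[{poly K}]_d)
         (k' : nat) (G : 'I_k' -> rep Q K),
    (forall i, rep_ax (Pe i) (PX i)) /\
    forall M : rep Q K, is_rep M -> indec M -> rdim M = d ->
      (exists i, rep_iso M (G i)) \/
      (exists i lam, rep_iso M (spec_rep (Pe i) (PX i) lam)).

Inductive ncexpr (K : Type) :=
  | NCc of K | NCx | NCy
  | NCadd of ncexpr K & ncexpr K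
  | NCmul of ncexpr K & ncexpr K.

Fixpoint nceval (K : fieldType) (s : nat) (X Y : 'M[K]_s) (p : ncexpr K)
  : 'M[K]_s :=
  match p with
  | NCc c => c%:M
  | NCx => X
  | NCy => Y
  | NCadd p q => nceval X Y p + nceval X Y q
  | NCmul p q => nceval X Y p *m nceval X Y q
  end.

(* f.d. K<x,y>-modules = representations of the two-loop quiver *)
Definition loop2 : bquiver :=
  @BQuiver unit bool (fun _ => tt) (fun _ => tt) (fun _ _ => false).

Definition kxy_mod (K : fieldType) (s : nat) (X Y : 'M[K]_s) : rep loop2 K :=
  @Rep loop2 K s (fun _ => 1%:M) (fun b => if b then X else Y).

Definition ncsubst (K : fieldType) (r s : nat) (P : 'I_r -> 'I_r -> ncexpr K)
  (X Y : 'M[K]_s) : 'M[K]_(\sum_(i < r) s) :=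
  \mxblock_(i < r, j < r) nceval X Y (P i j).

(* the functor M (x)_{K<x,y>} - for a A-K<x,y>-bimodule M free of rank r    *)
(* over K<x,y>, where the A-action is given by r x r matrices over K<x,y>   *)
Definition nc_functor (K : fieldType) (Q : bquiver) (r : nat)
  (Pe : qV Q -> 'I_r -> 'I_r -> ncexpr K) (PX : qA Q -> 'I_r -> 'I_r -> ncexpr K)
  (s : nat) (X Y : 'M[K]_s) : rep Q K :=
  @Rep Q K (\sum_(i < r) s) (fun v => ncsubst (Pe v) X Y)
                            (fun a => ncsubst (PX a) X Y).

(* wildness: a representation embedding from f.d. K<x,y>-modules, i.e.     *)
(* the functor preserves indecomposability and reflects isomorphism        *)
Definition wild (K : fieldType) (Q : bquiver) : Prop :=
  exists (r : nat) (Pe : qV Q -> 'I_r -> 'I_r -> ncexpr K)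
         (PX : qA Q -> 'I_r -> 'I_r -> ncexpr K),
  [/\ forall s (X Y : 'M[K]_s), is_rep (nc_functor Pe PX X Y),
      forall s (X Y : 'M[K]_s), indec (kxy_mod X Y) ->
                                indec (nc_functor Pe PX X Y)
    & forall s (X Y : 'M[K]_s) s' (X' Y' : 'M[K]_s'),
        rep_iso (nc_functor Pe PX X Y) (nc_functor Pe PX X' Y') ->
        rep_iso (kxy_mod X Y) (kxy_mod X' Y')].

(* Main.v *)
(* By transposition we may assume b -> i, a_1 -> i, j -> a_{n-1}, c -> j.  Split
   the space at the glued vertex as U + W with U = ker alpha_n.  Apart from
   finitely many interval modules, an indecomposable amounts to U with vectors
   labelled by three chains, i.e. to a representation of the star with arms of
   m+1, l+1 and n+l+1 vertices, and the type is read off from the Tits form q.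

   Finite: q is positive and indecomposables are rigid bricks (Ringel).
   Wild: the star exceeds E6~, E7~ or E8~ by one vertex of an arm; the family
   S(Theta) of dimension delta (x) V with Theta = [[X, 1], [Y, 0]], together with
   the first half of V as the extra subspace, embeds the modules (X, Y).
   Tame (E7~, E8~): the defect <delta, -> gives a torsion pair, indecomposables of
   nonzero defect are rigid, and those of defect 0 are uniserial in regular
   simples.  A simple regular occurring in a regular object of dimension delta has
   a unique Ext-successor, lying in a finite cycle; any other is orthogonal to
   enough explicit regular objects to have q = 0, hence is some S(lambda). *)

Require Import Defs.
From HB Require Import structures.
From mathcomp Require Import all_boot all_order all_algebra.
From mathcomp Require Import zify ring lra.
From Stdlib Require Import Classical ClassicalEpsilon FunctionalExtensionality.
Set Implicit Arguments. Unset Strict Implicit. Unset Printing Implicit Defensive.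
Import Order.TTheory GRing.Theory Num.Theory.
Local Open Scope ring_scope.

(** * Representations and homomorphisms *)

(** Passing from star data to modules is faithful but not full: after gluing, an interval attached
    by alpha_1 can run through the glued vertex and beyond, so it shares vertices with U and with
    the intervals attached by gamma. Finiteness and tameness use only what survives: isomorphic star
    data give isomorphic modules, and an indecomposable module has indecomposable star data.
    Wildness and infiniteness need the converse, proved only for data whose vectors are linearly
    independent on each arm: there the component on U is multiplicative, and an endomorphism
    vanishing on U has square zero.

    The orientation of the arms disappears because the intervals with a fixed attached end are
    totally ordered by the maps that are nonzero at this end; only the lengths of the arms matter.

    The arguments rest on the Euler form, on Ringel's lemma about indecomposables that are not
    bricks, and on integer tables of regular subobjects, valid in every characteristic because
    injectivity is certified by integral right inverses. *)

Notation hom M N := (@is_hom _ _ M N).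

Definition wit (T : Type) (P : T -> Prop) (h : exists x, P x) : T :=
  proj1_sig (constructive_indefinite_description P h).

Lemma witP (T : Type) (P : T -> Prop) (h : exists x, P x) : P (wit h).
Proof. exact: proj2_sig (constructive_indefinite_description P h). Qed.

Section Reps.
Variables (Q : bquiver) (K : fieldType).
Implicit Types L M N X Z I : rep Q K.

Lemma hom_id M : hom M M 1%:M.
Proof. by split=> i; rewrite mul1mx mulmx1. Qed.

Lemma hom_comp L M N P R : hom L M P -> hom M N R -> hom L N (P *m R).
Proof.
move=> [h1 h2] [h3 h4]; split=> i.
  by rewrite mulmxA h1 -mulmxA h3 mulmxA.
by rewrite mulmxA h2 -mulmxA h4 mulmxA.
Qed.

Lemma hom_0 M N : hom M N 0.
Proof. by split=> i; rewrite mul0mx mulmx0. Qed.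

Lemma hom_add M N P R : hom M N P -> hom M N R -> hom M N (P + R).
Proof. by move=> [h1 h2] [h3 h4]; split=> i; rewrite mulmxDr mulmxDl ?h1 ?h3 ?h2 ?h4. Qed.

Lemma hom_scale M N a P : hom M N P -> hom M N (a *: P).
Proof. by move=> [h1 h2]; split=> i; rewrite -scalemxAr -scalemxAl ?h1 ?h2. Qed.

Lemma hom_sub M N P R : hom M N P -> hom M N R -> hom M N (P - R).
Proof. by move=> h1 h2; rewrite -scaleN1r; apply: hom_add => //; apply: hom_scale. Qed.

Lemma hom_injK L Z X B P :
  hom Z X B -> row_free B -> hom L X (P *m B) -> hom L Z P.
Proof.
move=> [h1 h2] /row_free_inj fB [h3 h4]; split=> i; apply: fB.
  by rewrite -!mulmxA h3 h1 !mulmxA.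
by rewrite -!mulmxA h4 h2 !mulmxA.
Qed.

Lemma hom_surjK X I L c P :
  hom X I c -> row_full c -> hom X L (c *m P) -> hom I L P.
Proof.
move=> [h1 h2] /row_full_inj fc [h3 h4]; split=> i; apply: fc.
  by rewrite !mulmxA -h1 -mulmxA h3.
by rewrite !mulmxA -h2 -mulmxA h4.
Qed.

Lemma hom_inv M N P P' :
  hom M N P -> P *m P' = 1%:M -> P' *m P = 1%:M -> hom N M P'.
Proof.
move=> [h1 h2] e1 e2; split=> i.
  by rewrite -[RHS]mulmx1 -e1 mulmxA -(mulmxA P') h1 !mulmxA e2 mul1mx.
by rewrite -[RHS]mulmx1 -e1 mulmxA -(mulmxA P') h2 !mulmxA e2 mul1mx.
Qed.

Lemma iso_sym M N : rep_iso M N -> rep_iso N M.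
Proof. by move=> [P [P' [h e1 e2]]]; exists P', P; split=> //; apply: hom_inv e1 e2. Qed.

Lemma iso_trans L M N : rep_iso L M -> rep_iso M N -> rep_iso L N.
Proof.
move=> [P [P' [h e1 e2]]] [R [R' [k f1 f2]]]; exists (P *m R), (R' *m P'); split.
- exact: hom_comp h k.
- by rewrite mulmxA -(mulmxA P) f1 mulmx1.
- by rewrite mulmxA -(mulmxA R') e2 mulmx1.
Qed.

Lemma iso_bij M N P : hom M N P -> row_free P -> row_full P -> rep_iso M N.
Proof. by move=> h f1 f2; exists P, (pinvmx P); split; rewrite ?mulmxVp ?mulVpmx. Qed.

Lemma iso_free M N P : hom M N P -> row_free P -> rdim M = rdim N -> rep_iso M N.
Proof. by move=> h f e; apply: (iso_bij h); rewrite // /row_full (eqP f) e. Qed.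

Lemma iso_full M N P : hom M N P -> row_full P -> rdim M = rdim N -> rep_iso M N.
Proof. by move=> h f e; apply: (iso_bij h); rewrite // /row_free (eqP f) e. Qed.

Lemma iso_dim M N : rep_iso M N -> rdim M = rdim N.
Proof.
move=> [P [P' [_ e1 e2]]]; apply/eqP; rewrite eqn_leq; apply/andP; split.
  by rewrite -{1}(mxrank1 K (rdim M)) -e1 (leq_trans (mxrankM_maxl _ _)) ?rank_leq_col.
by rewrite -{1}(mxrank1 K (rdim N)) -e2 (leq_trans (mxrankM_maxl _ _)) ?rank_leq_col.
Qed.

Lemma rep_inj Z X B : hom Z X B -> row_free B -> is_rep X -> is_rep Z.
Proof.
move=> [h1 h2] /row_free_inj fB [a1 a2 a3 a4 a5]; split.
- by move=> v; apply: fB; rewrite -mulmxA h1 mulmxA h1 -mulmxA a1.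
- by move=> v w /a2 e; apply: fB; rewrite -mulmxA h1 mulmxA h1 -mulmxA e mulmx0 mul0mx.
- apply: fB; rewrite mul1mx mulmx_suml (eq_bigr (fun v => B *m re X v)) //.
  by rewrite -mulmx_sumr a3 mulmx1.
- move=> a; apply: fB; rewrite -[RHS]mulmxA h1 [RHS]mulmxA -(mulmxA (re Z _)) !h2.
  by rewrite !mulmxA h1 {1}a4 !mulmxA.
- by move=> a b /a5 e; apply: fB; rewrite -mulmxA h2 mulmxA h2 -mulmxA e mulmx0 mul0mx.
Qed.

Lemma rep_surj X I c : hom X I c -> row_full c -> is_rep X -> is_rep I.
Proof.
move=> [h1 h2] /row_full_inj fB [a1 a2 a3 a4 a5]; split.
- by move=> v; apply: fB; rewrite mulmxA -h1 -mulmxA -h1 mulmxA a1.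
- by move=> v w /a2 e; apply: fB; rewrite mulmxA -h1 -mulmxA -h1 mulmxA e mulmx0 mul0mx.
- apply: fB; rewrite mulmx1 mulmx_sumr (eq_bigr (fun v => re X v *m c)) //.
  by rewrite -mulmx_suml a3 mul1mx.
- move=> a; apply: fB; rewrite !mulmxA -h1 -(mulmxA _ c) -!h2 -!mulmxA -h1.
  by rewrite {1}a4 !mulmxA.
- by move=> a b /a5 e; apply: fB; rewrite mulmxA -h2 -mulmxA -h2 mulmxA e mulmx0 mul0mx.
Qed.

Lemma iso_rep M N : rep_iso M N -> is_rep M -> is_rep N.
Proof.
move=> [P [P' [h e1 e2]]]; apply: rep_surj h _.
by apply/row_fullP; exists P'.
Qed.

Lemma iso_indec M N : rep_iso M N -> indec M -> indec N.
Proof.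
move=> MN [M0 Md]; split; first by rewrite -(iso_dim MN).
move: MN => [P [P' [h e1 e2]]] R hR RR.
have h' := hom_inv h e1 e2.
have [||e|e] := Md (P *m R *m P').
- exact: hom_comp (hom_comp h hR) h'.
- by rewrite !mulmxA -(mulmxA _ P') e2 mulmx1 -(mulmxA P) RR.
- left; rewrite -[R]mul1mx -[_ *m R]mulmx1 -e2.
  by rewrite !mulmxA -(mulmxA P') -(mulmxA P') e mulmx0 mul0mx.
right; rewrite -[R]mul1mx -[_ *m R]mulmx1 -e2.
by rewrite !mulmxA -(mulmxA P') -(mulmxA P') e mulmx1.
Qed.

Definition stab X k (B : 'M[K]_(k, rdim X)) : Prop :=
  (forall v, (B *m re X v <= B)%MS) /\ (forall a, (B *m rX X a <= B)%MS).

Lemma stab_eqmx X k k' (B : 'M_(k, rdim X)) (B' : 'M_(k', rdim X)) :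
  (B :=: B')%MS -> stab B -> stab B'.
Proof.
move=> e [h1 h2]; split=> i; rewrite -e.
  by rewrite -(eqmxMr (re X i) e).
by rewrite -(eqmxMr (rX X i) e).
Qed.

Lemma stab_hom M N P : hom M N P -> stab P.
Proof. by move=> [h1 h2]; split=> i; rewrite -?h1 -?h2 submxMl. Qed.

Lemma stab_ker M N P : hom M N P -> stab (kermx P).
Proof.
move=> [h1 h2]; split=> i; apply/sub_kermxP; rewrite -mulmxA ?h1 ?h2 mulmxA.
  by rewrite mulmx_ker mul0mx.
by rewrite mulmx_ker mul0mx.
Qed.

Lemma stab_add X k k' (B : 'M_(k, rdim X)) (B' : 'M_(k', rdim X)) :
  stab B -> stab B' -> stab (B + B')%MS.
Proof.
by move=> [h1 h2] [h3 h4]; split=> i; rewrite addsmxMr addsmxS.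
Qed.

Lemma stab_cap X k k' (B : 'M_(k, rdim X)) (B' : 'M_(k', rdim X)) :
  stab B -> stab B' -> stab (B :&: B')%MS.
Proof.
move=> [h1 h2] [h3 h4]; split=> i; rewrite sub_capmx; apply/andP; split.
- by apply: submx_trans (h1 i); rewrite submxMr ?capmxSl.
- by apply: submx_trans (h3 i); rewrite submxMr ?capmxSr.
- by apply: submx_trans (h2 i); rewrite submxMr ?capmxSl.
- by apply: submx_trans (h4 i); rewrite submxMr ?capmxSr.
Qed.

Lemma stab_sub X k (B : 'M_(k, rdim X)) : stab B ->
  exists Z (b : 'M_(rdim Z, rdim X)), [/\ hom Z X b, row_free b & (b :=: B)%MS].
Proof.
move=> /(stab_eqmx (eqmx_sym (eq_row_base B))) [s1 s2].
pose b := row_base B.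
exists (@Rep Q K _ (fun v => b *m re X v *m pinvmx b) (fun a => b *m rX X a *m pinvmx b)), b.
split; [split=> i /= | exact: row_base_free | exact: eq_row_base].
  by rewrite mulmxKpV.
by rewrite mulmxKpV.
Qed.

Lemma stab_quo X k (B : 'M_(k, rdim X)) : stab B ->
  exists I (c : 'M_(rdim X, rdim I)), [/\ hom X I c, row_full c & (kermx c :=: B)%MS].
Proof.
move=> [s1 s2].
have [r [c [R [fc fR ec]]]] : exists r (c : 'M_(rdim X, r)) (R : 'M_(r, rdim X)),
    [/\ row_full c, row_free R & c *m R = cokermx B].
  exists _, (col_base (cokermx B)), (row_base (cokermx B)).
  by rewrite col_base_full row_base_free mulmx_base.
have ker : (kermx c :=: B)%MS.
  apply/eqmxP; apply/andP; split.
    by rewrite submxE -ec mulmxA mulmx_ker mul0mx.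
  apply/sub_kermxP; apply: (row_free_inj fR).
  by rewrite -mulmxA ec mulmx_coker mul0mx.
(* [pinvmx c] is a linear section of c. As Y maps the kernel B of c into itself, the map induced on
   the quotient does not depend on the section. *)
have key (Y : 'M[K]_(rdim X)) : (B *m Y <= B)%MS -> Y *m c = c *m (pinvmx c *m Y *m c).
  move=> /submxP [E eE].
  have : (1%:M - c *m pinvmx c <= kermx c)%MS.
    by apply/sub_kermxP; rewrite mulmxBl mul1mx -mulmxA mulVpmx // mulmx1 subrr.
  rewrite ker => /submxP [D /eqP]; rewrite subr_eq => /eqP eD.
  have Bc : B *m c = 0 by apply/sub_kermxP; rewrite ker.
  rewrite -[Y in LHS]mul1mx eD !mulmxDl -(mulmxA D) eE -!mulmxA Bc !mulmx0 add0r.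
  by rewrite !mulmxA.
exists (@Rep Q K _ (fun v => pinvmx c *m re X v *m c) (fun a => pinvmx c *m rX X a *m c)), c.
by split=> //; split=> i /=; apply: key.
Qed.

Lemma hom_image M N P : hom M N P ->
  exists I (c : 'M_(rdim M, rdim I)) (b : 'M_(rdim I, rdim N)),
  [/\ hom M I c, hom I N b, row_full c, row_free b & P = c *m b].
Proof.
move=> hP; have [I [b [hb fb eb]]] := stab_sub (stab_hom hP).
have [c Pc] : exists c, P = c *m b by apply/submxP; rewrite eb.
exists I, c, b; split=> //.
  by apply: hom_injK hb fb _; rewrite -Pc.
rewrite /row_full -(mxrankMfree c fb) -Pc -eb.
by rewrite (eqP (fb : \rank b == _)).
Qed.

(** * Short exact sequences *)

Definition exact Z X I (k : 'M_(rdim Z, rdim X)) (c : 'M_(rdim X, rdim I)) :=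
  [/\ hom Z X k, hom X I c, row_free k, row_full c & (kermx c :=: k)%MS].

Lemma exact_sub Z X k : hom Z X k -> row_free k ->
  exists I (c : 'M_(rdim X, rdim I)), @exact Z X I k c.
Proof.
move=> hk fk; have [I [c [hc fc e]]] := stab_quo (stab_hom hk).
by exists I, c.
Qed.

Lemma exact_quo X I c : hom X I c -> row_full c ->
  exists Z (k : 'M_(rdim Z, rdim X)), @exact Z X I k c.
Proof.
move=> hc fc; have [Z [k [hk fk e]]] := stab_sub (stab_ker hc).
by exists Z, k; split=> //; apply: eqmx_sym.
Qed.

Lemma exact_comp0 Z X I k c : @exact Z X I k c -> k *m c = 0.
Proof. by move=> [_ _ _ _ e]; apply/sub_kermxP; rewrite e. Qed.

Lemma exact_factor Z X I k c m (P : 'M_(m, rdim X)) :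
  @exact Z X I k c -> P *m c = 0 -> exists R, P = R *m k.
Proof. by move=> [_ _ _ _ e] /sub_kermxP; rewrite e => /submxP. Qed.

Lemma exact_factor_hom Z X I k c L P :
  @exact Z X I k c -> hom L X P -> P *m c = 0 -> exists2 R, hom L Z R & P = R *m k.
Proof.
move=> ex hP /(exact_factor ex) [R e]; exists R => //.
by case: ex => hk _ fk _ _; apply: (hom_injK hk fk); rewrite -e.
Qed.

Lemma exact_cofactor Z X I k c m (P : 'M_(rdim X, m)) :
  @exact Z X I k c -> k *m P = 0 -> P = c *m (pinvmx c *m P).
Proof.
move=> [_ _ _ fc e] kP; apply/eqP; rewrite mulmxA -subr_eq0 -{1}[P]mul1mx -mulmxBl.
have : (1%:M - c *m pinvmx c <= k)%MS.
  by rewrite -e; apply/sub_kermxP; rewrite mulmxBl mul1mx -mulmxA mulVpmx // mulmx1 subrr.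
by move=> /submxP [D ->]; rewrite -mulmxA kP mulmx0.
Qed.

Lemma exact_cofactor_hom Z X I k c L P :
  @exact Z X I k c -> hom X L P -> k *m P = 0 -> exists2 R, hom I L R & P = c *m R.
Proof.
move=> ex hP /(exact_cofactor ex) e; exists (pinvmx c *m P) => //.
by case: ex => _ hc _ fc _; apply: (hom_surjK hc fc); rewrite -e.
Qed.

Definition dm M (v : qV Q) : nat := \rank (re M v).

Lemma iso_dm M N : rep_iso M N -> dm M =1 dm N.
Proof.
move=> [P [P' [[h _] e1 e2]]] v; rewrite /dm.
have fP : row_free P by apply/row_freeP; exists P'.
have fP' : row_full P by apply/row_fullP; exists P'.
by rewrite -(mxrankMfree _ fP) h (eqmxMfull _ fP').
Qed.

Lemma exact_dm Z X I k c v : is_rep X -> @exact Z X I k c -> dm X v = (dm Z v + dm I v)%N.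
Proof.
move=> [a1 _ _ _ _] [[hk _] [hc _] fk fc e].
rewrite /dm -(mxrank_mul_ker (re X v) c) hc (eqmxMfull _ fc) addnC; congr addn.
rewrite -(mxrankMfree (re Z v) fk).
apply/eqmx_rank/andP; split.
  have /submxP [D eD] : (re X v :&: kermx c <= k)%MS by rewrite -e capmxSr.
  have : (re X v :&: kermx c <= re X v)%MS by apply: capmxSl.
  move=> /submxP [E eE].
  have -> : (re X v :&: kermx c)%MS = (re X v :&: kermx c)%MS *m re X v.
    by rewrite {2}eE -mulmxA a1 -eE.
  by rewrite eD -mulmxA -hk submxMl.
rewrite sub_capmx e submxMl andbT hk.
exact: submxMl.
Qed.

Lemma rdim_sum M : is_rep M -> rdim M = (\sum_v dm M v)%N.
Proof.
move=> [a1 a2 a3 _ _].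
have d : mxdirect (\sum_v re M v)%MS.
  apply/mxdirect_sumsP => v _; set S := (\sum_(j | _) _)%MS.
  have z : (S *m re M v <= (0 : 'M[K]_(rdim M)))%MS.
    rewrite sumsmxMr; apply/sumsmx_subP => w wv.
    by rewrite a2 ?sub0mx //.
  have /submxP [D eD] := capmxSl (re M v) S.
  apply/eqP; rewrite -submx0; apply: submx_trans z.
  by rewrite {1}eD -{1}a1 mulmxA -eD submxMr ?capmxSr.
rewrite -[LHS](mxrank1 K); have /mxdirectP /= <- := d.
apply: eqmx_rank; rewrite submx1 andbT -a3.
by apply: summx_sub => v _; rewrite (sumsmx_sup v).
Qed.

End Reps.

Lemma nat_min (P : nat -> Prop) :
  (exists n, P n) -> exists2 n, P n & forall m, P m -> (n <= m)%N.
Proof.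
move=> [n]; elim/ltn_ind: n => n IH Pn.
have [[m [mn Pm]]|no] := classic (exists m, (m < n)%N /\ P m); first exact: IH mn Pm.
by exists n => // m Pm; rewrite leqNgt; apply/negP => mn; apply: no; exists m.
Qed.

Lemma nat_max (P : nat -> Prop) b :
  (exists n, P n) -> (forall n, P n -> (n <= b)%N) ->
  exists2 n, P n & forall m, P m -> (m <= n)%N.
Proof.
move=> [n Pn] Pb; have [|m [k Pk ->] mmin] := @nat_min (fun m => exists2 k, P k & m = b - k)%N.
  by exists (b - n)%N, n.
exists k => // j Pj.
have := mmin (b - j)%N (ex_intro2 _ _ j Pj erefl); have := Pb j Pj; have := Pb k Pk; lia.
Qed.

(** * Fitting decompositions and indecomposable summands *)

Section Fitting.
Variable (K : fieldType).

(** Write the characteristic polynomial as X^m g with g prime to X and u X^m + w g = 1. Then E = (u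
    X^m)(P) is the projection onto the part where P is invertible. Being a polynomial in P, it
    commutes with whatever commutes with P, so it is an endomorphism of a representation as soon as
    P is. *)
Lemma fitting_mx n (P : 'M[K]_n) : exists E : 'M[K]_n,
  [/\ E *m E = E, forall A, P *m A = A *m P -> E *m A = A *m E,
      E = 1%:M -> P \in unitmx & E = 0 -> exists k, iter k (mulmx P) 1%:M = 0].
Proof.
case: n P => [|n] P.
  exists 0; split; rewrite ?mul0mx //.
  - by move=> A _; rewrite mulmx0 mul0mx.
  - by rewrite unitmxE det_mx00 unitr1.
  - by exists 0%N => /=; apply/matrixP; case.
have [m [g gr e]] := multiplicity_XsubC (char_poly P) 0.
rewrite monic_neq0 ?char_poly_monic //= in gr.
rewrite subr0 in e.
have cop : coprimep ('X^m : {poly K}) g.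
  by apply: coprimep_expl; rewrite coprimep_sym -['X]subr0 -polyC0 coprimep_XsubC.
have /Bezout_eq1_coprimepP [[u w] /= uw] := cop.
have CH : horner_mx P ('X^m * g) = 0 by rewrite mulrC -e Cayley_Hamilton.
have iterE k : iter k (mulmx P) 1%:M = horner_mx P 'X^k.
  by elim: k => [|k IH]; rewrite ?expr0 ?rmorph1 // iterS IH exprS rmorphM /= horner_mx_X.
pose E := horner_mx P (u * 'X^m); exists E; split.
- rewrite /E mulmxE -rmorphM /=.
  have -> : u * 'X^m * (u * 'X^m) = u * 'X^m - u * w * ('X^m * g).
    have ux : u * 'X^m = 1 - w * g by rewrite -uw addrK.
    by rewrite {2}ux; ring.
  rewrite rmorphB /=; have -> : horner_mx P (u * w * ('X^m * g)) = 0.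
    by rewrite rmorphM /= CH mulr0.
  by rewrite subr0.
- by move=> A cA; apply: comm_horner_mx.
- case: m => [|m] in e cop uw CH E *.
    move=> _; rewrite -row_free_unit -kermx_eq0; apply: contraNT gr => k0.
    by move: e; rewrite expr0 mulr1 => <-; rewrite -eigenvalue_root_char /eigenvalue
      /eigenspace raddf0 subr0.
  rewrite /E exprS mulrCA rmorphM /= horner_mx_X => e1.
  by have [] := mulmx1_unit e1.
- move=> E0; exists m; rewrite iterE.
  have h : horner_mx P (w * g) = 1%:M.
    by rewrite -[LHS]add0r -[X in X + _]E0 -rmorphD /= uw rmorph1.
  by rewrite -[LHS]mulr1 -[1]h -rmorphM /= mulrCA rmorphM /= CH mulr0.
Qed.

End Fitting.

Section Indec.
Variables (Q : bquiver) (K : fieldType).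
Implicit Types L M N X Z I : rep Q K.

Lemma hom_comm M P E : hom M M P ->
  (forall A, P *m A = A *m P -> E *m A = A *m E) -> hom M M E.
Proof. by move=> [h1 h2] c; split=> i; rewrite c. Qed.

Lemma indec_fitting M P : indec M -> hom M M P ->
  P \in unitmx \/ exists k, iter k (mulmx P) 1%:M = 0.
Proof.
move=> [_ Md] hP; have [E [EE cE E1 E0]] := fitting_mx P.
by have [/E0|/E1] := Md E (hom_comm hP cE) EE; [right|left].
Qed.

Definition brick M := (0 < rdim M)%N /\
  forall P, hom M M P -> P <> 0 -> P \in unitmx.

(** A nontrivial idempotent P splits X, and f survives composition with P or with 1 - P; induction
    on the dimension applies to the image of the idempotent that was chosen. *)
Lemma indec_factor L X f : hom L X f -> f <> 0 ->
  exists Y (i : 'M_(rdim Y, rdim X)) (p : 'M_(rdim X, rdim Y)),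
  [/\ indec Y, hom Y X i, hom X Y p, i *m p = 1%:M & f *m p <> 0].
Proof.
have [n] := ubnP (rdim X); elim: n => // n IH in L X f *; rewrite ltnS => Xn hf f0.
have [iX|] := classic (indec X).
  by exists X, 1%:M, 1%:M; split; rewrite ?mulmx1 //; exact: hom_id.
have X0 : (0 < rdim X)%N.
  by rewrite lt0n; apply/negP => /eqP e; case: f0; apply/matrixP => i j; by have := leq_trans (ltn_ord j) (eq_leq e).
move=> ni; have [P nP] : exists P, ~ (hom X X P -> P *m P = P -> P = 0 \/ P = 1%:M).
  by apply: not_all_ex_not => h; apply: ni.
case: (imply_to_and _ _ nP) => hP nP'; case: (imply_to_and _ _ nP') => PP n01.
have P0 : P <> 0 by move=> e; apply: n01; left.
have P1 : P <> 1%:M by move=> e; apply: n01; right.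
suff [E [hE EE fE E1]] : exists E, [/\ hom X X E, E *m E = E, f *m E <> 0 & E <> 1%:M].
  have [Y [c [b [hc hb fc fb Ecb]]]] := hom_image hE.
  have bc : b *m c = 1%:M.
    apply: (row_full_inj fc); apply: (row_free_inj fb).
    by rewrite mulmx1 -Ecb mulmxA -(mulmxA _ c b) -!Ecb EE.
  have Yn : (rdim Y < rdim X)%N.
    rewrite -(eqP (fc : \rank c == _)) ltn_neqAle rank_leq_row andbT.
    apply/negP => fr; apply: E1; have fr' : row_free c by [].
    by apply: (row_free_inj fr'); rewrite mul1mx Ecb -mulmxA bc mulmx1.
  have fc0 : f *m c <> 0 by move=> e; apply: fE; rewrite Ecb mulmxA e mul0mx.
  have [Z [i [p [iZ hi hp ip fp]]]] := IH _ _ _ (leq_trans Yn Xn) (hom_comp hf hc) fc0.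
  exists Z, (i *m b), (c *m p); split=> //.
  - exact: hom_comp hi hb.
  - exact: hom_comp hc hp.
  - by rewrite mulmxA -(mulmxA i) bc mulmx1.
  - by rewrite mulmxA.
have [e|] := classic (f *m P = 0); last by exists P.
exists (1%:M - P); split.
- exact: hom_sub (hom_id _) hP.
- by rewrite mulmxBl mul1mx mulmxBr mulmx1 PP subrr subr0.
- by rewrite mulmxBr mulmx1 e subr0.
- by move=> /eqP; rewrite -subr_eq0 addrC addKr oppr_eq0 => /eqP.
Qed.

End Indec.

Lemma brick_scalar (Q : bquiver) (K : closedFieldType) (M : rep Q K) P :
  brick M -> hom M M P -> exists a, P = a%:M.
Proof.
move=> [M0 b] hP.
have [a ra] : exists a, root (char_poly P) a.
  by apply: closed_rootP; rewrite size_char_poly -lt0n.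
exists a; apply: NNPP => ne.
have h : hom M M (P - a%:M).
  by rewrite -scalemx1; apply: hom_sub => //; apply: hom_scale; exact: hom_id.
have : P - a%:M \in unitmx.
  by apply: b h _ => /eqP; rewrite subr_eq0 => /eqP.
rewrite -row_free_unit -kermx_eq0; apply/negP.
by move: ra; rewrite -eigenvalue_root_char.
Qed.

(** * Extensions and the Euler form *)

Section Graded.
Variables (Q : bquiver) (K : fieldType).
Implicit Types L M N X Z I : rep Q K.

Definition grad M N (P : 'M[K]_(rdim M, rdim N)) : Prop :=
  forall v, re M v *m P = P *m re N v.

Definition gpr M N (P : 'M[K]_(rdim M, rdim N)) : 'M[K]_(rdim M, rdim N) :=
  \sum_v re M v *m P *m re N v.

Definition cocyc M N (h : qA Q -> 'M[K]_(rdim M, rdim N)) : Prop :=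
  forall a, h a = re M (qs a) *m h a *m re N (qt a).

Definition cobd M N (P : 'M[K]_(rdim M, rdim N)) (a : qA Q) :=
  rX M a *m P - P *m rX N a.

(** Vanishing of Ext^1 over the path algebra: the standard two-term resolution presents Ext^1 as
    arrow cochains modulo coboundaries of graded maps. The stars and lines to which the
    classification is applied have no relations. *)
Definition Ext0 M N : Prop := forall h, @cocyc M N h ->
  exists2 P, grad P & forall a, h a = cobd P a.

Lemma hom_grad M N P : hom M N P -> grad P.
Proof. by case. Qed.

Lemma hom_cobd M N P : hom M N P <-> grad P /\ forall a, cobd P a = 0.
Proof.
split=> [[h1 h2]|[h1 h2]]; split=> // a; first by rewrite /cobd h2 subrr.
by apply/eqP; rewrite -subr_eq0; apply/eqP; apply: h2.
Qed.

Lemma rep_eX M a : is_rep M -> re M (qs a) *m rX M a = rX M a.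
Proof. by move=> [a1 _ _ a4 _]; rewrite a4 !mulmxA a1. Qed.

Lemma rep_Xe M a : is_rep M -> rX M a *m re M (qt a) = rX M a.
Proof. by move=> [a1 _ _ a4 _]; rewrite a4 -!mulmxA a1. Qed.

Lemma rep_ee M v w : is_rep M -> re M v *m re M w = if v == w then re M v else 0.
Proof. by move=> [a1 a2 _ _ _]; case: eqVneq => [<-|/a2 //]; rewrite a1. Qed.

Lemma gpr_grad M N P : is_rep M -> is_rep N -> grad (@gpr M N P).
Proof.
move=> hM hN v; rewrite /gpr mulmx_sumr mulmx_suml; apply: eq_bigr => w _.
rewrite !mulmxA rep_ee // -!(mulmxA _ _ (re N v)) rep_ee // (eq_sym w).
by case: eqVneq => [->|_] //; rewrite !mul0mx mulmx0.
Qed.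

Lemma gpr_id M N P : is_rep M -> grad P -> @gpr M N P = P.
Proof.
move=> hM g; rewrite /gpr (eq_bigr (fun v => re M v *m P)); last first.
  by move=> v _; rewrite -mulmxA -g mulmxA rep_ee ?eqxx.
by rewrite -mulmx_suml; case: hM => _ _ -> _ _; rewrite mul1mx.
Qed.

Lemma gpr_mull L M N A P : grad A -> A *m @gpr M N P = @gpr L N (A *m P).
Proof. by move=> g; rewrite /gpr mulmx_sumr; apply: eq_bigr => v _; rewrite !mulmxA g. Qed.

Lemma gpr_mulr L M N P B : grad B -> @gpr M N P *m B = @gpr M L (P *m B).
Proof. by move=> g; rewrite /gpr mulmx_suml; apply: eq_bigr => v _; rewrite -!mulmxA g. Qed.

Lemma grad_mul L M N A B : @grad L M A -> @grad M N B -> @grad L N (A *m B).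
Proof. by move=> gA gB v; rewrite mulmxA gA -!mulmxA gB. Qed.

Lemma grad_sub M N A B : @grad M N A -> @grad M N B -> @grad M N (A - B).
Proof. by move=> gA gB v; rewrite mulmxBr mulmxBl gA gB. Qed.

Lemma grad_add M N A B : @grad M N A -> @grad M N B -> @grad M N (A + B).
Proof. by move=> gA gB v; rewrite mulmxDr mulmxDl gA gB. Qed.

Lemma grad_scale M N x A : @grad M N A -> @grad M N (x *: A).
Proof. by move=> gA v; rewrite -scalemxAr -scalemxAl gA. Qed.

Lemma cobd_cocyc M N P : is_rep M -> is_rep N -> @grad M N P -> cocyc (cobd P).
Proof.
move=> hM hN g a; rewrite /cobd mulmxBr mulmxBl !mulmxA rep_eX // g.
by rewrite -!mulmxA rep_Xe // -g !mulmxA rep_Xe // -(mulmxA P) rep_eX.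
Qed.

Lemma cobd_mull L M N A P : hom L M A -> forall a, @cobd L N (A *m P) a = A *m @cobd M N P a.
Proof. by move=> [_ h] a; rewrite /cobd mulmxBr !mulmxA h. Qed.

Lemma cobd_mulr L M N P B : hom M L B -> forall a, @cobd N L (P *m B) a = @cobd N M P a *m B.
Proof. by move=> [_ h] a; rewrite /cobd mulmxBl -!mulmxA h. Qed.

Lemma cobd_add M N P R a : @cobd M N (P + R) a = cobd P a + cobd R a.
Proof. by rewrite /cobd mulmxDr mulmxDl opprD addrACA. Qed.

Lemma cobd_scale M N x P a : @cobd M N (x *: P) a = x *: cobd P a.
Proof. by rewrite /cobd scalerBr scalemxAr scalemxAl. Qed.

Lemma cobd_sub M N P R a : @cobd M N (P - R) a = cobd P a - cobd R a.
Proof. by rewrite -scaleN1r cobd_add cobd_scale scaleN1r. Qed.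

Lemma cocyc_mull L M N A h : @grad L M A -> @cocyc M N h -> @cocyc L N (fun a => A *m h a).
Proof. by move=> g c a; rewrite {1}c !mulmxA g. Qed.

Lemma cocyc_mulr L M N h B : @grad N L B -> @cocyc M N h -> @cocyc M L (fun a => h a *m B).
Proof. by move=> g c a; rewrite {1}c -!mulmxA g. Qed.

Lemma cocyc_mk M N (h : qA Q -> 'M[K]_(rdim M, rdim N)) : is_rep M -> is_rep N ->
  cocyc (fun a => re M (qs a) *m h a *m re N (qt a)).
Proof. by move=> hM hN a; rewrite !mulmxA rep_ee // eqxx -!mulmxA rep_ee // eqxx. Qed.

Lemma cocyc_sub M N h h' : @cocyc M N h -> @cocyc M N h' -> @cocyc M N (fun a => h a - h' a).
Proof. by move=> c c' a; rewrite mulmxBr mulmxBl -c -c'. Qed.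

Lemma cocyc_factor N Z X I k c h : is_rep N -> is_rep X -> @exact _ _ Z X I k c ->
  @cocyc N X h -> (forall a, h a *m c = 0) ->
  exists2 h', @cocyc N Z h' & forall a, h a = h' a *m k.
Proof.
move=> hN hX ex ch hz; have [hk _ fk _ _] := ex; have hZ := rep_inj hk fk hX.
have h1 a : exists H, h a = H *m k by apply: exact_factor ex (hz a).
pose H a := wit (h1 a).
have HE a : h a = H a *m k by rewrite /H /wit; case: constructive_indefinite_description.
exists (fun a => re N (qs a) *m H a *m re Z (qt a)); first exact: cocyc_mk.
by move=> a; rewrite ch HE -!mulmxA; case: hk => hk _; rewrite hk.
Qed.

Lemma cocyc_cofactor N Z X I k c h : is_rep N -> is_rep X -> @exact _ _ Z X I k c ->
  @cocyc X N h -> (forall a, k *m h a = 0) ->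
  exists2 h', @cocyc I N h' & forall a, h a = c *m h' a.
Proof.
move=> hN hX ex ch hz; have [_ hc _ fc _] := ex; have hI := rep_surj hc fc hX.
have h1 a : exists H, h a = c *m H by eexists; apply: exact_cofactor ex (hz a).
pose H a := wit (h1 a).
have HE a : h a = c *m H a by rewrite /H /wit; case: constructive_indefinite_description.
exists (fun a => re I (qs a) *m H a *m re N (qt a)); first exact: cocyc_mk.
by move=> a; rewrite ch HE !mulmxA; case: hc => hc _; rewrite hc.
Qed.

(** A graded lift of f always exists. Its failure to commute with the arrows is a cochain with
    values in Z, and a graded map bounding this cochain corrects the lift. *)
Lemma Ext0_exact_lift N Z X I k c f : is_rep N -> is_rep X -> @exact _ _ Z X I k c ->
  Ext0 N Z -> hom N I f -> exists2 g, hom N X g & g *m c = f.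
Proof.
move=> hN hX ex E0 hf; have [hk hc fk fc _] := ex.
have hZ := rep_inj hk fk hX; have hI := rep_surj hc fc hX.
pose g0 := @gpr N X (f *m pinvmx c).
have gg : grad g0 by apply: gpr_grad.
have gc : g0 *m c = f.
  rewrite gpr_mulr; last exact: hom_grad hc.
  by rewrite -mulmxA mulVpmx // mulmx1 gpr_id //; apply: hom_grad.
have hz a : cobd g0 a *m c = 0.
  by rewrite -(cobd_mulr _ hc) gc; case/hom_cobd: hf.
have [H cH eH] := cocyc_factor hN hX ex (cobd_cocyc hN hX gg) hz.
have [P gP eP] := E0 _ cH.
exists (g0 - P *m k); last by rewrite mulmxBl -mulmxA (exact_comp0 ex) mulmx0 subr0.
apply/hom_cobd; split; first by apply: grad_sub => //; apply: grad_mul (hom_grad hk).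
by move=> a; rewrite cobd_sub (cobd_mulr _ hk) -eP eH subrr.
Qed.

Lemma Ext0_exact_extend L Z X I k c p : is_rep L -> is_rep X -> @exact _ _ Z X I k c ->
  Ext0 I L -> hom Z L p -> exists2 q, hom X L q & k *m q = p.
Proof.
move=> hL hX ex E0 hp; have [hk hc fk fc _] := ex.
have hZ := rep_inj hk fk hX; have hI := rep_surj hc fc hX.
pose q0 := @gpr X L (pinvmx k *m p).
have gg : grad q0 by apply: gpr_grad.
have kq : k *m q0 = p.
  rewrite (gpr_mull _ (hom_grad hk)) mulmxA mulmxVp // mul1mx gpr_id //.
  exact: hom_grad hp.
have hz a : k *m cobd q0 a = 0.
  by rewrite -(cobd_mull _ hk) kq; case/hom_cobd: hp.
have [H cH eH] := cocyc_cofactor hL hX ex (cobd_cocyc hX hL gg) hz.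
have [P gP eP] := E0 _ cH.
exists (q0 - c *m P); last by rewrite mulmxBr mulmxA (exact_comp0 ex) mul0mx subr0.
apply/hom_cobd; split; first by apply: grad_sub => //; apply: grad_mul (hom_grad hc) _.
by move=> a; rewrite cobd_sub (cobd_mull _ hc) -eP eH subrr.
Qed.

(** Right exactness of Ext^1, the hereditary property: a cochain lifts along a surjection of the
    second argument without any obstruction. *)
Lemma Ext0_quo M N N' c : is_rep M -> is_rep N -> hom N N' c -> row_full c ->
  Ext0 M N -> Ext0 M N'.
Proof.
move=> hM hN hc fc E0 h ch.
have hN' := rep_surj hc fc hN; have [hc1 _] := hc.
have [P gP eP] := E0 _ (cocyc_mk (fun a => h a *m pinvmx c) hM hN).
exists (P *m c); first by apply: grad_mul gP (hom_grad hc).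
move=> a; rewrite (cobd_mulr _ hc) -eP -mulmxA hc1.
by rewrite [RHS]mulmxA -(mulmxA (re M _)) -(mulmxA (h a)) mulVpmx // mulmx1 -ch.
Qed.

Lemma Ext0_sub M M' N k : is_rep M -> is_rep N -> hom M' M k -> row_free k ->
  Ext0 M N -> Ext0 M' N.
Proof.
move=> hM hN hk fk E0 h ch.
have hM' := rep_inj hk fk hM; have [hk1 _] := hk.
have [P gP eP] := E0 _ (cocyc_mk (fun a => pinvmx k *m h a) hM hN).
exists (k *m P); first by apply: grad_mul (hom_grad hk) gP.
move=> a; rewrite (cobd_mull _ hk) -eP mulmxA (mulmxA k) -hk1.
by rewrite -(mulmxA (re M' _)) (mulmxA k) mulmxVp // mul1mx -ch.
Qed.

Lemma Ext0_iso M M' N N' : is_rep M -> is_rep N -> rep_iso M M' -> rep_iso N N' ->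
  Ext0 M N -> Ext0 M' N'.
Proof.
move=> hM hN MM NN E0; have hN' := iso_rep NN hN.
have [k [k' [hk e1 e2]]] := iso_sym MM; have [c [c' [hc e3 e4]]] := NN.
apply: (@Ext0_sub M M' N' k) => //; first by apply/row_freeP; exists k'.
by apply: (@Ext0_quo M N N' c) => //; apply/row_fullP; exists c'.
Qed.

Lemma Ext0_ext_r M Z X I k c : is_rep M -> is_rep X -> @exact _ _ Z X I k c ->
  Ext0 M Z -> Ext0 M I -> Ext0 M X.
Proof.
move=> hM hX ex EZ EI h ch; have [hk hc fk fc _] := ex.
have hZ := rep_inj hk fk hX; have hI := rep_surj hc fc hX.
have [P gP eP] := EI _ (cocyc_mulr (hom_grad hc) ch).
pose P0 := @gpr M X (P *m pinvmx c).
have gP0 : grad P0 by apply: gpr_grad.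
have P0c : P0 *m c = P.
  rewrite gpr_mulr; last exact: hom_grad hc.
  by rewrite -mulmxA mulVpmx // mulmx1 gpr_id.
have hz a : (h a - cobd P0 a) *m c = 0.
  by rewrite mulmxBl -(cobd_mulr _ hc) P0c eP subrr.
have [H cH eH] := cocyc_factor hM hX ex (cocyc_sub ch (cobd_cocyc hM hX gP0)) hz.
have [R gR eR] := EZ _ cH.
exists (P0 + R *m k); first by apply: grad_add gP0 (grad_mul gR (hom_grad hk)).
move=> a; rewrite cobd_add (cobd_mulr _ hk) -eR.
by rewrite -eH addrC subrK.
Qed.

Lemma Ext0_ext_l N Z X I k c : is_rep N -> is_rep X -> @exact _ _ Z X I k c ->
  Ext0 Z N -> Ext0 I N -> Ext0 X N.
Proof.
move=> hN hX ex EZ EI h ch; have [hk hc fk fc _] := ex.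
have hZ := rep_inj hk fk hX; have hI := rep_surj hc fc hX.
have [P gP eP] := EZ _ (cocyc_mull (hom_grad hk) ch).
pose P0 := @gpr X N (pinvmx k *m P).
have gP0 : grad P0 by apply: gpr_grad.
have kP0 : k *m P0 = P.
  by rewrite (gpr_mull _ (hom_grad hk)) mulmxA mulmxVp // mul1mx gpr_id.
have hz a : k *m (h a - cobd P0 a) = 0.
  by rewrite mulmxBr -(cobd_mull _ hk) kP0 eP subrr.
have [H cH eH] := cocyc_cofactor hN hX ex (cocyc_sub ch (cobd_cocyc hX hN gP0)) hz.
have [R gR eR] := EI _ cH.
exists (P0 + c *m R); first by apply: grad_add gP0 (grad_mul (hom_grad hc) gR).
move=> a; rewrite cobd_add (cobd_mull _ hc) -eR.
by rewrite -eH addrC subrK.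
Qed.

(** The identity of Z extends to a retraction q of k, and q k is an idempotent endomorphism of X. *)
Lemma indec_exact Z X I k c : indec X -> is_rep X -> @exact _ _ Z X I k c ->
  Ext0 I Z -> rdim Z = 0%N \/ rdim I = 0%N.
Proof.
move=> [X0 Xd] hX ex E0; have [hk hc fk fc _] := ex.
have hZ := rep_inj hk fk hX.
have [q hq kq] := Ext0_exact_extend hZ hX ex E0 (hom_id Z).
case: (Xd (q *m k)).
- exact: hom_comp hq hk.
- by rewrite -!mulmxA (mulmxA k) kq mul1mx.
- move=> e; left; have : k *m (q *m k) = 0 by rewrite e mulmx0.
  rewrite mulmxA kq mul1mx => k0; move: fk; rewrite /row_free k0 mxrank0 => /eqP; lia.
- move=> e; right; have c0 : c = 0.
    by rewrite -[c]mul1mx -e -mulmxA (exact_comp0 ex) mulmx0.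
  move: fc; rewrite /row_full c0 mxrank0 => /eqP; lia.
Qed.

End Graded.

(** * Coordinates for graded maps and the dimensions of Hom and Ext *)

Definition cbase (K : fieldType) n (E : 'M[K]_n) : 'M[K]_(n, \rank E) := locked (col_base E).
Definition rbase (K : fieldType) n (E : 'M[K]_n) : 'M[K]_(\rank E, n) := locked (row_base E).

Lemma cr_base (K : fieldType) n (E : 'M[K]_n) : cbase E *m rbase E = E.
Proof. by rewrite /cbase /rbase -!lock mulmx_base. Qed.

Lemma cbase_inj (K : fieldType) n (E : 'M[K]_n) m : injective (@mulmx K _ _ m (cbase E)).
Proof. by apply: row_full_inj; rewrite /cbase -lock col_base_full. Qed.

Lemma rbase_inj (K : fieldType) n (E : 'M[K]_n) m : injective ((@mulmx K m _ _)^~ (rbase E)).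
Proof. by apply: row_free_inj; rewrite /rbase -lock row_base_free. Qed.

Lemma idem_base (K : fieldType) n (E : 'M[K]_n) : E *m E = E -> rbase E *m cbase E = 1%:M.
Proof.
move=> EE; apply: (@cbase_inj _ _ E); apply: (@rbase_inj _ _ E).
by rewrite mulmx1 mulmxA cr_base -mulmxA cr_base EE.
Qed.

Section Euler.
Variables (Q : bquiver) (K : fieldType).
Implicit Types M N : rep Q K.

Definition eul (x y : qV Q -> int) : int :=
  \sum_v x v * y v - \sum_a x (qs a) * y (qt a).

Definition dz M v : int := (dm M v)%:Z.

Lemma base_ne M v w : is_rep M -> v != w ->
  rbase (re M v) *m cbase (re M w) = 0.
Proof.
move=> [a1 a2 _ _ _] vw; apply: (@cbase_inj _ _ (re M v)); apply: (@rbase_inj _ _ (re M w)).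
by rewrite mulmx0 mul0mx mulmxA cr_base -mulmxA cr_base a2.
Qed.

Section Fix.
Variables (M N : rep Q K).

Definition S0 : finType := {v : qV Q & ('I_(dm M v) * 'I_(dm N v))%type}.
Definition S1 : finType := {a : qA Q & ('I_(dm M (qs a)) * 'I_(dm N (qt a)))%type}.

Definition Phi0 (f : {ffun S0 -> K^o}) : 'M[K]_(rdim M, rdim N) :=
  \sum_v cbase (re M v) *m
    (\matrix_(i, j) f (Tagged (fun v => ('I_(dm M v) * 'I_(dm N v))%type) (i, j)))
    *m rbase (re N v).

Lemma Phi0_lin : linear Phi0.
Proof.
move=> a f g; rewrite /Phi0 scaler_sumr -big_split /=; apply: eq_bigr => v _.
rewrite scalemxAl scalemxAr -mulmxDl -mulmxDr; congr (_ *m _ *m _).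
by apply/matrixP => i j; rewrite !mxE !ffunE.
Qed.
HB.instance Definition _ := GRing.isLinear.Build K _ _ _ Phi0 Phi0_lin.

(** The differential from graded maps to arrow cochains, in coordinates. Its kernel has dimension
    [hd] and its cokernel dimension [ed], so that [eulE] is the Euler characteristic of a two-term
    complex. *)
Definition Dif (f : {ffun S0 -> K^o}) : {ffun S1 -> K^o} :=
  [ffun s => (rbase (re M (qs (tag s))) *m cobd (Phi0 f) (tag s)
     *m cbase (re N (qt (tag s)))) (tagged s).1 (tagged s).2].

Lemma Dif_lin : linear Dif.
Proof.
move=> a f g; apply/ffunP => s; rewrite !ffunE Phi0_lin cobd_add cobd_scale.
by rewrite mulmxDr mulmxDl -scalemxAr -scalemxAl !mxE.
Qed.
HB.instance Definition _ := GRing.isLinear.Build K _ _ _ Dif Dif_lin.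

Definition cls (h : qA Q -> 'M[K]_(rdim M, rdim N)) : {ffun S1 -> K^o} :=
  [ffun s => (rbase (re M (qs (tag s))) *m h (tag s)
     *m cbase (re N (qt (tag s)))) (tagged s).1 (tagged s).2].

Definition hsp : {vspace 'M[K]_(rdim M, rdim N)} :=
  (linfun Phi0 @: lker (linfun Dif))%VS.
Definition hd : nat := \dim hsp.
Definition ed : nat := (#|{: S1}| - \dim (limg (linfun Dif)))%N.

Hypotheses (hM : is_rep M) (hN : is_rep N).

Lemma base_eq (X : rep Q K) v : is_rep X -> rbase (re X v) *m cbase (re X v) = 1%:M.
Proof. by move=> [a1 _ _ _ _]; rewrite idem_base. Qed.

Lemma Phi0_coord f v : rbase (re M v) *m Phi0 f *m cbase (re N v) =
  \matrix_(i, j) f (Tagged (fun v => ('I_(dm M v) * 'I_(dm N v))%type) (i, j)).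
Proof.
rewrite /Phi0 mulmx_sumr mulmx_suml (bigD1 v) //= big1 ?addr0 => [|w wv].
  by rewrite !mulmxA base_eq // mul1mx -mulmxA base_eq // mulmx1.
by rewrite !mulmxA base_ne // ?mul0mx // eq_sym.
Qed.

Lemma Phi0_grad f : grad (Phi0 f).
Proof.
move=> v; rewrite /Phi0 mulmx_sumr mulmx_suml; apply: eq_bigr => w _.
rewrite -(cr_base (re M v)) -[X in _ = _ *m X](cr_base (re N v)).
have [->|vw] := eqVneq v w.
  rewrite -!mulmxA (mulmxA (rbase (re M w))) base_eq // mul1mx.
  by rewrite (mulmxA (rbase (re N w)) (cbase _)) base_eq // mul1mx.
rewrite !mulmxA -(mulmxA (cbase (re M v))) base_ne // mulmx0 !mul0mx.
by rewrite -(mulmxA _ (rbase (re N w))) base_ne 1?eq_sym // mulmx0 mul0mx.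
Qed.

Lemma Phi0_onto P : grad P -> exists f, P = Phi0 f.
Proof.
move=> gP; exists [ffun s : S0 => (rbase (re M (tag s)) *m P
     *m cbase (re N (tag s))) (tagged s).1 (tagged s).2].
rewrite -[LHS](gpr_id hM gP) /gpr /Phi0; apply: eq_bigr => v _.
rewrite -[X in X *m P](cr_base (re M v)) -[X in _ *m X = _](cr_base (re N v)) !mulmxA.
congr (_ *m _).
rewrite -!mulmxA; congr (_ *m _); apply/matrixP => i j.
by rewrite [RHS]mxE ffunE /= -mulmxA.
Qed.

Lemma Phi0_inj f : Phi0 f = 0 -> f = 0.
Proof.
move=> e; apply/ffunP => [[v [i j]]]; rewrite [RHS]ffunE.
have := Phi0_coord f v; rewrite e mulmx0 mul0mx => /matrixP /(_ i j).
by rewrite !mxE.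
Qed.

Lemma cls_inj h : cocyc h -> cls h = 0 -> forall a, h a = 0.
Proof.
move=> ch e a; rewrite ch -[re M _]cr_base -[re N _]cr_base.
suff z : rbase (re M (qs a)) *m h a *m cbase (re N (qt a)) = 0.
  rewrite !mulmxA -(mulmxA (cbase _)) -(mulmxA (cbase _)) z.
  by rewrite mulmx0 mul0mx.
apply/matrixP => i j; have /ffunP/(_ (Tagged (fun a => ('I_(dm M (qs a)) * 'I_(dm N (qt a)))%type) (i, j))) := e.
by rewrite !ffunE /= => ->; rewrite mxE.
Qed.

Lemma cls_cobd f : cls (cobd (Phi0 f)) = Dif f.
Proof. by []. Qed.

Lemma cls_add h h' : cls (fun a => h a + h' a) = cls h + cls h'.
Proof. by apply/ffunP => s; rewrite !ffunE mulmxDr mulmxDl mxE. Qed.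

Lemma cls_scale x h : cls (fun a => x *: h a) = x *: cls h.
Proof. by apply/ffunP => s; rewrite !ffunE -scalemxAr -scalemxAl mxE. Qed.

Lemma cls_sub h h' : cls (fun a => h a - h' a) = cls h - cls h'.
Proof. by apply/ffunP => s; rewrite !ffunE mulmxBr mulmxBl mxE; congr (_ + _); rewrite mxE. Qed.

Lemma cls_onto (g : {ffun S1 -> K^o}) : exists2 h, cocyc h & cls h = g.
Proof.
exists (fun a => cbase (re M (qs a)) *m
  (\matrix_(i, j) g (Tagged (fun a => ('I_(dm M (qs a)) * 'I_(dm N (qt a)))%type) (i, j)))
    *m rbase (re N (qt a))).
  move=> a; rewrite -[X in _ = X *m _ *m _]cr_base -[X in _ = _ *m X]cr_base.
  rewrite -!mulmxA (mulmxA (rbase (re M _)) (cbase _)) base_eq // mul1mx.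
  by rewrite (mulmxA (rbase (re N _)) (cbase _)) base_eq // mul1mx.
apply/ffunP => [[a [i j]]]; rewrite ffunE /= !mulmxA base_eq // mul1mx -mulmxA.
by rewrite base_eq // mulmx1 mxE.
Qed.

Lemma hspP P : reflect (hom M N P) (P \in hsp).
Proof.
apply: (iffP memv_imgP) => [[f]|hP].
  rewrite memv_ker lfunE /= => /eqP e ->; rewrite lfunE /=; apply/hom_cobd.
  split; first exact: Phi0_grad.
  by apply: cls_inj e; apply: cobd_cocyc => //; apply: Phi0_grad.
have [f ef] := Phi0_onto (hom_grad hP); exists f; last by rewrite lfunE.
rewrite memv_ker lfunE /=; apply/eqP/ffunP => s; rewrite !ffunE -ef.
by have [_ ->] := (hom_cobd P).1 hP; rewrite mulmx0 mul0mx mxE.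
Qed.

Lemma hdE : hd = \dim (lker (linfun Dif)).
Proof.
rewrite /hd; apply: limg_dim_eq; apply/eqP; rewrite -subv0; apply/subvP => f.
rewrite memv_cap => /andP [_]; rewrite memv_ker lfunE /= => /eqP /Phi0_inj ->.
exact: mem0v.
Qed.

Lemma card_S0 : #|{: S0}| = (\sum_v dm M v * dm N v)%N.
Proof.
rewrite card_tagged sumnE big_map big_enum /=; apply: eq_bigr => v _.
by rewrite card_prod !card_ord.
Qed.

Lemma card_S1 : #|{: S1}| = (\sum_a dm M (qs a) * dm N (qt a))%N.
Proof.
rewrite card_tagged sumnE big_map big_enum /=; apply: eq_bigr => v _.
by rewrite card_prod !card_ord.
Qed.

Lemma dim_limg_le : (\dim (limg (linfun Dif)) <= #|{: S1}|)%N.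
Proof. by have := dimvS (subvf (limg (linfun Dif))); rewrite dimvf /dim /= muln1. Qed.

Lemma eulE : hd%:Z - ed%:Z = eul (dz M) (dz N).
Proof.
have := limg_ker_dim (linfun Dif) fullv; rewrite capfv -hdE dimvf /dim /= muln1 card_S0.
have := dim_limg_le; rewrite /ed /eul card_S1 /dz.
have -> : \sum_v (dm M v)%:Z * (dm N v)%:Z = (\sum_v dm M v * dm N v)%N%:Z.
  by rewrite [RHS](big_morph Posz PoszD (erefl (Posz 0))).
have -> : \sum_a (dm M (qs a))%:Z * (dm N (qt a))%:Z = (\sum_a dm M (qs a) * dm N (qt a))%N%:Z.
  by rewrite [RHS](big_morph Posz PoszD (erefl (Posz 0))).
lia.
Qed.

Lemma hd0P : hd = 0%N <-> forall P, hom M N P -> P = 0.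
Proof.
split=> [e P /hspP|h].
  by move: e; rewrite /hd => /eqP; rewrite dimv_eq0 => /eqP ->; rewrite memv0 => /eqP.
apply/eqP; rewrite dimv_eq0 -subv0; apply/subvP => P /hspP /h ->; exact: mem0v.
Qed.

Lemma ed0P : ed = 0%N <-> Ext0 M N.
Proof.
have full : ed = 0%N <-> limg (linfun Dif) = fullv.
  have := dim_limg_le; rewrite /ed => le; split=> [e|->]; last first.
    by rewrite dimvf /dim /= muln1 subnn.
  by apply/eqP; rewrite eqEdim subvf dimvf /dim /= muln1 -subn_eq0 e.
rewrite full; split=> [e h ch|E0].
  have : cls h \in limg (linfun Dif) by rewrite e memvf.
  move=> /memv_imgP [f _]; rewrite lfunE /= -cls_cobd => ec.
  exists (Phi0 f); first exact: Phi0_grad.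
  move=> a; apply/eqP; rewrite -subr_eq0; apply/eqP; move: a; apply: cls_inj.
    by apply: cocyc_sub => //; apply: cobd_cocyc => //; apply: Phi0_grad.
  by rewrite cls_sub ec subrr.
apply/eqP; rewrite eqEsubv subvf /=; apply/subvP => g _.
have [h ch <-] := cls_onto g; have [P gP eP] := E0 h ch; have [f ef] := Phi0_onto gP.
apply/memv_imgP; exists f; rewrite ?memvf // lfunE /= -cls_cobd.
by apply/ffunP => s; rewrite !ffunE eP ef.
Qed.

(** A complement of the image of [Dif] is at most a line. The chosen generator e0 later serves as
    the standard extension between consecutive simple regular objects. *)
Lemma ed1P : (ed <= 1)%N -> exists2 e0, cocyc e0 &
  forall h, @cocyc Q K M N h -> exists x P, grad P /\ forall a, h a = x *: e0 a + cobd P a.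
Proof.
move=> e1; have [E0|n0] := classic (Ext0 M N).
  exists (fun _ => 0); first by move=> a; rewrite mulmx0 mul0mx.
  move=> h /E0 [P gP eP]; exists 0, P; split=> // a; by rewrite scale0r add0r.
have [g gn] : exists g, g \notin limg (linfun Dif).
  apply: NNPP => no; apply: n0; apply/ed0P; rewrite /ed.
  have -> : limg (linfun Dif) = fullv.
    apply/eqP; rewrite eqEsubv subvf /=; apply/subvP => g _; apply: NNPP => gn.
    by apply: no; exists g; apply/negP.
  by rewrite dimvf /dim /= muln1 subnn.
have full : (<[g]> + limg (linfun Dif))%VS = fullv.
  apply/eqP; rewrite eqEdim subvf dimvf /dim /= muln1.
  have : (\dim (limg (linfun Dif)) < \dim (<[g]> + limg (linfun Dif)))%N.
    rewrite ltnNge; apply: contra gn => le.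
    have /eqP -> : limg (linfun Dif) == (<[g]> + limg (linfun Dif))%VS by rewrite eqEdim addvSr.
    by apply: subvP (addvSl _ _) _ _; rewrite memv_line.
  move=> lt; move: e1; rewrite /ed leq_subLR => e1; apply: leq_trans e1 _; lia.
have [e0 ce0 eg] := cls_onto g; exists e0 => // h ch.
have : cls h \in (<[g]> + limg (linfun Dif))%VS by rewrite full memvf.
move=> /memv_addP [_ /vlineP [x ->] [_ /memv_imgP [f _ ->]]]; rewrite lfunE /= -cls_cobd => ec.
exists x, (Phi0 f); split; first exact: Phi0_grad.
suff z a : x *: e0 a + cobd (Phi0 f) a - h a = 0.
  by move=> a; apply/eqP; rewrite eq_sym -subr_eq0 z.
move: a.
have c1 : cocyc (fun a => x *: e0 a).
  by move=> a; rewrite -scalemxAr -scalemxAl -ce0.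
have c2 := cobd_cocyc hM hN (Phi0_grad f).
apply: (@cls_inj (fun a => _ + _ - _)).
  by move=> a; rewrite mulmxBr mulmxDr mulmxBl mulmxDl -c1 -ch -c2.
by rewrite cls_sub cls_add cls_scale eg ec subrr.
Qed.

Lemma hd1P : (exists P0, forall P, hom M N P -> exists x, P = x *: P0) -> (hd <= 1)%N.
Proof.
move=> [P0 h]; apply: (@leq_trans (\dim <[P0]>)); last by rewrite dim_vline leq_b1.
by apply: dimvS; apply/subvP => P /hspP /h [x ->]; rewrite memvZ ?memv_line.
Qed.

End Fix.

Lemma hd_factor M N J p : is_rep M -> is_rep N -> is_rep J -> hom N J p ->
  (forall f, hom N M f -> exists2 g, hom J M g & f = p *m g) -> (hd N M <= hd J M)%N.
Proof.
move=> hM hN hJ hp fac.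
have := limg_ker_dim (linfun (mulmx p)) (hsp J M).
suff : (hd N M <= \dim (linfun (mulmx p) @: hsp J M))%N by rewrite -/(hd J M); lia.
apply: dimvS.
apply/subvP => f /(hspP hN hM) /fac [g /(hspP hJ hM) hg ->].
by apply/memv_imgP; exists g => //; rewrite lfunE.
Qed.

Lemma iso_dz M N : rep_iso M N -> dz M =1 dz N.
Proof. by move=> /iso_dm e v; rewrite /dz e. Qed.

Lemma exact_dz Z X I k c v : is_rep X -> @exact Q K Z X I k c -> dz X v = dz Z v + dz I v.
Proof. by move=> hX /(exact_dm v hX) e; rewrite /dz e PoszD. Qed.

Lemma eq_eul x x' y y' : x =1 x' -> y =1 y' -> eul x y = eul x' y'.
Proof.
by move=> ex ey; rewrite /eul; congr (_ - _); apply: eq_bigr => i _; rewrite !ex !ey.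
Qed.

Lemma eul_addl (x x' y : qV Q -> int) : eul (fun v => x v + x' v) y = eul x y + eul x' y.
Proof.
rewrite /eul addrACA -opprD; congr (_ - _); rewrite -big_split /=; apply: eq_bigr => i _; exact: mulrDl.
Qed.

Lemma eul_addr (x y y' : qV Q -> int) : eul x (fun v => y v + y' v) = eul x y + eul x y'.
Proof.
rewrite /eul addrACA -opprD; congr (_ - _); rewrite -big_split /=; apply: eq_bigr => i _; exact: mulrDr.
Qed.

Lemma eul_scalel k (x y : qV Q -> int) : eul (fun v => k * x v) y = k * eul x y.
Proof.
by rewrite /eul mulrBr !mulr_sumr; congr (_ - _); apply: eq_bigr => i _; rewrite mulrA.
Qed.

Lemma eul_scaler k (x y : qV Q -> int) : eul x (fun v => k * y v) = k * eul x y.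
Proof.
by rewrite /eul mulrBr !mulr_sumr; congr (_ - _); apply: eq_bigr => i _; rewrite mulrCA.
Qed.

End Euler.

(** * Bricks and rigid representations *)

Section Ringel.
Variables (Q : bquiver) (K : fieldType).
Implicit Types L M N X Y Z I : rep Q K.

Lemma hom_rank_min X : is_rep X -> indec X -> ~ brick X ->
  exists2 P, hom X X P /\ P <> 0 /\ (\rank P < rdim X)%N &
    forall R, hom X X R -> R <> 0 -> (\rank P <= \rank R)%N.
Proof.
move=> hX [X0 Xd] nb.
have [|n [P [hP [P0 rP]]] nmin] :=
  @nat_min (fun n => exists P, hom X X P /\ P <> 0 /\ \rank P = n).
  by exists (\rank (1%:M : 'M[K]_(rdim X))), 1%:M; split; [exact: hom_id|split=> //
    => /(congr1 (@mxrank _ _ _)); rewrite mxrank1 mxrank0; lia].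
exists P; last by move=> R hR R0; rewrite rP; apply: nmin; exists R.
split=> //; split=> //; rewrite ltn_neqAle rank_leq_row andbT.
apply/negP => /eqP e; apply: nb; split=> // R hR R0.
rewrite -row_free_unit -row_leq_rank; apply: leq_trans (eq_leq (esym e)) _.
by rewrite rP; apply: nmin; exists R.
Qed.

(** Ringel's lemma. Take a nonzero endomorphism P of least rank, with image I. Minimality makes I a
    brick and makes every nonzero map from I into a subobject of X injective. The image lies in the
    kernel of P, so some indecomposable summand Y of this kernel contains a copy of I. If Ext(I, Y)
    vanished, the projection of the kernel onto Y would extend to X and make Y a summand of X. *)
Lemma ringel X : is_rep X -> indec X -> ~ brick X ->
  exists Y I (i : 'M[K]_(rdim Y, rdim X)) (c : 'M[K]_(rdim X, rdim I)) (j : 'M[K]_(rdim I, rdim Y)),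
  [/\ indec Y, hom Y X i /\ row_free i, (rdim Y < rdim X)%N &
      [/\ brick I, hom X I c /\ row_full c, hom I Y j /\ row_free j & ~ Ext0 I Y]].
Proof.
move=> hX iX nb; have [P [hP [P0 rP]] Pmin] := hom_rank_min hX iX nb.
have [I [c [b [hc hb fc fb PE]]]] := hom_image hP.
have rI : \rank P = rdim I by rewrite PE mxrankMfree // (eqP (fc : \rank c == _)).
have PP0 : P *m P = 0.
  (* Otherwise minimality of the rank gives all positive powers of P the same row space, against
     Fitting's alternative for an endomorphism that is not invertible. *)
  apply: NNPP => PP.
  have e2 : (P *m P :=: P)%MS.
    apply/eqmxP; rewrite -(geq_leqif (mxrank_leqif_eq (submxMl P P))).
    by apply: Pmin PP; apply: hom_comp.
  have all k : (iter k.+1 (mulmx P) 1%:M :=: P)%MS.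
    elim: k => [|k IH]; first by rewrite /= mulmx1.
    have -> : iter k.+2 (mulmx P) 1%:M = iter k.+1 (mulmx P) 1%:M *m P.
      elim: (k.+1) => [|m IHm]; first by rewrite /= mul1mx mulmx1.
      by rewrite [LHS]iterS [in LHS]IHm mulmxA.
    exact: eqmx_trans (eqmxMr P IH) e2.
  case: (indec_fitting iX hP) => [u|[k]].
    by move: rP; rewrite mxrank_unit // ltnn.
  case: k => [|k] e.
    by case: iX => X0 _; move: (congr1 (@mxrank _ _ _) e); rewrite /= mxrank1 mxrank0; lia.
  by apply: P0; apply/eqP; rewrite -mxrank_eq0 -(all k) e mxrank0.
have bc : b *m c = 0.
  apply: (row_full_inj fc); apply: (row_free_inj fb).
  by rewrite mulmx0 mul0mx mulmxA -PE -mulmxA -PE PP0.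
have [Z [k ex]] := exact_quo hc fc; have [hk _ fk _ _] := ex.
have [b' hb' bE] := exact_factor_hom ex hb bc.
have b'0 : b' <> 0.
  by move=> e; apply: P0; rewrite PE bE e mul0mx mulmx0.
have [Y [i [p [iY hi hp ip bp]]]] := indec_factor hb' b'0.
have hZ := rep_inj hk fk hX.
have fi : row_free i by apply/row_freeP; exists p.
have hY := rep_inj hi fi hZ.
have IX : (rdim I < rdim X)%N by rewrite -rI.
have dZ : (rdim Z + rdim I)%N = rdim X.
  rewrite !rdim_sum //; last exact: rep_surj hc fc hX.
  by rewrite -big_split; apply: eq_bigr => v _; rewrite (exact_dm v hX ex).
have I0 : (0 < rdim I)%N by rewrite -rI lt0n mxrank_eq0; apply/eqP.
have dY : (rdim Y <= rdim Z)%N by rewrite -(eqP (fi : \rank i == _)) rank_leq_col.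
exists Y, I, (i *m k), c, (b' *m p); split=> //.
- split; first exact: hom_comp hi hk.
  by rewrite /row_free mxrankMfree.
- by lia.
split=> //.
- split=> // f hf f0; rewrite -row_free_unit /row_free eqn_leq rank_leq_row /=.
  have h := hom_comp (hom_comp hc hf) hb.
  have <- : \rank (c *m f *m b) = \rank f by rewrite mxrankMfree // (eqmxMfull _ fc).
  apply: leq_trans (eq_leq (esym rI)) _; apply: Pmin h _ => e; apply: f0.
  by apply: (row_full_inj fc); apply: (row_free_inj fb); rewrite e mulmx0 mul0mx.
- split; first exact: hom_comp hb' hp.
  have fik : row_free (i *m k) by rewrite /row_free mxrankMfree.
  have h := hom_comp (hom_comp hc (hom_comp hb' hp)) (hom_comp hi hk).
  have : (\rank P <= \rank (c *m (b' *m p) *m (i *m k)))%N.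
    apply: Pmin h _ => e; apply: bp.
    by apply: (row_full_inj fc); apply: (row_free_inj fik); rewrite e mulmx0 mul0mx.
  by rewrite mxrankMfree // (eqmxMfull _ fc) rI /row_free eqn_leq rank_leq_row.
move=> E0; have [q hq kq] := Ext0_exact_extend hY hX ex E0 hp.
case: iX => _ Xd; case: (Xd (q *m (i *m k))).
- exact: hom_comp hq (hom_comp hi hk).
- by rewrite -!mulmxA (mulmxA k) kq (mulmxA i) ip mul1mx.
- move=> e; have : (i *m k) *m (q *m (i *m k)) = 0 by rewrite e mulmx0.
  rewrite -mulmxA (mulmxA k) kq mulmxA ip mul1mx => z.
  by case: iY => Y0 _; have := mxrankMfree i fk; rewrite z mxrank0 (eqP (fi : \rank i == _)); lia.
- move=> e; have := mxrankM_maxl q (i *m k); rewrite e mxrank1 => le.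
  have := rank_leq_col q; lia.
Qed.

Lemma brick_eul M : is_rep M -> brick M ->
  (forall P, hom M M P -> exists a, P = a%:M) -> hd M M = 1%N.
Proof.
move=> hM [M0 b] sc; apply/eqP; rewrite eqn_leq; apply/andP; split.
  apply: hd1P => //; exists 1%:M => P /sc [x ->]; exists x; by rewrite scalemx1.
rewrite lt0n; apply/negP => /eqP /(hd0P hM hM) /(_ 1%:M (hom_id M)).
by move=> /(congr1 (@mxrank _ _ _)); rewrite mxrank1 mxrank0; lia.
Qed.

End Ringel.

(** * Rigid representations over an algebraically closed field *)

Section Line.
Variables (Q : bquiver) (K : closedFieldType).
Hypothesis freeQ : forall a b, @qrel Q a b = false.
Implicit Types L M N X Y Z I : rep Q K.

(** Two representations with equal dimension vectors become points of one representation space, with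
    the vertex idempotents of M fixed and only the arrow matrices varying. *)
Lemma same_frame M N : is_rep M -> is_rep N -> dm M =1 dm N ->
  exists X : qA Q -> 'M[K]_(rdim M), rep_iso N (@Rep Q K (rdim M) (re M) X).
Proof.
move=> hM hN e.
have hB (M1 M2 : rep Q K) : is_rep M1 -> is_rep M2 -> dm M1 =1 dm M2 ->
  let B := \sum_v cbase (re M1 v) *m (pid_mx (dm M1 v) *m rbase (re M2 v)) in
  (forall w, re M1 w *m B = cbase (re M1 w) *m (pid_mx (dm M1 w) *m rbase (re M2 w))) /\
  (forall w, B *m re M2 w = cbase (re M1 w) *m (pid_mx (dm M1 w) *m rbase (re M2 w))).
  move=> h1 h2 e12 /=; split=> w.
    rewrite mulmx_sumr (bigD1 w) //= big1 ?addr0 => [|v vw].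
      by rewrite -{1}(cr_base (re M1 w)) -mulmxA (mulmxA (rbase _) (cbase _)) base_eq // mul1mx.
    rewrite -(cr_base (re M1 w)) -mulmxA (mulmxA (rbase _) (cbase _)) base_ne // 1?eq_sym //.
    by rewrite mul0mx mulmx0.
  rewrite mulmx_suml (bigD1 w) //= big1 ?addr0 => [|v vw].
    rewrite -[X in _ *m X = _](cr_base (re M2 w)) -!mulmxA.
    by rewrite (mulmxA (rbase _) (cbase _)) base_eq // mul1mx.
  rewrite -(cr_base (re M2 w)) -!mulmxA (mulmxA (rbase _) (cbase _)) base_ne //.
  by rewrite mul0mx !mulmx0.
have hC (M1 M2 : rep Q K) : is_rep M1 -> is_rep M2 -> dm M1 =1 dm M2 ->
  (\sum_v cbase (re M1 v) *m (pid_mx (dm M1 v) *m rbase (re M2 v))) *m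
  (\sum_v cbase (re M2 v) *m (pid_mx (dm M2 v) *m rbase (re M1 v))) = 1%:M.
  move=> h1 h2 e12; have [_ _ <- _ _] := h1; rewrite mulmx_suml; apply: eq_bigr => v _.
  have [hL _] := hB M2 M1 h2 h1 (fsym e12).
  have -> : cbase (re M1 v) *m (pid_mx (dm M1 v) *m rbase (re M2 v)) =
    cbase (re M1 v) *m (pid_mx (dm M1 v) *m rbase (re M2 v)) *m re M2 v.
    rewrite -[X in _ = _ *m X](cr_base (re M2 v)) -!mulmxA.
    by rewrite (mulmxA (rbase _) (cbase _)) base_eq // mul1mx.
  rewrite -mulmxA hL -!mulmxA (mulmxA (rbase _) (cbase _)) base_eq // mul1mx.
  rewrite (mulmxA (pid_mx _)) -(e12 v) pid_mx_id; last by rewrite [dm M1 v]e12.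
  rewrite /dm pid_mx_1 mul1mx.
  by rewrite cr_base.
set B := \sum_v cbase (re N v) *m (pid_mx (dm N v) *m rbase (re M v)).
set B' := \sum_v cbase (re M v) *m (pid_mx (dm M v) *m rbase (re N v)).
have BB : B *m B' = 1%:M by apply: hC => //; apply: fsym.
have B'B : B' *m B = 1%:M by apply: hC.
exists (fun a => B' *m rX N a *m B), B, B'; split=> //.
have [h1 h2] := hB N M hN hM (fsym e).
split=> i /=; first by rewrite h1 h2.
by rewrite !mulmxA BB mul1mx.
Qed.

Lemma free_rep n (e : qV Q -> 'M[K]_n) (X : qA Q -> 'M[K]_n) : rep_ax e (fun _ => 0) ->
  (forall a, X a = e (qs a) *m X a *m e (qt a)) -> is_rep (@Rep Q K n e X).
Proof. by move=> [a1 a2 a3 _ _] h; split=> // a b; rewrite freeQ. Qed.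

(** The orbit of a rigid representation is open, here restricted to a line through M. An isomorphism
    from M to M + tY is sought as P_t = d - sum z_i P_i, where the coboundaries of the P_i are the
    standard basis of cochains. The condition becomes z (1 - tE) = - t d w(Y); with d = det(1 - tE)
    the adjugate gives a polynomial solution, and P_0 = 1. *)
Lemma rigid_line M (Y : qA Q -> 'M[K]_(rdim M)) : is_rep M -> Ext0 M M -> @cocyc Q K M M Y ->
  exists2 p : {poly K}, p.[0] != 0 &
  forall t, p.[t] != 0 -> rep_iso M (@Rep Q K (rdim M) (re M) (fun a => rX M a + t *: Y a)).
Proof.
move=> hM E0 cY; pose n1 := #|{: S1 M M}|.
pose w (h : qA Q -> 'M[K]_(rdim M)) : 'rV[K]_n1 := \row_i (@cls Q K M M h) (enum_val i).
have exQ (i : 'I_n1) : exists P, @grad Q K M M P /\ w (cobd P) = delta_mx 0 i.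
  have [h ch eh] := cls_onto hM hM ([ffun s => (s == enum_val i)%:R] : {ffun S1 M M -> K^o}).
  have [P gP eP] := E0 h ch; exists P; split=> //; apply/rowP => j.
  rewrite !mxE /= -(inj_eq enum_val_inj) -[RHS]/(_%:R).
  have <- : cls h (enum_val j) = (enum_val j == enum_val i)%:R by rewrite eh ffunE.
  by rewrite !ffunE eP.
pose P i := wit (exQ i).
have [gP eP] : (forall i, @grad Q K M M (P i)) /\ (forall i, w (cobd (P i)) = delta_mx 0 i).
  by split=> i; rewrite /P /wit; case: constructive_indefinite_description => ? [].
(* Row i of E is the cochain obtained by letting P_i act on Y, in the basis of cochains. *)
pose E : 'M[K]_n1 := \matrix_(i, j) w (fun a => P i *m Y a) 0 j.
pose Et : 'M[{poly K}]_n1 := 1%:M - 'X *: map_mx polyC E.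
pose zp : 'rV[{poly K}]_n1 := - ('X *: (map_mx polyC (w Y) *m \adj Et)).
pose Pp : 'M[{poly K}]_(rdim M) := (\det Et)%:M - \sum_i zp 0 i *: map_mx polyC (P i).
have evC m1 m2 (A : 'M[K]_(m1, m2)) t : map_mx (horner_eval t) (map_mx polyC A) = A.
  by apply/matrixP => i j; rewrite !mxE /= horner_evalE hornerC.
have evE t : map_mx (horner_eval t) Et = 1%:M - t *: E.
  by rewrite /Et map_mxB map_scalar_mx /= rmorph1 map_mxZ evC /= horner_evalE hornerX.
have evz t : map_mx (horner_eval t) zp = - (t *: (w Y *m \adj (1%:M - t *: E))).
  by rewrite /zp map_mxN map_mxZ map_mxM evC map_mx_adj evE /= horner_evalE hornerX.
have evP t : map_mx (horner_eval t) Pp =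
  (\det (1%:M - t *: E))%:M - \sum_i (map_mx (horner_eval t) zp) 0 i *: P i.
  rewrite /Pp map_mxB map_scalar_mx /= -det_map_mx evE; congr (_ - _).
  rewrite (raddf_sum (map_mx (horner_eval t))); apply: eq_bigr => i _.
  have gen (x : {poly K}) (A : 'M[K]_(rdim M)) :
    map_mx (horner_eval t) (x *: map_mx polyC A) = horner_eval t x *: A.
    by apply/matrixP => j k; rewrite !mxE /= !horner_evalE hornerM hornerC.
  by apply: etrans (gen _ _) _; congr (_ *: _); rewrite [RHS]mxE.
exists (\det Pp).
  have z0 : map_mx (horner_eval 0) zp = 0 by rewrite evz scale0r oppr0.
  have d0 : \det (1%:M - 0 *: E) = 1 by rewrite scale0r subr0 det1.
  rewrite -horner_evalE -det_map_mx evP d0 z0.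
  by rewrite big1 ?subr0 ?det1 ?oner_neq0 // => i _; rewrite mxE scale0r.
move=> t; rewrite -horner_evalE -det_map_mx => dt.
set Pt := map_mx (horner_eval t) Pp in dt *.
have u : Pt \in unitmx by rewrite unitmxE unitfE.
have hR : is_rep (@Rep Q K (rdim M) (re M) (fun a => rX M a + t *: Y a)).
  apply: free_rep; first by case: hM => a1 a2 a3 _ _; split=> // *; rewrite ?mulmx0 ?mul0mx.
  by move=> a; rewrite mulmxDr mulmxDl -scalemxAr -scalemxAl -cY; case: hM => _ _ _ <-.
have gPt : @grad Q K M M Pt.
  rewrite /Pt evP; apply: grad_sub.
    by move=> v; rewrite mul_mx_scalar mul_scalar_mx.
  by move=> v; rewrite mulmx_sumr mulmx_suml; apply: eq_bigr => i _; apply: grad_scale.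
apply: (@iso_free Q K M (@Rep Q K (rdim M) (re M) (fun a => rX M a + t *: Y a)) Pt) => //.
  2: by rewrite row_free_unit.
split=> // a /=; apply/eqP; rewrite -subr_eq0 mulmxDr opprD addrA -/(cobd _ _).
rewrite -scalemxAr -/(@cobd Q K M M Pt a).
pose H a := @cobd Q K M M Pt a - t *: (Pt *m Y a).
have cH : @cocyc Q K M M H.
  apply: cocyc_sub; first exact: cobd_cocyc.
  move=> b; rewrite -scalemxAr -scalemxAl; congr (_ *: _).
  exact: (@cocyc_mull Q K M M M Pt Y gPt cY b).
suff z : cls H = 0 by apply/eqP; exact: (cls_inj cH z a).
rewrite cls_sub cls_scale; pose z := map_mx (horner_eval t) zp.
have wcls h : cls h = [ffun s : S1 M M => w h 0 (enum_rank s)] :> {ffun S1 M M -> K^o}.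
  by apply/ffunP => s; rewrite [RHS]ffunE [RHS]mxE enum_rankK.
suff : w (@cobd Q K M M Pt) - t *: w (fun a => Pt *m Y a) = 0.
  move=> /rowP e; rewrite !wcls; apply/ffunP => s; rewrite !ffunE.
  by have := e (enum_rank s); rewrite !mxE.
have w_add h h' : w (fun a => h a + h' a) = w h + w h'.
  by apply/rowP => i; rewrite !mxE cls_add ffunE.
have w_scale x h : w (fun a => x *: h a) = x *: w h.
  by apply/rowP => i; rewrite !mxE cls_scale ffunE.
have w_ext h h' : h =1 h' -> w h = w h'.
  by move=> e; apply/rowP => i; rewrite !mxE !ffunE e.
have w_sum (F : 'I_n1 -> qA Q -> 'M[K]_(rdim M)) : w (fun a => \sum_i F i a) = \sum_i w (F i).
  have gen (s : seq 'I_n1) : w (fun a => \sum_(i <- s) F i a) = \sum_(i <- s) w (F i).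
    elim: s => [|i s IH].
      rewrite big_nil -[RHS](scale0r (w Y)) -w_scale; apply: w_ext => {}a.
      by rewrite big_nil scale0r.
    rewrite big_cons -IH -w_add; apply: w_ext => {}a; by rewrite big_cons.
  exact: gen.
set d := \det (1%:M - t *: E) in evP.
have evPt : Pt = d%:M - \sum_i z 0 i *: P i by apply: evP.
have -> : w (@cobd Q K M M Pt) = - z.
  have -> : w (@cobd Q K M M Pt) = w (fun a => \sum_i (- z 0 i) *: cobd (P i) a).
    apply: w_ext => {}a; rewrite evPt -scaleN1r cobd_add cobd_scale.
    have -> : @cobd Q K M M d%:M a = 0 :> 'M[K]_(rdim M).
      by rewrite /cobd mul_mx_scalar mul_scalar_mx subrr.
    rewrite add0r /cobd mulmx_sumr mulmx_suml -sumrB scaler_sumr; apply: eq_bigr => i _.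
    by rewrite -scalemxAr -scalemxAl -scalerBr scalerA mulN1r.
  rewrite w_sum; apply/rowP => j; rewrite summxE (bigD1 j) //= big1 ?addr0 => [|i ij].
    by rewrite w_scale eP [LHS]mxE [delta_mx _ _ _ _]mxE !eqxx mulr1 [RHS]mxE.
  by rewrite w_scale eP [LHS]mxE [delta_mx _ _ _ _]mxE [j == i]eq_sym (negPf ij) andbF mulr0.
have -> : w (fun a => Pt *m Y a) = d *: w Y - z *m E.
  have -> : w (fun a => Pt *m Y a) = w (fun a => d *: Y a + \sum_i (- z 0 i) *: (P i *m Y a)).
    apply: w_ext => {}a; rewrite evPt mulmxBl mul_scalar_mx; congr (_ + _).
    rewrite mulmx_suml -sumrN; apply: eq_bigr => i _.
    by rewrite -scalemxAl scaleNr.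
  rewrite w_add w_scale w_sum; congr (_ + _); apply/rowP => j.
  rewrite summxE !mxE -sumrN; apply: eq_bigr => i _.
  by rewrite w_scale !mxE mulNr.
have zE : z *m (1%:M - t *: E) = - (t * d) *: w Y.
  rewrite /z evz mulNmx -scalemxAl -mulmxA mul_adj_mx -/d mul_mx_scalar scalerA.
  by rewrite scaleNr.
move: zE; rewrite mulmxBr mulmx1 -scalemxAr => /eqP; rewrite subr_eq => /eqP zE.
by rewrite {1}zE scalerBr scalerA scaleNr opprD opprK opprB addrA subrK subrr.
Qed.

(** On the line joining the two points of the representation space each rigid orbit contains all but
    finitely many points, so the two orbits meet. *)
Lemma rigid_unique M N : is_rep M -> is_rep N -> Ext0 M M -> Ext0 N N ->
  dm M =1 dm N -> rep_iso M N.
Proof.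
move=> hM hN EM EN e; have [X NN'] := same_frame hM hN e.
set N' := Rep _ _ in NN'; have hN' := iso_rep NN' hN.
have EN' : Ext0 N' N' by apply: Ext0_iso EN.
apply: iso_trans (iso_sym NN').
have cX : @cocyc Q K M M (rX M) by case: hM.
have cX' : @cocyc Q K M M X by case: hN'.
have cY : @cocyc Q K M M (fun a => X a - rX M a) by apply: cocyc_sub.
have cY' : @cocyc Q K N' N' (fun a => rX M a - X a) by exact: cocyc_sub cX cX'.
have [p p0 hp] := rigid_line hM EM cY.
have [q q0 hq] := rigid_line hN' EN' cY'.
(* The line is parametrized from M for p and from N for q, whence the substitution of 1 - X for
   X. *)
have pq0 : p * (q \Po (1 - 'X)) != 0.
  rewrite mulf_neq0 //; first by apply: contraNneq p0 => ->; rewrite horner0.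
  apply: contraNneq q0 => e0; have := congr1 (fun r => r.[1]) e0.
  by rewrite horner_comp !hornerE subrr => ->.
have [t] := (closed_nonrootP _ pq0).
rewrite /root hornerM horner_comp !hornerE mulf_eq0 negb_or => /andP [/hp i1 /hq i2].
apply: iso_trans i1 _; apply: iso_sym; apply: iso_trans i2 _ => /=.
exists 1%:M, 1%:M; split; rewrite ?mulmx1 //; split=> a /=; rewrite mul1mx mulmx1 //.
by apply/matrixP => i j; rewrite !mxE; ring.
Qed.

Lemma brick_rigid M : is_rep M -> brick M -> 0 < eul (dz M) (dz M) ->
  Ext0 M M /\ eul (dz M) (dz M) = 1.
Proof.
move=> hM bM; have := brick_eul hM bM (fun P => @brick_scalar Q K M P bM).
move=> h1; have := eulE hM hM; rewrite h1 => <- e0.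
have e : ed M M = 0%N by lia.
by split; [apply/ed0P|rewrite e].
Qed.

Lemma brick_eul0 M : is_rep M -> brick M -> eul (dz M) (dz M) = 0 -> ed M M = 1%N.
Proof.
move=> hM bM; have := brick_eul hM bM (fun P => @brick_scalar Q K M P bM).
move=> h1; rewrite -(eulE hM hM) h1; lia.
Qed.

(** Induction on the dimension. If X is not a brick, Ringel's lemma yields a smaller indecomposable
    Y, rigid by induction, and a subobject I of Y with Ext(I, Y) nonzero; but Ext(Y, Y) = 0
    restricts to Ext(I, Y) = 0. A brick with positive form is rigid because its endomorphism ring is
    K. *)
Lemma dynkin X : (forall x : qV Q -> nat, (exists v, x v <> 0%N) ->
    0 < eul (fun v => (x v)%:Z) (fun v => (x v)%:Z)) ->
  is_rep X -> indec X -> [/\ brick X, Ext0 X X & eul (dz X) (dz X) = 1].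
Proof.
move=> pos; have [n] := ubnP (rdim X); elim: n X => // n IH X; rewrite ltnS => Xn hX iX.
have bX : brick X.
  apply: NNPP => nb; have [Y [I [i [c [j [iY [hi fi] lt [bI [hc fc] [hj fj] nE]]]]]]] := ringel hX iX nb.
  have hY := rep_inj hi fi hX.
  have [_ EY _] := IH Y (leq_trans lt Xn) hY iY.
  by apply: nE; apply: Ext0_sub hj fj EY.
have [] := brick_rigid hX bX; last by split.
apply: pos; apply: NNPP => no; case: bX => X0 _; move: X0; rewrite rdim_sum // big1 // => v _.
by apply: NNPP => d; apply: no; exists v.
Qed.

(** The representatives only have to be representations, not to satisfy P, which makes the notion
    stable under weakening P and under unions. *)
Definition fin_many (P : rep Q K -> Prop) := exists (T : finType) (F : T -> rep Q K),
  (forall t, is_rep (F t)) /\ forall M, P M -> exists t, rep_iso M (F t).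

Lemma zero_rep : is_rep (@Rep Q K 0 (fun _ => 0) (fun _ => 0)).
Proof. by split=> *; apply/matrixP; case. Qed.

(** A relation to a finite type that determines the isomorphism class suffices; values that are not
    attained receive the zero representation. *)
Lemma fin_by (T : finType) (inv : rep Q K -> T -> Prop) (P : rep Q K -> Prop) :
  (forall M, P M -> is_rep M) -> (forall M, P M -> exists t, inv M t) ->
  (forall M N t, P M -> P N -> inv M t -> inv N t -> rep_iso M N) -> fin_many P.
Proof.
move=> hP ex un.
have ch t : exists F, is_rep F /\ forall M, P M -> inv M t -> rep_iso M F.
  have [[M [PM iM]]|no] := classic (exists M, P M /\ inv M t).
    by exists M; split=> [|N PN iN]; [exact: hP|exact: un PN PM iN iM].
  by exists (@Rep Q K 0 (fun _ => 0) (fun _ => 0)); split=> [|M PM iM]; [exact: zero_rep|case: no; exists M].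
exists T, (fun t => wit (ch t)); split=> [t|M PM].
  by have [] := witP (ch t).
by have [t it] := ex M PM; exists t; have [_ h] := witP (ch t); apply: h.
Qed.

Lemma fin_many_rigid B : fin_many (fun M => [/\ is_rep M, Ext0 M M & forall v, dm M v < B]%N).
Proof.
case: B => [|B].
  apply: (@fin_by unit (fun _ _ => True)); first by move=> M [].
    by move=> M _; exists tt.
  move=> M N _ [hM EM dM] [hN EN dN] _ _; apply: rigid_unique => // v; by have := dM v.
apply: (@fin_by {ffun qV Q -> 'I_B.+1} (fun M f => forall v, f v = dm M v :> nat)).
- by move=> M [].
- move=> M [hM EM dM]; exists [ffun v => inord (dm M v)] => v.
  by rewrite ffunE inordK // dM.
- move=> M N f [hM EM dM] [hN EN dN] fM fN; apply: rigid_unique => // v.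
  by rewrite -fM -fN.
Qed.

Lemma fin_many_sub (P R : rep Q K -> Prop) : (forall M, P M -> R M) -> fin_many R -> fin_many P.
Proof. by move=> PR [T [F [hF e]]]; exists T, F; split=> // M /PR /e. Qed.

Lemma fin_many_or (P R : rep Q K -> Prop) : fin_many P -> fin_many R ->
  fin_many (fun M => P M \/ R M).
Proof.
move=> [T [F [hF e]]] [T' [F' [hF' e']]].
exists (T + T')%type, (fun t => match t with inl t => F t | inr t => F' t end).
split=> [[t|t] //|M [/e [t h]|/e' [t h]]]; first by exists (inl t).
by exists (inr t).
Qed.

End Line.

(** * The torsion pair of a defect *)

Section Torsion.
Variables (Q : bquiver) (K : closedFieldType).
Hypothesis freeQ : forall a b, @qrel Q a b = false.
Variables (delta : qV Q -> int) (S : K -> rep Q K).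
Implicit Types L M N X Y Z I J R : rep Q K.
Hypothesis S_rep : forall t, is_rep (S t).
Hypothesis S_dim : forall t, dz (S t) =1 delta.
Hypothesis S_orth : forall t u P, t <> u -> hom (S t) (S u) P -> P = 0.
Hypothesis rad : forall x, eul x delta = - eul delta x.
Hypothesis psd : forall x : qV Q -> nat, 0 <= eul (fun v => (x v)%:Z) (fun v => (x v)%:Z).
Hypothesis psd0 : forall x : qV Q -> nat,
  eul (fun v => (x v)%:Z) (fun v => (x v)%:Z) = 0 ->
  exists k : nat, forall v, (x v)%:Z = k%:Z * delta v.

Definition dfc M : int := eul delta (dz M).

Lemma avoid (s : seq K) : exists t, t \notin s.
Proof.
have p0 : \prod_(x <- s) ('X - x%:P) != 0 by rewrite monic_neq0 ?monic_prod_XsubC.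
have [t] := closed_nonrootP _ p0; rewrite root_prod_XsubC => ts.
by exists t.
Qed.

Lemma dfc_exact Z X I k c : is_rep X -> @exact Q K Z X I k c -> dfc X = dfc Z + dfc I.
Proof.
move=> hX ex; rewrite /dfc -eul_addr; apply: eq_eul => // v; exact: exact_dz ex.
Qed.

Lemma dfc_iso M N : rep_iso M N -> dfc M = dfc N.
Proof. by move=> /iso_dz e; apply: eq_eul. Qed.

Lemma dfc_dim0 M : rdim M = 0%N -> dfc M = 0.
Proof.
move=> e; have z v : dz M v = 0.
  by have := rank_leq_row (re M v); rewrite /dz /dm; lia.
by rewrite /dfc /eul big1 ?big1 ?subrr // => i _; rewrite z mulr0.
Qed.

Lemma delta_delta : eul delta delta = 0.
Proof. have := rad delta; lia. Qed.

Lemma hd_S t N : is_rep N -> (hd (S t) N)%:Z - (ed (S t) N)%:Z = dfc N.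
Proof. by move=> hN; rewrite eulE //; apply: eq_eul. Qed.

Lemma hd_toS t N : is_rep N -> (hd N (S t))%:Z - (ed N (S t))%:Z = - dfc N.
Proof.
move=> hN; rewrite eulE //; rewrite -/(eul (dz N) (dz (S t))).
by rewrite -rad; apply: eq_eul.
Qed.

Lemma nz_hom M N : is_rep M -> is_rep N -> (0 < hd M N)%N -> exists2 P, hom M N P & P <> 0.
Proof.
move=> hM hN h; apply: NNPP => no; move: h; rewrite lt0n => /negP; apply; apply/eqP.
by apply/(hd0P hM hN) => P hP; apply: NNPP => P0; apply: no; exists P.
Qed.

Lemma Ext0_SS t u : t <> u -> Ext0 (S t) (S u).
Proof.
move=> tu; apply/ed0P => //; have h0 : hd (S t) (S u) = 0%N.
  by apply/hd0P => // P; apply: S_orth.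
have := hd_S t (S_rep u); rewrite h0 /dfc.
have -> : eul delta (dz (S u)) = 0 by rewrite -[RHS]delta_delta; apply: eq_eul.
lia.
Qed.

(** Finite filtrations whose factors are zero or quotients of some S(t) with t in s. The list s is
    kept because orthogonality of the S(t) then gives Ext(S(u), X) = 0 for all u outside s. The dual
    notion [cog] uses subobjects of the S(t). *)
Inductive gen (s : seq K) : rep Q K -> Prop :=
| gen0 Z : rdim Z = 0%N -> gen s Z
| genS Z X I k c : is_rep X -> @exact Q K Z X I k c -> gen s Z ->
    (rdim I = 0%N \/ exists t d, t \in s /\ hom (S t) I d /\ row_full d) -> gen s X.

Inductive cog (s : seq K) : rep Q K -> Prop :=
| cog0 Z : rdim Z = 0%N -> cog s Z
| cogS Z X I k c : is_rep X -> @exact Q K Z X I k c -> cog s I ->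
    (rdim Z = 0%N \/ exists t d, t \in s /\ hom Z (S t) d /\ row_free d) -> cog s X.

Lemma Ext0_dim0r M N : rdim N = 0%N -> Ext0 M N.
Proof.
move=> e h ch; exists 0; first by move=> v; rewrite mulmx0 mul0mx.
by move=> a; apply/matrixP => i j; have := leq_trans (ltn_ord j) (eq_leq e).
Qed.

Lemma Ext0_dim0l M N : rdim M = 0%N -> Ext0 M N.
Proof.
move=> e h ch; exists 0; first by move=> v; rewrite mulmx0 mul0mx.
by move=> a; apply/matrixP => i; have := leq_trans (ltn_ord i) (eq_leq e).
Qed.

Lemma Ext0_gen s N X : is_rep N -> gen s X -> (forall t, t \in s -> Ext0 N (S t)) -> Ext0 N X.
Proof.
move=> hN g E; elim: g => [Z e|{}Z {}X {}I k c hX ex gZ IH h]; first exact: Ext0_dim0r.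
apply: Ext0_ext_r ex IH _ => //.
case: h => [e|[t [d [ts [hd' fd]]]]]; first exact: Ext0_dim0r.
by apply: (Ext0_quo hN (S_rep t) hd' fd); apply: E.
Qed.

Lemma Ext0_cog s N X : is_rep N -> cog s X -> (forall t, t \in s -> Ext0 (S t) N) -> Ext0 X N.
Proof.
move=> hN g E; elim: g => [Z e|{}Z {}X {}I k c hX ex gZ IH h]; first exact: Ext0_dim0l.
apply: Ext0_ext_l ex _ IH => //.
case: h => [e|[t [d [ts [hd' fd]]]]]; first exact: Ext0_dim0l.
by apply: (Ext0_sub (S_rep t) hN hd' fd); apply: E.
Qed.

Lemma gen_sub s s' X : {subset s <= s'} -> gen s X -> gen s' X.
Proof.
move=> ss; elim=> [Z e|{}Z {}X {}I k c hX ex gZ IH h]; first exact: gen0.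
apply: genS hX ex IH _; case: h => [|[t [d [/ss ts h]]]]; [by left|right].
by exists t, d.
Qed.

Lemma cog_sub s s' X : {subset s <= s'} -> cog s X -> cog s' X.
Proof.
move=> ss; elim=> [Z e|{}Z {}X {}I k c hX ex gZ IH h]; first exact: cog0.
apply: cogS hX ex IH _; case: h => [|[t [d [/ss ts h]]]]; [by left|right].
by exists t, d.
Qed.

Lemma rdim_exact Z X I k c : is_rep X -> @exact Q K Z X I k c -> rdim X = (rdim Z + rdim I)%N.
Proof.
move=> hX ex; have [hk hc fk fc _] := ex.
rewrite !rdim_sum //; [|exact: rep_surj hc fc hX|exact: rep_inj hk fk hX].
by rewrite -big_split; apply: eq_bigr => v _; rewrite (exact_dm v hX ex).
Qed.

Lemma rdim_free M N P : hom M N P -> row_free P -> (rdim M <= rdim N)%N.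
Proof. by move=> _ /eqP f; rewrite -f rank_leq_col. Qed.

Lemma rdim_full M N P : hom M N P -> row_full P -> (rdim N <= rdim M)%N.
Proof. by move=> _ /eqP f; rewrite -f rank_leq_row. Qed.

(** J is a subobject of M of largest dimension that is filtered by quotients of the S(t) with t in
    La. If a map from S(t) did not land in J, then J plus its image would be a larger one. *)
Lemma trace (La : K -> Prop) M : is_rep M -> exists J (k : 'M[K]_(rdim J, rdim M)) s,
  [/\ hom J M k, row_free k, gen s J, forall t, t \in s -> La t &
      forall t f, La t -> hom (S t) M f -> exists2 g, hom (S t) J g & f = g *m k].
Proof.
move=> hM.
pose P n := exists J (k : 'M[K]_(rdim J, rdim M)) s,
  [/\ hom J M k, row_free k, gen s J, forall t, t \in s -> La t & rdim J = n].
have [||n [J [k [s [hk fk gJ sL Jn]]]] nmax] := @nat_max P (rdim M).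
- exists 0%N, (@Rep Q K 0 (fun _ => 0) (fun _ => 0)), 0, [::]; split=> //.
  + by split=> i; rewrite mul0mx; apply/matrixP; case.
  + by rewrite /row_free mxrank0.
  + exact: gen0.
- by move=> n [J [k [s [hk fk _ _ <-]]]]; apply: rdim_free hk fk.
exists J, k, s; split=> // t f Lt hf.
have hJ := rep_inj hk fk hM.
have [X [x [hx fx ex]]] := stab_sub (stab_add (stab_hom hk) (stab_hom hf)).
have hX := rep_inj hx fx hM.
have [k' k'E] : exists k', k = k' *m x by apply/submxP; rewrite ex addsmxSl.
have [f' f'E] : exists f', f = f' *m x by apply/submxP; rewrite ex addsmxSr.
have hk' : hom J X k' by apply: hom_injK hx fx _; rewrite -k'E.
have hf' : hom (S t) X f' by apply: hom_injK hx fx _; rewrite -f'E.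
have fk' : row_free k'.
  by rewrite /row_free -(mxrankMfree _ fx) -k'E.
have [I [c exk]] := exact_sub hk' fk'; have [_ hc _ fc _] := exk.
have full : row_full (f' *m c).
  rewrite -sub1mx; have : (1%:M <= c)%MS by rewrite sub1mx.
  move=> /submx_trans; apply.
  have : ((1%:M : 'M[K]_(rdim X)) <= k' + f')%MS.
    have : (x <= (k' + f')%MS *m x)%MS by rewrite addsmxMr -k'E -f'E ex.
    move=> /submxP [E eE]; apply/submxP; exists E; apply: (row_free_inj fx).
    by rewrite mul1mx -mulmxA.
  by move=> /(submxMr c); rewrite addsmxMr (exact_comp0 exk) adds0mx mul1mx.
have gX : gen (t :: s) X.
  apply: genS hX exk _ _.
    by apply: gen_sub gJ => y ys; rewrite inE ys orbT.
  by right; exists t, (f' *m c); rewrite inE eqxx; split=> //; split=> //; apply: hom_comp hf' hc.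
have Xn : (rdim X <= n)%N.
  apply: nmax; exists X, x, (t :: s); split=> // y; rewrite inE => /orP [/eqP ->|/sL] //.
have I0 : rdim I = 0%N by have := rdim_exact hX exk; lia.
have z : f' *m c = 0.
  by apply/matrixP => i j; have := leq_trans (ltn_ord j) (eq_leq I0).
have [g hg gE] := exact_factor_hom exk hf' z.
by exists g => //; rewrite f'E gE -mulmxA -k'E.
Qed.

(** Dual to [trace]: J is a largest quotient with a filtration by subobjects of the S(t), and a map
    that does not factor through it would let the kernel shrink to the intersection of two
    kernels. *)
Lemma cotrace (La : K -> Prop) M : is_rep M -> exists J (c : 'M[K]_(rdim M, rdim J)) s,
  [/\ hom M J c, row_full c, cog s J, forall t, t \in s -> La t &
      forall t f, La t -> hom M (S t) f -> exists2 g, hom J (S t) g & f = c *m g].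
Proof.
move=> hM.
pose P n := exists J (c : 'M[K]_(rdim M, rdim J)) s,
  [/\ hom M J c, row_full c, cog s J, forall t, t \in s -> La t & rdim J = n].
have [||n [J [c [s [hc fc gJ sL Jn]]]] nmax] := @nat_max P (rdim M).
- exists 0%N, (@Rep Q K 0 (fun _ => 0) (fun _ => 0)), 0, [::]; split=> //.
  + by split=> i; rewrite mulmx0; apply/matrixP => ? [].
  + by rewrite /row_full mxrank0.
  + exact: cog0.
- by move=> n [J [k [s [hk fk _ _ <-]]]]; apply: rdim_full hk fk.
exists J, c, s; split=> // t f Lt hf.
have hJ := rep_surj hc fc hM.
have [X [x [hx fx ex]]] := stab_quo (stab_cap (stab_ker hc) (stab_ker hf)).
have hX := rep_surj hx fx hM.
have [W [w exw]] := exact_quo hx fx; have [hw _ fw _ ew] := exw.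
have wk : (w <= kermx c :&: kermx f)%MS by rewrite -ex ew.
have wc : w *m c = 0 by apply/sub_kermxP; apply: submx_trans wk (capmxSl _ _).
have wf : w *m f = 0 by apply/sub_kermxP; apply: submx_trans wk (capmxSr _ _).
have [c' hc' c'E] := exact_cofactor_hom exw hc wc.
have [f' hf' f'E] := exact_cofactor_hom exw hf wf.
have fc' : row_full c'.
  by rewrite -sub1mx (submx_trans _ (submxMl x c')) // -c'E sub1mx.
have [Z [k exk]] := exact_quo hc' fc'; have [hk _ fk _ _] := exk.
have free : row_free (k *m f').
  apply/row_freeP; apply/row_freeP; rewrite -kermx_eq0 -submx0.
  set y := kermx _; have yk : y *m (k *m f') = 0 by apply: mulmx_ker.
  pose z := y *m k *m pinvmx x.
  have zx : z *m x = y *m k by rewrite /z mulmxKpV // (submx_trans (submx1 _)) ?sub1mx.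
  have zk : (z <= kermx x)%MS.
    rewrite ex sub_capmx; apply/andP; split; apply/sub_kermxP.
      by rewrite c'E mulmxA zx -mulmxA (exact_comp0 exk) mulmx0.
    by rewrite f'E mulmxA zx -mulmxA yk.
  move/sub_kermxP: zk; rewrite zx => yk0.
  by rewrite -[y]mulmx1; rewrite submx0; apply/eqP/(row_free_inj fk); rewrite mulmx1 yk0 mul0mx.
have gX : cog (t :: s) X.
  apply: cogS hX exk _ _.
    by apply: cog_sub gJ => y ys; rewrite inE ys orbT.
  by right; exists t, (k *m f'); rewrite inE eqxx; split=> //; split=> //; apply: hom_comp hk hf'.
have Xn : (rdim X <= n)%N.
  apply: nmax; exists X, x, (t :: s); split=> // y; rewrite inE => /orP [/eqP ->|/sL] //.
have Z0 : rdim Z = 0%N by have := rdim_exact hX exk; lia.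
have z : k *m f' = 0.
  by apply/matrixP => i; have := leq_trans (ltn_ord i) (eq_leq Z0).
have [g hg gE] := exact_cofactor_hom exk hf' z.
by exists g => //; rewrite f'E gE mulmxA -c'E.
Qed.

(** [semi] is the torsion-free class, preprojective and regular objects together; [neg] singles out
    the preprojective ones, and [Tp] is the torsion class of preinjective objects. A regular object
    is a [semi] one of defect zero. *)
Definition semi M := forall Z k, hom Z M k -> row_free k -> dfc Z <= 0.
Definition neg M := forall Z k, hom Z M k -> row_free k -> (0 < rdim Z)%N -> dfc Z < 0.
Definition Tp M := forall I c, hom M I c -> row_full c -> (0 < rdim I)%N -> 0 < dfc I.

Lemma semi_sub M Z k : hom Z M k -> row_free k -> semi M -> semi Z.
Proof.
move=> hk fk sM Y y hy fy; apply: (sM Y (y *m k)); first exact: hom_comp hy hk.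
by rewrite /row_free mxrankMfree.
Qed.

Lemma neg_sub M Z k : hom Z M k -> row_free k -> neg M -> neg Z.
Proof.
move=> hk fk sM Y y hy fy; apply: (sM Y (y *m k)); first exact: hom_comp hy hk.
by rewrite /row_free mxrankMfree.
Qed.

Lemma Tp_quo M I c : hom M I c -> row_full c -> Tp M -> Tp I.
Proof.
move=> hc fc sM Y y hy fy; apply: (sM Y (c *m y)); first exact: hom_comp hc hy.
by rewrite /row_full (eqmxMfull _ fc).
Qed.

(** Every map from S(t) lands in the trace J. For t outside the list of J, Ext(S(t), J) = 0, so dim
    Hom(S(t), J) equals the defect of J, which is at most 0. *)
Lemma semi_hom0 M : is_rep M -> semi M -> exists s : seq K, forall t, t \notin s ->
  forall f, hom (S t) M f -> f = 0.
Proof.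
move=> hM sM; have [J [k [s [hk fk gJ _ fac]]]] := trace (fun _ => True) hM.
have hJ := rep_inj hk fk hM.
exists s => t ts f hf; have [g hg ->] := fac t f I hf.
have E : Ext0 (S t) J.
  apply: (Ext0_gen (S_rep t) gJ) => u us; apply: Ext0_SS => e; by rewrite e us in ts.
have h0 : hd (S t) J = 0%N.
  by have := hd_S t hJ; have := sM J k hk fk; rewrite (ed0P (S_rep t) hJ).2 //; lia.
by rewrite ((hd0P (S_rep t) hJ).1 h0 g hg) mul0mx.
Qed.

Lemma semi_ext0 M : is_rep M -> semi M -> dfc M = 0 -> exists s : seq K, forall t, t \notin s ->
  Ext0 (S t) M.
Proof.
move=> hM sM d0; have [s hs] := semi_hom0 hM sM; exists s => t /hs h.
have h0 := (hd0P (S_rep t) hM).2 h.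
by apply/ed0P => //; have := hd_S t hM; rewrite h0 d0; lia.
Qed.

(** For t outside the list of the cotrace J, dim Hom(N, S(t)) is at most dim Hom(J, S(t)) = - defect
    J. Hence dim Ext(N, S(t)) is at most the defect of the kernel of N onto J, which is at most
    0. *)
Lemma semi_ext_to N : is_rep N -> semi N -> exists s : seq K, forall t, t \notin s ->
  Ext0 N (S t).
Proof.
move=> hN sN; have [J [c [s [hc fc gJ _ fac]]]] := cotrace (fun _ => True) hN.
have hJ := rep_surj hc fc hN.
have [Z [k ex]] := exact_quo hc fc; have [hk _ fk _ _] := ex.
exists s => t ts; apply/ed0P => //.
have E : Ext0 J (S t).
  apply: (Ext0_cog (S_rep t) gJ) => u us; apply: Ext0_SS => e; by rewrite -e us in ts.
have le : (hd N (S t) <= hd J (S t))%N by apply: (hd_factor _ hN hJ hc) => // f /(fac t f I).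
have := hd_toS t hJ; rewrite (ed0P hJ (S_rep t)).2 // => e1.
have := hd_toS t hN; have := dfc_exact hN ex; have := sN Z k hk fk; lia.
Qed.

(** If Z differs from its trace J, then Z/J has positive defect and receives a nonzero map from S(t)
    for a fresh t. This map lifts to Z because Ext(S(t), J) = 0, and it lands in J by construction,
    a contradiction. *)
Lemma Tp_gen Z (s0 : seq K) : is_rep Z -> Tp Z ->
  exists s, gen s Z /\ forall t, t \in s -> t \notin s0.
Proof.
move=> hZ tZ; have [J [k [s [hk fk gJ sL fac]]]] := trace (fun t => t \notin s0) hZ.
have hJ := rep_inj hk fk hZ; have [I [c ex]] := exact_sub hk fk; have [_ hc _ fc _] := ex.
have hI := rep_surj hc fc hZ.
exists s; split=> //; apply: (genS hZ ex gJ); left; apply: NNPP => I0.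
have dI : 0 < dfc I by apply: tZ hc fc _; lia.
have [t] := avoid (s ++ s0); rewrite mem_cat negb_or => /andP [ts ts0].
have pos : (0 < hd (S t) I)%N by have := hd_S t hI; lia.
have [f hf f0] := nz_hom (S_rep t) hI pos.
have E : Ext0 (S t) J.
  apply: (Ext0_gen (S_rep t) gJ) => u us; apply: Ext0_SS => e; by rewrite e us in ts.
have [g hg gc] := Ext0_exact_lift (S_rep t) hZ ex E hf.
have [h hh ge] := fac t g ts0 hg.
by apply: f0; rewrite -gc ge -mulmxA (exact_comp0 ex) mulmx0.
Qed.

Lemma neg_cog N (s0 : seq K) : is_rep N -> neg N ->
  exists s, cog s N /\ forall t, t \in s -> t \notin s0.
Proof.
move=> hN nN; have [J [c [s [hc fc gJ sL fac]]]] := cotrace (fun t => t \notin s0) hN.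
have hJ := rep_surj hc fc hN; have [Z [k ex]] := exact_quo hc fc; have [hk _ fk _ _] := ex.
have hZ := rep_inj hk fk hN.
exists s; split=> //; apply: (cogS hN ex gJ); left; apply: NNPP => Z0.
have dZ : dfc Z < 0 by apply: nN hk fk _; lia.
have [t] := avoid (s ++ s0); rewrite mem_cat negb_or => /andP [ts ts0].
have pos : (0 < hd Z (S t))%N by have := hd_toS t hZ; lia.
have [f hf f0] := nz_hom hZ (S_rep t) pos.
have E : Ext0 J (S t).
  apply: (Ext0_cog (S_rep t) gJ) => u us; apply: Ext0_SS => e; by rewrite -e us in ts.
have [g hg gc] := Ext0_exact_extend (S_rep t) hN ex E hf.
have [h hh ge] := fac t g ts0 hg.
by apply: f0; rewrite -gc ge mulmxA (exact_comp0 ex) mul0mx.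
Qed.

(** Z is filtered by quotients of S(t) with t avoiding the finitely many parameters for which Ext(N,
    S(t)) may be nonzero. Consequently the torsion sequence of any object splits. *)
Lemma Ext0_semi_Tp N Z : is_rep N -> is_rep Z -> semi N -> Tp Z -> Ext0 N Z.
Proof.
move=> hN hZ sN tZ; have [s0 h0] := semi_ext_to hN sN.
have [s [gZ hs]] := Tp_gen s0 hZ tZ.
by apply: (Ext0_gen hN gZ) => t /hs /h0.
Qed.

Lemma Ext0_neg_reg N R : is_rep N -> is_rep R -> neg N -> semi R -> dfc R = 0 -> Ext0 N R.
Proof.
move=> hN hR nN sR dR; have [s0 h0] := semi_ext0 hR sR dR.
have [s [gN hs]] := neg_cog s0 hN nN.
by apply: (Ext0_cog hR gN) => t /hs /h0.
Qed.

Lemma exact_pull Z X I k c Y y : is_rep X -> @exact Q K Z X I k c -> hom Y I y -> row_free y ->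
  exists W (w : 'M[K]_(rdim W, rdim X)) k' c',
  [/\ hom W X w, row_free w & @exact Q K Z W Y k' c'].
Proof.
move=> hX ex hy fy; have [hk hc fk fc kc] := ex.
have [D [d exy]] := exact_sub hy fy; have [_ hd' _ _ _] := exy.
have [W [w [hw fw ew]]] := stab_sub (stab_ker (hom_comp hc hd')).
have wz : w *m c *m d = 0 by rewrite -mulmxA; apply/sub_kermxP; rewrite ew.
have [c' hc' c'E] := exact_factor_hom exy (hom_comp hw hc) wz.
have [k' k'E] : exists k', k = k' *m w.
  apply/submxP; rewrite ew; apply/sub_kermxP.
  by rewrite mulmxA (exact_comp0 ex) mul0mx.
have hk' : hom Z W k' by apply: hom_injK hw fw _; rewrite -k'E.
exists W, w, k', c'; split=> //; split=> //.
- by rewrite /row_free -(mxrankMfree _ fw) -k'E.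
- have : (y *m pinvmx c <= kermx (c *m d))%MS.
    by apply/sub_kermxP; rewrite mulmxA -(mulmxA y) mulVpmx // mulmx1 (exact_comp0 exy).
  rewrite -ew => /submxP [E eE].
  rewrite -sub1mx; apply/submxP; exists E; apply: (row_free_inj fy).
  by rewrite mul1mx -mulmxA -c'E mulmxA -eE -mulmxA mulVpmx // mulmx1.
apply/eqmxP/andP; split; last first.
  apply/sub_kermxP; apply: (row_free_inj fy); rewrite mul0mx -mulmxA -c'E mulmxA -k'E.
  exact: exact_comp0 ex.
have : (kermx c' *m w <= k)%MS.
  rewrite -kc; apply/sub_kermxP; by rewrite -mulmxA c'E mulmxA mulmx_ker mul0mx.
move=> /submxP [E eE]; apply/submxP; exists E; apply: (row_free_inj fw).
by rewrite eE k'E mulmxA.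
Qed.

Lemma dfc_bound M : exists B : nat, forall Z k, hom Z M k -> row_free k -> dfc Z <= B%:Z.
Proof.
pose B := (\sum_v `|delta v| * rdim M + \sum_a `|delta (qs a)| * rdim M)%N.
exists B => Z k hk fk; have le v : (dm Z v <= rdim M)%N.
  by apply: leq_trans (rank_leq_row _) (rdim_free hk fk).
rewrite /dfc /eul /B PoszD; apply: lerD.
  rewrite (big_morph Posz PoszD (erefl (Posz 0))); apply: ler_sum => v _.
  rewrite /dz; have := le v; nia.
rewrite -sumrN (big_morph Posz PoszD (erefl (Posz 0))); apply: ler_sum => a _.
rewrite /dz; have := le (qt a); nia.
Qed.

(** Among the subobjects of largest defect Z has least dimension. A quotient of Z with nonpositive
    defect would leave a smaller such subobject, and a subobject of M/Z of positive defect would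
    pull back to one of larger defect. *)
Lemma torsion_seq M : is_rep M -> exists Z N k c, [/\ @exact Q K Z M N k c, Tp Z & semi N].
Proof.
move=> hM; have [B hB] := dfc_bound M.
pose P n := exists Z k, [/\ hom Z M k, row_free k & dfc Z = n%:Z].
have [||n Pn nmax] := @nat_max P B.
- exists 0%N, (@Rep Q K 0 (fun _ => 0) (fun _ => 0)), 0; split=> //.
  + by split=> i; rewrite mul0mx; apply/matrixP; case.
  + by rewrite /row_free mxrank0.
  + by rewrite dfc_dim0.
- by move=> n [Z [k [hk fk e]]]; have := hB Z k hk fk; rewrite e.
have Zmax Z k : hom Z M k -> row_free k -> dfc Z <= n%:Z.
  move=> hk fk; case e : (dfc Z) => [d|d] //.
  by rewrite lez_nat; apply: nmax; exists Z, k.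
have [|d [Z [k [hk fk dZ Zd]]] dmin] :=
  @nat_min (fun d => exists Z k, [/\ hom Z M k, row_free k, dfc Z = n%:Z & rdim Z = d]).
  by have [Z [k [hk fk e]]] := Pn; exists (rdim Z), Z, k.
have hZ := rep_inj hk fk hM.
have [N [c ex]] := exact_sub hk fk; have [_ hc _ fc _] := ex.
exists Z, N, k, c; split=> //.
  move=> I i hi fi I0; have [Y [y exy]] := exact_quo hi fi; have [hy _ fy _ _] := exy.
  have fyk : row_free (y *m k) by rewrite /row_free mxrankMfree.
  have := Zmax Y _ (hom_comp hy hk) fyk; have := dfc_exact hZ exy => e le.
  have : dfc I <> 0.
    move=> dI; have : (d <= rdim Y)%N.
      by apply: dmin; exists Y, (y *m k); split=> //; [exact: hom_comp hy hk|lia].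
    have := rdim_exact hZ exy; lia.
  lia.
move=> Y y hy fy; have [W [w [k' [c' [hw fw exw]]]]] := exact_pull hM ex hy fy.
have := Zmax W w hw fw; have := dfc_exact (rep_inj hw fw hM) exw; lia.
Qed.

Lemma exact0l_free Z X I k c : @exact Q K Z X I k c -> rdim Z = 0%N -> row_free c.
Proof.
move=> [_ _ _ _ e] Z0; rewrite -kermx_eq0 -submx0 e.
by rewrite submx0 -mxrank_eq0; have := rank_leq_row k; lia.
Qed.

Lemma exact0r_full Z X I k c : @exact Q K Z X I k c -> rdim I = 0%N -> row_full k.
Proof.
move=> [_ _ _ _ e] I0; rewrite -sub1mx -e; apply/sub_kermxP.
by apply/matrixP => i j; have := leq_trans (ltn_ord j) (eq_leq I0).
Qed.

Lemma indec_torsion M : is_rep M -> indec M -> semi M \/ Tp M.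
Proof.
move=> hM iM; have [Z [N [k [c [ex tZ sN]]]]] := torsion_seq hM.
have [hk hc fk fc _] := ex; have hZ := rep_inj hk fk hM; have hN := rep_surj hc fc hM.
case: (indec_exact iM hM ex (Ext0_semi_Tp hN hZ sN tZ)) => e.
  by left; apply: semi_sub hc _ sN; apply: exact0l_free ex e.
by right; apply: Tp_quo hk _ tZ; apply: exact0r_full ex e.
Qed.

(** R is a subobject of defect zero and of largest dimension; a nonzero subobject of the quotient
    with defect zero would enlarge it. *)
Lemma reg_seq M : is_rep M -> semi M -> exists R N k c,
  [/\ @exact Q K R M N k c, dfc R = 0, semi R & neg N].
Proof.
move=> hM sM.
pose P n := exists R k, [/\ hom R M k, row_free k, dfc R = 0 & rdim R = n].
have [||n [R [k [hk fk dR Rn]]] nmax] := @nat_max P (rdim M).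
- exists 0%N, (@Rep Q K 0 (fun _ => 0) (fun _ => 0)), 0; split=> //.
  + by split=> i; rewrite mul0mx; apply/matrixP; case.
  + by rewrite /row_free mxrank0.
  + by rewrite dfc_dim0.
- by move=> n [Z [k [hk fk _ <-]]]; apply: rdim_free hk fk.
have [N [c ex]] := exact_sub hk fk.
exists R, N, k, c; split=> //; first exact: semi_sub hk fk sM.
move=> Y y hy fy Y0; have [W [w [k' [c' [hw fw exw]]]]] := exact_pull hM ex hy fy.
have hW := rep_inj hw fw hM.
have := sM W w hw fw; have := dfc_exact hW exw; have := rdim_exact hW exw => e1 e2 le.
have : dfc W <> 0.
  by move=> d0; have : (rdim W <= n)%N; [apply: nmax; exists W, w|lia].
lia.
Qed.

Lemma indec_semi M : is_rep M -> indec M -> semi M -> dfc M = 0 \/ neg M.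
Proof.
move=> hM iM sM; have [R [N [k [c [ex dR sR nN]]]]] := reg_seq hM sM.
have [hk hc fk fc _] := ex; have hR := rep_inj hk fk hM; have hN := rep_surj hc fc hM.
case: (indec_exact iM hM ex (Ext0_neg_reg hN hR nN sR dR)) => e.
  by right; apply: neg_sub hc _ nN; apply: exact0l_free ex e.
left; rewrite (dfc_exact hM ex) dR dfc_dim0 //.
Qed.

(** A brick on which the form vanishes has dimension a multiple of delta, hence defect zero. *)
Lemma brick_dfc M : is_rep M -> brick M -> dfc M <> 0 -> Ext0 M M.
Proof.
move=> hM bM d0; have [|//] := brick_rigid hM bM.
have := psd (dm M); rewrite le_eqVlt => /orP [/eqP e|//].
have [k hk] := psd0 (esym e).
case: d0; rewrite /dfc -[RHS](mulr0 k%:Z) -delta_delta -eul_scaler; exact: eq_eul.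
Qed.

(** In Ringel's lemma the brick I is a quotient of M, so its defect is positive. Being contained in
    Y, it prevents Y from being torsion-free; Y is then torsion and smaller, and rigid by
    induction. *)
Lemma Tp_rigid M : is_rep M -> indec M -> Tp M -> Ext0 M M.
Proof.
have [n] := ubnP (rdim M); elim: n M => // n IH M; rewrite ltnS => Mn hM iM tM.
have bM : brick M.
  apply: NNPP => nb; have [Y [I [i [c [j [iY [hi fi] lt [bI [hc fc] [hj fj] nE]]]]]]] := ringel hM iM nb.
  have hY := rep_inj hi fi hM; apply: nE; apply: (Ext0_sub hY hY hj fj).
  apply: IH => //; first exact: leq_trans lt Mn.
  case: (indec_torsion hY iY) => // sY; have := sY I j hj fj.
  by case: bI => I0 _; have := tM I c hc fc I0; lia.
apply: brick_dfc => //; have [M0 _] := iM.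
have := tM M 1%:M (hom_id M) _ M0; rewrite /row_full mxrank1 eqxx => /(_ isT); lia.
Qed.

Lemma neg_rigid M : is_rep M -> indec M -> neg M -> Ext0 M M.
Proof.
have [n] := ubnP (rdim M); elim: n M => // n IH M; rewrite ltnS => Mn hM iM tM.
have bM : brick M.
  apply: NNPP => nb; have [Y [I [i [c [j [iY [hi fi] lt [bI [hc fc] [hj fj] nE]]]]]]] := ringel hM iM nb.
  have hY := rep_inj hi fi hM; apply: nE; apply: (Ext0_sub hY hY hj fj).
  apply: IH => //; first exact: leq_trans lt Mn.
  exact: neg_sub hi fi tM.
apply: brick_dfc => //; have [M0 _] := iM.
have := tM M 1%:M (hom_id M) _ M0; rewrite /row_free mxrank1 eqxx => /(_ isT); lia.
Qed.

Lemma indec_rigid_or_regular M : is_rep M -> indec M -> Ext0 M M \/ (semi M /\ dfc M = 0).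
Proof.
move=> hM iM; case: (indec_torsion hM iM) => [sM|tM]; last by left; apply: Tp_rigid.
case: (indec_semi hM iM sM) => [d0|nM]; first by right.
by left; apply: neg_rigid.
Qed.

End Torsion.

(** * Simple regular objects and strings *)

Section Simple.
Variables (Q : bquiver) (K : closedFieldType).
Variables (delta : qV Q -> int).
Implicit Types L M N X Y Z R : rep Q K.
Notation dfc := (dfc delta).
Notation semi := (semi delta).

(** Simple objects of the abelian category of regular objects: the only nonzero subobject of defect
    zero is the whole. *)
Definition simp X := [/\ is_rep X, semi X, dfc X = 0, (0 < rdim X)%N &
  forall Z k, hom Z X k -> row_free k -> (0 < rdim Z)%N -> dfc Z = 0 -> rdim Z = rdim X].

Lemma simp_iso X Y : rep_iso X Y -> simp X -> simp Y.
Proof.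
move=> XY [hX sX dX X0 mX]; have dXY := iso_dim XY.
have [f [f' [hf e1 e2]]] := iso_sym XY; have ff : row_free f by apply/row_freeP; exists f'.
split; first exact: iso_rep hX.
- exact: semi_sub hf ff sX.
- by rewrite -(dfc_iso delta XY).
- by rewrite -dXY.
move=> Z k hk fk Z0 dZ; rewrite -dXY; apply: (mX Z (k *m f)) => //; first exact: hom_comp hk hf.
by rewrite /row_free mxrankMfree.
Qed.

Lemma simp_free X M f : simp X -> is_rep M -> semi M -> hom X M f -> f <> 0 -> row_free f.
Proof.
move=> [hX sX dX X0 mX] hM sM hf f0.
have [I [c [b [hc hb fc fb fE]]]] := hom_image hf.
have [Z [k ex]] := exact_quo hc fc; have [hk _ fk _ _] := ex.
have e := dfc_exact delta hX ex; have le := sM I b hb fb; have le' := sX Z k hk fk.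
have [Z0|Z0] := posnP (rdim Z).
  by rewrite fE /row_free mxrankMfree //; exact: exact0l_free ex Z0.
have ZX := mX Z k hk fk Z0 ltac:(lia).
have I0 : rdim I = 0%N by have := rdim_exact hX ex; lia.
by case: f0; rewrite fE; apply/matrixP => i j; rewrite !mxE big1 // => y _;
  have := leq_trans (ltn_ord y) (eq_leq I0).
Qed.

Lemma simp_full X M f : simp X -> is_rep M -> semi M -> dfc M = 0 ->
  hom M X f -> f <> 0 -> row_full f.
Proof.
move=> [hX sX dX X0 mX] hM sM dM hf f0.
have [I [c [b [hc hb fc fb fE]]]] := hom_image hf.
have [Z [k ex]] := exact_quo hc fc; have [hk _ fk _ _] := ex.
have e := dfc_exact delta hM ex; have le := sX I b hb fb; have le' := sM Z k hk fk.
have [I0|I0] := posnP (rdim I).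
  by case: f0; rewrite fE; apply/matrixP => i j; rewrite !mxE big1 // => y _;
    have := leq_trans (ltn_ord y) (eq_leq I0).
have IX := mX I b hb fb I0 ltac:(lia).
by rewrite fE /row_full (eqmxMfull _ fc) (eqP (fb : \rank b == _)) IX.
Qed.

Lemma simp_brick X : simp X -> brick X.
Proof.
move=> sX; have [hX s dX X0 mX] := sX; split=> // f hf f0.
by rewrite -row_free_unit; apply: simp_free hf f0.
Qed.

Lemma simp_hom_iso X Y f : simp X -> simp Y -> hom X Y f -> f <> 0 -> rep_iso X Y.
Proof.
move=> sX sY hf f0; have [hX sX' dX _ _] := sX; have [hY sY' dY _ _] := sY.
by apply: (iso_bij hf); [exact: simp_free hf f0|exact: simp_full hf f0].
Qed.

Lemma semi_quo M N R k c : is_rep M -> semi M -> @exact Q K R M N k c -> dfc R = 0 -> semi N.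
Proof.
move=> hM sM ex dR Y y hy fy; have [W [w [k' [c' [hw fw exw]]]]] := exact_pull hM ex hy fy.
have := sM W w hw fw; have := dfc_exact delta (rep_inj hw fw hM) exw; lia.
Qed.

(** Dividing out a maximal proper subobject of defect zero leaves a simple regular quotient;
    iteration yields composition series. *)
Lemma simp_top M : is_rep M -> semi M -> dfc M = 0 -> (0 < rdim M)%N ->
  exists R N k c, [/\ @exact Q K R M N k c, simp N, semi R & dfc R = 0].
Proof.
move=> hM sM dM M0.
pose P n := exists R k, [/\ hom R M k, row_free k, dfc R = 0, (rdim R < rdim M)%N & rdim R = n].
have [||n [R [k [hk fk dR RM Rn]]] nmax] := @nat_max P (rdim M).
- exists 0%N, (@Rep Q K 0 (fun _ => 0) (fun _ => 0)), 0; split=> //.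
  + by split=> i; rewrite mul0mx; apply/matrixP; case.
  + by rewrite /row_free mxrank0.
  + by rewrite dfc_dim0.
- by move=> n [Z [k [hk fk _ _ <-]]]; apply: rdim_free hk fk.
have [N [c ex]] := exact_sub hk fk; have [_ hc _ fc _] := ex.
have eN := rdim_exact hM ex; have dN := dfc_exact delta hM ex.
have sN := semi_quo hM sM ex dR.
exists R, N, k, c; split=> //; last exact: semi_sub hk fk sM.
split=> //; [exact: rep_surj hc fc hM|lia|lia|].
move=> Z z hz fz Z0 dZ; have [W [w [k' [c' [hw fw exw]]]]] := exact_pull hM ex hz fz.
have hW := rep_inj hw fw hM; have eW := rdim_exact hW exw.
have dW := dfc_exact delta hW exw.
have := rdim_free hw fw; rewrite leq_eqVlt => /orP [/eqP e|lt]; first by lia.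
have : (rdim W <= n)%N by apply: nmax; exists W, w; split=> //; lia.
lia.
Qed.

End Simple.

(** * Iterated extensions of simple regular objects as scalar matrices *)

Section Frames.
Variables (Q : bquiver) (K : closedFieldType) (delta : qV Q -> int).
Implicit Types L M X Y Z R : rep Q K.
Notation simp := (simp delta).
Variables (I : eqType) (T : I -> rep Q K) (sg : I -> I).
Variable eps : forall i j : I, qA Q -> 'M[K]_(rdim (T i), rdim (T j)).
Hypothesis sg_inj : injective sg.
Hypothesis simp_T : forall X, simp X -> exists2 i, simp (T i) & rep_iso X (T i).
Hypothesis ext_T : forall i j h, simp (T i) -> simp (T j) -> @cocyc Q K (T i) (T j) h ->
  exists x P, [/\ @grad Q K (T i) (T j) P, forall a, h a = x *: eps i j a + cobd P a &
    (x <> 0 -> j = sg i)].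

(** The identity from T(i) to T(j) when i = j. Using [pid_mx] avoids a transport along the equality
    of indices. *)
Definition II i j : 'M[K]_(rdim (T i), rdim (T j)) :=
  if i == j then pid_mx (rdim (T i)) else 0.

Lemma II1 i : II i i = 1%:M.
Proof. by rewrite /II eqxx pid_mx_1. Qed.

Lemma II_eps i j l a : i = j -> II i j *m eps j l a = eps i l a.
Proof. by move=> <-; rewrite II1 mul1mx. Qed.

Lemma eps_II i j l a : j = l -> eps i j a *m II j l = eps i l a.
Proof. by move=> <-; rewrite II1 mulmx1. Qed.

Lemma II_II i j l : i = j -> II i j *m II j l = II i l.
Proof. by move=> <-; rewrite II1 mul1mx. Qed.

Lemma hom_II i j : hom (T i) (T j) (II i j).
Proof.
rewrite /II; case: eqVneq => [<-|_]; last exact: hom_0.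
by rewrite pid_mx_1; exact: hom_id.
Qed.

(** As a graded space M is the direct sum of the T(idx k), with injections j and projections p. The
    arrows act diagonally except for N k l times the standard extension [eps]. All information about
    M is thus in the scalar matrix N, which is nilpotent when the frame comes from a composition
    series. *)
Definition frame M r (idx : 'I_r -> I) (N : 'M[K]_r)
  (j : forall k, 'M[K]_(rdim (T (idx k)), rdim M))
  (p : forall k, 'M[K]_(rdim M, rdim (T (idx k)))) : Prop :=
  [/\ forall k, simp (T (idx k)), forall k, @grad Q K (T (idx k)) M (j k),
      forall k a, j k *m rX M a = rX (T (idx k)) a *m j k +
         \sum_l N k l *: (eps (idx k) (idx l) a *m j l),
      forall k l, j k *m p l = (k == l)%:R *: II (idx k) (idx l) &
      \sum_k p k *m j k = 1%:M].

Lemma frame_re M r idx N j p v k : @frame M r idx N j p ->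
  re M v *m p k = p k *m re (T (idx k)) v.
Proof.
move=> [_ gj _ jp pj]; rewrite -[LHS]mul1mx -pj mulmx_suml (bigD1 k) //= big1 ?addr0.
  by rewrite mulmxA -(mulmxA (p k)) -gj -!mulmxA jp eqxx scale1r II1 mulmx1.
move=> l lk; rewrite mulmxA -(mulmxA (p l)) -gj -!mulmxA jp (negPf lk) scale0r !mulmx0.
by [].
Qed.

Lemma frame_rX M r idx N j p a k : @frame M r idx N j p ->
  rX M a *m p k = p k *m rX (T (idx k)) a + \sum_l N l k *: (p l *m eps (idx l) (idx k) a).
Proof.
move=> [_ gj xj jp pj]; rewrite -[LHS]mul1mx -pj mulmx_suml.
rewrite (eq_bigr (fun l => p l *m (rX (T (idx l)) a *m j l *m p k) +
  N l k *: (p l *m eps (idx l) (idx k) a))).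
  rewrite big_split /=; congr (_ + _); rewrite (bigD1 k) //= big1 ?addr0.
    by rewrite -!mulmxA jp eqxx scale1r II1 mulmx1.
  by move=> l lk; rewrite -!mulmxA jp (negPf lk) scale0r !mulmx0.
move=> l _; rewrite mulmxA -(mulmxA (p l)) xj -!mulmxA mulmxDl mulmxDr; congr (_ + _).
  by rewrite -!mulmxA.
rewrite mulmx_suml mulmx_sumr (bigD1 k) //= big1 ?addr0.
  by rewrite -scalemxAl -scalemxAr -mulmxA jp eqxx scale1r II1 mulmx1.
by move=> m mk; rewrite -scalemxAl -mulmxA jp (negPf mk) scale0r mulmx0 scaler0 mulmx0.
Qed.

(** The endomorphism of M with scalar blocks g. It commutes with the arrows when g respects the
    indices and commutes with N, so graded idempotents commuting with N give idempotent
    endomorphisms of M. *)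
Definition Th M r (idx : 'I_r -> I) j p (g : 'M[K]_r) : 'M[K]_(rdim M) :=
  \sum_k \sum_l g k l *: (p k *m II (idx k) (idx l) *m j l).

Definition graded r r' (idx : 'I_r -> I) (idx' : 'I_r' -> I) (g : 'M[K]_(r, r')) :=
  forall k l, g k l != 0 -> idx k = idx' l.

Lemma Th_hom M r idx N j p g : @frame M r idx N j p -> graded idx idx g ->
  g *m N = N *m g -> hom M M (@Th M r idx j p g).
Proof.
move=> fr gg gN; have [_ gj xj jp pj] := fr; split=> [v|a].
  rewrite /Th mulmx_sumr mulmx_suml; apply: eq_bigr => k _.
  rewrite mulmx_sumr mulmx_suml; apply: eq_bigr => l _.
  rewrite -scalemxAl -scalemxAr; congr (_ *: _).
  have [hI _] := hom_II (idx k) (idx l).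
  rewrite -!mulmxA (mulmxA (re M v)) (frame_re v k fr) -!mulmxA.
  by rewrite (mulmxA (re (T (idx k)) v)) hI -!mulmxA gj.
pose A := \sum_k \sum_l g k l *: (p k *m rX (T (idx k)) a *m II (idx k) (idx l) *m j l).
pose B := \sum_k \sum_l (g *m N) k l *: (p k *m eps (idx k) (idx l) a *m j l).
transitivity (A + B).
  rewrite /Th mulmx_sumr.
  under eq_bigr => k _.
    rewrite mulmx_sumr.
    under eq_bigr => l _ do
      rewrite -scalemxAr !mulmxA (frame_rX a k fr) !mulmxDl scalerDr.
    rewrite big_split /=; over.
  rewrite big_split /=; congr (_ + _).
  rewrite /B gN [LHS]exchange_big /=; under eq_bigr => l _.
    under eq_bigr => k _ do rewrite !mulmx_suml scaler_sumr.
    rewrite exchange_big /=; over.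
  rewrite [LHS]exchange_big /=; apply: eq_bigr => k _; apply: eq_bigr => l _.
  rewrite mxE scaler_suml; apply: eq_bigr => m _.
  have [->|nz] := eqVneq (g m l) 0; first by rewrite mulr0 !scale0r.
  by rewrite -!scalemxAl scalerA mulrC -!mulmxA (mulmxA _ (II _ _)) eps_II //; apply: gg.
symmetry; rewrite /Th mulmx_suml.
under eq_bigr => k _.
  rewrite mulmx_suml.
  under eq_bigr => l _ do rewrite -scalemxAl -!mulmxA xj !mulmxDr scalerDr.
  rewrite big_split /=; over.
rewrite big_split /=; congr (_ + _); apply: eq_bigr => k _.
  apply: eq_bigr => l _; have [_ hI] := hom_II (idx k) (idx l).
  by rewrite -!mulmxA [in LHS](mulmxA (II _ _)) -hI -!mulmxA.
under eq_bigr => l _ do rewrite !mulmx_sumr scaler_sumr.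
rewrite exchange_big /=; apply: eq_bigr => l _; rewrite mxE scaler_suml.
apply: eq_bigr => m _; have [->|nz] := eqVneq (g k m) 0; first by rewrite mul0r !scale0r.
by rewrite -!scalemxAr scalerA (mulmxA (II _ _)) II_eps ?mulmxA //; apply: gg.
Qed.

Lemma Th_coord M r idx N j p g k l : @frame M r idx N j p ->
  j k *m @Th M r idx j p g *m p l = g k l *: II (idx k) (idx l).
Proof.
move=> [_ gj xj jp pj]; rewrite /Th mulmx_sumr mulmx_suml (bigD1 k) //= [X in _ + X]big1 ?addr0.
  rewrite mulmx_sumr mulmx_suml (bigD1 l) //= [X in _ + X]big1 ?addr0.
    rewrite -scalemxAr -scalemxAl !mulmxA jp eqxx scale1r II1 mul1mx -mulmxA jp eqxx.
    by rewrite scale1r II1 mulmx1.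
  move=> m ml; rewrite -scalemxAr -scalemxAl -!mulmxA jp (negPf ml) scale0r !mulmx0.
  by rewrite scaler0.
move=> m mk; rewrite mulmx_sumr mulmx_suml big1 // => n _.
by rewrite -scalemxAr -scalemxAl !mulmxA jp eq_sym (negPf mk) scale0r !mul0mx scaler0.
Qed.

Lemma Th_mul M r idx N j p g g' : @frame M r idx N j p -> graded idx idx g ->
  @Th M r idx j p g *m @Th M r idx j p g' = @Th M r idx j p (g *m g').
Proof.
move=> [_ gj xj jp pj] gg; rewrite {1}/Th mulmx_suml; apply: eq_bigr => k _.
rewrite mulmx_suml; under eq_bigr => l _.
  rewrite {1}/Th mulmx_sumr (bigD1 l) //= [X in _ + X]big1 ?addr0; last first.
    move=> m ml; rewrite mulmx_sumr big1 // => n _.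
    rewrite -scalemxAl -scalemxAr -!mulmxA (mulmxA (j l)) jp eq_sym (negPf ml).
    by rewrite scale0r mul0mx !mulmx0 !scaler0.
  rewrite mulmx_sumr; under eq_bigr => m _.
    rewrite -scalemxAl -scalemxAr -!mulmxA (mulmxA (j l)) jp eqxx scale1r II1 mul1mx scalerA.
    over.
  over.
rewrite exchange_big /=; apply: eq_bigr => m _; rewrite mxE scaler_suml.
apply: eq_bigr => l _; have [->|nz] := eqVneq (g k l) 0; first by rewrite mul0r !scale0r.
by rewrite (mulmxA (II _ _)) II_II ?mulmxA //; apply: gg.
Qed.

Lemma Th_eq M r idx N j p g g' : @frame M r idx N j p -> graded idx idx g -> graded idx idx g' ->
  @Th M r idx j p g = @Th M r idx j p g' -> g = g'.
Proof.
move=> fr gg gg' e; have [sT _ _ _ _] := fr.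
apply/matrixP => k l; have := Th_coord g k l fr; rewrite e (Th_coord g' k l fr).
have [ei|ni] := eqVneq (idx k) (idx l); last first.
  have z g0 : graded idx idx g0 -> g0 k l = 0.
    by move=> h; apply/eqP; apply: contraNT ni => /h ->.
  by rewrite !z.
have [_ _ _ T0 _] := sT k.
have II0 : II (idx k) (idx l) != 0.
  apply/eqP => /(congr1 (fun A => \rank A)); rewrite /II -ei eqxx mxrank0.
  by rewrite rank_pid_mx ?ei // -ei; lia.
move=> /eqP; rewrite eq_sym -subr_eq0 -scalerBl scaler_eq0 (negPf II0) orbF subr_eq0.
by move=> /eqP.
Qed.

(** A graded change of basis that conjugates N into N' carries the frame along; it is applied with
    N' a Jordan block. *)
Lemma reframe M r idx N j p h (idx' : 'I_h -> I) (N' : 'M[K]_h) V W :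
  @frame M r idx N j p -> (forall k, simp (T (idx' k))) ->
  graded idx' idx V -> graded idx idx' W -> V *m W = 1%:M -> W *m V = 1%:M ->
  V *m N = N' *m V -> exists j' p', @frame M h idx' N' j' p'.
Proof.
move=> fr sT' gV gW VW WV VN; have [_ gj xj jp pj] := fr.
pose j' k := \sum_l V k l *: (II (idx' k) (idx l) *m j l).
pose p' k := \sum_l W l k *: (p l *m II (idx l) (idx' k)).
have jp' k l : j' k *m p l = V k l *: II (idx' k) (idx l).
  rewrite /j' mulmx_suml (bigD1 l) //= big1 ?addr0.
    by rewrite -scalemxAl -mulmxA jp eqxx scale1r II1 mulmx1.
  by move=> m ml; rewrite -scalemxAl -mulmxA jp (negPf ml) scale0r mulmx0 scaler0.
exists j', p'; split=> //.
- move=> k v; rewrite /j' mulmx_sumr mulmx_suml; apply: eq_bigr => l _.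
  rewrite -scalemxAr -scalemxAl; congr (_ *: _).
  by have [hI _] := hom_II (idx' k) (idx l); rewrite mulmxA hI -!mulmxA gj.
- move=> k a; rewrite {1}/j' mulmx_suml.
  under eq_bigr => l _ do rewrite -scalemxAl -mulmxA xj mulmxDr scalerDr.
  rewrite big_split /=; congr (_ + _).
    rewrite mulmx_sumr; apply: eq_bigr => l _; rewrite -scalemxAr; congr (_ *: _).
    by have [_ hI] := hom_II (idx' k) (idx l); rewrite mulmxA -hI -mulmxA.
  under eq_bigr => l _ do rewrite mulmx_sumr scaler_sumr.
  rewrite exchange_big /=.
  under [RHS]eq_bigr => l _ do rewrite /j' mulmx_sumr scaler_sumr.
  rewrite [RHS]exchange_big /=; apply: eq_bigr => m _.
  transitivity ((V *m N) k m *: (eps (idx' k) (idx m) a *m j m)).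
    rewrite mxE scaler_suml; apply: eq_bigr => l _.
    have [->|nz] := eqVneq (V k l) 0; first by rewrite mul0r !scale0r.
    by rewrite -scalemxAr scalerA mulmxA II_eps //; apply: gV.
  rewrite VN mxE scaler_suml; apply: eq_bigr => l _.
  have [->|nz] := eqVneq (V l m) 0; first by rewrite mulr0 !scale0r mulmx0 scaler0.
  by rewrite -scalemxAr scalerA mulmxA eps_II //; apply: gV.
- move=> k l; rewrite /p' mulmx_sumr.
  transitivity ((V *m W) k l *: II (idx' k) (idx' l)); last by rewrite VW mxE.
  rewrite mxE scaler_suml; apply: eq_bigr => m _.
  rewrite -scalemxAr mulmxA jp' -scalemxAl scalerA mulrC.
  have [->|nz] := eqVneq (V k m) 0; first by rewrite mul0r !scale0r.
  by rewrite II_II //; apply: gV.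
rewrite -pj.
under eq_bigr => k _ do rewrite /p' mulmx_suml.
rewrite exchange_big /=; apply: eq_bigr => l _.
under eq_bigr => k _ do rewrite /j' mulmx_sumr.
rewrite exchange_big /= (bigD1 l) //= [X in _ + X]big1 ?addr0.
  transitivity ((W *m V) l l *: (p l *m j l)); last by rewrite WV mxE eqxx scale1r.
  rewrite mxE scaler_suml; apply: eq_bigr => k _.
  have [->|nz] := eqVneq (W l k) 0; first by rewrite mul0r !scale0r mul0mx.
  rewrite -scalemxAl -scalemxAr scalerA -mulmxA (mulmxA (II _ _)) II_II; last exact: gW.
  by rewrite II1 mul1mx.
move=> m ml.
transitivity ((W *m V) l m *: (p l *m II (idx l) (idx m) *m j m)).
  rewrite mxE scaler_suml; apply: eq_bigr => k _.
  have [->|nz] := eqVneq (W l k) 0; first by rewrite mul0r !scale0r mul0mx.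
  rewrite -scalemxAl -scalemxAr scalerA -!mulmxA (mulmxA (II _ _)) II_II //; exact: gW.
by rewrite WV mxE eq_sym (negPf ml) scale0r.
Qed.

Lemma frame_iso M M' r idx N j p j' p' : @frame M r idx N j p -> @frame M' r idx N j' p' ->
  rep_iso M M'.
Proof.
move=> fr fr'; have [_ gj xj jp pj] := fr; have [_ gj' xj' jp' pj'] := fr'.
exists (\sum_k p k *m j' k), (\sum_k p' k *m j k); split.
- split=> [v|a].
    rewrite mulmx_sumr mulmx_suml; apply: eq_bigr => k _.
    by rewrite mulmxA (frame_re v k fr) -!mulmxA gj'.
  rewrite mulmx_sumr mulmx_suml.
  under eq_bigr => k _ do rewrite mulmxA (frame_rX a k fr) mulmxDl.
  under [RHS]eq_bigr => k _ do rewrite -mulmxA xj' mulmxDr.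
  rewrite !big_split /=; congr (_ + _); first by apply: eq_bigr => k _; rewrite !mulmxA.
  under eq_bigr => k _ do rewrite mulmx_suml.
  under [RHS]eq_bigr => k _ do rewrite mulmx_sumr.
  rewrite exchange_big /=; apply: eq_bigr => k _; apply: eq_bigr => l _.
  by rewrite -scalemxAl -scalemxAr mulmxA.
- rewrite -pj mulmx_suml; apply: eq_bigr => k _; rewrite mulmx_sumr (bigD1 k) //= big1 ?addr0.
    by rewrite -mulmxA (mulmxA (j' k)) jp' eqxx scale1r II1 mul1mx.
  move=> l lk; rewrite -mulmxA (mulmxA (j' k)) jp' eq_sym (negPf lk) scale0r.
  by rewrite mul0mx mulmx0.
rewrite -pj' mulmx_suml; apply: eq_bigr => k _; rewrite mulmx_sumr (bigD1 k) //= big1 ?addr0.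
  by rewrite -mulmxA (mulmxA (j k)) jp eqxx scale1r II1 mul1mx.
move=> l lk; rewrite -mulmxA (mulmxA (j k)) jp eq_sym (negPf lk) scale0r.
by rewrite mul0mx mulmx0.
Qed.

Definition shift h : 'M[K]_h := \matrix_(s, t) (s.+1 == t)%:R.

(** The uniserial object with top T(i), each factor being followed below by the one of its image
    under [sg], down to the socle. *)
Definition strframe M i h := exists j p, @frame M h (fun s : 'I_h => iter s sg i) (shift h) j p.

Lemma strframe_iso M M' i h : strframe M i h -> strframe M' i h -> rep_iso M M'.
Proof. by move=> [j [p f]] [j' [p' f']]; apply: frame_iso f f'. Qed.

End Frames.

(** * Indecomposable graded nilpotent matrices *)

Section Jordan.
Variables (K : closedFieldType) (I : eqType) (sg : I -> I).
Hypothesis sg_inj : injective sg.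

Definition mpw r (N : 'M[K]_r) k := iter k (mulmx N) 1%:M.

Lemma mpw0 r (N : 'M[K]_r) : mpw N 0 = 1%:M. Proof. by []. Qed.
Lemma mpwS r (N : 'M[K]_r) k : mpw N k.+1 = N *m mpw N k. Proof. by []. Qed.

Lemma mpwD r (N : 'M[K]_r) k l : mpw N (k + l) = mpw N k *m mpw N l.
Proof. by elim: k => [|k IH]; rewrite ?mul1mx // addSn !mpwS IH mulmxA. Qed.

Lemma mpwSr r (N : 'M[K]_r) k : mpw N k.+1 = mpw N k *m N.
Proof. by rewrite -addn1 mpwD /mpw /= mulmx1. Qed.

Variables (r : nat) (idx : 'I_r -> I) (N : 'M[K]_r).
Hypothesis r0 : (0 < r)%N.
Hypothesis N_up : forall x y, N x y != 0 -> (x < y)%N /\ idx y = sg (idx x).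
Hypothesis N_ind : forall g : 'M[K]_r, graded idx idx g -> g *m N = N *m g -> g *m g = g ->
  g = 0 \/ g = 1%:M.

Lemma mpw_up k x y : mpw N k x y != 0 -> (x + k <= y)%N /\ idx y = iter k sg (idx x).
Proof.
elim: k x => [|k IH] x.
  have [<-|ne] := eqVneq x y; first by rewrite addn0.
  by rewrite mpw0 mxE (negPf ne) eqxx.
rewrite mpwS mxE => nz.
have [z /andP [n1 n2]] : exists z, (N x z != 0) && (mpw N k z y != 0).
  apply/existsP; apply: contraNT nz => /existsPn h; apply/eqP; apply: big1 => z _.
  by have := h z; rewrite negb_and !negbK => /orP [/eqP ->|/eqP ->]; rewrite ?mul0r ?mulr0.
have [lt e] := N_up n1; have [le e'] := IH _ n2; split; first lia.
by rewrite iterSr e' e.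
Qed.

(** Let h be the largest exponent with N^h nonzero and choose a nonzero entry (x0, y0) of N^h. The
    rows of V are e_x0 N^s, the columns of [Phi] are N^(h-t) e_y0, and [W] = [Phi] (V [Phi])^-1.
    Then W V is a nonzero graded idempotent commuting with N, hence 1, so N is a single Jordan block
    on the orbit of idx x0 under sg. *)
Lemma graded_string : exists i h (V : 'M[K]_(h, r)) (W : 'M[K]_(r, h)),
  [/\ V *m W = 1%:M, W *m V = 1%:M, graded (fun s : 'I_h => iter s sg i) idx V,
      graded idx (fun s : 'I_h => iter s sg i) W & V *m N = shift K h *m V].
Proof.
have Nr : mpw N r = 0.
  apply/matrixP => x y; rewrite mxE; apply: NNPP => /eqP /mpw_up [le _].
  by have := ltn_ord y; lia.
have [|h Nh hmin] := @nat_min (fun k => mpw N k = 0); first by exists r.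
case: h Nh hmin => [|h] Nh hmin.
  have /matrixP /(_ (Ordinal r0) (Ordinal r0)) := Nh.
  by rewrite mpw0 !mxE eqxx => /eqP; rewrite oner_eq0.
have [x0 [y0 nz]] : exists x y, mpw N h x y != 0.
  apply: NNPP => no; have : mpw N h = 0.
    apply/matrixP => x y; rewrite [RHS]mxE; apply: NNPP => /eqP e; apply: no; by exists x, y.
  by move=> /hmin; rewrite ltnn.
have [_ ey0] := mpw_up nz.
pose i := idx x0.
pose V : 'M[K]_(h.+1, r) := \matrix_(s, l) mpw N s x0 l.
pose Phi : 'M[K]_(r, h.+1) := \matrix_(l, t) mpw N (h - t) l y0.
pose G := V *m Phi.
have GE s t : G s t = mpw N (s + (h - t)) x0 y0.
  by rewrite mpwD [RHS]mxE mxE; apply: eq_bigr => l _; rewrite !mxE.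
have big k : (h < k)%N -> mpw N k = 0.
  by move=> hk; rewrite -(subnKC hk) mpwD Nh mul0mx.
(* The entry of N^(s+h-t) at (x0, y0) vanishes for t < s and is the chosen nonzero one for t = s, so
   G is triangular. *)
have uG : G \in unitmx.
  rewrite -unitmx_tr unitmxE unitfE det_trig.
    apply/prodf_neq0 => s _; rewrite mxE GE subnKC //; by have := ltn_ord s; lia.
  apply/is_trig_mxP => s t st; rewrite mxE GE big ?mxE //.
  by have := ltn_ord s; have := ltn_ord t; lia.
have VN : V *m N = shift K h.+1 *m V.
  apply/matrixP => s l; transitivity (mpw N s.+1 x0 l).
    by rewrite mpwSr !mxE; apply: eq_bigr => m _; rewrite mxE.
  rewrite [RHS]mxE; have [sh|sh] := ltnP s h.
    rewrite (bigD1 (Ordinal (sh : s.+1 < h.+1)%N)) //= big1 ?addr0.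
      by rewrite !mxE eqxx mul1r.
    move=> t; rewrite -val_eqE /= => ts; rewrite mxE eq_sym (negPf ts) mul0r //.
  rewrite big ?mxE // big1 // => t _; rewrite mxE.
  have -> : (s.+1 == t) = false by have := ltn_ord t; lia.
  by rewrite mul0r.
have NP : N *m Phi = Phi *m shift K h.+1.
  apply/matrixP => l t; transitivity (mpw N (h - t).+1 l y0).
    by rewrite mpwS !mxE; apply: eq_bigr => m _; rewrite mxE.
  rewrite [RHS]mxE; have [t0|t0] := posnP t.
    rewrite t0 subn0 Nh mxE big1 // => s _; rewrite [shift _ _ _ _]mxE t0 mulr0 //.
  have lt : (t.-1 < h.+1)%N by have := ltn_ord t; lia.
  rewrite (bigD1 (Ordinal lt)) //= big1 ?addr0.
    rewrite [X in _ = X * _]mxE [shift _ _ _ _]mxE /= prednK // eqxx mulr1.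
    by have -> : (h - t.-1 = (h - t).+1)%N by have := ltn_ord t; lia.
  move=> s; rewrite -val_eqE /= => ts; rewrite [shift _ _ _ _]mxE.
  by rewrite (_ : (s.+1 == t) = false) ?mulr0 //; lia.
have GJ : G *m shift K h.+1 = shift K h.+1 *m G.
  by rewrite /G -mulmxA -NP mulmxA VN mulmxA.
have GiJ : invmx G *m shift K h.+1 = shift K h.+1 *m invmx G.
  rewrite -[LHS]mulmx1 -(mulmxV uG) mulmxA -(mulmxA (invmx G)) -GJ mulmxA mulVmx //.
  by rewrite mul1mx.
pose W := Phi *m invmx G.
have VW : V *m W = 1%:M by rewrite /W mulmxA mulmxV.
have gV : graded (fun s : 'I_h.+1 => iter s sg i) idx V.
  by move=> s l; rewrite mxE => /mpw_up [_ ->].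
have it_inj k : injective (iter k sg) by elim: k => [|k IH] // x y /= /sg_inj /IH.
have gP : graded idx (fun s : 'I_h.+1 => iter s sg i) Phi.
  move=> l s; rewrite mxE => /mpw_up [_ e]; apply: (it_inj (h - s)%N).
  rewrite -e -iterD subnK //; by have := ltn_ord s; lia.
have gG : graded (fun s : 'I_h.+1 => iter s sg i) (fun s : 'I_h.+1 => iter s sg i) G.
  move=> s t; rewrite GE => /mpw_up [_ e]; apply: (it_inj (h - t)%N).
  rewrite -!iterD subnK; last by have := ltn_ord t; lia.
  by rewrite -ey0 e addnC.
have gGi : graded (fun s : 'I_h.+1 => iter s sg i) (fun s : 'I_h.+1 => iter s sg i) (invmx G).
  (* Being graded amounts to commuting with the diagonal indicator matrices of the index classes, a
     property that passes to the inverse. *)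
  move=> s t nz'; pose D : 'M[K]_h.+1 := diag_mx (\row_u (iter u sg i == iter s sg i)%:R).
  have GD : G *m D = D *m G.
    apply/matrixP => a b; rewrite mul_mx_diag mul_diag_mx [LHS]mxE [RHS]mxE ![(\row__ _) _ _]mxE.
    have [->|/gG ->] := eqVneq (G a b) 0; first by rewrite mulr0 mul0r.
    by rewrite mulrC.
  have GiD : invmx G *m D = D *m invmx G.
    rewrite -[LHS]mulmx1 -(mulmxV uG) mulmxA -(mulmxA (invmx G)) -GD mulmxA mulVmx //.
    by rewrite mul1mx.
  have /matrixP /(_ s t) := GiD; rewrite mul_mx_diag mul_diag_mx !mxE eqxx mul1r => e.
  apply/esym/eqP; apply: contraNT nz' => ne; by rewrite -e (negPf ne) mulr0.
have gW : graded idx (fun s : 'I_h.+1 => iter s sg i) W.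
  move=> l t; rewrite mxE => nz'.
  have [s /andP [n1 n2]] : exists s, (Phi l s != 0) && (invmx G s t != 0).
    apply/existsP; apply: contraNT nz' => /existsPn H; apply/eqP; apply: big1 => z _.
    by have := H z; rewrite negb_and !negbK => /orP [/eqP ->|/eqP ->]; rewrite ?mul0r ?mulr0.
  by rewrite (gP _ _ n1) (gGi _ _ n2).
have gE : graded idx idx (W *m V).
  move=> l m; rewrite mxE => nz'.
  have [s /andP [n1 n2]] : exists s, (W l s != 0) && (V s m != 0).
    apply/existsP; apply: contraNT nz' => /existsPn H; apply/eqP; apply: big1 => z _.
    by have := H z; rewrite negb_and !negbK => /orP [/eqP ->|/eqP ->]; rewrite ?mul0r ?mulr0.
  by rewrite (gW _ _ n1) (gV _ _ n2).
exists i, h.+1, V, W; split=> //.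
have EN : (W *m V) *m N = N *m (W *m V).
  by rewrite /W -mulmxA VN !mulmxA NP -!mulmxA (mulmxA (invmx G)) GiJ !mulmxA.
have EE : (W *m V) *m (W *m V) = W *m V by rewrite -mulmxA (mulmxA V) VW mul1mx.
case: (N_ind gE EN EE) => // E0.
have V0 : V = 0 by rewrite -[V]mul1mx -VW -mulmxA E0 mulmx0.
have := congr1 (fun A : 'M_(_, _) => A ord0 x0) V0.
by rewrite !mxE /= eqxx => /eqP; rewrite oner_eq0.
Qed.

End Jordan.

(** * Indecomposable regular objects are strings *)

Section Strings.
Variables (Q : bquiver) (K : closedFieldType) (delta : qV Q -> int).
Implicit Types L M X Y Z R : rep Q K.
Notation dfc := (dfc delta).
Notation semi := (semi delta).
Notation simp := (simp delta).
Variables (I : eqType) (T : I -> rep Q K) (sg : I -> I).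
Variable eps : forall i j : I, qA Q -> 'M[K]_(rdim (T i), rdim (T j)).
Hypothesis sg_inj : injective sg.
Hypothesis simp_T : forall X, simp X -> exists2 i, simp (T i) & rep_iso X (T i).
Hypothesis eps_coc : forall i j, @cocyc Q K (T i) (T j) (eps i j).
Hypothesis ext_T : forall i j h, simp (T i) -> simp (T j) -> @cocyc Q K (T i) (T j) h ->
  exists x P, [/\ @grad Q K (T i) (T j) P, forall a, h a = x *: eps i j a + cobd P a &
    (x <> 0 -> j = sg i)].
Notation frame := (frame delta eps).

Lemma abel6 (V : zmodType) (h A e c c' S : V) :
  h - (A + e + (c + (c' - S))) = h - (A + c) - (e + c') + S.
Proof. by rewrite addrACA [e + (_ - _)]addrA [A + c + (_ - _)]addrA opprD opprK opprD !addrA. Qed.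

(** The components of a cochain are normalized one index at a time, in increasing order. As N is
    strictly upper triangular, the correction made at l0 changes only components of larger index. *)
Lemma frame_cocyc R r idx N j p i h : is_rep R -> @frame R r idx N j p -> simp (T i) ->
  (forall x y, N x y != 0 -> (x < y)%N /\ idx y = sg (idx x)) -> @cocyc Q K (T i) R h ->
  exists (x : 'I_r -> K) P, [/\ @grad Q K (T i) R P,
    forall a, h a = \sum_l x l *: (eps i (idx l) a *m j l) + cobd P a &
    forall l, x l <> 0 -> idx l = sg i].
Proof.
move=> hR fr si Nup ch; have [sT gj xj jp pj] := fr; have [hTi _ _ _ _] := si.
have gp k : @grad Q K R (T (idx k)) (p k) by move=> v; apply: frame_re fr.
suff [x [P [gP zx xs]]] : exists (x : 'I_r -> K) P, [/\ @grad Q K (T i) R P,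
    forall l a, (h a - (\sum_l x l *: (eps i (idx l) a *m j l) + cobd P a)) *m p l = 0 &
    forall l, x l <> 0 -> idx l = sg i].
  exists x, P; split=> // a; apply/eqP; rewrite -subr_eq0; apply/eqP.
  rewrite -[LHS]mulmx1 -pj mulmx_sumr big1 // => l _.
  by rewrite mulmxA zx mul0mx.
suff H d : (d <= r)%N -> exists (x : 'I_r -> K) P, [/\ @grad Q K (T i) R P,
    forall (l : 'I_r) a, (l < d)%N ->
      (h a - (\sum_l x l *: (eps i (idx l) a *m j l) + cobd P a)) *m p l = 0 &
    forall l, x l <> 0 -> idx l = sg i].
  by have [x [P [gP zx xs]]] := H r (leqnn r); exists x, P; split=> // l a; apply: zx.
elim: d => [|d IH] dr.
  exists (fun _ => 0), 0; split=> //; by move=> v; rewrite mulmx0 mul0mx.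
have [x [P [gP zx xs]]] := IH (ltnW dr).
pose l0 := Ordinal dr.
pose h' a := h a - (\sum_l x l *: (eps i (idx l) a *m j l) + cobd P a).
have ch' : @cocyc Q K (T i) R h'.
  apply: cocyc_sub ch _ => a; rewrite mulmxDr mulmxDl -(cobd_cocyc hTi hR gP); congr (_ + _).
  rewrite mulmx_sumr mulmx_suml; apply: eq_bigr => l _.
  rewrite -scalemxAr -scalemxAl; congr (_ *: _).
  by rewrite -(cocyc_mulr (gj l) (@eps_coc i (idx l))).
have [x0 [P0 [gP0 e0 s0]]] := ext_T si (sT l0) (cocyc_mulr (gp l0) ch').
exists (fun l => x l + (if l == l0 then x0 else 0)), (P + P0 *m j l0); split.
- by apply: grad_add gP (grad_mul gP0 (gj l0)).
- move=> l a; rewrite ltnS => ld.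
  have -> : h a - (\sum_l0 (x l0 + (if l0 == Ordinal dr then x0 else 0)) *:
      (eps i (idx l0) a *m j l0) + cobd (P + P0 *m j l0) a) =
    h' a - (h' a *m p l0) *m j l0 + \sum_m N l0 m *: (P0 *m eps (idx l0) (idx m) a *m j m).
    rewrite e0 cobd_add /h'.
    under eq_bigr do rewrite scalerDl.
    rewrite big_split /= -/l0.
    have -> : \sum_(l1 < r) (if l1 == l0 then x0 else 0) *: (eps i (idx l1) a *m j l1) =
      x0 *: (eps i (idx l0) a *m j l0).
      rewrite (bigD1 l0) //= eqxx big1 ?addr0 // => m /negPf ->; by rewrite scale0r.
    have -> : cobd (P0 *m j l0) a = cobd P0 a *m j l0 -
      \sum_m N l0 m *: (P0 *m eps (idx l0) (idx m) a *m j m).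
      rewrite /cobd mulmxBl -!mulmxA xj mulmxDr opprD addrA; congr (_ - _).
      rewrite mulmx_sumr; apply: eq_bigr => m _; by rewrite -scalemxAr mulmxA.
    rewrite [(_ + cobd P0 a) *m _]mulmxDl -[(_ *: _) *m j l0]scalemxAl; exact: abel6.
  rewrite mulmxDl mulmxBl -[h' a *m p l0 *m j l0 *m p l]mulmxA jp mulmx_suml.
  rewrite [X in _ + X]big1 ?addr0; last first.
    move=> m _; have [->|nz] := eqVneq (N l0 m) 0; first by rewrite scale0r mul0mx.
    have [lt _] := Nup _ _ nz; rewrite -scalemxAl -!mulmxA jp.
    have -> : (m == l) = false by apply/negP => /eqP e; move: lt; rewrite e /=; lia.
    by rewrite scale0r !mulmx0 scaler0.
  have [e|ne] := eqVneq l0 l; first by rewrite -e scale1r II1 mulmx1 subrr.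
  rewrite scale0r mulmx0 subr0 /h' zx //.
  by move: ne; rewrite -val_eqE /=; lia.
move=> l; case: eqP => [->|_]; last by rewrite addr0; apply: xs.
move=> nz; have [x00|] := eqVneq x0 0; last by move/eqP/s0.
by apply: xs => e; apply: nz; rewrite e x00 addr0.
Qed.

Lemma frame_ex_step M R X r idx N j p k c i : is_rep M -> @exact Q K R M X k c ->
  simp (T i) -> rep_iso X (T i) -> @frame R r idx N j p ->
  (forall x y, N x y != 0 -> (x < y)%N /\ idx y = sg (idx x)) ->
  exists idx' (N' : 'M[K]_r.+1) j' p', @frame M r.+1 idx' N' j' p' /\
  (forall x y, N' x y != 0 -> (x < y)%N /\ idx' y = sg (idx' x)).
Proof.
move=> hM ex0 si [f [f' [hf e1 e2]]] fr Nup; have [hk hc0 fk fc0 kc0] := ex0.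
have ff : row_full f by apply/row_fullP; exists f'.
have fff : row_free f by apply/row_freeP; exists f'.
pose d := c *m f.
have hd' : hom M (T i) d by apply: hom_comp hc0 hf.
have fd : row_full d by rewrite /d /row_full (eqmxMfull _ fc0).
have ex : @exact Q K R M (T i) k d.
  split=> //; apply: eqmx_trans kc0; apply/eqmxP/andP; split; apply/sub_kermxP.
    by apply: (row_free_inj fff); rewrite mul0mx -mulmxA mulmx_ker.
  by rewrite /d mulmxA mulmx_ker mul0mx.
have [sT gj xj jp pj] := fr; have [hTi _ _ _ _] := si; have hR := rep_inj hk fk hM.
pose s0 := @gpr Q K (T i) M (pinvmx d).
have gs0 : grad s0 by apply: gpr_grad.
have s0d : s0 *m d = 1%:M.
  by rewrite gpr_mulr ?mulVpmx ?gpr_id //; [move=> v; rewrite mulmx1 mul1mx|exact: hom_grad].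
have hz a : cobd s0 a *m d = 0.
  by rewrite -(cobd_mulr _ hd') s0d; have [_ ->] := (hom_cobd _).1 (hom_id (T i)).
have [h ch he] := cocyc_factor hTi hM ex (cobd_cocyc hTi hM gs0) hz.
have [x [P [gP eP xs]]] := frame_cocyc hR fr si Nup ch.
pose s := s0 - P *m k.
have kd := exact_comp0 ex.
have sd : s *m d = 1%:M by rewrite mulmxBl s0d -mulmxA kd mulmx0 subr0.
have gs : grad s by apply: grad_sub gs0 (grad_mul gP (hom_grad hk)).
have sX a : s *m rX M a = rX (T i) a *m s + \sum_l (- x l) *: (eps i (idx l) a *m (j l *m k)).
  have : cobd s a = \sum_l x l *: (eps i (idx l) a *m (j l *m k)).
    rewrite cobd_sub (cobd_mulr _ hk) he eP mulmxDl addrK mulmx_suml.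
    by apply: eq_bigr => l _; rewrite -scalemxAl mulmxA.
  rewrite /cobd => /eqP; rewrite subr_eq addrC -subr_eq => /eqP <-; congr (_ + _).
  by rewrite -sumrN; apply: eq_bigr => l _; rewrite scaleNr.
have [q qE] : exists q, 1%:M - d *m s = q *m k.
  by apply: (exact_factor ex); rewrite mulmxBl mul1mx -mulmxA sd mulmx1 subrr.
have kq : k *m q = 1%:M.
  by apply: (row_free_inj fk); rewrite -mulmxA -qE mulmxBr mulmx1 mulmxA kd mul0mx subr0 mul1mx.
have sq : s *m q = 0.
  by apply: (row_free_inj fk); rewrite -mulmxA -qE mulmxBr mulmx1 mulmxA sd mul1mx subrr mul0mx.
(* The new top T(i) has index [None], placed first through [unlift ord0]. Its row is the only new
   one in the matrix and its column is zero, so strict upper triangularity persists. *)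
pose idxo (o : option 'I_r) := if o is Some l then idx l else i.
pose jo o : 'M[K]_(rdim (T (idxo o)), rdim M) := match o with Some l => j l *m k | None => s end.
pose po o : 'M[K]_(rdim M, rdim (T (idxo o))) := match o with Some l => q *m p l | None => d end.
pose No (o o' : option 'I_r) := match o, o' with Some l, Some m => N l m
  | None, Some m => - x m | _, None => 0 end.
exists (fun y => idxo (unlift ord0 y)), (\matrix_(y, z) No (unlift ord0 y) (unlift ord0 z)),
  (fun y => jo (unlift ord0 y)), (fun y => po (unlift ord0 y)).
split; first split.
- by move=> y; case: (unlift ord0 y).
- move=> y; case: (unlift ord0 y) => [l|] //=; exact: grad_mul (gj l) (hom_grad hk).
- move=> y a; under eq_bigr do rewrite mxE.
  rewrite big_ord_recl unlift_none.
  under eq_bigr do rewrite liftK.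
  case: (unlift ord0 y) => [l|] /=; rewrite scale0r add0r //.
  case: hk => _ hkX; rewrite -mulmxA -hkX mulmxA xj mulmxDl -mulmxA; congr (_ + _).
  by rewrite mulmx_suml; apply: eq_bigr => m _; rewrite -scalemxAl -mulmxA.
- move=> y z; have -> : (y == z) = (unlift ord0 y == unlift ord0 z).
    by case: (unliftP ord0 y) => [u ->|->]; case: (unliftP ord0 z) => [w ->|->];
      rewrite ?(inj_eq lift_inj) // eqxx.
  case: (unlift ord0 y) => [l|]; case: (unlift ord0 z) => [m|] /=.
  + by rewrite -mulmxA (mulmxA k) kq mul1mx jp.
  + by rewrite -mulmxA kd mulmx0 scale0r.
  + by rewrite mulmxA sq mul0mx scale0r.
  + by rewrite sd scale1r II1.
- rewrite big_ord_recl unlift_none; under eq_bigr do rewrite liftK.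
  rewrite /= (eq_bigr (fun l => q *m (p l *m j l) *m k)) => [|l _]; last by rewrite !mulmxA.
  by rewrite -mulmx_suml -mulmx_sumr pj mulmx1 -qE addrC subrK.
move=> y z; rewrite mxE; case: (unliftP ord0 y) => [u|] ->; case: (unliftP ord0 z) => [w|] -> //=.
- by move=> /Nup [lt e]; rewrite /bump /=; split=> //; lia.
- by rewrite eqxx.
- by rewrite oppr_eq0 => /eqP /xs.
- by rewrite eqxx.
Qed.

Lemma frame_ex M : is_rep M -> semi M -> dfc M = 0 ->
  exists r idx (N : 'M[K]_r) j p, @frame M r idx N j p /\
  (forall x y, N x y != 0 -> (x < y)%N /\ idx y = sg (idx x)).
Proof.
have [n] := ubnP (rdim M); elim: n M => // n IH M; rewrite ltnS => Mn hM sM dM.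
have [M0|M0] := posnP (rdim M).
  have [z] : inhabited ('I_0 -> I) by constructor=> [[]].
  exists 0%N, z, 0, (fun k => 0), (fun k => 0); split; last by case.
  split; try by case.
  by rewrite big_ord0; apply/matrixP => y; have := leq_trans (ltn_ord y) (eq_leq M0).
have [R [N [k [c [ex sN sR dR]]]]] := simp_top hM sM dM M0.
have [hk hc fk fc _] := ex; have hR := rep_inj hk fk hM.
have RM : (rdim R < rdim M)%N.
  by have := rdim_exact hM ex; have [_ _ _ N0 _] := sN; lia.
have [r [idx [NN [j [p [fr Nup]]]]]] := IH R (leq_trans RM Mn) hR sR dR.
have [i si iso] := simp_T sN.
have [idx' [N' [j' [p' h]]]] := frame_ex_step hM ex si iso fr Nup.
by exists r.+1, idx', N', j', p'.
Qed.

Lemma regular_string M : is_rep M -> indec M -> semi M -> dfc M = 0 ->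
  exists i h, [/\ (0 < h <= rdim M)%N, (forall s, (s < h)%N -> simp (T (iter s sg i))) &
    strframe delta sg eps M i h].
Proof.
move=> hM iM sM dM; have [r [idx [N [j [p [fr Nup]]]]]] := frame_ex hM sM dM.
have r0 : (0 < r)%N.
  rewrite lt0n; apply/negP => /eqP r0; subst r.
  case: fr => _ _ _ _ ; rewrite big_ord0; case: iM => M0 _ /(congr1 (@mxrank _ _ _)).
  by rewrite mxrank1 mxrank0; lia.
have ind (g : 'M[K]_r) : graded idx idx g -> g *m N = N *m g -> g *m g = g -> g = 0 \/ g = 1%:M.
  move=> gg gN gE; have [_ _ _ _ pj] := fr.
  have g1 : graded idx idx (1%:M : 'M[K]_r).
    by move=> k l; have [<-|ne] := eqVneq k l => //; rewrite mxE (negPf ne) eqxx.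
  have g0 : graded idx idx (0 : 'M[K]_r) by move=> k l; rewrite mxE eqxx.
  have [_ Md] := iM; case: (Md _ (Th_hom fr gg gN)).
  - by rewrite (Th_mul _ fr gg) gE.
  - move=> e; left; apply: (Th_eq fr gg g0); rewrite e /Th big1 // => k _.
    by rewrite big1 // => l _; rewrite mxE scale0r.
  - move=> e; right; apply: (Th_eq fr gg g1); rewrite e /Th -pj; apply: eq_bigr => k _.
    rewrite (bigD1 k) //= [X in _ + X]big1 ?addr0; first by rewrite mxE eqxx scale1r II1 mulmx1.
    by move=> l lk; rewrite mxE eq_sym (negPf lk) scale0r.
have [i [h [V [W [VW WV gV gW VN]]]]] := graded_string sg_inj r0 Nup ind.
have sTi (s : 'I_h) : simp (T (iter s sg i)).
  have [l nz] : exists l, V s l != 0.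
    apply: NNPP => no; have := congr1 (fun A : 'M_(_, _) => A s s) VW.
    rewrite !mxE eqxx big1 => [/esym/eqP|l _]; first by rewrite oner_eq0.
    have [->|nz] := eqVneq (V s l) 0; first by rewrite mul0r.
    by case: no; exists l.
  by rewrite (gV _ _ nz); case: fr.
have [j' [p' fr']] := reframe fr sTi gV gW VW WV VN.
exists i, h; split; last by exists j', p'.
  apply/andP; split.
    rewrite lt0n; apply/negP => /eqP h0; subst h.
    have := congr1 (@mxrank _ _ _) WV; rewrite mxrank1 => e.
    have := leq_trans (mxrankM_maxl W V) (rank_leq_col W); rewrite e leqn0 => /eqP e'.
    by rewrite e' in r0.
  have [_ _ _ jp _] := fr'.
  (* One coordinate in each T gives h independent vectors of M, whence h is at most the dimension of
     M. *)
  pose z (s : 'I_h) : 'I_(rdim (T (iter s sg i))) :=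
    Ordinal (let: And5 _ _ _ T0 _ := sTi s in T0).
  pose A : 'M[K]_(h, rdim M) := \matrix_(s, m) j' s (z s) m.
  pose B : 'M[K]_(rdim M, h) := \matrix_(m, s) p' s m (z s).
  have AB : A *m B = 1%:M.
    apply/matrixP => s t; transitivity ((j' s *m p' t) (z s) (z t)).
      by rewrite !mxE; apply: eq_bigr => m _; rewrite !mxE.
    rewrite jp; have [->|ne] := eqVneq s t; first by rewrite scale1r II1 !mxE !eqxx.
    by rewrite scale0r !mxE (negPf ne).
  have := mxrankM_maxl A B; rewrite AB mxrank1 => le.
  exact: leq_trans le (rank_leq_col _).
by move=> s sh; have := sTi (Ordinal sh).
Qed.

End Strings.

(** * Attaching three arms to a vector space *)

Section Fmx.
Variable R : nzRingType.
Implicit Types I J L : finType.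

Definition fmx I J (f : I -> J -> R) : 'M[R]_(#|I|, #|J|) :=
  \matrix_(i, j) f (enum_val i) (enum_val j).

Definition unfmx I J (A : 'M[R]_(#|I|, #|J|)) (i : I) (j : J) : R :=
  A (enum_rank i) (enum_rank j).

Lemma fmxK I J (f : I -> J -> R) i j : unfmx (fmx f) i j = f i j.
Proof. by rewrite /unfmx mxE !enum_rankK. Qed.

Lemma unfmxK I J (A : 'M[R]_(#|I|, #|J|)) : fmx (unfmx A) = A.
Proof. by apply/matrixP => i j; rewrite mxE /unfmx !enum_valK. Qed.

Lemma eq_fmx I J (f g : I -> J -> R) : f =2 g -> fmx f = fmx g.
Proof. by move=> e; apply/matrixP => i j; rewrite !mxE e. Qed.

Lemma fmx_inj I J (f g : I -> J -> R) : fmx f = fmx g -> f =2 g.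
Proof. by move=> e i j; rewrite -fmxK e fmxK. Qed.

Lemma fmx_mul I J L (f : I -> J -> R) (g : J -> L -> R) :
  fmx f *m fmx g = fmx (fun i l => \sum_j f i j * g j l).
Proof.
apply/matrixP => i l; rewrite !mxE [RHS](reindex _ (onW_bij _ (enum_val_bij _))) /=.
by apply: eq_bigr => j _; rewrite !mxE.
Qed.

Lemma fmx1 I : fmx (fun i j : I => (i == j)%:R) = 1%:M.
Proof. by apply/matrixP => i j; rewrite !mxE (inj_eq enum_val_inj). Qed.

Lemma fmx0 I J : fmx (fun (i : I) (j : J) => 0) = 0.
Proof. by apply/matrixP => i j; rewrite !mxE. Qed.

Lemma fmx_sum I J (L : finType) (f : L -> I -> J -> R) :
  \sum_l fmx (f l) = fmx (fun i j => \sum_l f l i j).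
Proof. by apply/matrixP => i j; rewrite summxE mxE; apply: eq_bigr => l _; rewrite mxE. Qed.

End Fmx.

Lemma map_fmx (R R' : nzRingType) (h : R -> R') (I J : finType) (f : I -> J -> R) :
  map_mx h (fmx f) = fmx (fun i j => h (f i j)).
Proof. by apply/matrixP => i j; rewrite !mxE. Qed.

(** Three arms attached to the vertex [actr] of a bound quiver. Position 0 is next to the centre,
    [aat] leads from it into the centre, and [adir] is true for edges pointing away from the centre.
    Vertices at different positions may coincide in Q, as they do in the glued quiver; the star is
    another instance. *)
Record attq (Q : bquiver) := AttQ {
  al : 'I_3 -> nat;
  agr : 'I_3 -> nat -> qV Q;
  actr : qV Q;
  aat : 'I_3 -> qA Q;
  aed : 'I_3 -> nat -> qA Q;
  adir : 'I_3 -> nat -> bool }.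

Record attq_ok (Q : bquiver) (D : attq Q) : Prop := AttOk {
  ok_len : forall r, (0 < al D r)%N;
  ok_ats : forall r, qs (aat D r) = agr D r 0;
  ok_att : forall r, qt (aat D r) = actr D;
  ok_eds : forall r k, (k.+1 < al D r)%N ->
     qs (aed D r k) = if adir D r k then agr D r k else agr D r k.+1;
  ok_edt : forall r k, (k.+1 < al D r)%N ->
     qt (aed D r k) = if adir D r k then agr D r k.+1 else agr D r k;
  ok_rel1 : forall r k, (k.+2 < al D r)%N -> adir D r k -> adir D r k.+1 ->
     ~~ qrel (aed D r k.+1) (aed D r k);
  ok_rel2 : forall r k, (k.+2 < al D r)%N -> ~~ adir D r k -> ~~ adir D r k.+1 ->
     ~~ qrel (aed D r k) (aed D r k.+1);
  ok_rel3 : forall r, (1 < al D r)%N -> ~~ adir D r 0 -> ~~ qrel (aat D r) (aed D r 0);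
  ok_ed_inj : forall r k k', (k.+1 < al D r)%N -> (k'.+1 < al D r)%N ->
     aed D r k = aed D r k' -> k = k';
  ok_at_ed : forall r k, (k.+1 < al D r)%N -> aat D r <> aed D r k;
  ok_at_inj : injective (aat D) }.

(** A vector space with basis [mU] and a finite family of labelled vectors. Each t stands for an
    interval module on the first [mn t] positions of the arm [marm t], attached to the space by
    sending its vector at position 0 to the vector [mg t]. *)
Record mobj (R : Type) := MObj {
  mU : finType; mT : finType; marm : mT -> 'I_3; mn : mT -> nat; mg : mT -> mU -> R }.

Section Att.
Variables (Q : bquiver) (D : attq Q).
Hypothesis okD : attq_ok D.

Definition mok (R : Type) (O : mobj R) : Prop :=
  forall t : mT O, (0 < mn t <= al D (marm t))%N.

Definition cell (R : Type) (O : mobj R) : finType := {t : mT O & 'I_(mn t)}.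
Definition ix (R : Type) (O : mobj R) : finType := (mU O + cell O)%type.

Definition mkc (R : Type) (O : mobj R) (t : mT O) (k : 'I_(mn t)) : ix O :=
  inr (Tagged (fun t : mT O => 'I_(mn t)) k).

Definition ixgr (R : Type) (O : mobj R) (x : ix O) : qV Q :=
  match x with inl _ => actr D | inr c => agr D (marm (tag c)) (tagged c) end.

Section Ring.
Variables (R : nzRingType).
Implicit Type O : mobj R.

Definition cstep O (a : qA Q) (c c' : cell O) : R :=
  ((tag c == tag c') && (adir D (marm (tag c)) (tagged c)) &&
    (aed D (marm (tag c)) (tagged c) == a) && (tagged c' == (tagged c).+1 :> nat))%:R +
  ((tag c == tag c') && (~~ adir D (marm (tag c')) (tagged c')) &&
    (aed D (marm (tag c')) (tagged c') == a) && (tagged c == (tagged c').+1 :> nat))%:R.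

Definition attX O (a : qA Q) (x y : ix O) : R :=
  match x, y with
  | inl _, _ => 0
  | inr c, inl u => ((tagged c == 0 :> nat) && (aat D (marm (tag c)) == a))%:R * mg (tag c) u
  | inr c, inr c' => cstep a c c'
  end.

Definition atte O (v : qV Q) (x y : ix O) : R := ((x == y) && (ixgr x == v))%:R.

Definition fget O (F : ix O -> R) (t : mT O) (k : nat) : R :=
  match insub k : option 'I_(mn t) with Some k' => F (mkc k') | None => 0 end.

Lemma fget_in O F (t : mT O) (k : 'I_(mn t)) : fget F t k = F (mkc k).
Proof. by rewrite /fget valK. Qed.

Lemma fget_out O F (t : mT O) k : (mn t <= k)%N -> fget F t k = 0.
Proof. by move=> h; rewrite /fget insubF // ltnNge h. Qed.

Lemma sum_get O (F : ix O -> R) (t : mT O) k :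
  \sum_(c : cell O) (if (tag c == t) && (tagged c == k :> nat) then F (inr c) else 0) = fget F t k.
Proof.
have [kn|kn] := ltnP k (mn t); last first.
  rewrite fget_out // big1 // => [[t' k']] _ /=; case: eqP => [e|//]; subst t'.
  by have -> : (k' == k :> nat) = false by have := ltn_ord k'; lia.
rewrite -[k in RHS]/(val (Ordinal kn)) fget_in.
rewrite (bigD1 (Tagged (fun t : mT O => 'I_(mn t)) (Ordinal kn))) //= !eqxx /= big1 ?addr0 //.
move=> [t' k'] /= ne; case: eqP => [e|//]; subst t'; case: eqP => [e|//].
by case/eqP: ne; rewrite /Tagged; congr existT; apply: val_inj.
Qed.

Lemma attX_row O a (t : mT O) (k : 'I_(mn t)) (F : ix O -> R) :
  \sum_y attX a (mkc k) y * F y =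
  ((k == 0 :> nat) && (aat D (marm t) == a))%:R * \sum_u mg t u * F (inl u) +
  (adir D (marm t) k && (aed D (marm t) k == a))%:R * fget F t k.+1 +
  ((0 < k)%N && ~~ adir D (marm t) k.-1 && (aed D (marm t) k.-1 == a))%:R * fget F t k.-1.
Proof.
rewrite big_sumType /= -addrA; congr (_ + _).
  by rewrite mulr_sumr; apply: eq_bigr => u _; rewrite mulrA.
rewrite -!sum_get !mulr_sumr -big_split /=; apply: eq_bigr => [[t' k']] _ /=.
rewrite /cstep /= mulrDl (eq_sym t'); have [e|_] := eqVneq t t'; last first.
  by rewrite /= !mul0r !mulr0.
subst t' => /=; congr (_ + _).
  by case: (nat_of_ord k' == k.+1); rewrite ?andbT ?andbF ?mul0r ?mulr0.
case: (nat_of_ord k =P k'.+1) => [kk|kk].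
  by rewrite kk /= eqxx andbT.
rewrite andbF mul0r; case: (nat_of_ord k' =P k.-1) => [e|_]; last by rewrite mulr0.
case: posnP => [k0|k0] /=; first by rewrite mul0r.
by case: kk; rewrite e prednK.
Qed.

Lemma attX_col O a (t : mT O) (k : 'I_(mn t)) (F : ix O -> R) :
  \sum_y F y * attX a y (mkc k) =
  fget F t k.-1 * ((0 < k)%N && adir D (marm t) k.-1 && (aed D (marm t) k.-1 == a))%:R +
  fget F t k.+1 * (~~ adir D (marm t) k && (aed D (marm t) k == a))%:R.
Proof.
rewrite big_sumType /= big1 ?add0r; last by move=> u _; rewrite mulr0.
rewrite -!sum_get !mulr_suml -big_split /=; apply: eq_bigr => [[t' k']] _ /=.
rewrite /cstep /= mulrDr; have [e|_] := eqVneq t' t; last first.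
  by rewrite /= !mul0r !mulr0.
subst t' => /=; congr (_ + _).
  have [kk|kk] := eqVneq (k : nat) k'.+1.
    by rewrite kk /= eqxx andbT.
  rewrite andbF mulr0; case: eqP => [e|_]; last by rewrite mul0r.
  case: posnP => [k0|k0] /=; first by rewrite mulr0.
  by move: kk; rewrite e prednK // eqxx.
by case: (nat_of_ord k' == k.+1); rewrite ?andbT ?andbF ?mul0r ?mulr0.
Qed.

Lemma attX_colU O a (u : mU O) (F : ix O -> R) : mok O ->
  \sum_y F y * attX a y (inl u) =
  \sum_t fget F t 0 * ((aat D (marm t) == a)%:R * mg t u).
Proof.
move=> hO; rewrite big_sumType /= big1 ?add0r; last by move=> w _; rewrite mulr0.
under [RHS]eq_bigr => t _ do rewrite -sum_get mulr_suml.
rewrite exchange_big /=; apply: eq_bigr => c _; rewrite (bigD1 (tag c)) //= big1 ?addr0.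
  by rewrite eqxx /=; case: (nat_of_ord (tagged c) == 0%N); rewrite /= ?mul0r ?mulr0.
by move=> t tc; rewrite eq_sym (negPf tc) /= mul0r.
Qed.

Lemma sum_e (I : finType) (x : I) (b : bool) (F : I -> R) :
  \sum_y ((x == y) && b)%:R * F y = b%:R * F x.
Proof.
rewrite (bigD1 x) //= eqxx /= big1 ?addr0 // => y yx.
by rewrite eq_sym (negPf yx) mul0r.
Qed.

Lemma attX_gr O a x y : mok O -> @attX O a x y != 0 -> ixgr x = qs a /\ ixgr y = qt a.
Proof.
move=> hO; case: x => [u|[t k]]; first by rewrite /= eqxx.
case: y => [u|[t' k']] /=.
  case: (nat_of_ord k =P 0%N) => [k0|_] /=; last by rewrite mul0r eqxx.
  case: (aat D (marm t) =P a) => [<-|_] /=; last by rewrite mul0r eqxx.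
  by rewrite k0 (ok_ats okD) (ok_att okD).
rewrite /cstep /=; case: (t =P t') => [e|_] /=; last by rewrite addr0 eqxx.
subst t'; have lt := ltn_ord k; have lt' := ltn_ord k'; have /andP [_ le] := hO t.
case: (boolP (adir _ _ k)) => dk /=.
  case: (aed D (marm t) k =P a) => [<-|_] /=.
    case: (nat_of_ord k' =P k.+1) => [e _|_] /=.
      have h : (k.+1 < al D (marm t))%N by apply: leq_trans le; rewrite -e.
      by rewrite (ok_eds okD h) (ok_edt okD h) dk e.
    case: (boolP (adir _ _ k')) => dk' /=; first by rewrite addr0 eqxx.
    case: (_ =P aed D (marm t) k) => [<-|_] /=; last by rewrite addr0 eqxx.
    case: (nat_of_ord k =P k'.+1) => [e _|_] /=; last by rewrite addr0 eqxx.
    have h : (k'.+1 < al D (marm t))%N by apply: leq_trans le; rewrite -e.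
    by rewrite (ok_eds okD h) (ok_edt okD h) (negPf dk') e.
  case: (boolP (adir _ _ k')) => dk' /=; first by rewrite addr0 eqxx.
  case: (_ =P a) => [<-|_] /=; last by rewrite addr0 eqxx.
  case: (nat_of_ord k =P k'.+1) => [e _|_] /=; last by rewrite addr0 eqxx.
  have h : (k'.+1 < al D (marm t))%N by apply: leq_trans le; rewrite -e.
  by rewrite (ok_eds okD h) (ok_edt okD h) (negPf dk') e.
case: (boolP (adir _ _ k')) => dk' /=; first by rewrite addr0 eqxx.
case: (_ =P a) => [<-|_] /=; last by rewrite addr0 eqxx.
case: (nat_of_ord k =P k'.+1) => [e _|_] /=; last by rewrite addr0 eqxx.
have h : (k'.+1 < al D (marm t))%N by apply: leq_trans le; rewrite -e.
by rewrite (ok_eds okD h) (ok_edt okD h) (negPf dk') e.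
Qed.

Lemma fget_attX O a (t : mT O) (k : nat) (z : ix O) (b : bool) (c : qA Q) :
  mok O -> (forall k' : 'I_(mn t), k' = k :> nat -> b -> attX a (mkc k') z = 0) ->
  b%:R * fget (fun y => attX a y z) t k = 0.
Proof.
move=> hO h; case: b h => h; last by rewrite mul0r.
have [kn|kn] := ltnP k (mn t); last by rewrite fget_out ?mulr0.
by rewrite -[k]/(val (Ordinal kn)) fget_in h ?mulr0.
Qed.

Lemma attX_rel O a b x z : mok O -> qrel a b -> \sum_y @attX O b x y * attX a y z = 0.
Proof.
move=> hO rab; case: x => [u|[t k]]; first by rewrite big1 // => y _; rewrite mul0r.
have lt := ltn_ord k; have /andP [_ le] := hO t.
rewrite -/(mkc k) attX_row.
have -> : \sum_u mg t u * attX a (inl u) z = 0 by rewrite big1 // => u _; rewrite mulr0.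
rewrite mulr0 add0r !fget_attX ?addr0 // => k' ek.
  case/andP => /andP [k0 dk] /eqP eb.
  case: z => [u|[t' l]] /=.
    case: eqP => [e0|_] /=; last by rewrite mul0r.
    case: eqP => [ea|_] /=; last by rewrite mul0r.
    have k1 : (k : nat) = 1%N by lia.
    have h1 : (1 < al D (marm t))%N by lia.
    move: dk eb; rewrite k1 /= => dk eb.
    by have := ok_rel3 okD h1 dk; rewrite ea eb rab.
  rewrite /cstep /=; case: eqP => [e|_] /=; last by rewrite addr0.
  subst t'; rewrite ek (negPf dk) /= add0r.
  case: (boolP (adir _ _ l)) => dl //=; case: eqP => [ea|_] //=; case: eqP => [el|_] //=.
  have h1 : (l.+2 < al D (marm t))%N by lia.
  move: dk eb; rewrite el => dk eb.
  by have := ok_rel2 okD h1 dl dk; rewrite ea eb rab.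
case/andP => dk /eqP eb.
case: z => [u|[t' l]] /=; first by rewrite ek /= mul0r.
rewrite /cstep /=; case: eqP => [e|_] /=; last by rewrite addr0.
subst t'; rewrite ek eqSS; have lt' := ltn_ord l.
have -> : (~~ adir D (marm t) l && (aed D (marm t) l == a) && (nat_of_ord k == l)) = false.
  by case: (nat_of_ord k =P l) => [<-|_]; rewrite ?andbF // dk.
rewrite addr0; case: (boolP (adir _ _ k.+1)) => dl //=; case: eqP => [ea|_] //=.
case: eqP => [el|_] //=.
have h1 : (k.+2 < al D (marm t))%N by lia.
by have := ok_rel1 okD h1 dk dl; rewrite ea eb rab.
Qed.

Lemma att_rep_ax O : mok O ->
  rep_ax (fun v => fmx (@atte O v)) (fun a => fmx (@attX O a)).
Proof.
move=> hO; split.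
- move=> v; rewrite fmx_mul; apply: eq_fmx => x z; rewrite sum_e /atte.
  by case: (x == z); case: (ixgr x == v); rewrite ?mulr1 ?mulr0 ?mul0r.
- move=> v w vw; rewrite fmx_mul -[RHS](fmx0 _ (ix O) (ix O)); apply: eq_fmx => x z.
  rewrite sum_e /atte; case: (ixgr x =P v) => [->|_]; last by rewrite mul0r.
  by rewrite (negPf vw) andbF mulr0.
- rewrite fmx_sum -fmx1; apply: eq_fmx => x y.
  rewrite (bigD1 (ixgr x)) //= /atte eqxx andbT big1 ?addr0 // => v vx.
  by rewrite [_ == v]eq_sym (negPf vx) andbF.
- move=> a; rewrite !fmx_mul; apply: eq_fmx => x z.
  have [e0|nz] := eqVneq (attX a x z) 0; last first.
    have [g1 g2] := attX_gr hO nz.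
    rewrite (bigD1 z) //= [X in _ + X]big1 ?addr0; last first.
      by move=> y yz; rewrite /atte (negPf yz) mulr0.
    by rewrite sum_e /atte g1 g2 !eqxx mul1r mulr1.
  rewrite e0 big1 // => y _; rewrite sum_e /atte.
  by case: (y =P z) => [->|_]; rewrite ?mulr0 // e0 mulr0 mul0r.
- move=> a b rab; rewrite fmx_mul -[RHS](fmx0 _ (ix O) (ix O)); apply: eq_fmx => x z.
  exact: attX_rel.
Qed.

End Ring.

Section Field.
Variables (K : fieldType).
Implicit Type O : mobj K.

Definition att O : rep Q K :=
  @Rep Q K #|{: ix O}| (fun v => fmx (@atte _ O v)) (fun a => fmx (@attX _ O a)).

Lemma att_rep O : mok O -> is_rep (att O).
Proof. exact: att_rep_ax. Qed.

(** There is a map between the intervals of lengths n and n' that is nonzero at the attached end: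
    the shorter interval is a subobject of the longer one if the edge past its end points inwards,
    and a quotient if that edge points outwards. *)
Definition okl (r : 'I_3) (n n' : nat) : bool :=
  [|| n == n', (n < n')%N && ~~ adir D r n.-1 | (n' < n)%N && adir D r n'.-1].

Definition mhom O O' (phi : mT O -> mT O' -> K) (psi : mU O -> mU O' -> K) : Prop :=
  (forall t t', phi t t' != 0 -> marm t = marm t' /\ okl (marm t) (mn t) (mn t')) /\
  (forall t u', \sum_t' phi t t' * mg t' u' = \sum_u mg t u * psi u u').

Definition atth O O' (phi : mT O -> mT O' -> K) (psi : mU O -> mU O' -> K) (x : ix O) (y : ix O') : K :=
  match x, y with
  | inl u, inl u' => psi u u'
  | inr c, inr c' => if tagged c == tagged c' :> nat then phi (tag c) (tag c') else 0
  | _, _ => 0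
  end.

Lemma hom_fmx O O' (P : ix O -> ix O' -> K) :
  hom (att O) (att O') (fmx P) <->
  (forall x y, P x y != 0 -> ixgr x = ixgr y) /\
  (forall a x z, \sum_y attX a x y * P y z = \sum_y P x y * attX a y z).
Proof.
split=> [[h1 h2]|[h1 h2]].
  split=> [x y nz|a x z]; last first.
    by have := h2 a; rewrite /= !fmx_mul => /fmx_inj; apply.
  have := h1 (ixgr x); rewrite /= !fmx_mul => /fmx_inj /(_ x y).
  rewrite sum_e eqxx mul1r (bigD1 y) //= [X in _ + X]big1 ?addr0; last first.
    by move=> z zy; rewrite /atte (negPf zy) mulr0.
  rewrite /atte eqxx /=; case: eqP => [//|_]; rewrite mulr0 => e.
  by rewrite e eqxx in nz.
split=> i /=; rewrite !fmx_mul; apply: eq_fmx => x z; last exact: h2.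
rewrite sum_e (bigD1 z) //= [X in _ + X]big1 ?addr0; last first.
  by move=> y yz; rewrite /atte (negPf yz) mulr0.
rewrite /atte eqxx /=; have [->|/h1 ->] := eqVneq (P x z) 0; first by rewrite mulr0 mul0r.
by rewrite mulrC.
Qed.

Lemma fget_atth O O' phi psi (x : ix O) (t' : mT O') k :
  fget (@atth O O' phi psi x) t' k =
  match x with inl _ => 0 | inr c => if (tagged c == k :> nat) && (k < mn t')%N then phi (tag c) t' else 0 end.
Proof.
have [kn|kn] := ltnP k (mn t').
  rewrite -[k]/(val (Ordinal kn)) fget_in; case: x => [u|c] //=.
  by rewrite andbT.
rewrite fget_out //; case: x => [u|c] //=; by rewrite andbF.
Qed.

Lemma fget_atth2 O O' phi psi (z : ix O') (t : mT O) k :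
  fget (fun x => @atth O O' phi psi x z) t k =
  match z with inl _ => 0 | inr c => if (k == tagged c :> nat) && (k < mn t)%N then phi t (tag c) else 0 end.
Proof.
have [kn|kn] := ltnP k (mn t).
  rewrite -[k]/(val (Ordinal kn)) fget_in; case: z => [u|c] //=.
  by rewrite andbT.
rewrite fget_out //; case: z => [u|c] //=; by rewrite andbF.
Qed.

Lemma att_hom O O' phi psi : mok O -> mok O' -> @mhom O O' phi psi ->
  hom (att O) (att O') (fmx (@atth O O' phi psi)).
Proof.
move=> hO hO' [hl hg]; apply/hom_fmx; split.
  case=> [u|c] [u'|c'] //=; rewrite ?eqxx //.
  case: (nat_of_ord (tagged c) =P tagged c') => [e|_]; last by rewrite eqxx.
  by move=> /hl [-> _]; rewrite e.
move=> a [u|[t k]] z.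
  rewrite big1; last by move=> y _; rewrite mul0r.
  case: z => [u'|[t' k']].
    rewrite attX_colU // big1 // => t' _; by rewrite fget_atth mul0r.
  by rewrite -/(mkc k') attX_col !fget_atth !mul0r addr0.
rewrite -/(mkc k) attX_row; case: z => [u'|[t' k']].
  rewrite !fget_atth2 !mulr0 !addr0 attX_colU //=.
  under [RHS]eq_bigr => t' _.
    rewrite fget_atth /=.
    have -> : (0 < mn t')%N by case/andP: (hO' t').
    rewrite andbT.
    have -> : (if nat_of_ord k == 0%N then phi t t' else 0) * ((aat D (marm t') == a)%:R * mg t' u') =
      ((nat_of_ord k == 0%N) && (aat D (marm t) == a))%:R * (phi t t' * mg t' u').
      have [->|/hl [-> _]] := eqVneq (phi t t') 0; first by rewrite if_same !mul0r mulr0.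
      by case: (nat_of_ord k == 0%N); case: (_ == a); rewrite ?mul1r ?mul0r ?mulr0.
    over.
  by rewrite -mulr_sumr hg.
rewrite -/(mkc k') attX_col !fget_atth !fget_atth2 /= big1 ?mulr0 ?add0r; last first.
  by move=> u _; rewrite mulr0.
have lt := ltn_ord k; have lt' := ltn_ord k'.
have [->|nz] := eqVneq (phi t t') 0; first by rewrite !if_same !mulr0 !mul0r.
have [ea ol] := hl _ _ nz; rewrite -ea; congr (_ + _).
  case: (k' =P k.+1 :> nat) => [e|ne]; last first.
    rewrite (_ : (k.+1 == k' :> nat) = false) /=; last by apply/eqP => e'; apply: ne.
    case: posnP => [k0|k0]; first by rewrite mulr0 mulr0.
    by rewrite (_ : (k == k'.-1 :> nat) = false) ?mul0r ?mulr0 //=; apply/eqP => e'; apply: ne; rewrite e' prednK.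
  rewrite e /= eqxx /=.
  case: (boolP (adir _ _ _)) => dk; rewrite ?andbF ?mul0r ?mulr0 //=.
  rewrite [X in _ * X = _](_ : _ = phi t t'); last first.
    case: ifP => // h; move: ol; rewrite /okl.
    have en : mn t = k.+1 by apply/eqP; rewrite eqn_leq lt andbT leqNgt h.
    by move: lt'; rewrite en e /= dk andbF => lt''; rewrite (ltn_eqF lt'') ltnNge (ltnW lt'').
  have kt' : (k < mn t')%N by rewrite ltnW // -e.
  by rewrite eqxx kt' mulrC.
case: (k =P k'.+1 :> nat) => [e|ne]; last first.
  rewrite /=.
  case: posnP => [k0|k0]; first by rewrite mul0r mul0r.
  by rewrite (_ : (k.-1 == k' :> nat) = false) ?mul0r ?mulr0 //=; apply/eqP => e'; apply: ne; rewrite -e' prednK.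
rewrite e /= eqxx /=.
case: (boolP (adir _ _ _)) => dk; rewrite ?andbF ?mul0r ?mulr0 //=.
have -> : (k' < mn t)%N by rewrite ltnW // -e.
rewrite [X in _ = X * _](_ : _ = phi t t'); first by rewrite mulrC.
case: ifP => // h; move: ol; rewrite /okl.
have en : mn t' = k'.+1 by apply/eqP; rewrite eqn_leq lt' andbT leqNgt h.
by move: lt; rewrite en e /= (negPf dk) andbF orbF => lt''; rewrite (gtn_eqF lt'') ltnNge (ltnW lt'').
Qed.

Lemma okl_trans_lt r n n' n'' k : okl r n n' -> okl r n' n'' -> (k < n)%N -> (k < n'')%N -> (k < n')%N.
Proof.
rewrite /okl => h1 h2 kn kn''; rewrite ltnNge; apply/negP => kn'.
have e1 : (n < n')%N = false by lia.
have e2 : (n' < n'')%N by lia.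
have e3 : (n' < n)%N by lia.
have e4 : (n'' < n')%N = false by lia.
have e5 : (n == n') = false by lia.
have e6 : (n' == n'') = false by lia.
by move: h1 h2; rewrite e1 e2 e3 e4 e5 e6 /= orbF => -> .
Qed.

Definition fm_mul (I J L : finType) (f : I -> J -> K) (g : J -> L -> K) (i : I) (l : L) :=
  \sum_j f i j * g j l.

Lemma sum_cell O (F : cell O -> K) :
  \sum_c F c = \sum_t \sum_(k < mn t) F (Tagged (fun t : mT O => 'I_(mn t)) k).
Proof. by rewrite sig_big_dep /=; apply: eq_bigr => [[t k]] _. Qed.

Lemma atth_mul O O' O'' phi psi phi' psi' : @mhom O O' phi psi -> @mhom O' O'' phi' psi' ->
  forall x z, \sum_y @atth O O' phi psi x y * @atth O' O'' phi' psi' y z =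
    @atth O O'' (fm_mul phi phi') (fm_mul psi psi') x z.
Proof.
move=> [hl _] [hl' _] x z; rewrite big_sumType /=; case: x => [u|[t k]]; case: z => [u''|[t'' k'']] /=.
- by rewrite [X in _ + X]big1 ?addr0 // => c _; rewrite mul0r.
- by rewrite !big1 ?addr0 // => c _; rewrite ?mulr0 ?mul0r.
- by rewrite !big1 ?addr0 // => c _; rewrite ?mulr0 ?mul0r.
rewrite big1 ?add0r; last by move=> c _; rewrite mul0r.
rewrite sum_cell /=; case: (nat_of_ord k =P k'') => [e|ne]; last first.
  rewrite big1 // => t' _; rewrite big1 // => k' _.
  by do 2 case: eqP => ?; rewrite ?mulr0 ?mul0r //; case: ne; congruence.
apply: eq_bigr => t' _.
have [p0|p0] := eqVneq (phi t t') 0.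
  by rewrite p0 mul0r big1 // => k' _; rewrite if_same mul0r.
have [p0'|p0'] := eqVneq (phi' t' t'') 0.
  by rewrite p0' mulr0 big1 // => k' _; rewrite if_same mulr0.
have [am o1] := hl _ _ p0; have [am' o2] := hl' _ _ p0'.
have kt : (k < mn t')%N.
  by rewrite am in o1; apply: okl_trans_lt o1 o2 _ _ => //; rewrite e.
rewrite (bigD1 (Ordinal kt)) //= big1 ?addr0; first by rewrite eqxx e eqxx.
move=> k' /eqP nk; case: eqP => [ek|_]; last by rewrite mul0r.
by case: nk; apply: val_inj.
Qed.

Definition fdel (I : eqType) (i j : I) : K := (i == j)%:R.

Lemma fm_mulE (I J L : finType) (f : I -> J -> K) (g : J -> L -> K) :
  fmx f *m fmx g = fmx (fm_mul f g).
Proof. by rewrite fmx_mul. Qed.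

Lemma atth_id O : @atth O O (@fdel (mT O)) (@fdel (mU O)) =2 @fdel (ix O).
Proof.
rewrite /fdel; case=> [u|[t k]] [u'|[t' k']] //=.
case: (eqVneq t t') => [e|ne]; last first.
  rewrite if_same; case: eqP => // [[e]]; by rewrite e eqxx in ne.
subst t'; case: eqP => [e|ne]; last by case: eqP => // e; case: ne; case: e => /eqP; rewrite eq_Tagged /= => /eqP ->.
have -> : k = k' by apply: val_inj.
by rewrite eqxx.
Qed.

Lemma atth_inj O O' phi psi phi' psi' : mok O -> mok O' ->
  @atth O O' phi psi =2 @atth O O' phi' psi' -> phi =2 phi' /\ psi =2 psi'.
Proof.
move=> hO hO' e; split=> [t t'|u u']; last exact: (e (inl u) (inl u')).
have /andP [p _] := hO t; have /andP [p' _] := hO' t'.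
by have := e (mkc (Ordinal p)) (mkc (Ordinal p')).
Qed.

Lemma att_iso O O' phi psi phi' psi' : mok O -> mok O' ->
  @mhom O O' phi psi -> @mhom O' O phi' psi' ->
  fm_mul phi phi' =2 @fdel _ -> fm_mul psi psi' =2 @fdel _ ->
  fm_mul phi' phi =2 @fdel _ -> fm_mul psi' psi =2 @fdel _ -> rep_iso (att O) (att O').
Proof.
move=> hO hO' h h' e1 e2 e3 e4.
have c O1 O2 : forall (p p' : mT O1 -> mT O2 -> K) (s s' : mU O1 -> mU O2 -> K),
  p =2 p' -> s =2 s' -> atth p s =2 atth p' s'.
  by move=> p p' s s' ep es [u|y] [u'|y'] //=; rewrite ?es ?ep.
exists (fmx (atth phi psi)), (fmx (atth phi' psi')); split; first exact: att_hom.
- rewrite fm_mulE -fmx1; apply: eq_fmx => x z.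
  rewrite /fm_mul (atth_mul h h') -[RHS]atth_id; exact: c.
- rewrite fm_mulE -fmx1; apply: eq_fmx => x z.
  rewrite /fm_mul (atth_mul h' h) -[RHS]atth_id; exact: c.
Qed.

Section HomExtract.
Variables (O O' : mobj K) (P : ix O -> ix O' -> K).
Hypotheses (hO : mok O) (hO' : mok O') (hP : hom (att O) (att O') (fmx P)).

(** Reads labelled-vector data off an arbitrary homomorphism of the attached representations.
    Components between different arms or from the centre into an arm, which exist when vertices
    coincide, are dropped by [phiP] and [psiP]. *)
Definition Pg t t' k := fget (fun x => fget (P x) t' k) t k.
Definition phiP t t' := if marm t == marm t' then Pg t t' 0 else 0.
Definition psiP u u' := P (inl u) (inl u').

Lemma Pg_in t t' (k : 'I_(mn t)) (k' : 'I_(mn t')) : k = k' :> nat ->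
  Pg t t' k = P (mkc k) (mkc k').
Proof. by move=> e; rewrite /Pg fget_in e fget_in. Qed.

Lemma hom_edge_out t t' (k : 'I_(mn t)) (k1 : 'I_(mn t')) : marm t = marm t' ->
  k1 = k.+1 :> nat -> adir D (marm t) k ->
  fget (fun y => P y (mkc k1)) t k.+1 = fget (P (mkc k)) t' k.
Proof.
move=> am e1 dk; have /andP [_ l'] := hO' t'; have /andP [_ l] := hO t.
have lk1 := ltn_ord k1; have lk := ltn_ord k.
have k2 : (k.+1 < al D (marm t))%N by rewrite am; apply: leq_trans l'; rewrite -e1.
have /hom_fmx [_ /(_ (aed D (marm t) k) (mkc k) (mkc k1))] := hP.
rewrite attX_row attX_col dk !eqxx mul1r -am e1 /= dk eqxx mulr1.
have -> : (aat D (marm t) == aed D (marm t) k) = false by apply/eqP/(ok_at_ed okD).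
rewrite andbF mul0r add0r; case: (posnP k) => k0 /=.
  rewrite mul0r addr0 => ->; have [h|h] := ltnP k.+2 (mn t').
    case: eqP => [/(ok_ed_inj okD) e|_]; last by rewrite andbF mulr0 addr0.
    by have /n_Sn : k = k.+1 :> nat by rewrite e // am; apply: leq_trans l'.
  by rewrite (@fget_out _ _ _ _ k.+2) // mul0r addr0.
have -> : (aed D (marm t) k.-1 == aed D (marm t) k) = false.
  apply/eqP => /(ok_ed_inj okD) e; have : k.-1 = k by apply: e => //; lia.
  by lia.
rewrite andbF mul0r addr0 => ->; have [h|h] := ltnP k.+2 (mn t').
  case: eqP => [/(ok_ed_inj okD) e|_]; last by rewrite andbF mulr0 addr0.
  by have /n_Sn : k = k.+1 :> nat by rewrite e // am; apply: leq_trans l'.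
by rewrite (@fget_out _ _ _ _ k.+2) // mul0r addr0.
Qed.

Lemma hom_edge_in t t' (k1 : 'I_(mn t)) (k : 'I_(mn t')) : marm t = marm t' ->
  k1 = k.+1 :> nat -> ~~ adir D (marm t) k ->
  fget (fun y => P y (mkc k)) t k = fget (P (mkc k1)) t' k.+1.
Proof.
move=> am e1 dk; have /andP [_ l'] := hO' t'; have /andP [_ l] := hO t.
have lk1 := ltn_ord k1; have lk := ltn_ord k.
have k2 : (k.+1 < al D (marm t))%N by apply: leq_trans l; rewrite -e1.
have /hom_fmx [_ /(_ (aed D (marm t) k) (mkc k1) (mkc k))] := hP.
rewrite attX_row attX_col e1 /= -am !eqxx dk /= mul1r mulr1 mul0r add0r.
have -> : (adir D (marm t) k.+1 && (aed D (marm t) k.+1 == aed D (marm t) k))%:R *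
   fget (fun y => P y (mkc k)) t k.+2 = 0.
  have [h|h] := ltnP k.+2 (mn t); last by rewrite fget_out ?mulr0.
  case: eqP => [/(ok_ed_inj okD) e|_]; last by rewrite andbF mul0r.
  by have /n_Sn : k = k.+1 :> nat by rewrite e //; apply: leq_trans l.
rewrite add0r => ->; case: (posnP k) => k0 /=; first by rewrite mulr0 add0r.
have -> : (aed D (marm t) k.-1 == aed D (marm t) k) = false.
  apply/eqP => /(ok_ed_inj okD) e; have : k.-1 = k by apply: e => //; lia.
  by lia.
by rewrite andbF mulr0 add0r.
Qed.

Lemma Pg_const t t' k : marm t = marm t' -> (k < mn t)%N -> (k < mn t')%N -> Pg t t' k = Pg t t' 0.
Proof.
move=> am; elim: k => // k IH h h'; rewrite -IH; try lia.
have g : (k < mn t)%N by lia. have g' : (k < mn t')%N by lia.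
rewrite (@Pg_in t t' (Ordinal h) (Ordinal h') erefl) (@Pg_in t t' (Ordinal g) (Ordinal g') erefl).
case: (boolP (adir D (marm t) k)) => dk.
  have := @hom_edge_out t t' (Ordinal g) (Ordinal h') am erefl dk.
  by rewrite -[k.+1]/(val (Ordinal h)) fget_in -[k in RHS]/(val (Ordinal g')) fget_in.
have := @hom_edge_in t t' (Ordinal h) (Ordinal g') am erefl dk.
by rewrite -[k in LHS]/(val (Ordinal g)) fget_in -[k.+1]/(val (Ordinal h')) fget_in.
Qed.

(** If the order fails, commutation with the edge just past the end of the shorter interval compares
    the coefficient with zero. *)
Lemma phiP_okl t t' : phiP t t' != 0 -> marm t = marm t' /\ okl (marm t) (mn t) (mn t').
Proof.
rewrite /phiP; case: (marm t =P marm t') => [am nz|_]; last by rewrite eqxx.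
split=> //; move: nz; rewrite /okl; case: (ssrnat.ltngtP (mn t) (mn t')) => //= lt.
- have /andP [p _] := hO t.
  rewrite orbF; apply: contraNN => dk.
  have g : ((mn t).-1 < mn t)%N by rewrite prednK.
  have g' : ((mn t).-1 < mn t')%N by apply: leq_ltn_trans lt; rewrite leq_pred.
  have h' : ((mn t).-1.+1 < mn t')%N by rewrite prednK.
  rewrite -(@Pg_const t t' (mn t).-1) // (@Pg_in t t' (Ordinal g) (Ordinal g') erefl).
  have := @hom_edge_out t t' (Ordinal g) (Ordinal h') am erefl dk.
  by rewrite fget_out /= ?prednK // -[(mn t).-1]/(val (Ordinal g')) fget_in => <-.
- have /andP [p _] := hO' t'.
  apply: contraNT => dk.
  have g : ((mn t').-1 < mn t)%N by apply: leq_ltn_trans lt; rewrite leq_pred.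
  have g' : ((mn t').-1 < mn t')%N by rewrite prednK.
  have h : ((mn t').-1.+1 < mn t)%N by rewrite prednK.
  rewrite -(@Pg_const t t' (mn t').-1) // (@Pg_in t t' (Ordinal g) (Ordinal g') erefl).
  have := @hom_edge_in t t' (Ordinal h) (Ordinal g') am erefl dk.
  by rewrite [RHS]fget_out /= ?prednK // -[(mn t').-1]/(val (Ordinal g)) fget_in => ->.
Qed.

Lemma phiP_mhom : mhom phiP psiP.
Proof.
split=> [t t'|t u']; first exact: phiP_okl.
have /andP [p l] := hO t.
have /hom_fmx [_ /(_ (aat D (marm t)) (mkc (Ordinal p)) (inl u'))] := hP.
rewrite attX_row attX_colU //= eqxx mul1r mul0r addr0.
have -> : (adir D (marm t) 0 && (aed D (marm t) 0 == aat D (marm t)))%:R * fget (fun y => P y (inl u')) t 1 = 0.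
  have [h|h] := ltnP 1 (mn t); last by rewrite fget_out ?mulr0.
  case: eqP => [e|_]; last by rewrite andbF mul0r.
  by case: (@ok_at_ed _ _ okD (marm t) 0); rewrite ?e //; apply: leq_trans l.
rewrite addr0 => ->; apply: eq_bigr => t' _; rewrite /phiP /Pg -[0%N in LHS]/(val (Ordinal p)) fget_in.
rewrite (inj_eq (ok_at_inj okD)) eq_sym.
by case: eqP => _; rewrite ?mul1r ?mul0r ?mulr0.
Qed.

End HomExtract.

End Field.
End Att.

(** * The chain of labels on an arm *)

Section Order.
Variables (Q : bquiver) (D : attq Q).

Lemma okl_refl r n : okl D r n n. Proof. by rewrite /okl eqxx. Qed.

(** Whatever the direction of the edge past the end of the shorter interval, it yields a map one way
    or the other. *)
Lemma okl_total r n n' : okl D r n n' || okl D r n' n.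
Proof.
rewrite /okl; case: (ssrnat.ltngtP n n') => // _; rewrite /= ?orbF;
by case: (adir D r _); rewrite ?orbT.
Qed.

Lemma okl_anti r n n' : okl D r n n' -> okl D r n' n -> n = n'.
Proof.
rewrite /okl; case: (ssrnat.ltngtP n n') => //= _; rewrite ?orbF => h1 h2.
  by rewrite h2 in h1.
by rewrite h1 in h2.
Qed.

Lemma okl_trans r : transitive (okl D r).
Proof.
move=> n' n n''; rewrite /okl; case: (ssrnat.ltngtP n n') => H1;
case: (ssrnat.ltngtP n' n'') => H2; case: (ssrnat.ltngtP n n'') => H3;
  try (exfalso; lia); rewrite /= ?orbF => h1 h2; subst;
  first [by [] | exact: h1 | exact: h2 | by rewrite h1 in h2 | by rewrite h2 in h1].
Qed.

(** The position of the length n in its chain. Replacing lengths by ranks turns an arm of any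
    orientation into one with all arrows towards the centre, where the order on lengths is the usual
    one; [lab] is the inverse. *)
Definition rk r n := count (fun n' => okl D r n' n) (iota 1 (al D r)).

Lemma rk_le r n n' : okl D r n n' -> (rk r n <= rk r n')%N.
Proof. by move=> h; apply: sub_count => k /= hk; apply: okl_trans hk h. Qed.

Lemma rk_okl r n n' : (0 < n <= al D r)%N -> (0 < n' <= al D r)%N ->
  okl D r n n' = (rk r n <= rk r n')%N.
Proof.
move=> hn hn'; apply/idP/idP; first exact: rk_le.
apply: contraLR => h; rewrite -ltnNge.
have h' : okl D r n' n by have := okl_total r n n'; rewrite (negPf h).
rewrite /rk -!size_filter.
have -> : (size [seq k <- iota 1 (al D r) | okl D r k n'] <
           size [seq k <- iota 1 (al D r) | okl D r k n])%N =
  (size (n :: [seq k <- iota 1 (al D r) | okl D r k n']) <=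
           size [seq k <- iota 1 (al D r) | okl D r k n])%N by [].
apply: uniq_leq_size.
  by rewrite /= filter_uniq ?iota_uniq // andbT mem_filter (negPf h).
move=> k; rewrite inE !mem_filter mem_iota => /orP [/eqP ->|/andP [k1 k2]].
  by rewrite okl_refl; lia.
by rewrite k2 (okl_trans k1 h').
Qed.

Lemma rk_bound r n : (0 < n <= al D r)%N -> (0 < rk r n <= al D r)%N.
Proof.
move=> hn; rewrite /rk; apply/andP; split.
  by rewrite -has_count; apply/hasP; exists n; [rewrite mem_iota; lia | apply: okl_refl].
by rewrite (leq_trans (count_size _ _)) ?size_iota.
Qed.

Definition lab r k := nth 0%N (iota 1 (al D r)) (index k [seq rk r n | n <- iota 1 (al D r)]).

Lemma lab_spec r k : (0 < k <= al D r)%N -> (0 < lab r k <= al D r)%N /\ rk r (lab r k) = k.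
Proof.
move=> hk; set s := [seq rk r n | n <- iota 1 (al D r)].
have mi n : (n \in iota 1 (al D r)) = (0 < n <= al D r)%N by rewrite mem_iota; lia.
have us : uniq s.
  rewrite map_inj_in_uniq ?iota_uniq // => n n'; rewrite !mi => hn hn' e.
  by apply: (@okl_anti r); rewrite rk_okl // e.
have ss : {subset s <= iota 1 (al D r)}.
  by move=> x /mapP [n]; rewrite mi => hn ->; rewrite mi rk_bound.
have [_ es] : (size s = size (iota 1 (al D r))) * (s =i iota 1 (al D r)).
  by apply: uniq_min_size => //; rewrite size_map.
have ks : k \in s by rewrite es mi.
have isz : (index k s < al D r)%N by rewrite -{1}(size_iota 1 (al D r)) -(size_map (rk r)) index_mem.
rewrite /lab -/s; split; first by rewrite -mi mem_nth // size_iota.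
by rewrite -(nth_map 0%N 0%N (rk r)) ?size_iota // -/s nth_index.
Qed.

Lemma lab_okl r k k' : (0 < k <= al D r)%N -> (0 < k' <= al D r)%N ->
  okl D r (lab r k) (lab r k') = (k <= k')%N.
Proof.
move=> /lab_spec [h1 h2] /lab_spec [h3 h4]; by rewrite rk_okl // h2 h4.
Qed.

End Order.

Section Pivot.
Variable K : fieldType.
Implicit Type O : mobj K.

(** Morphisms of labelled data for an abstract order on labels, so that data over Q and over the
    star can be compared without their representations. *)
Definition phom (ol : 'I_3 -> nat -> nat -> bool) O O' (phi : mT O -> mT O' -> K) (psi : mU O -> mU O' -> K) : Prop :=
  (forall t t', phi t t' != 0 -> marm t = marm t' /\ ol (marm t) (mn t) (mn t')) /\
  (forall t u', \sum_t' phi t t' * mg t' u' = \sum_u mg t u * psi u u').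

Definition pindec ol O := (inhabited (mU O + mT O)) /\
  forall phi psi, @phom ol O O phi psi -> fm_mul phi phi =2 phi -> fm_mul psi psi =2 psi ->
  (phi =2 (fun _ _ => 0) /\ psi =2 (fun _ _ => 0)) \/
  (phi =2 @fdel K _ /\ psi =2 @fdel K _).

Definition piso ol O O' := exists phi psi phi' psi',
  [/\ @phom ol O O' phi psi, @phom ol O' O phi' psi',
    fm_mul phi phi' =2 @fdel K _ /\ fm_mul psi psi' =2 @fdel K _ &
    fm_mul phi' phi =2 @fdel K _ /\ fm_mul psi' psi =2 @fdel K _].

End Pivot.

Section PivotAtt.
Variables (K : fieldType) (Q : bquiver) (D : attq Q).
Hypothesis okD : attq_ok D.
Implicit Type O : mobj K.

Lemma piso_att O O' : mok D O -> mok D O' -> piso (okl D) O O' -> rep_iso (att D O) (att D O').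
Proof.
move=> h h' [phi [psi [phi' [psi' [p1 p2 [e1 e2] [e3 e4]]]]]].
exact: (att_iso h h' p1 p2).
Qed.

Lemma indec_pindec O : mok D O -> indec (att D O) -> pindec (okl D) O.
Proof.
move=> h [d0 ih]; split.
  have : (0 < #|{: ix O}|)%N by [].
  case/card_gt0P => [[u|c] _]; first by split; left.
  by split; right; apply: (tag c).
move=> phi psi p e1 e2.
have e : fmx (atth phi psi) *m fmx (atth phi psi) = fmx (atth phi psi).
  rewrite fm_mulE; apply: eq_fmx => x z; rewrite /fm_mul (atth_mul p p).
  by case: x z => [u|c] [u'|c'] //=; rewrite ?e1 ?e2.
case: (ih _ (att_hom h h p) e) => e0; [left|right].
  have : atth phi psi =2 atth (fun (_ _ : mT O) => 0) (fun (_ _ : mU O) => 0).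
    move=> x z; rewrite (fmx_inj (etrans e0 (esym (fmx0 _ _ _)))).
    by case: x z => [u|c] [u'|c'] //=; rewrite if_same.
  exact: (atth_inj h h).
have : atth phi psi =2 atth (@fdel K (mT O)) (@fdel K (mU O)).
  by move=> x z; rewrite (fmx_inj (etrans e0 (esym (fmx1 _ _)))) atth_id.
exact: (atth_inj h h).
Qed.

Hypothesis agr_inj : forall r k r' k', (k < al D r)%N -> (k' < al D r')%N ->
  agr D r k = agr D r' k' -> r = r' /\ k = k'.
Hypothesis agr_ctr : forall r k, (k < al D r)%N -> agr D r k <> actr D.

(** If all positions are distinct vertices, as in the star, attaching is full: a homomorphism has no
    components besides those read off by [phiP] and [psiP]. *)
Lemma free_atth O O' (P : ix O -> ix O' -> K) : mok D O -> mok D O' ->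
  hom (att D O) (att D O') (fmx P) -> P =2 atth (phiP P) (psiP P).
Proof.
move=> h h' hP; have /hom_fmx [hg _] := hP.
have z x y : ixgr D x <> ixgr D y -> P x y = 0.
  by move=> n; apply/eqP; apply: contraT => /hg /n.
case=> [u|[t k]] [u'|[t' k']] //=.
- apply: z => /= /esym; apply: agr_ctr; apply: leq_trans (ltn_ord k') _.
  by have /andP [] := h' t'.
- apply: z => /=; apply: agr_ctr; apply: leq_trans (ltn_ord k) _.
  by have /andP [] := h t.
have b : (k < al D (marm t))%N by apply: leq_trans (ltn_ord k) _; have /andP [] := h t.
have b' : (k' < al D (marm t'))%N by apply: leq_trans (ltn_ord k') _; have /andP [] := h' t'.
case: (nat_of_ord k =P k') => [e|ne]; last by apply: z => /= /agr_inj [] // _ /ne.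
rewrite /phiP; case: (marm t =P marm t') => [am|ne]; last by apply: z => /= /agr_inj [].
have kt' : (k < mn t')%N by rewrite e.
by rewrite -(Pg_const okD h h' hP am (ltn_ord k) kt') -(Pg_in P e).
Qed.

Lemma free_att_piso O O' : mok D O -> mok D O' -> rep_iso (att D O) (att D O') -> piso (okl D) O O'.
Proof.
move=> h h' [P0 [P0' [hP eP eP']]].
have hP' : hom (att D O') (att D O) P0'.
  split=> [v|a].
    by rewrite -[LHS]mul1mx -eP' -mulmxA [X in _ *m X]mulmxA -hP.1 -!mulmxA eP mulmx1.
  by rewrite -[LHS]mul1mx -eP' -mulmxA [X in _ *m X]mulmxA -hP.2 -!mulmxA eP mulmx1.
move: hP hP' eP eP'; rewrite -(unfmxK P0) -(unfmxK P0'); set P := unfmx P0; set P' := unfmx P0'.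
move=> hP hP'; have m := phiP_mhom okD h h' hP; have m' := phiP_mhom okD h' h hP'.
rewrite !fm_mulE -!fmx1 => /fmx_inj eP /fmx_inj eP'.
exists (phiP P), (psiP P), (phiP P'), (psiP P'); split=> //; apply: (atth_inj h h) || apply: (atth_inj h' h').
  move=> x z; rewrite atth_id -(atth_mul m m') -[RHS]eP /fm_mul.
  by apply: eq_bigr => y _; rewrite -!free_atth.
move=> x z; rewrite atth_id -(atth_mul m' m) -[RHS]eP' /fm_mul.
by apply: eq_bigr => y _; rewrite -!free_atth.
Qed.

Lemma pindec_indec O : mok D O -> pindec (okl D) O -> indec (att D O).
Proof.
move=> h [[i] ih]; split.
  apply/card_gt0P; case: i => [u|t]; first by exists (inl u).
  by have /andP [p _] := h t; exists (mkc (Ordinal p)).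
move=> P0; rewrite -(unfmxK P0); set P := unfmx P0 => hP.
have m := phiP_mhom okD h h hP; have f := free_atth h h hP.
rewrite fm_mulE => /fmx_inj e.
have e2 : atth (fm_mul (phiP P) (phiP P)) (fm_mul (psiP P) (psiP P)) =2 atth (phiP P) (psiP P).
  move=> x z; rewrite -(atth_mul m m) -f -e /fm_mul.
  by apply: eq_bigr => y _; rewrite -!f.
have [e3 e4] := atth_inj h h e2.
case: (ih _ _ m e3 e4) => [] [e5 e6]; [left|right].
  rewrite -(fmx0 K (ix O) (ix O)); apply: eq_fmx => x z; rewrite f.
  by case: x z => [u|c] [u'|c'] //=; rewrite ?e5 ?e6 ?if_same.
rewrite -fmx1; apply: eq_fmx => x z; rewrite f -[RHS]/(fdel K x z) -atth_id.
by case: x z => [u|c] [u'|c'] //=; rewrite ?e5 ?e6.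
Qed.

End PivotAtt.

(** * The star with all arrows towards the centre *)

Section Star.
Variable la : 'I_3 -> nat.

Definition starQ : bquiver :=
  @BQuiver (option {r : 'I_3 & 'I_(la r).+1}) {r : 'I_3 & 'I_(la r).+1}
    (fun c => Some c)
    (fun c => if tagged c == 0%N :> nat then None else Some (@Tagged _ (tag c) (fun r => 'I_(la r).+1) (inord (tagged c).-1)))
    (fun _ _ => false).

Definition starD : attq starQ := @AttQ starQ (fun r => (la r).+1)
  (fun r k => Some (@Tagged _ r (fun r => 'I_(la r).+1) (inord k))) None
  (fun r => @Tagged _ r (fun r => 'I_(la r).+1) ord0)
  (fun r k => @Tagged _ r (fun r => 'I_(la r).+1) (inord k.+1)) (fun _ _ => false).

Lemma star_agr_inj r k r' k' : (k < al starD r)%N -> (k' < al starD r')%N ->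
  agr starD r k = agr starD r' k' -> r = r' /\ k = k'.
Proof.
move=> /= h h' e; have e1 : @Tagged _ r (fun r => 'I_(la r).+1) (inord k) = @Tagged _ r' (fun r => 'I_(la r).+1) (inord k').
  by case: e.
have e2 : r = r' := f_equal (@tag _ _) e1; split=> //.
by move: (f_equal (fun c : {r & 'I_(la r).+1} => val (tagged c)) e1); rewrite /= !inordK.
Qed.

Lemma star_ok : attq_ok starD.
Proof.
split=> //=.
- by move=> r; rewrite (_ : inord 0 = ord0) //; apply: val_inj; rewrite /= inordK.
- by move=> r k h; rewrite inordK.
- move=> r k k' h h' e; have := f_equal (fun c : {r & 'I_(la r).+1} => val (tagged c)) e.
  by rewrite /= !inordK // => [[]].
- move=> r k h e; have := f_equal (fun c : {r & 'I_(la r).+1} => val (tagged c)) e.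
  by rewrite /= inordK.
- by move=> r r' e; exact: (f_equal (@tag _ _) e).
Qed.

Lemma star_okl r n n' : okl starD r n n' = (n <= n')%N.
Proof. by rewrite /okl /= !andbT !andbF orbF [RHS]leq_eqVlt. Qed.

End Star.

(** * Representations of a line *)

Section Basis.
Variables (Q : bquiver) (K : fieldType).

Lemma basis_iso (M : rep Q K) (J : finType) (b : J -> 'rV[K]_(rdim M)) (d : J -> 'cV[K]_(rdim M))
  (e : qV Q -> J -> J -> K) (X : qA Q -> J -> J -> K) :
  (forall i j, b i *m d j = (i == j)%:R%:M) -> \sum_j d j *m b j = 1%:M ->
  (forall i v, b i *m re M v = \sum_j e v i j *: b j) ->
  (forall i a, b i *m rX M a = \sum_j X a i j *: b j) ->
  rep_iso M (@Rep Q K #|J| (fun v => fmx (e v)) (fun a => fmx (X a))).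
Proof.
move=> bd db he hX.
pose B : 'M[K]_(#|J|, rdim M) := \matrix_i b (enum_val i).
pose C : 'M[K]_(rdim M, #|J|) := \matrix_(i, j) d (enum_val j) i 0.
have BC : B *m C = 1%:M.
  apply/matrixP => i j; have := congr1 (fun A : 'M_1 => A 0 0) (bd (enum_val i) (enum_val j)).
  rewrite !mxE eqxx mulr1n (inj_eq enum_val_inj) => <-.
  by apply: eq_bigr => k _; rewrite !mxE.
have CB : C *m B = 1%:M.
  rewrite -db; apply/matrixP => i j; rewrite summxE [RHS](reindex _ (onW_bij _ (enum_val_bij _))) /= mxE.
  by apply: eq_bigr => k _; rewrite !mxE big_ord1.
have hB A (F : J -> J -> K) : (forall i, b i *m A = \sum_j F i j *: b j) -> B *m A = fmx F *m B.
  move=> h; apply/row_matrixP => i; rewrite !row_mul rowK h mulmx_sum_row.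
  rewrite [LHS](reindex _ (onW_bij _ (enum_val_bij _))) /=.
  by apply: eq_bigr => k _; rewrite !mxE rowK.
apply: iso_sym; exists B, C; split=> //.
by split=> [v|a] /=; apply/esym/hB.
Qed.

End Basis.

Section Line.
Variables (K : closedFieldType) (N : nat) (o : 'I_N -> bool).
Notation L := (lineQ o).
Notation V := ('I_N.+1).

Lemma line_free a b : @qrel L a b = false. Proof. by []. Qed.

Section Roots.
Variable x : V -> nat.
Let y (k : nat) : int := if k is k'.+1 then (if (k' <= N)%N then (x (inord k'))%:Z else 0) else 0.

Lemma sq_diff (w : nat -> int) n : w 0%N = 0 ->
  \sum_(k < n) (w k.+1 - w k) ^+ 2 =
  2 * \sum_(k < n) w k.+1 ^+ 2 - 2 * \sum_(k < n) w k * w k.+1 - w n ^+ 2.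
Proof.
move=> w0; elim: n => [|n IH]; first by rewrite !big_ord0 w0; ring.
by rewrite !big_ord_recr /= IH; ring.
Qed.

(** The vector is padded with a zero on each side, which makes the form of type A half the sum of
    the squared jumps. A positive vector of value 1 has exactly two jumps, both of size one, hence
    is an interval. *)
Lemma line_eul : 2 * eul (Q := L) (fun v => (x v)%:Z) (fun v => (x v)%:Z) =
  \sum_(k < N.+2) (y k.+1 - y k) ^+ 2.
Proof.
rewrite sq_diff // big_ord_recr [in RHS]/= (ltnn N) addr0.
rewrite [\sum_(k < _) y k * _]big_ord_recr [\sum_(k < _) y k * _]big_ord_recl /= ltnn mulr0 addr0 mul0r add0r.
rewrite addr0 /eul mulrBr; congr (_ * _ - _ * _).
  apply: eq_bigr => k _; rewrite -ltnS ltn_ord expr2; congr (_ * _);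
  by congr (x _)%:Z; apply: val_inj; rewrite /= inordK.
apply: eq_bigr => k _ /=; have lk := ltn_ord k.
rewrite /bump /= add0n add1n lk (ltnW lk).
by case: (o k) => //; rewrite mulrC.
Qed.

Hypothesis x0 : exists v, x v <> 0%N.

Lemma line_two : exists lo hi : nat, [/\ (lo <= hi <= N)%N,
   (forall k, (k < lo)%N -> y k.+1 = 0) /\ (forall k, (hi < k)%N -> y k.+1 = 0),
   0 < y lo.+1 & 0 < y hi.+1].
Proof.
have ex : exists k, [&& (k <= N)%N & x (inord k) != 0%N].
  have [v hv] := x0; exists v; rewrite inord_val; apply/andP; split; last exact/eqP.
  by rewrite -ltnS.
have bd k : [&& (k <= N)%N & x (inord k) != 0%N] -> (k <= N)%N by case/andP.
exists (ex_minn ex), (ex_maxn ex bd).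
case: ex_minnP => lo /andP [lo1 lo2] lo3; case: ex_maxnP => hi /andP [hi1 hi2] hi3.
split.
- by rewrite hi1 andbT; apply: hi3; rewrite lo1.
- split=> k hk /=; case: ifP => // hN.
    by case: eqP (lo3 k) => [->|_] //; rewrite hN /= => /(_ isT); lia.
  by case: eqP (hi3 k) => [->|_] //; rewrite hN /= => /(_ isT); lia.
- by rewrite /= lo1; lia.
- by rewrite /= hi1; lia.
Qed.

Lemma line_pos : 0 < eul (Q := L) (fun v => (x v)%:Z) (fun v => (x v)%:Z).
Proof.
have [lo [hi [h1 [h2 _] h3 _]]] := line_two.
suff : 0 < 2 * eul (Q := L) (fun v => (x v)%:Z) (fun v => (x v)%:Z) by lia.
have lo2 : (lo < N.+2)%N by lia.
rewrite line_eul (bigD1 (Ordinal lo2)) //= ltr_wpDr ?sumr_ge0 //; first by move=> i _; rewrite sqr_ge0.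
have -> : y lo = 0 by case: (posnP lo) => [->//|l0]; rewrite -(prednK l0) h2 // prednK.
by rewrite subr0 exprn_gt0.
Qed.

Lemma line_root : eul (Q := L) (fun v => (x v)%:Z) (fun v => (x v)%:Z) = 1 ->
  exists lo hi : nat, (lo < hi <= N.+1)%N /\ forall v : V, x v = (lo <= v < hi)%N.
Proof.
move=> e1; have [lo [hi [h1 [h2 h2'] h3 h4]]] := line_two.
have := line_eul; rewrite e1 => e2.
have lo2 : (lo < N.+2)%N by lia. have hi2 : (hi.+1 < N.+2)%N by lia.
have ylo : y lo = 0 by case: (posnP lo) => [->//|l0]; rewrite -(prednK l0) h2 // prednK.
have yhi : y hi.+2 = 0 by exact: h2'.
move: e2; rewrite (bigD1 (Ordinal lo2)) // (bigD1 (Ordinal hi2)) //=; last first.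
  by apply/eqP => /(congr1 val) /=; lia.
rewrite -/(y hi.+2) -/(y lo.+1) -/(y hi.+1) ylo yhi subr0 sub0r sqrrN.
set R := \sum_(_ | _) _ => e3.
have R0 : 0 <= R by apply: sumr_ge0 => i _; rewrite sqr_ge0.
have s1 : 1 <= y lo.+1 ^+ 2 by rewrite expr2; nia.
have s2 : 1 <= y hi.+1 ^+ 2 by rewrite expr2; nia.
have t1 : y lo.+1 = 1 by rewrite !expr2 in s1 s2 e3; nia.
have {}R0 : R = 0 by lia.
have st k : (k < N.+2)%N -> k <> lo -> k <> hi.+1 -> y k.+1 = y k.
  move=> kN n1 n2.
  have /eqP := R0; rewrite psumr_eq0; last by move=> i _; rewrite sqr_ge0.
  move=> /allP /(_ (Ordinal kN)); rewrite mem_index_enum => /(_ isT).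
  rewrite -!(inj_eq val_inj) /= => /implyP H.
  have : (y k.+1 - y k) ^+ 2 == 0 by apply: H; apply/andP; split; apply/eqP.
  by rewrite sqrf_eq0 subr_eq0 => /eqP.
have cst k : (lo <= k <= hi)%N -> y k.+1 = 1.
  elim: k => [|k IH] hk; first by rewrite -t1; congr y; lia.
  case: (lo =P k.+1) => [<- //|ne].
  by rewrite st; [apply: IH; lia | lia | lia | lia].
exists lo, hi.+1; split; first lia.
move=> v; have vN : (v <= N)%N by rewrite -ltnS.
have yv : y v.+1 = x v by rewrite /= vN inord_val.
case: (ltnP v lo) => [l|l]; first by move: yv; rewrite h2 //; lia.
case: (ltnP v hi.+1) => [g|g]; last by move: yv; rewrite h2' //; lia.
by move: yv; rewrite cst; lia.
Qed.

End Roots.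

Definition itv (lo hi : nat) : finType := {v : V | (lo <= v < hi)%N}.

Definition thin lo hi : rep L K := @Rep L K #|itv lo hi|
  (fun v => fmx (fun x y : itv lo hi => ((x == y) && (val x == v))%:R))
  (fun a => fmx (fun x y : itv lo hi => ((val x == qs a) && (val y == qt a))%:R)).

Lemma thin_rep lo hi : is_rep (thin lo hi).
Proof.
split=> //=.
- move=> v; rewrite fmx_mul; apply: eq_fmx => x z; rewrite sum_e.
  by case: (x == z); case: (_ == v); rewrite ?mulr1 ?mulr0 ?mul0r.
- move=> v w vw; rewrite fmx_mul -[RHS](fmx0 _ (itv lo hi) (itv lo hi)); apply: eq_fmx => x z.
  rewrite sum_e; case: (val x =P v) => [->|_]; last by rewrite mul0r.
  by rewrite (negPf vw) andbF mulr0.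
- rewrite fmx_sum -fmx1; apply: eq_fmx => x y.
  rewrite (bigD1 (val x)) //= eqxx andbT big1 ?addr0 // => v vx.
  by rewrite [_ == v]eq_sym (negPf vx) andbF.
- move=> a; rewrite !fmx_mul; apply: eq_fmx => x z.
  rewrite (bigD1 z) //= [X in _ + X]big1 ?addr0; last first.
    by move=> y yz; rewrite (negPf yz) mulr0.
  rewrite sum_e eqxx /=.
  by case: (val x == _); case: (val z == _); rewrite ?mulr1 ?mulr0 ?mul0r.
Qed.

Lemma thin_dm lo hi (v : V) : dm (thin lo hi) v = (lo <= v < hi)%N.
Proof.
rewrite /dm /=; case: (boolP (lo <= v < hi)%N) => h.
  pose v' : itv lo hi := exist _ v h.
  have E (x y : itv lo hi) : (x == y) && (val x == v) = (x == v') && (y == v').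
    rewrite -(inj_eq val_inj x v') /=; case: (sval x =P v) => [e|_]; last by rewrite andbF.
    have -> : x = v' by apply: val_inj.
    by rewrite andbT eq_sym.
  rewrite (_ : fmx _ = delta_mx (enum_rank v') (enum_rank v')) ?mxrank_delta //.
  by apply/matrixP => i j; rewrite !mxE E -!(can_eq enum_valK) !enum_rankK.
rewrite (_ : fmx _ = 0) ?mxrank0 // -(fmx0 _ (itv lo hi) (itv lo hi)).
apply: eq_fmx => x y; case: (sval x =P v) => [e|_]; last by rewrite andbF.
by have := valP x; rewrite /= e (negPf h).
Qed.

Lemma thin_indec lo hi : (lo < hi <= N.+1)%N -> indec (thin lo hi).
Proof.
move=> lh; have loN : (lo < N.+1)%N by lia.
have i0 : (lo <= Ordinal loN < hi)%N by rewrite /=; lia.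
pose x0 : itv lo hi := exist _ (Ordinal loN) i0.
split; first by apply/card_gt0P; exists x0.
move=> P0; rewrite -(unfmxK P0); set F := unfmx P0 => [[h1 h2]].
have off x y : x <> y -> F x y = 0.
  move=> ne; have := h1 (val x); rewrite /= !fmx_mul => /fmx_inj /(_ x y).
  rewrite sum_e eqxx mul1r (bigD1 y) //= big1 ?addr0; last first.
    by move=> z zy; rewrite (negPf zy) mulr0.
  rewrite eqxx /=; case: (sval y =P sval x) => [e|_]; last by rewrite mulr0.
  by case: ne; apply: val_inj.
have step (k : 'I_N) (x y : itv lo hi) : val x = inord k -> val y = inord k.+1 -> F x x = F y y.
  move=> ex ey; pose xs := if o k then x else y; pose xt := if o k then y else x.
  have es : sval xs = (if o k then inord k else inord k.+1) by rewrite /xs /=; case: (o k).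
  have et : sval xt = (if o k then inord k.+1 else inord k) by rewrite /xt /=; case: (o k).
  suff : F xs xs = F xt xt by rewrite /xs /xt; case: (o k).
  have := h2 k; rewrite [rX _ _]/= !fmx_mul => /fmx_inj /(_ xs xt).
  rewrite (bigD1 xt) //= [X in _ + X]big1 ?addr0; last first.
    by move=> z /eqP zx; rewrite off // mulr0.
  rewrite (bigD1 xs) //= [X in _ = _ + X]big1 ?addr0; last first.
    by move=> z /eqP zx; rewrite off ?mul0r // => e; apply: zx.
  by rewrite es et !eqxx mul1r mulr1.
have cst x : F x x = F x0 x0.
  have H : forall k, (lo + k < hi)%N -> forall x, val x = inord (lo + k) -> F x x = F x0 x0.
    elim=> [|k IH] hk y ey.
      suff -> : y = x0 by [].
      by apply: val_inj; rewrite ey addn0; apply: val_inj; rewrite /= inordK.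
    have kN : (lo + k < N)%N by lia.
    have kN' : (lo + k < N.+1)%N by lia.
    have iz : (lo <= (inord (lo + k) : V) < hi)%N by rewrite inordK //; lia.
    pose z : itv lo hi := exist _ (inord (lo + k)) iz.
    have hk' : (lo + k < hi)%N by lia.
    rewrite -(IH hk' z erefl); apply/esym.
    by apply: (step (Ordinal kN)); rewrite ?ey ?addnS.
  have := valP x; rewrite /= => hx.
  have /andP [hx1 hx2] := hx.
  by apply: (H (sval x - lo)%N); rewrite subnKC ?inord_val.
rewrite fm_mulE => /fmx_inj e.
have FF : F x0 x0 * F x0 x0 = F x0 x0.
  rewrite -[RHS]e /fm_mul (bigD1 x0) //= big1 ?addr0 // => y /eqP yx.
  by rewrite off ?mul0r // => h; apply: yx.
have eF x y : F x y = F x0 x0 * (x == y)%:R.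
  by case: (x =P y) => [->|ne]; [rewrite mulr1 cst | rewrite off ?mulr0].
have /eqP : F x0 x0 * (F x0 x0 - 1) = 0 by rewrite mulrBr FF mulr1 subrr.
rewrite mulf_eq0 subr_eq0 => /orP [/eqP F0|/eqP F1]; [left|right].
  by rewrite -(fmx0 _ (itv lo hi) (itv lo hi)); apply: eq_fmx => x y; rewrite eF F0 mul0r.
by rewrite -fmx1; apply: eq_fmx => x y; rewrite eF F1 mul1r.
Qed.

Lemma line_indec M : is_rep M -> indec M ->
  exists lo hi : nat, (lo < hi <= N.+1)%N /\ rep_iso M (thin lo hi).
Proof.
have dy := fun X => @dynkin L K X (@line_pos).
move=> hM iM; have [_ rM eM] := dy _ hM iM.
have [|lo [hi [lh dM]]] := @line_root (dm M) _ eM.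
  apply: NNPP => h; case: iM => r0 _; move: r0; rewrite rdim_sum // big1 // => v _.
  by apply: NNPP => h'; case: h; exists v.
exists lo, hi; split=> //; have hT := thin_rep lo hi.
have [_ rT _] := dy _ hT (thin_indec lh).
by apply: (rigid_unique line_free) => // v; rewrite dM thin_dm.
Qed.

(** A decomposition into intervals recorded as basis vectors b with dual coordinates d; in this form
    the basis can be lifted along a quotient map and corrected vector by vector. *)
Definition ibasis (M : rep L K) (T : finType) (S : T -> pred V)
    (b : T -> V -> 'rV[K]_(rdim M)) (d : T -> V -> 'cV[K]_(rdim M)) :=
  [/\ forall t v t' v', S t v -> S t' v' ->
        b t v *m d t' v' = ((t == t') && (v == v'))%:R%:M,
      \sum_t \sum_(v | S t v) d t v *m b t v = 1%:M,
      forall t v w, S t v -> b t v *m re M w = (v == w)%:R *: b t v &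
      forall t v a, S t v -> b t v *m rX M a =
        if (v == qs a) && S t (qt a) then b t (qt a) else 0].

Lemma row_fmx (I J : finType) (f : I -> J -> K) n (A : 'M_(_, n)) i :
  row (enum_rank i) (fmx f *m A) = \sum_j f i j *: row (enum_rank j) A.
Proof.
rewrite row_mul mulmx_sum_row [LHS](reindex _ (onW_bij _ (enum_rank_bij _))) /=.
by apply: eq_bigr => j _; rewrite !mxE !enum_rankK.
Qed.

Lemma thin_ibasis M lo hi : rep_iso M (thin lo hi) ->
  exists b d, @ibasis M unit (fun _ v => lo <= v < hi)%N b d.
Proof.
move=> /iso_sym [P [P' [hP PP' P'P]]].
pose b (_ : unit) (v : V) : 'rV[K]_(rdim M) :=
  if insub v is Some x then row (enum_rank (x : itv lo hi)) P else 0.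
pose d (_ : unit) (v : V) : 'cV[K]_(rdim M) :=
  if insub v is Some x then col (enum_rank (x : itv lo hi)) P' else 0.
have bE t (v : V) (h : (lo <= v < hi)%N) : b t v = row (enum_rank (exist _ v h : itv lo hi)) P.
  by rewrite /b insubT.
have dE t (v : V) (h : (lo <= v < hi)%N) : d t v = col (enum_rank (exist _ v h : itv lo hi)) P'.
  by rewrite /d insubT.
exists b, d; split.
- move=> [] v [] v' h h'; rewrite (bE _ _ h) (dE _ _ h') /=.
  apply/rowP => i; rewrite ord1 !mxE eqxx mulr1n.
  have := congr1 (fun A : 'M_#|itv lo hi| => A (enum_rank (exist _ v h : itv lo hi)) (enum_rank (exist _ v' h' : itv lo hi))) PP'.
  rewrite !mxE (inj_eq enum_rank_inj) -(inj_eq val_inj) /= => <-.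
  by apply: eq_bigr => k _; rewrite !mxE.
- rewrite (bigD1 tt) //= [X in _ + X]big1 ?addr0; last by case.
  rewrite -P'P.
  rewrite (reindex_omap (val : itv lo hi -> V) insub) /=; last by move=> v h; rewrite insubT.
  transitivity (\sum_(x : itv lo hi) col (enum_rank x) P' *m row (enum_rank x) P).
    apply: eq_big => [x|x _]; first by rewrite valK eqxx (valP x).
    by rewrite /b /d valK.
  rewrite (reindex _ (onW_bij _ (enum_val_bij _))) /=.
  apply/matrixP => i j; rewrite summxE mxE; apply: eq_bigr => k _.
  by rewrite enum_valK !mxE big_ord1 !mxE.
- move=> t v w h; rewrite (bE _ _ h) -row_mul -hP.1 row_fmx.
  rewrite (bigD1 (exist _ v h : itv lo hi)) //= eqxx big1 ?addr0 // => y yx.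
  by rewrite eq_sym (negPf yx) scale0r.
- move=> t v a h; rewrite (bE _ _ h) -row_mul -hP.2 row_fmx; move: (qs a : V) (qt a : V) => s q.
  have [e|ne] := eqVneq v s; last first.
    by rewrite big1 // => y _; rewrite scale0r.
  subst s => /=.
  case: ifP => [ht|ht].
    rewrite (bE _ _ ht) (bigD1 (exist _ q ht : itv lo hi)) //= ?eqxx scale1r.
    rewrite big1 ?addr0 // => y; rewrite -(inj_eq val_inj) /= => /negPf ->.
    by rewrite ?andbF scale0r.
  rewrite big1 // => y _; rewrite ?eqxx /=.
  case: (sval y =P q) => [ey|ney]; last by rewrite scale0r.
  by have := valP y; rewrite /= ey ht.
Qed.

Lemma line_dec M : is_rep M -> exists (T : finType) (lo hi : T -> nat) b d,
  (forall t, lo t < hi t <= N.+1)%N /\ @ibasis M T (fun t v => lo t <= v < hi t)%N b d.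
Proof.
have [n] := ubnP (rdim M); elim: n M => // n IH M rn hM.
have [r0|r0] := posnP (rdim M).
  exists void, (fun _ => 0%N), (fun _ => 0%N), (fun _ _ => 0), (fun _ _ => 0); split=> [[]|].
  by split=> [[]||[]|[]] //; apply/matrixP => i; move: (i); rewrite r0 => [[]].
have [iM|niM] := classic (indec M).
  have [lo [hi [lh iso]]] := line_indec hM iM; have [b [d h]] := thin_ibasis iso.
  by exists unit, (fun _ => lo), (fun _ => hi), b, d.
have [P hP [PP [P0 P1]]] : exists2 P, hom M M P & P *m P = P /\ P <> 0 /\ P <> 1%:M.
  apply: NNPP => h; apply: niM; split=> // P hP PP.
  by apply: NNPP => h'; case: h; exists P => //; split=> //; split=> e; apply: h'; [left|right].
have split_ E : hom M M E -> E *m E = E -> exists M1 (k : 'M_(rdim M1, rdim M)) c,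
  [/\ hom M1 M k, hom M M1 c, k *m c = 1%:M & c *m k = E].
  move=> hE EE; have [M1 [c [k [hc hk fc fk e]]]] := hom_image hE.
  exists M1, k, c; split=> //.
  apply: (row_free_inj fk); rewrite mul1mx; apply: (row_full_inj fc).
  by rewrite !mulmxA -e -mulmxA -e EE.
have small E M1 k c : hom M1 M k -> k *m c = 1%:M -> c *m k = E -> E <> 1%:M -> (rdim M1 < n)%N.
  move=> hk kc ck E1; apply: leq_trans (_ : rdim M <= n)%N => //.
  have fk : row_free k by apply/row_freeP; exists c.
  rewrite ltn_neqAle (rdim_free hk fk) andbT; apply/eqP => e; case: E1.
  have fk' : row_full k by rewrite /row_full (eqP fk) e.
  by apply: (row_full_inj fk'); rewrite mulmx1 -ck mulmxA kc mul1mx.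
have hQ : hom M M (1%:M - P) by apply: hom_sub => //; apply: hom_id.
have QQ : (1%:M - P) *m (1%:M - P) = 1%:M - P.
  by rewrite mulmxBl mul1mx mulmxBr mulmx1 PP subrr subr0.
have [M1 [k1 [c1 [hk1 hc1 kc1 ck1]]]] := split_ _ hP PP.
have [M2 [k2 [c2 [hk2 hc2 kc2 ck2]]]] := split_ _ hQ QQ.
have f1 : row_free k1 by apply/row_freeP; exists c1.
have f2 : row_free k2 by apply/row_freeP; exists c2.
have kc12 : k1 *m c2 = 0.
  by apply: (row_free_inj f2); rewrite mul0mx -mulmxA ck2 mulmxBr mulmx1 -ck1 mulmxA kc1 mul1mx subrr.
have kc21 : k2 *m c1 = 0.
  apply: (row_free_inj f1); rewrite mul0mx -mulmxA ck1.
  by rewrite -[LHS]mul1mx -kc2 -mulmxA (mulmxA c2) ck2 mulmxBl mul1mx PP subrr mulmx0.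
have Q1 : 1%:M - P <> 1%:M by move=> e; apply: P0; rewrite -[P](subKr 1%:M) e subrr.
have [T1 [lo1 [hi1 [b1 [d1 [lh1 [A1 B1 C1 D1]]]]]]] := IH _ (small _ _ _ _ hk1 kc1 ck1 P1) (rep_inj hk1 f1 hM).
have [T2 [lo2 [hi2 [b2 [d2 [lh2 [A2 B2 C2 D2]]]]]]] := IH _ (small _ _ _ _ hk2 kc2 ck2 Q1) (rep_inj hk2 f2 hM).
exists (T1 + T2)%type, (fun x => match x with inl t => lo1 t | inr t => lo2 t end),
  (fun x => match x with inl t => hi1 t | inr t => hi2 t end),
  (fun x v => match x with inl t => b1 t v *m k1 | inr t => b2 t v *m k2 end),
  (fun x v => match x with inl t => c1 *m d1 t v | inr t => c2 *m d2 t v end).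
split; first by case.
split.
- case=> t v [] t' v' h h'; rewrite -mulmxA (mulmxA _ _ (_ t' v')) ?kc1 ?kc2 ?kc12 ?kc21 ?mul1mx ?mul0mx ?mulmx0.
  + exact: A1.
  + by rewrite raddf0.
  + by rewrite raddf0.
  + exact: A2.
- rewrite big_sumType /= -[RHS](subrK P) [RHS]addrC -{1}ck1 -ck2; congr (_ + _).
    rewrite -[in RHS](mulmx1 c1) -B1 mulmx_sumr mulmx_suml; apply: eq_bigr => t _.
    rewrite mulmx_sumr mulmx_suml; apply: eq_bigr => v _; by rewrite !mulmxA.
  rewrite -[in RHS](mulmx1 c2) -B2 mulmx_sumr mulmx_suml; apply: eq_bigr => t _.
  rewrite mulmx_sumr mulmx_suml; apply: eq_bigr => v _; by rewrite !mulmxA.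
- case=> t v w h; first by rewrite -mulmxA -hk1.1 mulmxA C1 // scalemxAl.
  by rewrite -mulmxA -hk2.1 mulmxA C2 // scalemxAl.
- case=> t v a h.
    by rewrite -mulmxA -hk1.2 mulmxA D1 //; case: ifP => _; rewrite ?mul0mx.
  by rewrite -mulmxA -hk2.2 mulmxA D2 //; case: ifP => _; rewrite ?mul0mx.
Qed.

End Line.

(** * Reduction of the exceptional algebra to a star *)

Section Exc.
Variables (n m l : nat) (o : 'I_(m + n + l).+2 -> bool).
Notation N := (m + n + l).+2.
Notation V := ('I_N.+1).
Hypothesis n1 : (0 < n)%N.
Hypotheses (ob : o (inord m)) (oa1 : ~~ o (inord m.+1)) (oan : ~~ o (inord (m + n)))
  (oc : ~~ o (inord (m + n).+1)).
Notation E := (exc_alg o).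
Notation iV := (inord m.+1 : V).
Notation jV := (inord (m + n).+1 : V).
Definition gl (v : V) : qV E := glue_map (Q := lineQ o) iV jV v.
Definition Qs (a : 'I_N) : V := qs (b := lineQ o) a.
Definition Qt (a : 'I_N) : V := qt (b := lineQ o) a.
Definition aan : 'I_N := inord (m + n).

Lemma vE (k : nat) (v : V) : (k <= N)%N -> (v == inord k) = (v == k :> nat).
Proof. by move=> h; rewrite -(inj_eq val_inj) /= inordK. Qed.

Lemma gl_i : gl iV = None. Proof. by rewrite /gl /glue_map insubF // eqxx. Qed.
Lemma gl_j : gl jV = None. Proof. by rewrite /gl /glue_map insubF // eqxx andbF. Qed.

Lemma gl_in (v : V) (h : (v != iV) && (v != jV)) : gl v = Some (exist _ v h).
Proof. by rewrite /gl /glue_map insubT. Qed.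

Lemma gl_None v : gl v = None -> v = iV \/ v = jV.
Proof.
have [/eqP ->|h1] := boolP (v == iV); first by left.
have [/eqP ->|h2] := boolP (v == jV); first by right.
have h : (v != iV) && (v != jV) by rewrite h1.
by rewrite (gl_in h).
Qed.

Lemma gl_inj v w : v <> iV -> w <> iV -> gl v = gl w -> v = w.
Proof.
move=> /eqP vi /eqP wi; have [/eqP ->|vj] := boolP (v == jV).
  by rewrite gl_j => /esym /gl_None [] // e; rewrite e eqxx in wi.
have hv : (v != iV) && (v != jV) by rewrite vi.
rewrite (gl_in hv); have [/eqP ->|wj] := boolP (w == jV); first by rewrite gl_j.
have hw : (w != iV) && (w != jV) by rewrite wi.
by rewrite (gl_in hw) => [[]].
Qed.

Lemma arr_at (a : 'I_N) k : (k < N)%N -> a = k :> nat -> a = inord k.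
Proof. by move=> kN e; apply: val_inj; rewrite /= inordK. Qed.

Lemma QsE (a : 'I_N) : Qs a = (if o a then a : nat else a.+1) :> nat.
Proof. by rewrite /Qs /=; have := ltn_ord a; case: (o a) => h; rewrite inordK //; lia. Qed.
Lemma QtE (a : 'I_N) : Qt a = (if o a then a.+1 else a : nat) :> nat.
Proof. by rewrite /Qt /=; have := ltn_ord a; case: (o a) => h; rewrite inordK //; lia. Qed.

Lemma o_at (a : 'I_N) : [/\ (a == m :> nat) -> o a, (a == m.+1 :> nat) -> ~~ o a,
   (a == m + n :> nat)%N -> ~~ o a & (a == (m + n).+1 :> nat) -> ~~ o a].
Proof.
split=> /eqP e.
- by rewrite (@arr_at a m) //; lia.
- by rewrite (@arr_at a m.+1) //; lia.
- by rewrite (@arr_at a (m + n)) //; lia.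
- by rewrite (@arr_at a (m + n).+1) //; lia.
Qed.

(** In this orientation i is a sink and alpha_n is the only arrow leaving j, so gluing adds exactly
    the relations that beta followed by alpha_n, and alpha_1 followed by alpha_n, vanish. *)
Lemma Qs_i a : Qs a != iV.
Proof.
rewrite vE ?QsE; last by lia.
have [h1 h2 h3 h4] := o_at a; case: ifP => oa; apply/eqP => e.
  by move: h2; rewrite e eqxx oa => /(_ isT).
have ea : (a == m :> nat) by apply/eqP; case: e.
by move: (h1 ea); rewrite oa.
Qed.

Lemma Qs_j a : Qs a = jV -> a = aan.
Proof.
move/eqP; rewrite vE ?QsE; last by lia.
have [h1 h2 h3 h4] := o_at a; case: ifP => oa /eqP e.
  by move: h4; rewrite e eqxx oa => /(_ isT).
by apply: arr_at; lia.
Qed.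

Lemma Qt_i a : Qt a = iV -> (a == m :> nat) || (a == m.+1 :> nat).
Proof. by move/eqP; rewrite vE ?QtE; [case: ifP => oa /eqP e; lia | lia]. Qed.

Lemma Qt_j a : Qt a = jV -> a = (m + n).+1 :> nat.
Proof.
move/eqP; rewrite vE ?QtE; last by lia.
have [h1 h2 h3 h4] := o_at a; case: ifP => oa /eqP e //.
have ea : (a == m + n :> nat)%N by apply/eqP; case: e.
by move: (h3 ea); rewrite oa.
Qed.

Lemma Qs_an : Qs aan = jV.
Proof. by apply: val_inj; rewrite /= QsE /aan (negPf oan) !inordK //; lia. Qed.

Lemma qrel_i a : Qt a = iV -> @qrel E aan a.
Proof.
by move=> e; apply/or3P; apply: Or33; apply/andP; split; apply/eqP; [exact: Qs_an|].
Qed.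

Section Reduce.
Variable K : closedFieldType.
Variable M : rep E K.
Hypothesis hM : is_rep M.

(** Every arrow kills this subspace, and by the relations it contains the images of beta and
    alpha_1. *)
Definition Uker := (re M None :&: kermx (rX M aan))%MS.

Lemma eX a : re M (gl (Qs a)) *m rX M a = rX M a. Proof. exact: (@rep_eX E K M a hM). Qed.
Lemma Xe a : rX M a *m re M (gl (Qt a)) = rX M a. Proof. exact: (@rep_Xe E K M a hM). Qed.

Lemma Uker_e k (x : 'M_(k, _)) v : (x <= Uker)%MS -> x *m re M v = (v == None)%:R *: x.
Proof.
rewrite sub_capmx => /andP [/submxP [y ->] _]; rewrite -mulmxA rep_ee // eq_sym.
by case: eqP => [<-|_]; rewrite ?scale1r ?scale0r ?mulmx0.
Qed.

Lemma Uker_X k (x : 'M_(k, _)) a : (x <= Uker)%MS -> x *m rX M a = 0.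
Proof.
move=> xU; rewrite -eX mulmxA Uker_e //; case: eqP => [h|_]; last by rewrite scale0r mul0mx.
rewrite scale1r; case: (gl_None h) => e; first by have := Qs_i a; rewrite e eqxx.
rewrite (Qs_j e); move: xU; rewrite sub_capmx => /andP [_ /sub_kermxP].
by [].
Qed.

Lemma Uker_sub k (x : 'M_(k, _)) : x *m re M None = x -> x *m rX M aan = 0 -> (x <= Uker)%MS.
Proof. by move=> h1 h2; rewrite sub_capmx -{1}h1 submxMl; apply/sub_kermxP. Qed.

Lemma Uker_in a : Qt a = iV -> (rX M a <= Uker)%MS.
Proof.
move=> e; apply: Uker_sub; first by rewrite -{2}(Xe a) e gl_i.
by case: hM => _ _ _ _; apply; apply: qrel_i.
Qed.

Lemma Uker_stab : stab Uker.
Proof.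
split=> [v|a]; first by rewrite Uker_e // scalemx_sub.
by rewrite Uker_X // sub0mx.
Qed.

(** The quotient by U is a representation of the line that vanishes at i, hence a sum of intervals.
    Lifting its basis, the arrows act as on the intervals up to errors in U. As U lives at the glued
    vertex, the errors, recorded by g, occur only along arrows into this vertex that leave the
    interval. *)
Lemma exc_basis : exists (k : nat) (T : finType) (lo hi : T -> nat)
  (u : 'I_k -> 'rV[K]_(rdim M)) (du : 'I_k -> 'cV[K]_(rdim M))
  (b : T -> V -> 'rV[K]_(rdim M)) (d : T -> V -> 'cV[K]_(rdim M)) (g : 'I_N -> T -> 'I_k -> K),
  [/\ forall t, (lo t < hi t <= N.+1)%N /\ ~~ (lo t <= m.+1 < hi t)%N,
      [/\ forall t (v : V) t' (v' : V), (lo t <= v < hi t)%N -> (lo t' <= v' < hi t')%N ->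
        b t v *m d t' v' = ((t == t') && (v == v'))%:R%:M,
      forall t (v : V) i, (lo t <= v < hi t)%N -> b t v *m du i = 0,
      forall t (v : V) i, (lo t <= v < hi t)%N -> u i *m d t v = 0,
      forall i j, u i *m du j = (i == j)%:R%:M &
      \sum_i du i *m u i + \sum_t \sum_(v : V | (lo t <= v < hi t)%N) d t v *m b t v = 1%:M],
      (forall i v, u i *m re M v = (v == None)%:R *: u i) /\ (forall i a, u i *m rX M a = 0),
      forall t (v : V) w, (lo t <= v < hi t)%N -> b t v *m re M w = (gl v == w)%:R *: b t v &
      forall t (v : V) a, (lo t <= v < hi t)%N -> b t v *m rX M a =
        if v == Qs a then (if (lo t <= Qt a < hi t)%N then b t (Qt a) else
          (gl (Qt a) == None)%:R *: \sum_i g a t i *: u i) else 0].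
Proof.
have [C [c [hc fc kc]]] := stab_quo Uker_stab.
have hC : is_rep C := rep_surj hc fc hM.
have XC0 a : Qt a = iV -> rX C a = 0.
  move=> e; apply: (row_full_inj fc); rewrite mulmx0 -hc.2.
  by apply/sub_kermxP; rewrite kc Uker_in.
(* The glued vertex of the quotient is placed at j, while i carries zero; the arrows into i act by
   zero on the quotient because their images lie in U. *)
pose C' : rep (lineQ o) K := @Rep (lineQ o) K (rdim C)
  (fun v : V => if v == iV then 0 else re C (gl v)) (fun a => rX C a).
have hC' : is_rep C'.
  case: hC => c1 c2 c3 c4 _; split=> //=.
  - by move=> v; case: ifP => _; rewrite ?mul0mx.
  - move=> v w vw; case: eqP => vi; first by rewrite mul0mx.
    case: eqP => wi; first by rewrite mulmx0.
    by apply: c2; apply: contra vw => /eqP /(gl_inj vi wi) ->.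
  - have ij : jV != iV by rewrite vE ?inordK //; lia.
    rewrite -c3 (partition_big gl predT) //=; apply: eq_bigr => w _.
    have [v [vi vw]] : exists v : V, v <> iV /\ gl v = w.
      case: w => [x|]; last by exists jV; split; [apply/eqP | apply: gl_j].
      have h := valP x; exists (val x); split; first by apply/eqP; case/andP: h.
      by rewrite (gl_in h); congr Some; apply: val_inj.
    rewrite (bigD1 v) /= ?vw // (introF eqP vi) big1 ?addr0 // => v' /andP [/eqP e /eqP ne].
    by case: eqP => // vi'; case: ne; apply: gl_inj; rewrite ?vw.
  - move=> a; rewrite -/(Qs a) -/(Qt a) (negPf (Qs_i a)); case: eqP => [e|_]; last exact: c4.
    by rewrite mulmx0 XC0.
have [T [lo [hi [b0 [d [lh [D1 D2 D3 D4]]]]]]] := line_dec hC'.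
pose S t (v : V) := (lo t <= v < hi t)%N.
have Si t : ~~ S t iV.
  apply/negP => h; have := D3 t iV iV h; rewrite /= eqxx mulmx0 scale1r => b00.
  have := D1 t iV t iV h h; rewrite -b00 mul0mx !eqxx /= => /(congr1 (fun A : 'M_1 => A 0 0)).
  by rewrite !mxE eqxx => /eqP; rewrite eq_sym oner_eq0.
have Sn t v : S t v -> v != iV by apply: contraTneq => ->; apply: Si.
have D3' t v w : S t v -> b0 t v *m re C w = (gl v == w)%:R *: b0 t v.
  move=> h; have vi := Sn _ _ h; have := D3 t v v h; rewrite /= (negPf vi) ?eqxx scale1r => e.
  rewrite -{1}e -mulmxA rep_ee //; case: eqP => _; last by rewrite mulmx0 scale0r.
  by rewrite e scale1r.
pose b1 t v := b0 t v *m pinvmx c *m re M (gl v).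
have b1c t v : S t v -> b1 t v *m c = b0 t v.
  move=> h; rewrite /b1 -mulmxA hc.1 mulmxA mulmxKpV ?submx_full // D3' // eqxx scale1r //.
have b1e t v w : b1 t v *m re M w = (gl v == w)%:R *: b1 t v.
  rewrite /b1 -!mulmxA rep_ee //; case: eqP => _; rewrite ?scale1r // !mulmx0 scale0r //.
pose ga : 'I_N := inord (m + n).+1.
have gaE : ga = (m + n).+1 :> nat by rewrite /ga inordK //; lia.
have Qtga : Qt ga = jV.
  have [_ _ _ /(_ (introT eqP gaE)) h] := o_at ga.
  by apply: val_inj; rewrite /= QtE (negPf h) gaE inordK //; lia.
have Sqs t v a : S t v -> v <> Qs a -> b0 t v *m rX C a = 0.
  by move=> h ne; have := D4 t v a h; rewrite /= -/(Qs a) (introF eqP ne) /=.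
(* If the interval contains both j and c, its vector at j is chosen as the image under gamma of the
   lift at c, which removes the error along gamma. *)
pose b t v := if (v == jV) && S t (Qs ga) then b1 t (Qs ga) *m rX M ga else b1 t v.
have be t v w : b t v *m re M w = (gl v == w)%:R *: b t v.
  rewrite /b; case: ifP => [/andP [/eqP -> _]|_]; last exact: b1e.
  by rewrite -(Xe ga) -!mulmxA rep_ee // Qtga; case: eqP => _; rewrite ?scale1r // !mulmx0 scale0r.
have bc t v : S t v -> b t v *m c = b0 t v.
  move=> h; rewrite /b; case: ifP => [/andP [/eqP ev hs]|_]; last exact: b1c.
  rewrite -mulmxA hc.2 mulmxA b1c // D4 // -/(Qs ga) -/(Qt ga) eqxx Qtga -ev.
  by rewrite -/(S t v) h.
have Uc k (x : 'M_(k, _)) : x *m c = 0 <-> (x <= Uker)%MS.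
  by split=> [/sub_kermxP|h]; [rewrite kc | apply/sub_kermxP; rewrite kc].
have c0 x (v : V) : x *m c = 0 -> x *m re M (gl v) = x -> v <> iV -> v <> jV -> x = 0 :> 'rV_(rdim M).
  move=> /Uc h e vi vj; rewrite -e Uker_e //; case: eqP => [/gl_None []//|_].
  by rewrite scale0r.
pose B := row_base Uker; pose k := \rank Uker.
have BU : (B <= Uker)%MS by rewrite eq_row_base.
have UB p (x : 'M_(p, _)) : (x <= Uker)%MS -> x *m pinvmx B *m B = x.
  by move=> h; rewrite mulmxKpV // eq_row_base.
have Br : B *m pinvmx B = 1%:M.
  by apply: (row_free_inj (row_base_free _)); rewrite mul1mx UB.
(* The projection onto U along the span of the lifted basis. *)
pose s := 1%:M - \sum_t \sum_(v | S t v) c *m d t v *m b t v : 'M_(rdim M).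
have sU : (s <= Uker)%MS.
  apply/Uc; rewrite /s mulmxBl mul1mx -[X in X - _]mulmx1 -D2 mulmx_sumr mulmx_suml.
  apply/eqP; rewrite subr_eq0; apply/eqP; apply: eq_bigr => t _.
  rewrite mulmx_sumr mulmx_suml; apply: eq_bigr => v h.
  by rewrite -[RHS]mulmxA bc // mulmxA.
have Bd t v : B *m (c *m d t v) = 0 by rewrite mulmxA (iffRL (Uc _ _) BU) mul0mx.
have Bs : B *m s = B.
  rewrite /s mulmxBr mulmx1 mulmx_sumr big1 ?subr0 // => t _.
  by rewrite mulmx_sumr big1 // => v _; rewrite mulmxA Bd mul0mx.
have bd t v t' v' : S t v -> S t' v' -> b t v *m (c *m d t' v') = ((t == t') && (v == v'))%:R%:M.
  by move=> h h'; rewrite mulmxA bc // D1.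
have bs t v : S t v -> b t v *m s = 0.
  move=> h; rewrite /s mulmxBr mulmx1; apply/eqP; rewrite subr_eq0 eq_sym; apply/eqP.
  rewrite mulmx_sumr (bigD1 t) //= [X in _ + X]big1 ?addr0; last first.
    move=> t' tt'; rewrite mulmx_sumr big1 // => v' h'; rewrite mulmxA bd //.
    by rewrite [t == _]eq_sym (negPf tt') /= raddf0 mul0mx.
  rewrite mulmx_sumr (bigD1 v) //= [X in _ + X]big1 ?addr0; last first.
    move=> v' /andP [h' vv']; rewrite mulmxA bd // eqxx /=.
    by rewrite [v == _]eq_sym (negPf vv') /= raddf0 mul0mx.
  by rewrite mulmxA bd // !eqxx mul1mx.
pose x t a := b t (Qs a) *m rX M a.
exists k, T, lo, hi, (fun i => row i B), (fun i => col i (s *m pinvmx B)), b,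
  (fun t v => c *m d t v), (fun a t i => (x t a *m pinvmx B) 0 i).
have rowU i : (row i B <= Uker)%MS by rewrite (submx_trans _ BU) ?row_sub.
split.
- by move=> t; split=> //; have := Si t; rewrite /S inordK //; lia.
- split=> //.
  + by move=> t v i h; rewrite colE !mulmxA bs // !mul0mx.
  + by move=> t v i _; rewrite -row_mul Bd row0.
  + move=> i j; apply/matrixP => p q; rewrite !ord1 !mxE.
    have := congr1 (fun A : 'M_k => A i j) Br; rewrite -{1}Bs -mulmxA !mxE eqxx mulr1n => <-.
    by apply: eq_bigr => r _; rewrite !mxE.
  + rewrite (_ : \sum_i _ = s); last first.
      rewrite -[RHS](UB _ _ sU); apply/matrixP => p q; rewrite summxE mxE.
      by apply: eq_bigr => r _; rewrite !mxE big_ord1 !mxE.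
    by rewrite /s subrK.
- by split=> [i v|i a]; [apply: Uker_e | apply: Uker_X].
- by move=> t v w _; apply: be.
move=> t v a h; case: (v =P Qs a) => [ev|ne]; last first.
  rewrite -eX mulmxA be; case: eqP => [e|_]; last by rewrite scale0r mul0mx.
  by case: ne; apply: gl_inj e; [apply/eqP/(Sn t) | apply/eqP/Qs_i].
rewrite ev -/(x t a); have xe : x t a *m re M (gl (Qt a)) = x t a by rewrite /x -mulmxA Xe.
have xc : x t a *m c = if S t (Qt a) then b0 t (Qt a) else 0.
  by rewrite /x -mulmxA hc.2 mulmxA bc -?ev // D4 // -/(Qs a) -/(Qt a) ev eqxx.
rewrite -/(S t (Qt a)); case: ifP => hS.
  have Qi : Qt a <> iV by apply/eqP/(Sn t).
  have [Qj|Qj] := eqVneq (Qt a) jV.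
    have ea : a = ga by apply: val_inj; rewrite /= gaE; apply: Qt_j.
    have hs : S t (Qs ga) by rewrite -ea -ev.
    rewrite /b Qj eqxx hs /= /x -ea /b; case: ifP => // /andP [/eqP Qsj _].
    by have := Qs_j Qsj; rewrite ea => /(congr1 val) /=; rewrite gaE inordK; lia.
  apply/eqP; rewrite -subr_eq0; apply/eqP.
  apply: (@c0 _ (Qt a)) => //; last exact/eqP.
    by rewrite mulmxBl xc hS bc // subrr.
  by rewrite mulmxBl xe be eqxx scale1r.
rewrite hS in xc; case: eqP => [e|ne].
  rewrite scale1r -[LHS](UB _ _ (iffLR (Uc _ _) xc)) {1}[_ *m pinvmx B]row_sum_delta mulmx_suml.
  by apply: eq_bigr => i _; rewrite -scalemxAl rowE.
rewrite scale0r; apply: (@c0 _ (Qt a)) => // e; apply: ne; rewrite e.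
  exact: gl_i.
exact: gl_j.
Qed.

End Reduce.
End Exc.

(** * The three arms of the exceptional algebra *)

Section ExcAtt.
Variables (n m l : nat) (o : 'I_(m + n + l).+2 -> bool).
Notation N := (m + n + l).+2.
Notation V := ('I_N.+1).
Hypothesis n1 : (0 < n)%N.
Hypotheses (ob : o (inord m)) (oa1 : ~~ o (inord m.+1)) (oan : ~~ o (inord (m + n)))
  (oc : ~~ o (inord (m + n).+1)).
Notation E := (exc_alg o).
Notation iV := (inord m.+1 : V).
Notation jV := (inord (m + n).+1 : V).
Notation gl := (@gl n m l o).
Notation Qs := (@Qs n m l o).
Notation Qt := (@Qt n m l o).

(** Arm 0 runs b, x_1, ..., x_m; arm 1 runs c, y_1, ..., y_l; arm 2 runs a_1, ..., a_(n-1), j, c,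
    y_1, ..., y_l. Position k of arm 1 is thus position n + k of arm 2, and position n - 1 of arm 2
    is the glued vertex itself. *)
Definition posn (r k : nat) : nat :=
  match r with 0 => m - k | 1 => (m + n).+2 + k | _ => m.+2 + k end.
Definition pos r k : V := inord (posn r k).
Definition exl (r : nat) : nat := match r with 0 => m.+1 | 1 => l.+1 | _ => (n + l).+1 end.
Definition exat (r : nat) : 'I_N := inord (match r with 0 => m | 1 => (m + n).+1 | _ => m.+1 end).
Definition exed (r k : nat) : 'I_N :=
  inord (match r with 0 => m - k.+1 | 1 => (m + n).+2 + k | _ => m.+2 + k end).
Definition exdir (r k : nat) : bool := if r is 0 then ~~ o (exed r k) else o (exed r k).

Definition excD : attq E := @AttQ E (fun r => exl r) (fun r k => gl (pos r k)) None
  (fun r => exat r) (fun r k => exed r k) (fun r k => exdir r k).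

Lemma posE r k : (k < exl r)%N -> pos r k = posn r k :> nat.
Proof. by rewrite /pos; case: r => [|[|r]] /= h; rewrite inordK //; lia. Qed.

Lemma exedE r k : (k.+1 < exl r)%N -> exed r k =
  (match r with 0 => m - k.+1 | 1 => (m + n).+2 + k | _ => m.+2 + k end)%N :> nat.
Proof. by rewrite /exed; case: r => [|[|r]] /= h; rewrite inordK //; lia. Qed.

Lemma exatE r : exat r = (match r with 0 => m | 1 => (m + n).+1 | _ => m.+1 end)%N :> nat.
Proof. by rewrite /exat; case: r => [|[|r]] /=; rewrite inordK //; lia. Qed.

Lemma exat_o r : o (exat r) = (r == 0%N).
Proof. by rewrite /exat; case: r => [|[|r]] /=; rewrite ?(negPf oa1) ?(negPf oc). Qed.

Lemma Qs_at r : Qs (exat r) = pos r 0.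
Proof.
apply: val_inj; rewrite /= (QsE n1 ob oa1 oan oc) exat_o exatE posE; last by case: r => [|[|r]].
by case: r => [|[|r]] /=; lia.
Qed.

Lemma Qt_at r : Qt (exat r) = if r == 1%N then jV else iV.
Proof.
apply: val_inj; rewrite /= (QtE n1 ob oa1 oan oc) exat_o exatE.
by case: r => [|[|r]] /=; rewrite inordK //; lia.
Qed.

Lemma Qs_ed r k : (k.+1 < exl r)%N -> Qs (exed r k) = pos r (if exdir r k then k else k.+1).
Proof.
move=> h; apply: val_inj; rewrite /= (QsE n1 ob oa1 oan oc) exedE // posE; last by case: ifP => _; lia.
by case: r h => [|[|r]] /= h; rewrite /exdir; case: (o _) => /=; lia.
Qed.

Lemma Qt_ed r k : (k.+1 < exl r)%N -> Qt (exed r k) = pos r (if exdir r k then k.+1 else k).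
Proof.
move=> h; apply: val_inj; rewrite /= (QtE n1 ob oa1 oan oc) exedE // posE; last by case: ifP => _; lia.
by case: r h => [|[|r]] /= h; rewrite /exdir; case: (o _) => /=; lia.
Qed.

Lemma gl_at r : gl (Qt (exat r)) = None.
Proof. by rewrite Qt_at; case: ifP => _; [apply: gl_j | apply: gl_i]. Qed.

Lemma pos_i r k : (k < exl r)%N -> pos r k != iV.
Proof.
move=> h; rewrite vE ?posE //; last by lia.
by case: r h => [|[|r]] /= h; lia.
Qed.

Lemma src_cases r k a : (k < exl r)%N -> Qs a = pos r k ->
  [\/ k = 0%N /\ a = exat r, [/\ a = exed r k, exdir r k & (k.+1 < exl r)%N] |
      [/\ (0 < k)%N, a = exed r k.-1 & ~~ exdir r k.-1]].
Proof.
move=> h /(congr1 (@nat_of_ord _)); rewrite (QsE n1 ob oa1 oan oc) posE //.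
have la := ltn_ord a; have [h1 h2 h3 h4] := o_at n1 ob oa1 oan oc a.
case: (posnP k) => k0.
  case oA : (o a) => e.
    case: r h e => [|[|r]] /= h e.
    - apply: Or31; split=> //; apply: val_inj; rewrite /= exatE; lia.
    - have lt : (k.+1 < l.+1)%N by lia.
      have ea : a = exed 1 k by apply: val_inj; rewrite /= exedE //=; lia.
      by apply: Or32; split=> //; rewrite /exdir -ea.
    - have lt : (k.+1 < (n + l).+1)%N by lia.
      have ea : a = exed r.+2 k by apply: val_inj; rewrite /= exedE //=; lia.
      by apply: Or32; split=> //; rewrite /exdir -ea.
  case: r h e => [|[|r]] /= h e.
  - have lt : (k.+1 < m.+1)%N by lia.
    have ea : a = exed 0 k by apply: val_inj; rewrite /= exedE //=; lia.
    by apply: Or32; split=> //; rewrite /exdir -ea oA.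
  - by apply: Or31; split=> //; apply: val_inj; rewrite /= exatE; lia.
  - by apply: Or31; split=> //; apply: val_inj; rewrite /= exatE; lia.
have lt' : (k.-1.+1 < exl r)%N by rewrite prednK.
case oA : (o a) => e.
  case: r h e lt' => [|[|r]] /= h e lt'.
  - have ea : a = exed 0 k.-1 by apply: val_inj; rewrite /= exedE //=; lia.
    by apply: Or33; split=> //; rewrite /exdir -ea oA.
  - have lt : (k.+1 < l.+1)%N by lia.
    have ea : a = exed 1 k by apply: val_inj; rewrite /= exedE //=; lia.
    by apply: Or32; split=> //; rewrite /exdir -ea.
  - have lt : (k.+1 < (n + l).+1)%N by lia.
    have ea : a = exed r.+2 k by apply: val_inj; rewrite /= exedE //=; lia.
    by apply: Or32; split=> //; rewrite /exdir -ea.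
case: r h e lt' => [|[|r]] /= h e lt'.
- have lt : (k.+1 < m.+1)%N by lia.
  have ea : a = exed 0 k by apply: val_inj; rewrite /= exedE //=; lia.
  by apply: Or32; split=> //; rewrite /exdir -ea oA.
- have ea : a = exed 1 k.-1 by apply: val_inj; rewrite /= exedE //=; lia.
  by apply: Or33; split=> //; rewrite /exdir -ea oA.
- have ea : a = exed r.+2 k.-1 by apply: val_inj; rewrite /= exedE //=; lia.
  by apply: Or33; split=> //; rewrite /exdir -ea oA.
Qed.

Lemma exed_inj r k k' : (k.+1 < exl r)%N -> (k'.+1 < exl r)%N -> exed r k = exed r k' -> k = k'.
Proof.
move=> h h' /(congr1 (@nat_of_ord _)); rewrite !exedE //.
by case: r h h' => [|[|r]] /=; lia.
Qed.

Lemma exat_ed r k : (k.+1 < exl r)%N -> exat r <> exed r k.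
Proof.
move=> h /(congr1 (@nat_of_ord _)); rewrite exedE // exatE.
by case: r h => [|[|r]] /=; lia.
Qed.

Lemma exc_ok : attq_ok excD.
Proof.
have nr r k a : (k.+1 < exl r)%N -> ~~ @qrel E a (exed r k).
  move=> h; apply/negP => /or3P [//|/andP [/eqP e _]|/andP [_ /eqP e]].
    by have := Qs_i n1 ob oa1 oan oc a; rewrite /Qs e eqxx.
  have h' : ((if exdir r k then k.+1 else k) < exl r)%N by case: ifP => _; lia.
  by have := pos_i h'; rewrite -Qt_ed // /Qt e eqxx.
split=> /=.
- by case=> [[|[|[|r]]] hr].
- by move=> r; congr (gl _); apply: Qs_at.
- by move=> r; apply: gl_at.
- by move=> r k h; have e := f_equal gl (Qs_ed h); rewrite (fun_if (pos r)) (fun_if gl) in e; exact: e.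
- by move=> r k h; have e := f_equal gl (Qt_ed h); rewrite (fun_if (pos r)) (fun_if gl) in e; exact: e.
- by move=> r k h _ _; apply: nr; lia.
- by move=> r k h _ _; apply: nr; lia.
- by move=> r h _; apply: nr.
- by move=> r k k' h h' e; apply: (exed_inj h h' e).
- by move=> r k h; apply: exat_ed.
- move=> r r' /(congr1 (@nat_of_ord _)); rewrite !exatE => e; apply: val_inj; move: e.
  by case: r => [[|[|[|r]]] hr]; case: r' => [[|[|[|r']]] hr'] //=; lia.
Qed.

Definition ethin (K : fieldType) lo hi : rep E K := @Rep E K #|@itv N lo hi|
  (fun v => fmx (fun x y : @itv N lo hi => ((x == y) && (gl (val x) == v))%:R))
  (fun a => fmx (fun x y : @itv N lo hi => ((val x == Qs a) && (val y == Qt a))%:R)).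

(** The interval ends at the source of beta, alpha_1 or gamma while this arrow leaves it, so the
    interval may be attached to U. *)
Definition attd lo hi := [|| hi == m.+1, lo == m.+2 | lo == (m + n).+2].

Lemma unattached lo hi a : (lo < hi <= N.+1)%N -> ~~ (lo <= m.+1 < hi)%N -> ~~ attd lo hi ->
  (lo <= Qs a < hi)%N -> ~~ (lo <= Qt a < hi)%N -> gl (Qt a) == None = false.
Proof.
move=> lh ni na hs ht; apply/eqP => /gl_None; have [h1 h2 h3 h4] := o_at n1 ob oa1 oan oc a.
move: na hs ht; rewrite /attd (QsE n1 ob oa1 oan oc) (QtE n1 ob oa1 oan oc) => na hs ht [e|e].
  case/orP: (Qt_i n1 ob oa1 oan oc e) => /eqP ea; move: hs ht.
    by rewrite h1 ea ?eqxx //; lia.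
  by rewrite (negPf (h2 _)) ea ?eqxx //; lia.
have ea := Qt_j n1 ob oa1 oan oc e; move: hs ht.
by rewrite (negPf (h4 _)) ea ?eqxx //; lia.
Qed.

(** An interval that is not attached splits off as a direct summand, so it is all of an
    indecomposable M. Otherwise each interval starts at one of the three attaching arrows and M is
    given by labelled vectors in U. *)
Lemma exc_dec (K : closedFieldType) (M : rep E K) : is_rep M -> indec M ->
  (exists lo hi, (lo < hi <= N.+1)%N /\ rep_iso M (ethin K lo hi)) \/
  (exists O, mok excD O /\ rep_iso M (att excD O)).
Proof.
move=> hM iM.
have [k [T [lo [hi [u [du [b [d [g [lh [D1 D2 D3 D4 D5] [U1 U2] B1 B2]]]]]]]]]] := exc_basis n1 ob oa1 oan oc hM.
pose S t (v : V) := (lo t <= v < hi t)%N.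
have B2' t v a : S t v -> v <> Qs a -> b t v *m rX M a = 0.
  by move=> h ne; rewrite B2 // (introF eqP ne).
case: (classic (exists t, ~~ attd (lo t) (hi t))) => [[t na]|all]; [left|right].
  (* P is the projection onto the span of the interval t. It is an endomorphism, since no error term
     starts in t and P kills all errors from other intervals. *)
  have [P PE] : exists P : 'M_(rdim M), P = \sum_(v : V | S t v) d t v *m b t v by eexists.
  have bP t' v : S t' v -> b t' v *m P = if t' == t then b t' v else 0.
    move=> h; rewrite PE mulmx_sumr; case: eqP => [e|ne]; last first.
      by rewrite big1 // => w hw; rewrite mulmxA D1 // (introF eqP ne) raddf0 mul0mx.
    subst t'; rewrite (bigD1 v) //= big1 ?addr0 ?mulmxA ?D1 ?eqxx ?mul1mx //.
    move=> w /andP [hw wv]; rewrite mulmxA D1 // eqxx [v == _]eq_sym (negPf wv) raddf0 mul0mx //.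
  have uP i : u i *m P = 0.
    by rewrite PE mulmx_sumr big1 // => v h; rewrite mulmxA D3 // mul0mx.
  have B3 v a : S t v -> b t v *m rX M a = if (v == Qs a) && S t (Qt a) then b t (Qt a) else 0.
    move=> h; rewrite B2 //; case: eqP => //= e; rewrite -/(S t (Qt a)); case: ifP => // hn.
    have [l1 l2] := lh t; rewrite (unattached l1 l2 na) ?scale0r //; first by rewrite -e.
    by rewrite -/(S t _) hn.
  have comm A : (forall i, u i *m A *m P = 0) ->
      (forall t' v, S t' v -> b t' v *m A *m P = b t' v *m P *m A) -> A *m P = P *m A.
    move=> c1 c2; rewrite -[LHS]mul1mx -[RHS]mul1mx -D5 !mulmxDl !mulmx_suml; congr (_ + _).
      by apply: eq_bigr => i _; rewrite -!mulmxA (mulmxA _ A) c1 (mulmxA (u i)) uP !mul0mx.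
    apply: eq_bigr => t' _; rewrite !mulmx_suml; apply: eq_bigr => v h.
    by rewrite -!mulmxA (mulmxA _ A) c2 // -mulmxA.
  have hP : hom M M P.
    split=> [w|a]; apply: comm.
    - by move=> i; rewrite U1 -scalemxAl uP scaler0.
    - move=> t' v h; rewrite B1 // -scalemxAl bP //; case: ifP => _; last by rewrite mul0mx scaler0.
      by rewrite B1.
    - by move=> i; rewrite U2 mul0mx.
    - move=> t' v h; rewrite bP //; case: (t' =P t) => [e|ne].
        subst t'; rewrite B3 //; case: ifP => [/andP [_ h']|_]; last by rewrite mul0mx.
        by rewrite bP // eqxx.
      rewrite mul0mx B2 //; case: eqP => _; last by rewrite mul0mx.
      case: ifP => h'; first by rewrite bP // (introF eqP ne).
      by rewrite -scalemxAl mulmx_suml big1 ?scaler0 // => i _; rewrite -scalemxAl uP scaler0.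
  have PP : P *m P = P.
    by rewrite {1}PE mulmx_suml [RHS]PE; apply: eq_bigr => v h; rewrite -mulmxA bP // eqxx.
  have [l1 _] := lh t; have loN : (lo t < N.+1)%N by lia.
  have s0 : S t (Ordinal loN) by rewrite /S /=; lia.
  have P1 : P = 1%:M.
    case: (iM.2 _ hP PP) => // P0; have := D1 t _ t _ s0 s0.
    have := bP t _ s0; rewrite P0 mulmx0 eqxx => <-; rewrite mul0mx !eqxx => /(congr1 (fun A : 'M_1 => A 0 0)).
    by rewrite !mxE eqxx => /eqP; rewrite eq_sym oner_eq0.
  exists (lo t), (hi t); split=> //.
  pose it := @itv N (lo t) (hi t).
  have Sx (x : it) : S t (sval x) := valP x.
  apply: (@basis_iso E K M it (fun x => b t (val x)) (fun x => d t (val x))).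
  - by move=> x y; rewrite D1 ?(valP x) ?(valP y) // eqxx (inj_eq val_inj).
  - rewrite -P1 PE [RHS](reindex_omap (val : it -> V) insub) /=; last by move=> v h; rewrite insubT.
    by apply: eq_big => [x|x _] //; rewrite -[sval x]/(val x) valK eqxx andbT; apply/esym; exact: (valP x).
  - move=> x w; rewrite (B1 _ _ _ (Sx x)) (bigD1 x) //= eqxx big1 ?addr0 // => y yx.
    by rewrite eq_sym (negPf yx) scale0r.
  - move=> x a; rewrite (B3 _ _ (Sx x)); case: (sval x =P Qs a) => e /=; last first.
      by rewrite big1 // => y _; rewrite scale0r.
    case: ifP => h.
      rewrite (bigD1 (exist _ (Qt a) h : it)) //= eqxx scale1r big1 ?addr0 // => y.
      by rewrite -(inj_eq val_inj) /= => /negPf ->; rewrite scale0r.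
    rewrite big1 // => y _; case: eqP => [ey|_]; last by rewrite scale0r.
    by have := valP y; rewrite /= ey -/(S t (Qt a)) h.
pose rm t : 'I_3 := if hi t == m.+1 then inord 0 else if lo t == m.+2 then inord 2 else inord 1.
have rmP t : [/\ (hi t - lo t <= exl (rm t))%N,
    forall j, (j < hi t - lo t)%N -> S t (pos (rm t) j) &
    forall v, S t v -> exists2 j, (j < hi t - lo t)%N & v = pos (rm t) j].
  have [l1 l2] := lh t.
  have at_ : attd (lo t) (hi t) by apply/negPn/negP => h; apply: all; exists t.
  have ll : (hi t - lo t <= exl (rm t))%N.
    rewrite /rm; case: eqP => e1; first by rewrite inordK //= e1; lia.
    case: eqP => e2; first by rewrite inordK //= e2; lia.
    by move: at_; rewrite inordK /attd //=; lia.
  split=> // [j hj|v hv].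
    rewrite /S posE; last by lia.
    rewrite /rm; case: eqP => e1; first by rewrite inordK //= e1; lia.
    case: eqP => e2; first by rewrite inordK //= e2; lia.
    by move: at_; rewrite inordK /attd //=; lia.
  have [j hj e] : exists2 j, (j < hi t - lo t)%N & v = posn (rm t) j :> nat.
    move: hv; rewrite /S /rm; case: eqP => e1; first by rewrite inordK //= => hv; exists (m - v)%N; lia.
    case: eqP => e2; first by rewrite inordK //= => hv; exists (v - m.+2)%N; lia.
    by rewrite inordK //= => hv; exists (v - (m + n).+2)%N; move: at_; rewrite /attd; lia.
  by exists j => //; apply: val_inj; rewrite /= posE //; lia.
pose O : mobj K := @MObj K 'I_k T rm (fun t => hi t - lo t)%N (fun t i => g (exat (rm t)) t i).
have mO : mok excD O.
  move=> t; have [h _ _] := rmP t; have [l1 _] := lh t; apply/andP; split=> //=; lia.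
exists O; split=> //.
have okp t j : (j < hi t - lo t)%N -> (j < exl (rm t))%N.
  by have [h _ _] := rmP t; move=> hj; apply: leq_trans hj h.
have Sp t j : (j < hi t - lo t)%N -> S t (pos (rm t) j) by have [_ h _] := rmP t; apply: h.
have pinj t j j' : (j < hi t - lo t)%N -> (j' < hi t - lo t)%N -> pos (rm t) j = pos (rm t) j' -> j = j'.
  move=> /okp h /okp h' /(congr1 (@nat_of_ord _)); rewrite !posE //.
  by case: (nat_of_ord (rm t)) h h' => [|[|r]] /=; lia.
pose b' (y : ix O) := match y with inl i => u i | inr c => b (tag c) (pos (rm (tag c)) (tagged c)) end.
pose d' (y : ix O) := match y with inl i => du i | inr c => d (tag c) (pos (rm (tag c)) (tagged c)) end.
apply: (@basis_iso E K M (ix O) b' d').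
- case=> [i|[t j]] [i'|[t' j']] //=.
  + by rewrite D3 ?raddf0 //; apply: Sp.
  + by rewrite D2 ?raddf0 //; apply: Sp.
  rewrite (D1 _ _ _ _ (Sp _ _ (ltn_ord j)) (Sp _ _ (ltn_ord j'))).
  rewrite [X in _ = (nat_of_bool X)%:R%:M](_ : _ = (t == t') && (pos (rm t) j == pos (rm t') j')) //.
  apply/eqP/andP => [e|[/eqP e]].
    pose f (y : ix O) := if y is inr c then (tag c, pos (rm (tag c)) (tagged c)) else (t, pos 0 0).
    by split; apply/eqP; [exact: (f_equal (fst \o f) e) | exact: (f_equal (snd \o f) e)].
  subst t' => /eqP /pinj e.
  by have -> : j = j' by apply: val_inj; apply: e.
- rewrite big_sumType /= -[RHS]D5; congr (_ + _).
  transitivity (\sum_t \sum_(j < hi t - lo t) d t (pos (rm t) j) *m b t (pos (rm t) j)).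
    by rewrite [RHS]sig_big_dep /=; apply: eq_bigr => [[t j]].
  apply: eq_bigr => t _.
  have [_ _ sur] := rmP t.
  rewrite [RHS](reindex_omap (fun j : 'I_(hi t - lo t) => pos (rm t) j)
    (fun v => [pick j : 'I_(hi t - lo t) | pos (rm t) j == v])) /=; last first.
    move=> v /sur [j hj ->]; case: pickP => [j' /eqP e|/(_ (Ordinal hj))] /=; last by rewrite eqxx.
    by rewrite e.
  apply: eq_bigl => j; rewrite -/(S t _) Sp //; case: pickP => [j' /eqP e|/(_ j)]; last by rewrite eqxx.
  by apply/esym/eqP; congr Some; apply: val_inj; apply: pinj e => /=.
- case=> [i|[t j]] w /=.
    rewrite U1 (bigD1 (inl i)) //= /atte eqxx /= [None == _]eq_sym big1 ?addr0 // => y yx.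
    by rewrite eq_sym (negPf yx) scale0r.
  rewrite B1; last exact: Sp.
  rewrite (bigD1 (mkc j)) //= /atte eqxx /= big1 ?addr0 // => y yx.
  by rewrite [_ == y]eq_sym (negPf yx) scale0r.
case=> [i|[t j]] a /=; first by rewrite U2 big1 // => y _; rewrite scale0r.
apply/rowP => p; rewrite summxE.
transitivity (\sum_y attX excD a (mkc (j : 'I_(@mn _ O t))) y * b' y 0 p); last first.
  by apply: eq_bigr => y _; rewrite mxE.
rewrite (attX_row excD a (j : 'I_(@mn _ O t)) (fun y => b' y 0 p)).
have lj := ltn_ord j.
have fb q : (q < hi t - lo t)%N -> fget (fun y : ix O => b' y 0 p) t q = b t (pos (rm t) q) 0 p.
  by move=> h; rewrite -[q]/(val (Ordinal h)) (@fget_in _ O).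
have [_ _ _ _ _ _ _ _ einj ated _] := exc_ok.
have le q : (q < hi t - lo t)%N -> (q < al excD (rm t))%N := okp t q.
case: (pos (rm t) j =P Qs a) => [e|ne].
  case: (src_cases (okp _ _ lj) (esym e)) => [[j0 ea]|[ea dj jl]|[j0 ea dj]].
  - rewrite (B2 _ _ _ (Sp _ _ lj)) e eqxx ifF; last first.
      rewrite -/(S t (Qt a)) ea Qt_at; apply/negP; rewrite /S; have [_ l2] := lh t.
      case: ifP => r1; last by rewrite inordK ?(negPf l2) //; lia.
      rewrite inordK; last by lia.
      move: (rmP t) => [_ h _]; have /= := h 0%N (leq_ltn_trans (leq0n _) lj).
      rewrite /S posE; last by apply: okp; apply: leq_ltn_trans lj.
      move: r1; rewrite /rm; case: (hi t =P m.+1) => e1; first by rewrite inordK.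
      case: (lo t =P m.+2) => e2; first by rewrite inordK.
      rewrite inordK //= => _; have : attd (lo t) (hi t) by apply/negPn/negP => h'; apply: all; exists t.
      by rewrite /attd; lia.
    rewrite ea gl_at eqxx scale1r summxE /= eqxx j0 /= mul1r mul0r addr0.
    have -> : (exdir (rm t) 0 && (exed (rm t) 0 == exat (rm t)))%:R * fget (fun y : ix O => b' y 0 p) t 1 = 0.
      have [h|h] := ltnP 1 (hi t - lo t); last by rewrite (@fget_out _ O) ?mulr0.
      by rewrite [_ == exat _]eq_sym (introF eqP (ated (rm t) 0%N (le _ h))) andbF mul0r.
    by rewrite addr0; apply: eq_bigr => i _; rewrite mxE.
  - rewrite (B2 _ _ _ (Sp _ _ lj)) e eqxx ea /= eqxx (introF eqP (ated (rm t) j jl)) andbF mul0r add0r dj mul1r.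
    rewrite [X in _ + X](_ : _ = 0) ?addr0; last first.
      case: (posnP j) => j0; first by rewrite mul0r.
      case: eqP => [e'|_]; last by rewrite andbF mul0r.
      by have := einj (rm t) j.-1 j _ jl e'; rewrite prednK // => /(_ (le _ lj)); move: j0; clear; move: (nat_of_ord j) => q; lia.
    have qt : Qt (exed (rm t) j) = pos (rm t) j.+1 by rewrite Qt_ed // dj.
    rewrite qt; have [h|h] := ltnP j.+1 (hi t - lo t).
      by rewrite -/(S t _) Sp // fb.
    rewrite (@fget_out _ O) // ifF; last first.
      apply/negP => hs; have [_ _ sur] := rmP t; have [q hq eq_] := sur _ hs.
      move: eq_ => /(congr1 (@nat_of_ord _)); rewrite (posE jl) (posE (okp _ _ hq)).
      have qj : (q < j.+1)%N := leq_trans hq h.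
      move: jl (okp _ _ hq) qj; move: (nat_of_ord (rm t)) (nat_of_ord j) => r j0; clear.
      by case: r => [|[|r]] /=; lia.
    rewrite -qt -ea; case: eqP => [/gl_None|_]; last by rewrite scale0r mxE.
    have oe : if nat_of_ord (rm t) is 0%N then ~~ o a else o a by rewrite ea; move: dj; rewrite /exdir; case: (nat_of_ord (rm t)).
    have va := exedE jl; rewrite -ea in va.
    case=> e'; [have /orP v' := Qt_i n1 ob oa1 oan oc e' | have v' := Qt_j n1 ob oa1 oan oc e'].
      by exfalso; move: jl va; case: (nat_of_ord (rm t)) => [|[|r]] /=; case: v' => /eqP -> //=; lia.
    exfalso; have [_ _ _ h4] := o_at n1 ob oa1 oan oc a; move: jl va oe; rewrite v' (negPf (h4 _)) ?v' //.
    by case: (nat_of_ord (rm t)) => [|[|r]] //=; lia.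
  - have jl : (j.-1.+1 < exl (rm t))%N by rewrite prednK // le.
    have qt : Qt (exed (rm t) j.-1) = pos (rm t) j.-1 by rewrite Qt_ed // (negPf dj).
    have hj : (j.-1 < hi t - lo t)%N by apply: leq_ltn_trans lj; rewrite leq_pred.
    rewrite (B2 _ _ _ (Sp _ _ lj)) e eqxx ea qt -/(S t _) Sp // /= (gtn_eqF j0) mul0r add0r eqxx j0 dj mul1r (fb _ hj).
    have [h|h] := ltnP j.+1 (hi t - lo t); last by rewrite (@fget_out _ O) ?mulr0 ?add0r.
    case: eqP => [e'|_]; last by rewrite andbF mul0r add0r.
    by have := einj (rm t) j j.-1 (le _ h) jl e'; move: j0; clear; move: (nat_of_ord j) => q; lia.
rewrite (B2' _ _ _ (Sp _ _ lj) ne) mxE /= [X in X * _](_ : _ = 0) ?mul0r ?add0r; last first.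
  case: eqP => // j0; case: eqP => // ea; case: ne; rewrite -ea Qs_at j0 //.
rewrite [X in X + _](_ : _ = 0) ?add0r; last first.
  have [h|h] := ltnP j.+1 (hi t - lo t); last by rewrite (@fget_out _ O) ?mulr0.
  case: (boolP (exdir _ _)) => dj; last by rewrite mul0r.
  case: eqP => [ea|_]; last by rewrite mul0r.
  by case: ne; rewrite -ea Qs_ed ?dj //; apply: le.
case: (posnP j) => j0; first by rewrite mul0r.
case: (boolP (exdir _ _)) => dj; first by rewrite mul0r.
case: eqP => [ea|_]; last by rewrite mul0r.
by case: ne; rewrite -ea Qs_ed ?(negPf dj) prednK //; apply: le.
Qed.

End ExcAtt.

(** * The quadratic form of a star *)

Lemma sum_option (V : nmodType) (A : finType) (F : option A -> V) :
  \sum_v F v = F None + \sum_a F (Some a).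
Proof.
rewrite (bigD1 None) //=; congr (_ + _).
by rewrite (reindex_omap Some id) //=; [apply: eq_bigl => a; rewrite eqxx | case].
Qed.

(** Completion of squares along an arm, starting at its tip; a multiple of the last square remains,
    to be absorbed by the centre. *)
Lemma arm_sq (y : nat -> rat) n :
  \sum_(i < n) (y i.+1 ^+ 2 - y i.+1 * y i.+2) =
  \sum_(i < n) (i.+2%:R / (2 * i.+1%:R)) * (y i.+1 - i.+1%:R / i.+2%:R * y i.+2) ^+ 2 -
  n%:R / (2 * n.+1%:R) * y n.+1 ^+ 2.
Proof.
elim: n => [|n IH]; first by rewrite !big_ord0 !mul0r subr0.
rewrite !big_ord_recr /= IH.
have e : forall (S A B N : rat), N + 1 != 0 -> N + 1 + 1 != 0 ->
  S - N / (2 * (N + 1)) * A ^+ 2 + (A ^+ 2 - A * B) =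
  S + (N + 1 + 1) / (2 * (N + 1)) * (A - (N + 1) / (N + 1 + 1) * B) ^+ 2 -
  (N + 1) / (2 * (N + 1 + 1)) * B ^+ 2.
  by move=> S A B N h1 h2; field; rewrite h1 h2.
by rewrite -!natr1 e // !natr1 pnatr_eq0.
Qed.

Section StarForm.
Variable la : 'I_3 -> nat.
Notation Q := (starQ la).

(** The arm is read from its tip, which has index 1; index [la r] + 2 is the centre, which is also
    the default value. *)
Definition ya (x : qV Q -> int) (r : 'I_3) (j : nat) : int :=
  if (0 < j <= (la r).+1)%N
  then x (Some (@Tagged _ r (fun r => 'I_(la r).+1) (inord ((la r).+1 - j)))) else x None.

Lemma star_eul (x : qV Q -> int) : eul x x = x None ^+ 2 +
  \sum_r \sum_(i < (la r).+1) (ya x r i.+1 ^+ 2 - ya x r i.+1 * ya x r i.+2).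
Proof.
rewrite /eul sum_option -addrA -sumrB sig_big_dep /=; congr (_ + _).
rewrite -(sig_big_dep xpredT (fun _ => xpredT)
  (fun r (k : 'I_(la r).+1) => ya x r k.+1 ^+ 2 - ya x r k.+1 * ya x r k.+2)) /=.
rewrite (eq_bigr (fun a : {r : 'I_3 & 'I_(la r).+1} => (fun r (k : 'I_(la r).+1) =>
  x (Some (Tagged (fun r => 'I_(la r).+1) k)) * x (Some (Tagged (fun r => 'I_(la r).+1) k)) -
  x (Some (Tagged (fun r => 'I_(la r).+1) k)) * x (qt (b := Q) (Tagged (fun r => 'I_(la r).+1) k))) (tag a) (tagged a))); last first.
  by case.
rewrite -(sig_big_dep xpredT (fun _ => xpredT) (fun r (k : 'I_(la r).+1) =>
  x (Some (Tagged (fun r => 'I_(la r).+1) k)) * x (Some (Tagged (fun r => 'I_(la r).+1) k)) -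
  x (Some (Tagged (fun r => 'I_(la r).+1) k)) * x (qt (b := Q) (Tagged (fun r => 'I_(la r).+1) k)))) /=.
apply: eq_bigr => r _; rewrite (reindex_inj rev_ord_inj) /=; apply: eq_bigr => k _.
have lk := ltn_ord k.
have e1 : ya x r k.+1 = x (Some (Tagged (fun r => 'I_(la r).+1) (rev_ord k))).
  rewrite /ya lk /=; congr (x (Some _)); congr (Tagged _ _).
  by apply: val_inj; rewrite /= inordK // subSS ltnS leq_subr.
rewrite -e1 -expr2; congr (_ - _ * _); rewrite /ya /=.
case: ifP => [/eqP h|h]; first by rewrite ifF //; lia.
rewrite ifT; last by lia.
congr (x (Some _)); congr (Tagged _ _); congr (inord _); lia.
Qed.

(** The classical quantity 1/p + 1/q + 1/r - 1, halved, where p, q, r count the vertices of the arms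
    together with the centre. It is what remains of the coefficient of the centre after the squares
    on the arms are completed. *)
Definition cst : rat := (\sum_r (la r).+2%:R^-1 - 1) / 2.

Lemma star_form (x : qV Q -> int) : (eul x x)%:~R = cst * (x None)%:~R ^+ 2 +
  \sum_r \sum_(i < (la r).+1) (i.+2%:R / (2 * i.+1%:R)) *
     ((ya x r i.+1)%:~R - i.+1%:R / i.+2%:R * (ya x r i.+2)%:~R) ^+ 2 :> rat.
Proof.
rewrite star_eul rmorphD rmorphXn rmorph_sum /=.
have e r : (\sum_(i < (la r).+1) (ya x r i.+1 ^+ 2 - ya x r i.+1 * ya x r i.+2))%:~R =
  \sum_(i < (la r).+1) (i.+2%:R / (2 * i.+1%:R)) *
     ((ya x r i.+1)%:~R - i.+1%:R / i.+2%:R * (ya x r i.+2)%:~R) ^+ 2 -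
  (la r).+1%:R / (2 * (la r).+2%:R) * (x None)%:~R ^+ 2 :> rat.
  rewrite rmorph_sum /= (_ : (x None)%:~R = (ya x r (la r).+2)%:~R :> rat); last first.
    by rewrite /ya ltnn.
  rewrite -(arm_sq (fun j => (ya x r j)%:~R)); apply: eq_bigr => i _.
  by rewrite rmorphB rmorphXn rmorphM.
have e' r : (la r).+1%:R / (2 * (la r).+2%:R) = 2^-1 - (la r).+2%:R^-1 / 2 :> rat.
  have E (N : rat) : N + 1 != 0 -> N / (2 * (N + 1)) = 2^-1 - (N + 1)^-1 / 2 by move=> h; field.
  by rewrite -[(la r).+2%:R]natr1 E // natr1 pnatr_eq0.
rewrite (eq_bigr _ (fun r _ => e r)) sumrB -mulr_suml (eq_bigr _ (fun r _ => e' r)) sumrB.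
rewrite sumr_const card_ord -mulr_suml /cst.
set A := (\sum_r \sum_(i < _) _); set B := \sum_r _; by field.
Qed.

Lemma sq_nonneg (x : qV Q -> int) r (i : nat) : 0 <= (i.+2%:R / (2 * i.+1%:R)) *
     ((ya x r i.+1)%:~R - i.+1%:R / i.+2%:R * (ya x r i.+2)%:~R) ^+ 2 :> rat.
Proof. by rewrite mulr_ge0 ?sqr_ge0 // divr_ge0 ?mulr_ge0 ?ler0n. Qed.

Lemma sq_sum_nonneg (x : qV Q -> int) : 0 <= \sum_r \sum_(i < (la r).+1) (i.+2%:R / (2 * i.+1%:R)) *
     ((ya x r i.+1)%:~R - i.+1%:R / i.+2%:R * (ya x r i.+2)%:~R) ^+ 2 :> rat.
Proof. by apply: sumr_ge0 => r _; apply: sumr_ge0 => i _; apply: sq_nonneg. Qed.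

Lemma star_sq_bound (x : qV Q -> int) r (i : nat) : (i < (la r).+1)%N ->
  (i.+2%:R / (2 * i.+1%:R)) *
     ((ya x r i.+1)%:~R - i.+1%:R / i.+2%:R * (ya x r i.+2)%:~R) ^+ 2 <=
  (eul x x)%:~R - cst * (x None)%:~R ^+ 2 :> rat.
Proof.
move=> hi; rewrite star_form (addrC (cst * _)) addrK (bigD1 r) //= (bigD1 (Ordinal hi)) //= -addrA lerDl.
rewrite addr_ge0 //; first by apply: sumr_ge0 => j _; apply: sq_nonneg.
by apply: sumr_ge0 => r' _; apply: sumr_ge0 => j _; apply: sq_nonneg.
Qed.

Lemma star_psd (x : qV Q -> int) : 0 <= cst -> 0 <= eul x x.
Proof.
move=> c0; rewrite -(ler0z rat) star_form addr_ge0 ?sq_sum_nonneg //.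
by rewrite mulr_ge0 // sqr_ge0.
Qed.

(** All completed squares vanish, so the vector is linear along the arm, counted from the tip. *)
Lemma star_zero_arm (x : qV Q -> int) r : 0 <= cst -> eul x x = 0 -> forall i, (i <= (la r).+1)%N ->
  (i.+1%:Z * ya x r 1 = ya x r i.+1)%R.
Proof.
move=> c0 q0; elim=> [|i IH] hi; first by rewrite mul1r.
have := star_sq_bound x (r := r) hi; rewrite q0 sub0r => h.
have h2 : (i.+2%:R / (2 * i.+1%:R)) * ((ya x r i.+1)%:~R - i.+1%:R / i.+2%:R * (ya x r i.+2)%:~R) ^+ 2 = 0 :> rat.
  apply/eqP; rewrite eq_le sq_nonneg andbT; apply: le_trans h _.
  by rewrite oppr_le0 mulr_ge0 // sqr_ge0.
move/eqP: h2; rewrite mulf_eq0 sqrf_eq0 mulf_eq0 invr_eq0 mulf_eq0 !pnatr_eq0 /= subr_eq0 => /eqP h2.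
have h3 : (i.+2%:Z * ya x r i.+1)%:~R = (i.+1%:Z * ya x r i.+2)%:~R :> rat.
  by rewrite !intrM h2 mulrA [i.+2%:~R * _]mulrCA divff ?mulr1 // pnatr_eq0.
have {h3} h3 : i.+2%:Z * ya x r i.+1 = i.+1%:Z * ya x r i.+2 by apply: (@intr_inj rat).
rewrite -IH in h3; last by lia.
have : i.+1%:Z * (i.+2%:Z * ya x r 1) = i.+1%:Z * ya x r i.+2 by rewrite -h3 mulrCA.
by move/mulfI; apply; rewrite -lt0n.
Qed.

(** A null vector of a semidefinite form lies in the radical of the symmetrized form. *)
Lemma eul_sym_zero (d x : qV Q -> int) : 0 <= cst -> eul d d = 0 -> eul x d = - eul d x.
Proof.
move=> c0 dd; apply/eqP; rewrite -addr_eq0; apply/eqP.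
have E t : eul (fun v => x v + t * d v) (fun v => x v + t * d v) =
   eul x x + t * (eul x d + eul d x).
  rewrite eul_addl !eul_addr !eul_scalel !eul_scaler dd; ring.
(* With s the symmetrized pairing and t = - (q(x) + 1) s, nonnegativity of q(x) + t s forces s^2 <
   1, so the integer s is 0. *)
have h1 := star_psd (fun v => x v + (- (eul x x + 1) * (eul x d + eul d x)) * d v) c0.
rewrite E in h1; set s := eul x d + eul d x in h1 *.
have q0 := star_psd x c0; nia.
Qed.

Lemma star_pos (x : qV Q -> nat) : 0 < cst -> (exists v, x v <> 0%N) ->
  0 < eul (fun v => (x v)%:Z) (fun v => (x v)%:Z).
Proof.
move=> c0 [v hv]; have c0' := ltW c0; rewrite lt_neqAle star_psd // andbT eq_sym; apply/eqP => q0.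
have u0 : x None = 0%N.
  have := star_form (fun v => (x v)%:Z); rewrite q0 mulr0z => e.
  have s0 := sq_sum_nonneg (fun v => (x v)%:Z); set S := \sum_r _ in e s0.
  have h : cst * (x None)%:~R ^+ 2 <= 0 :> rat by lra.
  apply/eqP; apply: contraT => u0; move: h; rewrite leNgt mulr_gt0 //.
  by rewrite exprn_gt0 // ltr0z ltz_nat lt0n.
apply: hv; case: v => [[r k]|//]; have lk := ltn_ord k.
have H := star_zero_arm (r := r) c0' q0.
have := H (la r).+1 (leqnn _); rewrite {2}/ya ltnn u0 => /eqP; rewrite mulf_eq0 => /orP [//|/eqP y1].
have := H (la r - k)%N _; rewrite y1 mulr0 /ya ltnS => /(_ (leq_trans (leq_subr _ _) (leqnSn _))).
rewrite ltnS leq_subr /= subSS => [[e]]; apply/esym; apply: etrans e _.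
congr (x (Some _)); congr (existT _ _ _); apply: val_inj; rewrite /= inordK subKn //.
Qed.

(** Finitely many positive roots: each term of the sum of squares is at most 1. The centre is
    therefore at most 1/[cst], and along an arm an entry exceeds its neighbour towards the centre by
    at most 2. *)
Lemma star_bound : 0 < cst -> exists B : nat, forall x : qV Q -> nat,
  eul (fun v => (x v)%:Z) (fun v => (x v)%:Z) = 1 -> forall v, (x v < B)%N.
Proof.
move=> c0; pose u := Num.bound (cst^-1); pose L := \max_r (la r).
exists (u + 2 * L.+2).+1 => x q1.
have cu : cst * (x None)%:R ^+ 2 <= 1 :> rat.
  have := star_form (fun v => (x v)%:Z); rewrite q1 => e.
  by rewrite [leRHS](_ : 1 = 1%:~R) // e lerDl sq_sum_nonneg.
have xu : (x None <= u)%N.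
  rewrite -(ler_nat rat); apply: (@le_trans _ _ ((x None)%:R ^+ 2)).
    case: (x None) => [|k]; first by rewrite sqr_ge0.
    by rewrite -natrX ler_nat expnS leq_pmulr // expn_gt0.
  apply: (@le_trans _ _ cst^-1); last first.
    by apply: ltW; apply: archi_boundP; rewrite invr_ge0 ltW.
  by rewrite -[leRHS]mul1r ler_pdivlMr // mulrC.
have step r i : (i < (la r).+1)%N -> ya (fun v => (x v)%:Z) r i.+1 <= ya (fun v => (x v)%:Z) r i.+2 + 2.
  move=> hi; have := star_sq_bound (fun v => (x v)%:Z) hi; rewrite q1 => h.
  set y1 := ya _ _ _ in h *; set y2 := ya _ _ _ in h *.
  have p2 : 0 <= y2%:~R :> rat by rewrite ler0z /y2 /ya; case: ifP.
  rewrite leNgt; apply/negP => lt12.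
  have {lt12} lt12 : y2%:~R + 2 < y1%:~R :> rat by rewrite -[2]/(2%:~R) -intrD ltr_int.
  have i1 : 0 < i.+1%:R :> rat by rewrite ltr0n.
  have i2 : 0 < i.+2%:R :> rat by rewrite ltr0n.
  have c1 : i.+1%:R / i.+2%:R * y2%:~R <= y2%:~R :> rat.
    by rewrite ler_piMl // ler_pdivrMr // mul1r ler_nat.
  have c2 : 1 / 2 <= i.+2%:R / (2 * i.+1%:R) :> rat.
    rewrite ler_pdivlMr ?mulr_gt0 // mulrA divff ?mul1r ?ler_nat //.
  have h1 : (i.+2%:R / (2 * i.+1%:R)) * (y1%:~R - i.+1%:R / i.+2%:R * y2%:~R) ^+ 2 <= 1 :> rat.
    by apply: le_trans h _; rewrite lerBlDr lerDl mulr_ge0 ?sqr_ge0 // ltW.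
  set E := i.+1%:R / i.+2%:R * y2%:~R in c1 h1.
  set c := i.+2%:R / _ in c2 h1; set D := y1%:~R - _ in h1.
  have hD : 2 < D by rewrite /D; lra.
  have hD2 : 4 < D ^+ 2 by nra.
  nra.
have arm r j : (j <= (la r).+1)%N ->
    ya (fun v => (x v)%:Z) r ((la r).+2 - j)%N <= u%:Z + 2 * j%:Z.
  elim: j => [|j IH] hj; first by rewrite subn0 /ya ltnn mulr0 addr0 lez_nat.
  have hi : ((la r).+2 - j.+1 = ((la r) - j).+1)%N by lia.
  rewrite hi; have := @step r (la r - j)%N; rewrite ltnS leq_subr => /(_ isT) h.
  apply: le_trans h _; have -> : ((la r - j).+2 = (la r).+2 - j)%N by lia.
  by have := IH (ltnW hj); lia.
have laL r : (la r <= L)%N by exact: (@leq_bigmax _ (fun r : 'I_3 => la r) r).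
case=> [[r k]|]; last by lia.
have lk := ltn_ord k; have := arm r k.+1 lk; rewrite subSS /ya.
have -> : (0 < (la r).+1 - k <= (la r).+1)%N by lia.
have -> : (inord ((la r).+1 - ((la r).+1 - k)) : 'I_(la r).+1) = k.
  by apply: val_inj; rewrite /= subKn ?inordK // ltnW.
move=> h; rewrite ltnS; apply: (@leq_trans (u + 2 * k.+1)%N).
  by rewrite -lez_nat PoszD PoszM; exact: h.
by have := laL r; move: lk; clear; move: (nat_of_ord k) => j; lia.
Qed.

Variable K : closedFieldType.

Lemma star_finite : 0 < cst -> fin_many (fun M : rep Q K => is_rep M /\ indec M).
Proof.
move=> c0; have [B hB] := star_bound c0.
have F := @fin_many_rigid Q K (fun _ _ => erefl) B.
apply: (fin_many_sub _ F) => M [hM iM].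
have [b r q] := dynkin (fun x => star_pos (x := x) c0) hM iM.
by split=> //; apply: hB.
Qed.

End StarForm.

Definition relabS (R : Type) (s : 'I_3 -> 'I_3) (f : 'I_3 -> nat -> nat) (O : mobj R) : mobj R :=
  @MObj R (mU O) (mT O) (fun t => s (marm t)) (fun t => f (marm t) (mn t)) (@mg _ O).

(** * Comparison of labelled data with the star *)

Section Canon.
Variables (K : fieldType) (Q : bquiver) (D : attq Q) (la : 'I_3 -> nat) (s s' : 'I_3 -> 'I_3).
Hypotheses (okD : attq_ok D) (ss' : cancel s s') (s's : cancel s' s)
  (hla : forall r, al D (s r) = (la r).+1).
Implicit Types O C : mobj K.
Notation SD := (starD la).

(** The space and its vectors stay the same; arms are matched by the bijection s and labels are
    replaced by ranks. The same matrices phi and psi are morphisms on both sides, which is the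
    content of the transfer lemmas. [ex] goes back. *)
Definition cv O := relabS s' (fun r => rk D r) O.
Definition ex C := relabS s (fun r k => lab D (s r) k) C.

Lemma al_s' r : (la (s' r)).+1 = al D r. Proof. by rewrite -hla s's. Qed.

Lemma cv_mok O : mok D O -> mok SD (cv O).
Proof. by move=> h t; rewrite /= al_s' rk_bound. Qed.

Lemma ex_mok C : mok SD C -> mok D (ex C).
Proof.
move=> h t; have H : (0 < @mn _ C t <= al D (s (@marm _ C t)))%N by rewrite hla; exact: h.
by have [] := lab_spec H.
Qed.

Lemma ex_rk C : mok SD C -> forall t : mT C, rk D (s (marm t)) (lab D (s (marm t)) (mn t)) = mn t.
Proof.
move=> h t; have H : (0 < @mn _ C t <= al D (s (@marm _ C t)))%N by rewrite hla; exact: h.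
by have [] := lab_spec H.
Qed.

Lemma cv_phom O O' phi psi : mok D O -> mok D O' ->
  phom (okl D) (O:=O) (O':=O') phi psi <-> phom (okl SD) (O:=cv O) (O':=cv O') phi psi.
Proof.
move=> h h'; split=> [[h1 h2]|[h1 h2]]; split=> // t t' /h1 [e1 e2].
  split; first by rewrite /= e1.
  by rewrite star_okl /= -e1 -rk_okl // e1.
have e3 : marm t = marm t' by apply: (can_inj s's).
split=> //; rewrite rk_okl //; last by rewrite e3.
by move: e2; rewrite star_okl /= -e3.
Qed.

Lemma cv_piso O O' : mok D O -> mok D O' -> piso (okl D) O O' <-> piso (okl SD) (cv O) (cv O').
Proof.
move=> h h'; split=> [[p [q [p' [q' [h1 h2 e1 e2]]]]]|[p [q [p' [q' [h1 h2 e1 e2]]]]]];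
  exists p, q, p', q'; split=> //; by apply/cv_phom.
Qed.

Lemma cv_pindec O : mok D O -> pindec (okl D) O -> pindec (okl SD) (cv O).
Proof. by move=> h [i hi]; split=> // p q /(cv_phom _ _ h h); apply: hi. Qed.

Lemma ex_phom C C' phi psi : mok SD C -> mok SD C' ->
  phom (okl D) (O:=ex C) (O':=ex C') phi psi <-> phom (okl SD) (O:=C) (O':=C') phi psi.
Proof.
move=> h h'; split=> [[h1 h2]|[h1 h2]]; split=> // t t' /h1 [e1 e2].
  have e3 : marm t = marm t' by apply: (can_inj ss').
  split=> //; move: e2; rewrite star_okl /= -e3 lab_okl ?hla ?h //.
  by rewrite e3 h'.
split; first by rewrite /= e1.
by move: e2; rewrite star_okl /= -e1 lab_okl ?hla ?h // e1 h'.
Qed.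

Lemma cvex_phom O C phi psi : mok D O -> mok SD C ->
  phom (okl D) (O:=O) (O':=ex C) phi psi <-> phom (okl SD) (O:=cv O) (O':=C) phi psi.
Proof.
move=> h h'; rewrite cv_phom //; last exact: ex_mok.
have R := ex_rk h'.
by split=> [] [h1 h2]; split=> // t t' /h1; rewrite !star_okl /= ss' R.
Qed.

Lemma exvc_phom O C phi psi : mok D O -> mok SD C ->
  phom (okl D) (O:=ex C) (O':=O) phi psi <-> phom (okl SD) (O:=C) (O':=cv O) phi psi.
Proof.
move=> h h'; rewrite cv_phom //; last exact: ex_mok.
have R := ex_rk h'.
by split=> [] [h1 h2]; split=> // t t' /h1; rewrite !star_okl /= ss' R.
Qed.

Lemma cvex_piso O C : mok D O -> mok SD C -> piso (okl SD) (cv O) C -> piso (okl D) O (ex C).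
Proof.
move=> h h' [p [q [p' [q' [h1 h2 e1 e2]]]]]; exists p, q, p', q'; split=> //.
  exact/cvex_phom.
exact/exvc_phom.
Qed.

Lemma cv_indec O : mok D O -> indec (att D O) -> indec (att SD (cv O)).
Proof.
move=> h i; apply: (pindec_indec (star_ok la)).
- exact: star_agr_inj.
- by [].
- exact: cv_mok.
- by apply: cv_pindec => //; apply: (indec_pindec h i).
Qed.

Lemma star_piso C C' : mok SD C -> mok SD C' -> rep_iso (att SD C) (att SD C') -> piso (okl SD) C C'.
Proof.
by apply: (free_att_piso (star_ok la)) => //; apply: star_agr_inj.
Qed.

(** Fullness holds over the star, so the isomorphism there comes from labelled data and gives one
    over Q; this implication tolerates coincidences of vertices in Q. *)
Lemma cv_transfer O O' : mok D O -> mok D O' ->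
  rep_iso (att SD (cv O)) (att SD (cv O')) -> rep_iso (att D O) (att D O').
Proof.
move=> h h' /star_piso H; apply: (piso_att h h'); apply/(cv_piso h h').
by apply: H; apply: cv_mok.
Qed.

Lemma ex_transfer O C : mok D O -> mok SD C ->
  rep_iso (att SD (cv O)) (att SD C) -> rep_iso (att D O) (att D (ex C)).
Proof.
move=> h h' /star_piso H; apply: (piso_att h); first exact: ex_mok.
by apply: cvex_piso => //; apply: H => //; apply: cv_mok.
Qed.

End Canon.

Section Finite.
Variables (K : closedFieldType) (Q : bquiver) (D : attq Q) (la : 'I_3 -> nat) (s s' : 'I_3 -> 'I_3).
Hypotheses (okD : attq_ok D) (s's : cancel s' s)
  (hla : forall r, al D (s r) = (la r).+1).
Notation SD := (starD la).

Definition null_obj : mobj K := @MObj K void void (fun _ => ord0) (fun _ => 0%N) (fun _ _ => 0).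
Lemma null_mok : mok D null_obj. Proof. by []. Qed.

(** A representative over Q is chosen for each star class that occurs among the data [cv O]; classes
    that do not occur receive the null datum. *)
Lemma fin_transfer (P : rep (starQ la) K -> Prop) : fin_many P ->
  fin_many (fun M : rep Q K => exists O, [/\ mok D O, P (att SD (cv D s' O)) & rep_iso M (att D O)]).
Proof.
move=> [T [F [Fr FP]]].
have ch t : exists O, mok D O /\ forall O', mok D O' ->
    rep_iso (att SD (cv D s' O')) (F t) -> rep_iso (att D O') (att D O).
  case: (classic (exists O, mok D O /\ rep_iso (att SD (cv D s' O)) (F t))) => [[O [h i]]|no].
    exists O; split=> // O' h' i'; apply: (cv_transfer s's hla h' h).
    exact: iso_trans i' (iso_sym i).
  by exists null_obj; split=> [|O' h' i']; [exact: null_mok | case: no; exists O'].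
pose G t := wit (ch t).
have GP t := witP (ch t).
exists T, (fun t => att D (G t)); split=> [t|M [O [h p i]]].
  by apply: (att_rep okD); have [] := GP t.
have [t it] := FP _ p; exists t; apply: iso_trans i _.
by have [_ g] := GP t; apply: g.
Qed.

Lemma fin_rep_finite : fin_many (fun M : rep Q K => is_rep M /\ indec M) -> rep_finite K Q.
Proof.
move=> [T [F [Fr FP]]]; exists #|T|, (fun i => F (enum_val i)); split=> // M h i.
by have [t it] := FP M (conj h i); exists (enum_rank t); rewrite enum_rankK.
Qed.

End Finite.

Section ExcFinite.
Variables (n m l : nat) (o : 'I_(m + n + l).+2 -> bool).
Notation N := (m + n + l).+2.
Hypothesis n1 : (0 < n)%N.
Hypotheses (ob : o (inord m)) (oa1 : ~~ o (inord m.+1)) (oan : ~~ o (inord (m + n)))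
  (oc : ~~ o (inord (m + n).+1)).
Notation E := (exc_alg o).
Variable K : closedFieldType.

Lemma ethin_many : fin_many (fun M : rep E K => is_rep M /\
  exists lo hi, (lo < hi <= N.+1)%N /\ rep_iso M (ethin o K lo hi)).
Proof.
(* Intervals on which the relations fail are replaced by the zero representation. *)
exists ('I_N.+2 * 'I_N.+2)%type, (fun p : 'I_N.+2 * 'I_N.+2 => if excluded_middle_informative (is_rep (ethin o K p.1 p.2))
  then ethin o K p.1 p.2 else @Rep E K 0 (fun _ => 0) (fun _ => 0)); split=> [p|M [hM [lo [hi [h i]]]]].
  destruct excluded_middle_informative => //=.
  by split=> //= *; apply/matrixP => [[]].
have l1 : (lo < N.+2)%N by lia. have l2 : (hi < N.+2)%N by lia.
exists (Ordinal l1, Ordinal l2) => /=.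
by destruct excluded_middle_informative as [|no] => //; case: no; apply: iso_rep i hM.
Qed.

Definition exla (r : nat) := (exl n m l r).-1.

Lemma exlaE (r : 'I_3) : al (excD o) (id r) = (exla r).+1.
Proof. by rewrite /= /exla; case: (nat_of_ord r) => [|[|k]]. Qed.

Lemma exc_finite : 0 < cst exla -> rep_finite K E.
Proof.
move=> c0; apply: fin_rep_finite.
have okD := exc_ok n1 ob oa1 oan oc.
have idK : cancel id (@id 'I_3) by [].
have F := fin_transfer okD idK exlaE (star_finite K c0).
apply: (fin_many_sub _ (fin_many_or ethin_many F)) => M [hM iM].
case: (exc_dec n1 ob oa1 oan oc hM iM) => [h|[O [h i]]]; [by left | right].
exists O; split=> //; split; last exact: (cv_indec idK exlaE h (iso_indec i iM)).
by apply: (att_rep (star_ok _)); apply: (cv_mok idK exlaE h).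
Qed.

End ExcFinite.

(** * Explicit families over the extended stars *)

(** On each arm the vectors are linearly independent, so the arm is a flag of subspaces of the
    centre and phi is determined by psi. *)
Definition RF (K : fieldType) (O : mobj K) : Prop := forall r (c : mT O -> K),
  (forall t, marm t <> r -> c t = 0) -> (forall u, \sum_t c t * mg t u = 0) -> forall t, c t = 0.

Lemma RF_phi (K : fieldType) (O O' : mobj K) ol phi psi : RF O' -> phom ol (O:=O) (O':=O') phi psi ->
  psi =2 (fun _ _ => 0) -> phi =2 (fun _ _ => 0).
Proof.
move=> rf [h1 h2] p0 t; apply: (rf (marm t)) => [t' ne|u].
  by apply/eqP; apply: contraT => /h1 [e _]; case: ne.
by rewrite h2 big1 // => w _; rewrite p0 mulr0.
Qed.

(* The codes 0, 1, 2, 3 in [tG t u] stand for the blocks 0, 1, Phi, Theta. *)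
Record tbl := Tbl { tu : nat; tt : nat; tarm : nat -> nat; tlab : nat -> nat;
  tG : nat -> nat -> nat; tpv : nat -> nat }.

Definition tvec (s : seq (nat * nat)) (u : nat) : nat :=
  nth 0%N (map snd s) (index u (map fst s)).

(** The vector delta of E8~ is 6 at the centre, with arms (3), (4, 2) and (5, 4, 3, 2, 1). Arms 1
    and 2 are coordinate flags, opposite enough to make maps nearly diagonal. The three vectors of
    arm 0 tie the coordinates together, and the last of them carries the parameter (Phi : Theta). *)
Definition tE8 : tbl := @Tbl 6 12
  (nth 0%N [:: 0; 0; 0; 1; 1; 1; 1; 2; 2; 2; 2; 2]%N)
  (nth 0%N [:: 1; 1; 1; 2; 2; 1; 1; 5; 4; 3; 2; 1]%N)
  (fun t => tvec (nth [::] [:: [:: (1, 1); (2, 1); (4, 1)]; [:: (0, 1); (3, 1); (4, 1)];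
     [:: (0, 2); (2, 3); (5, 1)]; [:: (4, 1)]; [:: (5, 1)]; [:: (2, 1)]; [:: (3, 1)];
     [:: (0, 1)]; [:: (1, 1)]; [:: (2, 1)]; [:: (3, 1)]; [:: (4, 1)]]%N t))
  (nth 0%N [:: 1; 3; 5; 4; 5; 2; 3; 0; 1; 2; 3; 4]%N).

(** The vector delta of E7~ is 4 at the centre, with arms (2), (3, 2, 1) and (3, 2, 1); again arm 0
    carries the parameters. *)
Definition tE7 : tbl := @Tbl 4 8
  (nth 0%N [:: 0; 0; 1; 1; 1; 2; 2; 2]%N)
  (nth 0%N [:: 1; 1; 3; 2; 1; 3; 2; 1]%N)
  (fun t => tvec (nth [::] [:: [:: (0, 1); (2, 1); (3, 1)]; [:: (1, 1); (2, 2); (3, 3)];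
     [:: (3, 1)]; [:: (2, 1)]; [:: (1, 1)]; [:: (0, 1)]; [:: (1, 1)]; [:: (2, 1)]]%N t))
  (nth 0%N [:: 0; 1; 3; 2; 1; 0; 1; 2]%N).

Definition tE6 : tbl := @Tbl 3 6
  (nth 0%N [:: 0; 0; 1; 1; 2; 2]%N) (nth 0%N [:: 2; 1; 2; 1; 2; 1]%N)
  (fun t => tvec (nth [::] [:: [:: (0, 1); (1, 1); (2, 1)]; [:: (1, 1); (2, 3)];
     [:: (2, 1)]; [:: (1, 1)]; [:: (0, 1)]; [:: (1, 1)]]%N t))
  (nth 0%N [:: 0; 1; 2; 1; 0; 1]%N).

(** Each vector has coefficient 1 at its pivot column, where the later vectors of the same arm
    vanish; this triangularity makes the vectors of an arm independent for all values of the
    parameters. *)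
Definition tcheck (tb : tbl) : bool :=
  all (fun t => [&& (tarm tb t < 3)%N, (tpv tb t < tu tb)%N, tG tb t (tpv tb t) == 1%N &
    all (fun t' => (tarm tb t == tarm tb t') && (t < t')%N ==> (tG tb t' (tpv tb t) == 0%N))
      (iota 0 (tt tb))]) (iota 0 (tt tb)).

Section Tab.
Variable tb : tbl.

Definition sv (R : nzRingType) h (Phi Theta : 'M[R]_h) (c : nat) : 'M[R]_h :=
  match c with 0 => 0 | 1 => 1%:M | 2 => Phi | _ => Theta end.

Definition tabO (R : nzRingType) h (Phi Theta : 'M[R]_h) (lb : nat -> 'I_h -> nat) : mobj R :=
  @MObj R ('I_(tu tb) * 'I_h)%type ('I_(tt tb) * 'I_h)%type
    (fun t => inord (tarm tb t.1)) (fun t => lb t.1 t.2)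
    (fun t u => sv Phi Theta (tG tb t.1 u.1) t.2 u.2).

Definition ole (r : 'I_3) (n n' : nat) := (n <= n')%N.
(** The labels of individual copies may differ from those of the table, provided that no comparison
    arises which the table forbids. This leaves room to raise the label of some copies of a top
    vector, which adds a vertex to its arm. *)
Definition lbok h h' (lb : nat -> 'I_h -> nat) (lb' : nat -> 'I_h' -> nat) :=
  forall t i t' i', tarm tb t = tarm tb t' -> (lb t i <= lb' t' i')%N -> (tlab tb t <= tlab tb t')%N.

Hypothesis ck : tcheck tb.

Lemma tck t : (t < tt tb)%N -> [/\ (tarm tb t < 3)%N, (tpv tb t < tu tb)%N, tG tb t (tpv tb t) = 1%N &
  forall t', (t' < tt tb)%N -> tarm tb t = tarm tb t' -> (t < t')%N -> tG tb t' (tpv tb t) = 0%N].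
Proof.
move=> ht; have /allP /(_ t) := ck; rewrite mem_iota add0n => /(_ ht) /and4P [h1 h2 /eqP h3 h4].
split=> // t' ht' a lt; have /allP /(_ t') := h4; rewrite mem_iota add0n => /(_ ht').
by rewrite a eqxx lt => /eqP.
Qed.

Lemma tarm_eq (t t' : nat) : (t < tt tb)%N -> (t' < tt tb)%N ->
  inord (tarm tb t) = inord (tarm tb t') :> 'I_3 -> tarm tb t = tarm tb t'.
Proof.
move=> /tck [a _ _ _] /tck [a' _ _ _] /(congr1 (@nat_of_ord _)).
by rewrite !inordK.
Qed.

Lemma tab_RF (K : fieldType) h (Phi Theta : 'M[K]_h) lb : RF (tabO Phi Theta lb).
Proof.
move=> r c hr hc [t k]; have [n] := ubnP (t : nat); elim: n t k => // n IH t k tn.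
have [_ pv g1 gz] := tck (ltn_ord t).
apply/eqP; apply: contraT => nz0.
have ar (t' : 'I_(tt tb)) k' : c (t', k') != 0 -> inord (tarm tb t') = r.
  by move=> nz; apply: NNPP => ne; have e := hr (t', k') ne; rewrite e eqxx in nz.
have := hc (Ordinal pv, k); rewrite (bigD1 (t, k)) //= g1 mxE eqxx mulr1 big1 ?addr0.
  by move/eqP; rewrite (negPf nz0).
move=> [t' k'] ne /=; have [->|nz] := eqVneq (c (t', k')) 0; first by rewrite mul0r.
have a : tarm tb t = tarm tb t'.
  by apply: (tarm_eq (ltn_ord t) (ltn_ord t')); rewrite (ar _ _ nz) (ar _ _ nz0).
case: (ssrnat.ltngtP t' t) => lt.
- by rewrite IH ?mul0r //; lia.
- by rewrite gz ?mxE ?mulr0.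
- have et : t' = t by apply: val_inj.
  subst t'; rewrite g1 mxE; case: eqP => [e|_]; last by rewrite mulr0.
  by rewrite e eqxx in ne.
Qed.

Section Hom.
Variables (K : fieldType) (h h' : nat) (Phi Theta : 'M[K]_h) (Phi' Theta' : 'M[K]_h').
Variables (lb : nat -> 'I_h -> nat) (lb' : nat -> 'I_h' -> nat).
Notation O := (tabO Phi Theta lb).
Notation O' := (tabO Phi' Theta' lb').
Variables (phi : mT O -> mT O' -> K) (psi : mU O -> mU O' -> K).
Hypothesis H : phom ole phi psi.

Definition Pt (t t' : nat) : 'M[K]_(h, h') := \matrix_(i, j)
  if insub t is Some a then if insub t' is Some b then phi (a, i) (b, j) else 0 else 0.
Definition Ps (u u' : nat) : 'M[K]_(h, h') := \matrix_(i, j)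
  if insub u is Some a then if insub u' is Some b then psi (a, i) (b, j) else 0 else 0.

Lemma PtE (t t' : 'I_(tt tb)) : Pt t t' = \matrix_(i, j) phi (t, i) (t', j).
Proof. by apply/matrixP => i j; rewrite !mxE !valK. Qed.
Lemma PsE (u u' : 'I_(tu tb)) : Ps u u' = \matrix_(i, j) psi (u, i) (u', j).
Proof. by apply/matrixP => i j; rewrite !mxE !valK. Qed.

(** Only the nonzero terms of the morphism equation at (t, u') are listed, so that on a concrete
    table each instance of [tab_eqn] reduces to an equation with a few blocks. *)
Definition supp (t u' : nat) := [seq t' <- iota 0 (tt tb) |
  [&& tarm tb t == tarm tb t', (tlab tb t <= tlab tb t')%N & tG tb t' u' != 0%N]].
Definition suppU (t : nat) := [seq u <- iota 0 (tu tb) | tG tb t u != 0%N].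
Definition cc c (P : 'M[K]_(h, h')) := match c with 0 => 0 | 1 => P | 2 => P *m Phi' | _ => P *m Theta' end.
Definition rr c (P : 'M[K]_(h, h')) := match c with 0 => 0 | 1 => P | 2 => Phi *m P | _ => Theta *m P end.

Lemma ccE c P : cc c P = P *m sv Phi' Theta' c.
Proof. by case: c => [|[|[|c]]] /=; rewrite ?mulmx0 ?mulmx1. Qed.
Lemma rrE c P : rr c P = sv Phi Theta c *m P.
Proof. by case: c => [|[|[|c]]] /=; rewrite ?mul0mx ?mul1mx. Qed.

Hypothesis hlb : lbok lb lb'.

Lemma tab_eqn t u' : (t < tt tb)%N -> (u' < tu tb)%N ->
  \sum_(t' <- supp t u') cc (tG tb t' u') (Pt t t') = \sum_(u <- suppU t) rr (tG tb t u) (Ps u u').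
Proof.
move=> ht hu; have [h1 h2] := H.
rewrite /supp /suppU !big_filter -!/(index_iota 0 _) !big_mkcond /=.
have -> : iota 0 (tt tb) = index_iota 0 (tt tb) by rewrite /index_iota subn0.
have -> : iota 0 (tu tb) = index_iota 0 (tu tb) by rewrite /index_iota subn0.
rewrite !big_mkord; apply/matrixP => i j; rewrite !summxE.
transitivity (\sum_t' phi (Ordinal ht, i) t' * @mg _ O' t' (Ordinal hu, j)).
  transitivity (\sum_(t' < tt tb) \sum_(k < h') phi (Ordinal ht, i) (t', k) * @mg _ O' (t', k) (Ordinal hu, j)); last first.
    by rewrite pair_bigA /=; apply: eq_bigr => [[]].
  apply: eq_bigr => t' _; apply/esym.
  transitivity ((cc (tG tb t' u') (Pt t t')) i j).
    by rewrite ccE -[t in RHS]/(val (Ordinal ht)) PtE !mxE; apply: eq_bigr => k _; rewrite !mxE.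
  case: ifP => // /negbT nn; rewrite ccE -[t in LHS]/(val (Ordinal ht)) PtE !mxE big1 // => k _.
  rewrite mxE; have [->|nz] := eqVneq (phi (Ordinal ht, i) (t', k)) 0; first by rewrite mul0r.
  have [am le] := h1 _ _ nz; have a : tarm tb t = tarm tb t' := tarm_eq ht (ltn_ord t') am.
  move: nn; rewrite a eqxx (hlb a le) /= negbK => /eqP ->; by rewrite mxE mulr0.
rewrite h2; transitivity (\sum_(u < tu tb) \sum_(k < h) @mg _ O (Ordinal ht, i) (u, k) * psi (u, k) (Ordinal hu, j)).
  by rewrite pair_bigA /=; apply: eq_bigr => [[]].
rewrite [RHS]big_mkcond /=; apply: eq_bigr => u _.
transitivity ((rr (tG tb t u) (Ps u u')) i j).
  by rewrite rrE -[u' in RHS]/(val (Ordinal hu)) PsE !mxE; apply: eq_bigr => k _; rewrite !mxE.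
by case: ifP => // /negbFE /eqP ->; rewrite !mxE.
Qed.

End Hom.
End Tab.

Arguments supp tb t u' /.
Arguments suppU tb t /.

Lemma ck8 : tcheck tE8. Proof. by vm_compute. Qed.
Lemma ck7 : tcheck tE7. Proof. by vm_compute. Qed.
Lemma ck6 : tcheck tE6. Proof. by vm_compute. Qed.

Ltac tabe E t u := have := E t u isT isT; rewrite /= !(big_cons, big_nil) /= ?addr0.

Section Spec.
Variables (K : fieldType) (h h' : nat) (Phi Theta : 'M[K]_h) (Phi' Theta' : 'M[K]_h').
Variables (lb : nat -> 'I_h -> nat) (lb' : nat -> 'I_h' -> nat).

Definition isdiag nu e6 (psi : 'I_nu * 'I_h -> 'I_nu * 'I_h' -> K) (p p6 : 'M[K]_(h, h')) :=
  forall u i u' j, psi (u, i) (u', j) = if u == u' then (if u == e6 :> nat then p6 i j else p i j) else 0.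

(** Maps between members are exactly as rigid as maps of Kronecker modules (Phi, Theta). The flags
    of arms 1 and 2 kill most off-diagonal blocks of psi (the equations z); the vectors of arm 0
    kill the rest and identify the diagonal blocks, except for the block of the last coordinate,
    which is linked to the others only through Phi and Theta. *)
Lemma spec8 (phi : mT (tabO tE8 Phi Theta lb) -> mT (tabO tE8 Phi' Theta' lb') -> K) psi :
  lbok tE8 lb lb' -> phom ole phi psi ->
  exists p p6, [/\ isdiag 5 psi p p6, Phi *m p = p6 *m Phi', Theta *m p = p6 *m Theta' &
    Pt phi 7 7 = p].
Proof.
move=> hl H; have E := tab_eqn ck8 H hl.
tabe E 7%N 1%N => /esym z01.
tabe E 7%N 2%N => /esym z02.
tabe E 7%N 3%N => /esym z03.
tabe E 7%N 4%N => /esym z04.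
tabe E 7%N 5%N => /esym z05.
tabe E 8%N 2%N => /esym z12.
tabe E 8%N 3%N => /esym z13.
tabe E 8%N 4%N => /esym z14.
tabe E 8%N 5%N => /esym z15.
tabe E 9%N 3%N => /esym z23.
tabe E 9%N 4%N => /esym z24.
tabe E 9%N 5%N => /esym z25.
tabe E 10%N 4%N => /esym z34.
tabe E 10%N 5%N => /esym z35.
tabe E 11%N 5%N => /esym z45.
tabe E 3%N 0%N => /esym z40.
tabe E 3%N 1%N => /esym z41.
tabe E 3%N 2%N => /esym z42.
tabe E 3%N 3%N => /esym z43.
tabe E 4%N 0%N => /esym z50.
tabe E 4%N 1%N => /esym z51.
tabe E 4%N 2%N => /esym z52.
tabe E 4%N 3%N => /esym z53.
tabe E 5%N 0%N => /esym z20.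
tabe E 5%N 1%N => /esym z21.
tabe E 6%N 0%N => /esym z30.
tabe E 6%N 1%N => /esym z31.
tabe E 0%N 1%N; rewrite ?z21 ?z41 ?(mulmx0, mul0mx, addr0, add0r) => a00.
tabe E 0%N 3%N; rewrite ?z13 ?z23 ?z43 ?(mulmx0, mul0mx, addr0, add0r) => a01.
tabe E 0%N 5%N; rewrite ?z15 ?z25 ?z45 ?(mulmx0, mul0mx, addr0, add0r) => a02.
tabe E 0%N 0%N; rewrite ?a01 ?a02 ?z20 ?z40 ?(mulmx0, mul0mx, addr0, add0r) => /esym z10.
tabe E 0%N 2%N; rewrite ?a01 ?a02 ?z12 ?z42 ?(mulmx0, mul0mx, addr0, add0r) => b02.
tabe E 0%N 4%N; rewrite ?a01 ?a02 ?z14 ?z24 ?(mulmx0, mul0mx, addr0, add0r) => b04.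
tabe E 1%N 1%N; rewrite ?z01 ?z31 ?z41 ?(mulmx0, mul0mx, addr0, add0r) => a10.
tabe E 1%N 3%N; rewrite ?z03 ?z43 ?(mulmx0, mul0mx, addr0, add0r) => a11.
tabe E 1%N 5%N; rewrite ?z05 ?z35 ?z45 ?(mulmx0, mul0mx, addr0, add0r) => a12.
tabe E 1%N 0%N; rewrite ?a10 ?a12 ?z30 ?z40 ?(mulmx0, mul0mx, addr0, add0r) => b10.
tabe E 1%N 2%N; rewrite ?a10 ?a12 ?z02 ?z42 ?(mulmx0, mul0mx, addr0, add0r) => /esym z32.
tabe E 1%N 4%N; rewrite ?a10 ?a12 ?z04 ?z34 ?(mulmx0, mul0mx, addr0, add0r) => b14.
tabe E 2%N 1%N; rewrite ?z01 ?z21 ?z51 ?(mulmx0, mul0mx, addr0, add0r) => a20.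
tabe E 2%N 3%N; rewrite ?z03 ?z23 ?z53 ?(mulmx0, mul0mx, addr0, add0r) => a21.
tabe E 2%N 5%N; rewrite ?z05 ?z25 ?(mulmx0, mul0mx, addr0, add0r) => a22.
tabe E 2%N 0%N; rewrite ?a20 ?a21 ?z20 ?z50 ?(mulmx0, mul0mx, addr0, add0r) => b20.
tabe E 2%N 2%N; rewrite ?a20 ?a21 ?z02 ?z52 ?(mulmx0, mul0mx, addr0, add0r) => b22.
tabe E 2%N 4%N; rewrite ?a20 ?a21 ?z04 ?z24 ?(mulmx0, mul0mx, addr0, add0r) => /esym z54.
tabe E 7%N 0%N => top.
pose D k := if k == 5%N then Ps psi 5 5 else Ps psi 0 0.
exists (Ps psi 0 0), (Ps psi 5 5); split.
- move=> u i u' j.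
  have Z k k' : (k < 6)%N -> (k' < 6)%N -> Ps psi k k' = if k == k' then D k else 0.
    by case: k => [|[|[|[|[|[|//]]]]]]; case: k' => [|[|[|[|[|[|//]]]]]] _ _ /=; first [assumption | rewrite /D /=; congruence].
  have -> : psi (u, i) (u', j) = Ps psi u u' i j by rewrite PsE mxE.
  rewrite (Z _ _ (ltn_ord u) (ltn_ord u')) /D -(inj_eq val_inj u u') /=.
  case: (nat_of_ord u == u'); last by rewrite mxE.
  by case: (nat_of_ord u == _).
- by rewrite -b20 a22.
- by rewrite -a22 b22; congr (_ *m _); congruence.
- by [].
Qed.

Lemma spec7 (phi : mT (tabO tE7 Phi Theta lb) -> mT (tabO tE7 Phi' Theta' lb') -> K) psi :
  lbok tE7 lb lb' -> phom ole phi psi ->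
  exists p p6, [/\ isdiag 1 psi p p6, Phi *m p = p6 *m Phi', Theta *m p = p6 *m Theta' &
    Pt phi 5 5 = p].
Proof.
move=> hl H; have E := tab_eqn ck7 H hl.
tabe E 5%N 1%N => /esym z01.
tabe E 5%N 2%N => /esym z02.
tabe E 5%N 3%N => /esym z03.
tabe E 6%N 2%N => /esym z12.
tabe E 6%N 3%N => /esym z13.
tabe E 7%N 3%N => /esym z23.
tabe E 2%N 0%N => /esym z30.
tabe E 2%N 1%N => /esym z31.
tabe E 2%N 2%N => /esym z32.
tabe E 3%N 0%N => /esym z20.
tabe E 3%N 1%N => /esym z21.
tabe E 4%N 0%N => /esym z10.
tabe E 0%N 0%N; rewrite ?z20 ?z30 ?(mulmx0, mul0mx, addr0, add0r) => a00.
tabe E 0%N 1%N; rewrite ?z01 ?z21 ?z31 ?(mulmx0, mul0mx, addr0, add0r) => a01.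
tabe E 0%N 2%N; rewrite ?a01 ?z02 ?z32 ?(mulmx0, mul0mx, addr0, add0r) => b02.
tabe E 0%N 3%N; rewrite ?a01 ?z03 ?z23 ?(mulmx0, mul0mx, addr0, add0r) => b03.
tabe E 1%N 0%N; rewrite ?z10 ?z20 ?z30 ?(mulmx0, mul0mx, addr0, add0r) => a10.
tabe E 1%N 1%N; rewrite ?z21 ?z31 ?(mulmx0, mul0mx, addr0, add0r) => a11.
tabe E 1%N 2%N; rewrite ?a10 ?z12 ?z32 ?(mulmx0, mul0mx, addr0, add0r) => b12.
tabe E 1%N 3%N; rewrite ?a10 ?z13 ?z23 ?(mulmx0, mul0mx, addr0, add0r) => b13.
tabe E 5%N 0%N => top.
pose D k := if k == 1%N then Ps psi 1 1 else Ps psi 0 0.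
exists (Ps psi 0 0), (Ps psi 1 1); split.
- move=> u i u' j.
  have Z k k' : (k < 4)%N -> (k' < 4)%N -> Ps psi k k' = if k == k' then D k else 0.
    by case: k => [|[|[|[|//]]]]; case: k' => [|[|[|[|//]]]] _ _ /=; first [assumption | rewrite /D /=; congruence].
  have -> : psi (u, i) (u', j) = Ps psi u u' i j by rewrite PsE mxE.
  rewrite (Z _ _ (ltn_ord u) (ltn_ord u')) /D -(inj_eq val_inj u u') /=.
  case: (nat_of_ord u == u'); last by rewrite mxE.
  by case: (nat_of_ord u == _).
- by rewrite -a11 b12; congr (_ *m _); congruence.
- by rewrite -a11 b13; congr (_ *m _); congruence.
- by [].
Qed.

(** This table has no entry Phi, and all diagonal blocks coincide, so what is left is the
    commutation of p with Theta. *)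
Lemma spec6 (phi : mT (tabO tE6 Phi Theta lb) -> mT (tabO tE6 Phi' Theta' lb') -> K) psi :
  lbok tE6 lb lb' -> phom ole phi psi ->
  exists p, [/\ isdiag 0 psi p p, Theta *m p = p *m Theta' &
    Pt phi 4 4 = p].
Proof.
move=> hl H; have E := tab_eqn ck6 H hl.
tabe E 4%N 1%N => /esym z01.
tabe E 4%N 2%N => /esym z02.
tabe E 5%N 2%N => /esym z12.
tabe E 2%N 0%N => /esym z20.
tabe E 2%N 1%N => /esym z21.
tabe E 3%N 0%N => /esym z10.
tabe E 0%N 0%N; rewrite ?z10 ?z20 ?(mulmx0, mul0mx, addr0, add0r) => a00.
tabe E 0%N 1%N; rewrite ?z01 ?z21 ?(mulmx0, mul0mx, addr0, add0r) => a01.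
tabe E 0%N 2%N; rewrite ?z02 ?z12 ?(mulmx0, mul0mx, addr0, add0r) => a02.
tabe E 1%N 0%N; rewrite ?z10 ?z20 ?(mulmx0, mul0mx, addr0, add0r) => a10.
tabe E 1%N 1%N; rewrite ?a10 ?z21 ?(mulmx0, mul0mx, addr0, add0r) => a11.
tabe E 1%N 2%N; rewrite ?a10 ?z12 ?(mulmx0, mul0mx, addr0, add0r) => b12.
tabe E 4%N 0%N => top.
pose D (k : nat) := Ps psi 0 0.
exists (Ps psi 0 0); split.
- move=> u i u' j.
  have Z k k' : (k < 3)%N -> (k' < 3)%N -> Ps psi k k' = if k == k' then D k else 0.
    by case: k => [|[|[|//]]]; case: k' => [|[|[|//]]] _ _ /=; first [assumption | rewrite /D /=; congruence].
  have -> : psi (u, i) (u', j) = Ps psi u u' i j by rewrite PsE mxE.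
  rewrite (Z _ _ (ltn_ord u) (ltn_ord u')) /D -(inj_eq val_inj u u') /=.
  case: (nat_of_ord u == u'); last by rewrite mxE.
  by case: (nat_of_ord u == _).
- transitivity (Ps psi 1 1 *m Theta'); last by congr (_ *m _); congruence.
  by rewrite -a11 b12; congr (_ *m _); congruence.
- by [].
Qed.

End Spec.

(** * Homomorphisms over the exceptional algebra between independent data *)

Section ExcHom.
Variables (n m l : nat) (o : 'I_(m + n + l).+2 -> bool).
Notation N := (m + n + l).+2.
Hypothesis n1 : (0 < n)%N.
Hypotheses (ob : o (inord m)) (oa1 : ~~ o (inord m.+1)) (oan : ~~ o (inord (m + n)))
  (oc : ~~ o (inord (m + n).+1)).
Notation E := (exc_alg o).
Notation D := (excD o).
Variable K : fieldType.
Implicit Types O : mobj K.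
Let okD := exc_ok n1 ob oa1 oan oc.
Let posE' := @posE n m l o n1 ob oa1 oan oc.
Let exedE' := @exedE n m l o n1 ob oa1 oan oc.
Let exatE' := @exatE n m l o n1 ob oa1 oan oc.
Let exed_inj' := @exed_inj n m l o n1 ob oa1 oan oc.
Let exat_ed' := @exat_ed n m l o n1 ob oa1 oan oc.

Lemma pos_j r k : (k < exl n m l r)%N -> gl o (pos n m l r k) = None -> (1 < r)%N /\ k = n.-1.
Proof.
move=> h /gl_None [e|e]; first by have := pos_i n1 ob oa1 oan oc h; rewrite e eqxx.
move/(congr1 (@nat_of_ord _)): e; rewrite posE' // inordK; last by lia.
by case: r h => [|[|r]] /=; lia.
Qed.

Lemma pos_eq r k r' k' : (k < exl n m l r)%N -> (k' < exl n m l r')%N -> (r < 3)%N -> (r' < 3)%N ->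
  gl o (pos n m l r k) = gl o (pos n m l r' k') ->
  [\/ r = r' /\ k = k', [/\ r = 1, r' = 2 & k' = n + k] | [/\ r = 2, r' = 1 & k = n + k']]%N.
Proof.
move=> h h' r3 r3' /gl_inj; have i1 := pos_i n1 ob oa1 oan oc h; have i2 := pos_i n1 ob oa1 oan oc h'.
move=> E; have {E} := E (elimN eqP i1) (elimN eqP i2); move=> /(congr1 (@nat_of_ord _)); rewrite !posE' //.
case: r r3 h i1 => [|[|[|//]]]; case: r' r3' h' i2 => [|[|[|//]]] //= _ h' _ _ h _ e;
  try (exfalso; lia); try (by apply: Or31; split => //; lia).
- by apply: Or32; split => //; lia.
- by apply: Or33; split => //; lia.
Qed.

Lemma exed_pn r q : (q.+1 < exl n m l r)%N -> (0 < q)%N ->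
  (exed n m l r q.-1 == exed n m l r q) = false.
Proof.
move=> h q0; apply/eqP => /exed_inj' H; have : q.-1 = q by apply: H => //; rewrite prednK // ltnW.
by move: q0; clear; lia.
Qed.

Lemma exed_sn r q : (q.+2 < exl n m l r)%N -> (exed n m l r q.+1 == exed n m l r q) = false.
Proof.
move=> h; apply/eqP => /exed_inj' H; have : q.+1 = q by apply: H => //; rewrite ltnW.
by clear; lia.
Qed.

Lemma aan2 : (1 < n)%N -> exed n m l 2%N (n - 2) = aan n m l /\ ~~ exdir o 2%N (n - 2).
Proof.
move=> n2; have e : exed n m l 2%N (n - 2) = aan n m l by rewrite /exed /aan; congr inord; lia.
by rewrite /exdir e.
Qed.

(** U is killed by alpha_n, whereas alpha_n is injective on the part of arm 2 at the glued vertex: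
    for n > 1 it moves that position to the preceding one, and for n = 1 it is the attaching map of
    arm 2, injective by independence. *)
Lemma exc_UW O O' (P : ix O -> ix O' -> K) : mok D O -> mok D O' -> RF O' ->
  hom (att D O) (att D O') (fmx P) -> forall u (c : cell O'), P (inl u) (inr c) = 0.
Proof.
move=> h h' rf hP u [t k].
have /hom_fmx [hg hX] := hP.
have z y : \sum_z P (inl u) z * attX D (aan n m l) z y = 0.
  by rewrite -hX big1 // => x _; rewrite mul0r.
apply/eqP; apply: contraT => nz; have /= e := hg _ _ nz.
have lk : (k < exl n m l (marm t))%N by apply: leq_trans (ltn_ord k) _; have /andP [] := h' t.
have [r2 ek] := pos_j lk (esym e).
have rt : marm t = 2 :> nat by have := ltn_ord (marm t); lia.
have [n2|n2] := ltnP 1 n.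
  have [e1 e2] := aan2 n2.
  have hk : (n - 2 < mn t)%N by have := ltn_ord k; rewrite ek; lia.
  have := z (mkc (Ordinal hk)); rewrite attX_col /= -e1 rt e2 eqxx mulr1.
  rewrite [X in X + _](_ : _ = 0) ?add0r; last first.
    case: (posnP (n - 2)) => n3; first by rewrite mulr0.
    case: (exed n m l 2%N (n - 2).-1 =P exed n m l 2%N (n - 2)) => [e3|_]; last by rewrite andbF mulr0.
    have := @exed_inj' 2%N (n - 2).-1 (n - 2) _ _ e3; rewrite /=.
    by move=> H; exfalso; have := H; lia.
  have -> : (n - 2).+1 = k by rewrite ek; lia.
  by rewrite fget_in => p0; rewrite p0 eqxx in nz.
have en : n = 1%N by lia.
have ea : aan n m l = exat n m l 2%N by rewrite /aan /exat en addn1.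
have c0 : forall t', (if marm t' == inord 2 :> 'I_3 then fget (P (inl u)) t' 0 else 0) = 0.
  apply: (rf (inord 2)) => [t' /eqP /negPf -> //|u'].
  rewrite -[RHS](z (inl u')) attX_colU //; apply: eq_bigr => t' _.
  rewrite ea /=; have ati := ok_at_inj okD.
  have -> : (exat n m l (marm t') == exat n m l 2%N) = (marm t' == inord 2).
    have := inj_eq ati (marm t') (inord 2); by rewrite /= inordK.
  by case: (marm t' == inord 2); rewrite ?mul1r ?mul0r ?mulr0.
have := c0 t; rewrite -(inj_eq val_inj) /= rt inordK // eqxx.
have k0 : k = 0%N :> nat by rewrite ek en.
by rewrite -k0 fget_in => p0; rewrite p0 eqxx in nz.
Qed.

Lemma exc_psi_mul O O' O'' (P : ix O -> ix O' -> K) (P' : ix O' -> ix O'' -> K) :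
  mok D O -> mok D O' -> RF O' -> hom (att D O) (att D O') (fmx P) ->
  fm_mul (psiP P) (psiP P') =2 psiP (fm_mul P P').
Proof.
move=> h h' rf hP u u''; rewrite /fm_mul /psiP big_sumType /= [X in _ = _ + X]big1 ?addr0 // => c _.
by rewrite (exc_UW h h' rf hP) mul0r.
Qed.

Lemma exc_iso_psi O O' : mok D O -> mok D O' -> RF O -> RF O' -> rep_iso (att D O) (att D O') ->
  exists phi psi phi' psi', [/\ phom (okl D) (O:=O) (O':=O') phi psi,
    phom (okl D) (O:=O') (O':=O) phi' psi', fm_mul psi psi' =2 @fdel K _ & fm_mul psi' psi =2 @fdel K _].
Proof.
move=> h h' rf rf' [P0 [P0' [hP eP eP']]]; have hP' := hom_inv hP eP eP'.
move: hP hP' eP eP'; rewrite -(unfmxK P0) -(unfmxK P0'); set P := unfmx P0; set P' := unfmx P0'.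
move=> hP hP'; rewrite !fm_mulE -!fmx1 => /fmx_inj eP /fmx_inj eP'.
exists (phiP P), (psiP P), (phiP P'), (psiP P'); split.
- exact: (phiP_mhom okD h h' hP).
- exact: (phiP_mhom okD h' h hP').
- by move=> u u'; rewrite (exc_psi_mul _ h h' rf' hP) /psiP eP /fdel.
- by move=> u u'; rewrite (exc_psi_mul _ h' h rf hP') /psiP eP' /fdel.
Qed.

(** By independence phi vanishes with psi, so nothing remains inside an arm. The only possible
    components lead from arm 2 to U or to arm 1, and neither U nor arm 1 is the source of a nonzero
    component. *)
Lemma exc_nil O (P : ix O -> ix O -> K) : mok D O -> RF O -> hom (att D O) (att D O) (fmx P) ->
  psiP P =2 (fun _ _ => 0) -> forall x z, fm_mul P P x z = 0.
Proof.
move=> h rf hP p0; have /hom_fmx [hg hX] := hP.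
have mm := phiP_mhom okD h h hP; have f0 := RF_phi rf mm p0.
have uz u y : P (inl u) y = 0 by case: y => [u'|c]; [exact: p0 | exact: (exc_UW h h rf hP)].
have ll t (k : 'I_(@mn _ O t)) : (k < exl n m l (marm t))%N.
  by apply: leq_trans (ltn_ord k) _; have /andP [] := h t.
have same t (k : 'I_(@mn _ O t)) t' (k' : 'I_(@mn _ O t')) : marm t = marm t' -> P (mkc k) (mkc k') = 0.
  move=> am; apply/eqP; apply: contraT => nz; have /= e := hg _ _ nz.
  have ek : k = k' :> nat.
    have := pos_eq (ll t k) (ll t' k') (ltn_ord _) (ltn_ord _) e.
    by rewrite -am; case=> [[_ //]|[e1 e2 _]|[e1 e2 _]]; rewrite e1 in e2.
  have := f0 t t'; rewrite /phiP am eqxx -(Pg_const okD h h hP am (ltn_ord k)) ?ek //.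
  by rewrite -ek (Pg_in P ek) => p; rewrite p eqxx in nz.
(* At the vertex c, gamma sends arm 1 into U but moves arm 2 one position further to the glued
   vertex. As P vanishes on U, the component at c is zero, and it is carried along the common edges
   to the other positions. *)
have ca t (k : 'I_(@mn _ O t)) t' (k' : 'I_(@mn _ O t')) : marm t = 1 :> nat -> marm t' = 2 :> nat ->
    P (mkc k) (mkc k') = 0.
  move=> a1 a2; apply/eqP; apply: contraT => nz; have /= e := hg _ _ nz.
  have ek : k' = (n + k)%N :> nat.
    have := pos_eq (ll t k) (ll t' k') (ltn_ord _) (ltn_ord _) e.
    by rewrite a1 a2; case=> [[]|[]|[]].
  suff H : forall q (h1 : (q < @mn _ O t)%N) (h2 : (n + q < @mn _ O t')%N),
      P (mkc (Ordinal h1)) (mkc (Ordinal h2)) = 0.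
    have h2 : (n + k < @mn _ O t')%N by rewrite -ek.
    have := H k (ltn_ord k) h2; rewrite (_ : Ordinal (ltn_ord k) = k); last exact: val_inj.
    by rewrite (_ : Ordinal h2 = k') => [p|]; [rewrite p eqxx in nz | apply: val_inj; rewrite /= ek].
  have al1 : forall q, (q < @mn _ O t)%N -> (q < l.+1)%N.
    by move=> q hq; apply: leq_trans hq _; have /andP [_] := h t; rewrite /= a1.
  have al2 : forall q, (q < @mn _ O t')%N -> (q < (n + l).+1)%N.
    by move=> q hq; apply: leq_trans hq _; have /andP [_] := h t'; rewrite /= a2.
  have ed12 q : exed n m l 1%N q = exed n m l 2%N (n + q) by rewrite /exed; congr inord; lia.
  elim=> [|q IH] h1 h2.
    have g : (n.-1 < @mn _ O t')%N by lia.
    have := hX (exat n m l 1%N) (mkc (Ordinal h1)) (mkc (Ordinal g)).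
    rewrite attX_row attX_col /= a1 a2 eqxx mul1r mul0r addr0 [X in X + _]big1; last by move=> u _; rewrite uz mulr0.
    rewrite add0r [LHS](_ : _ = 0); last first.
      have [h3|h3] := ltnP 1 (@mn _ O t); last by rewrite fget_out ?mulr0.
      rewrite [_ == exat _ _ _ _]eq_sym (introF eqP (exat_ed' (al1 1%N h3 : (1 < exl n m l 1%N)%N))).
      by rewrite andbF mul0r.
    rewrite [X in _ = X + _](_ : _ = 0) ?add0r; last first.
      case: (posnP n.-1) => n3; first by rewrite mulr0.
      case: (exed n m l 2%N n.-1.-1 =P exat n m l 1%N) => [e3|_]; last by rewrite andbF mulr0.
      move/(congr1 (@nat_of_ord _)): e3; rewrite exatE' exedE' /=; lia.
    have ee : exed n m l 2%N n.-1 = exat n m l 1%N by rewrite /exed /exat; congr inord; lia.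
    rewrite ee eqxx /exdir ee (negPf (_ : ~~ o (exat n m l 1%N))) ?mulr1; last first.
      by rewrite exat_o.
    rewrite prednK // -{1}(addn0 n) -[(n + 0)%N]/(val (Ordinal h2)) fget_in => <- //.
  have g1 : (q < @mn _ O t)%N by lia. have g2 : (n + q < @mn _ O t')%N by lia.
  rewrite -(IH g1 g2).
  have e1 : (q.+1 < exl n m l 1%N)%N := al1 _ h1.
  have h2' : ((n + q).+1 < @mn _ O t')%N by rewrite -addnS.
  have e2 : ((n + q).+1 < exl n m l 2%N)%N := al2 _ h2'.
  have eO : Ordinal h2 = Ordinal h2' by apply: val_inj; rewrite /= addnS.
  have dE : exdir o 1%N q = exdir o 2%N (n + q) by rewrite /exdir ed12.
  rewrite eO; case: (boolP (exdir o 1%N q)) => dq.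
    have := hX (exed n m l 1%N q) (mkc (Ordinal g1)) (mkc (Ordinal h2')).
    rewrite attX_row attX_col /= a1 a2 dq -dE dq ed12 !eqxx /= mul1r mulr1.
    rewrite -!ed12 [\sum_u mg t u * _]big1 ?mulr0 ?add0r; last by move=> u _; rewrite uz mulr0.
    rewrite [X in _ + X](_ : _ = 0) ?addr0; last first.
      case: (posnP q) => q0; first by rewrite mul0r.
      by rewrite (exed_pn e1 q0) andbF mul0r.
    rewrite -[q.+1]/(val (Ordinal h1)) fget_in => ->.
    rewrite [X in _ + X](_ : _ = 0) ?addr0; last first.
      have [h3|h3] := ltnP (n + q).+2 (@mn _ O t'); last by rewrite fget_out ?mul0r.
      have h4 : ((n + q).+2 < exl n m l 2%N)%N := al2 _ h3.
      by rewrite ed12 (exed_sn h4) andbF mulr0.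
    by rewrite -[(n + q)%N]/(val (Ordinal g2)) fget_in.
  have := hX (exed n m l 1%N q) (mkc (Ordinal h1)) (mkc (Ordinal g2)).
  rewrite attX_row attX_col /= a1 a2 -dE (negPf dq) eqxx ed12 eqxx /= mul1r mulr1.
  rewrite -[q]/(val (Ordinal g1)) fget_in -[(n + q).+1]/(val (Ordinal h2')) fget_in.
  rewrite mul0r add0r [X in X + _](_ : _ = 0) ?add0r; last first.
    have [h3|h3] := ltnP q.+2 (@mn _ O t); last by rewrite fget_out ?mulr0.
    have h4 : (q.+2 < exl n m l 1%N)%N := al1 _ h3.
    by rewrite -ed12 (exed_sn h4) andbF mul0r.
  move=> ->; rewrite [X in X + _](_ : _ = 0) ?add0r //.
  case: (posnP (n + q)) => q0; first by rewrite mulr0.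
  by rewrite (exed_pn e2 q0) andbF mulr0.
move=> x z; rewrite /fm_mul big1 // => y _.
case: x => [u|[t k]]; first by rewrite uz mul0r.
case: y => [u|[t' k']]; first by rewrite uz mulr0.
have [->|nz] := eqVneq (P (inr (existT _ t k)) (inr (existT _ t' k'))) 0; first by rewrite mul0r.
have /= e := hg _ _ nz.
case: (pos_eq (ll t k) (ll t' k') (ltn_ord _) (ltn_ord _) e) => [[ea _]|[a1 a2 _]|[a2 a1 _]].
- by have := same t k t' k' (val_inj ea) => p; rewrite p eqxx in nz.
- by have := ca t k t' k' a1 a2 => p; rewrite p eqxx in nz.
case: z => [u|[t'' k'']].
  have [->|nz'] := eqVneq (P (inr (existT _ t' k')) (inl u)) 0; first by rewrite mulr0.
  by have /= := hg _ _ nz' => /(pos_j (ll t' k')) [r2 _]; rewrite a1 in r2.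
have [->|nz'] := eqVneq (P (inr (existT _ t' k')) (inr (existT _ t'' k''))) 0; first by rewrite mulr0.
have /= e' := hg _ _ nz'.
case: (pos_eq (ll t' k') (ll t'' k'') (ltn_ord _) (ltn_ord _) e') => [[ea _]|[b1 b2 _]|[b2 b1 _]].
- by have := same t' k' t'' k'' (val_inj ea) => p; rewrite p eqxx in nz'.
- by have := ca t' k' t'' k'' b1 b2 => p; rewrite p eqxx in nz'.
- by rewrite a1 in b2.
Qed.

(** For an idempotent P the part on U is an idempotent psi, by multiplicativity. If psi = 0 then P =
    P^2 = 0; if psi = 1 the same applies to 1 - P. *)
Lemma exc_indec O : mok D O -> RF O -> inhabited (mU O) ->
  (forall phi psi, phom (okl D) (O:=O) (O':=O) phi psi -> fm_mul psi psi =2 psi ->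
     psi =2 (fun _ _ => 0) \/ psi =2 @fdel K _) -> indec (att D O).
Proof.
move=> h rf [u0] H; have key (P : ix O -> ix O -> K) : hom (att D O) (att D O) (fmx P) ->
    fm_mul P P =2 P -> psiP P =2 (fun _ _ => 0) -> fmx P = 0.
  move=> hP PP p0; rewrite -(fmx0 K (ix O) (ix O)); apply: eq_fmx => x z.
  by rewrite -PP; apply: exc_nil.
split; first by apply/card_gt0P; exists (inl u0).
move=> P0; rewrite -(unfmxK P0); set P := unfmx P0 => hP; rewrite fm_mulE => /fmx_inj PP.
have mm := phiP_mhom okD h h hP.
case: (H _ _ mm) => [u u'|p0|p1].
- by rewrite (exc_psi_mul _ h h rf hP) /psiP PP.
- by left; apply: key.
right; pose R : ix O -> ix O -> K := fun x z => fdel K x z - P x z.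
have eR : fmx R = 1%:M - fmx P.
  by rewrite -fmx1; apply/matrixP => i j; rewrite !mxE /R /fdel.
have hR : hom (att D O) (att D O) (fmx R) by rewrite eR; apply: hom_sub hP; apply: hom_id.
have PP' : fmx P *m fmx P = fmx P by rewrite fm_mulE; apply: eq_fmx.
have RR : fm_mul R R =2 R.
  apply: fmx_inj; rewrite -fm_mulE eR mulmxBl mul1mx mulmxBr mulmx1 PP' subrr subr0 //.
apply/eqP; rewrite eq_sym -subr_eq0 -eR; apply/eqP; apply: key => // u u'.
by rewrite /psiP /R -[P _ _]/(psiP P u u') p1 /fdel (inj_eq (@inl_inj _ _)) subrr.
Qed.

End ExcHom.

(** The last clause concerns the actual labels of the copies of the vector tc; it is through raised
    labels that a new subspace constrains p. *)
Definition spec1 (tb : tbl) (tc : nat) : Prop := forall (K : fieldType) h h' (Theta : 'M[K]_h) (Theta' : 'M[K]_h')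
  lb lb' (phi : mT (tabO tb 1%:M Theta lb) -> mT (tabO tb 1%:M Theta' lb') -> K) psi,
  lbok tb lb lb' -> phom ole phi psi ->
  exists p : 'M_(h, h'), [/\ forall u i u' j, psi (u, i) (u', j) = if u == u' then p i j else 0,
    Theta *m p = p *m Theta' & forall i j, p i j != 0 -> (lb tc i <= lb' tc j)%N].

Lemma Pt_lab (tb : tbl) tc (K : fieldType) h h' (Phi Theta : 'M[K]_h) (Phi' Theta' : 'M[K]_h')
  lb lb' (phi : mT (tabO tb Phi Theta lb) -> mT (tabO tb Phi' Theta' lb') -> K) psi p :
  phom ole phi psi -> Pt phi tc tc = p -> forall i j, p i j != 0 -> (lb tc i <= lb' tc j)%N.
Proof.
move=> [h1 _] <- i j; rewrite mxE; case: insubP => [t _ et|]; last by rewrite eqxx.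
by move/h1 => [_ /=]; rewrite /ole et.
Qed.

Lemma spec1_8 : spec1 tE8 7.
Proof.
move=> K h h' Theta Theta' lb lb' phi psi hl H; have [p [p6 [d e1 e2 t]]] := spec8 hl H.
rewrite mul1mx mulmx1 in e1; subst p6; exists p; split=> //; last exact: Pt_lab H t.
by move=> u i u' j; rewrite d if_same.
Qed.

Lemma spec1_7 : spec1 tE7 5.
Proof.
move=> K h h' Theta Theta' lb lb' phi psi hl H; have [p [p6 [d e1 e2 t]]] := spec7 hl H.
rewrite mul1mx mulmx1 in e1; subst p6; exists p; split=> //; last exact: Pt_lab H t.
by move=> u i u' j; rewrite d if_same.
Qed.

Lemma spec1_6 : spec1 tE6 4.
Proof.
move=> K h h' Theta Theta' lb lb' phi psi hl H; have [p [d e2 t]] := spec6 hl H.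
exists p; split=> //; last exact: Pt_lab H t.
by move=> u i u' j; rewrite d if_same.
Qed.

Lemma piso_reindex (K : fieldType) (ol : 'I_3 -> nat -> nat -> bool) (O O' : mobj K) (al : mU O -> mU O') (al' : mU O' -> mU O)
  (be : mT O -> mT O') (be' : mT O' -> mT O) : (forall r k, ol r k k) ->
  cancel al al' -> cancel al' al -> cancel be be' -> cancel be' be ->
  (forall t, marm (be t) = marm t) -> (forall t, mn (be t) = mn t) ->
  (forall t u, mg (be t) (al u) = mg t u) -> piso ol O O'.
Proof.
move=> olr k1 k2 k3 k4 e1 e2 e3.
have fd (I J : finType) (f : I -> J) (g : J -> I) : cancel g f ->
  fm_mul (fun i j => (f i == j)%:R) (fun j i => (g j == i)%:R) =2 (fun i i' => (g (f i) == i')%:R : K).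
  move=> c i i'; rewrite /fm_mul (bigD1 (f i)) //= eqxx mul1r big1 ?addr0 // => j ji.
  by rewrite eq_sym (negPf ji) mul0r.
exists (fun t t' => (be t == t')%:R), (fun u u' => (al u == u')%:R),
  (fun t' t => (be' t' == t)%:R), (fun u' u => (al' u' == u)%:R); split.
- split=> [t t'|t u'].
    by case: (be t =P t') => [<- _|_]; rewrite ?eqxx // e1 e2 olr.
  rewrite (bigD1 (be t)) //= eqxx mul1r big1 ?addr0; last first.
    by move=> t' tt; rewrite eq_sym (negPf tt) mul0r.
  rewrite (bigD1 (al' u')) //= k2 eqxx mulr1 big1 ?addr0 -?e3 ?k2 // => u uu.
  by case: (al u =P u') => [e|_]; [by rewrite -e k1 eqxx in uu | rewrite mulr0].
- split=> [t t'|t u'].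
    by case: (be' t =P t') => [<- _|_]; rewrite ?eqxx // -(e1 (be' t)) -(e2 (be' t)) k4 olr.
  rewrite (bigD1 (be' t)) //= eqxx mul1r big1 ?addr0; last first.
    by move=> t' tt; rewrite eq_sym (negPf tt) mul0r.
  rewrite (bigD1 (al u')) //= k1 eqxx mulr1 big1 ?addr0; first by rewrite -e3 k4.
  by move=> u uu; case: (al' u =P u') => [e|_]; [by rewrite -e k2 eqxx in uu | rewrite mulr0].
- by split=> i j; rewrite fd // /fdel ?k1 ?k3.
- by split=> i j; rewrite fd // /fdel ?k2 ?k4.
Qed.

Lemma rep_reindex (Q : bquiver) (K : fieldType) (M : rep Q K) (J : finType) (c : J -> 'I_(rdim M))
  (c' : 'I_(rdim M) -> J) (e : qV Q -> J -> J -> K) (X : qA Q -> J -> J -> K) :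
  cancel c c' -> cancel c' c -> (forall v x y, re M v (c x) (c y) = e v x y) ->
  (forall a x y, rX M a (c x) (c y) = X a x y) ->
  rep_iso M (@Rep Q K #|J| (fun v => fmx (e v)) (fun a => fmx (X a))).
Proof.
move=> k1 k2 he hX.
have bij : {on predT, bijective c} by apply: onW_bij; exists c'.
have H (A : 'M_(rdim M)) (f : J -> J -> K) : (forall x y, A (c x) (c y) = f x y) ->
    forall i, delta_mx 0 (c i) *m A = \sum_j f i j *: delta_mx 0 (c j) :> 'rV_(rdim M).
  move=> h i; rewrite -rowE; apply/rowP => q; rewrite summxE mxE (bigD1 (c' q)) //= big1 ?addr0.
    by rewrite !mxE k2 !eqxx mulr1 -h k2.
  move=> j jq; rewrite !mxE eqxx /=; case: eqP => [e0|_]; last by rewrite mulr0.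
  by rewrite e0 k1 eqxx in jq.
apply: (@basis_iso Q K M J (fun j => delta_mx 0 (c j)) (fun j => delta_mx (c j) 0)).
- move=> i j; rewrite mul_delta_mx_cond (can_eq k1); case: (i == j); last by rewrite mulr0n raddf0.
  by rewrite mulr1n; apply/matrixP => a b; rewrite !ord1 !mxE.
- transitivity (\sum_q (delta_mx q q : 'M[K]_(rdim M))); last first.
    by rewrite -mx1_sum_delta.
  rewrite [RHS](reindex c) //=; apply: eq_bigr => j _; by rewrite mul_delta_mx.
- by move=> i v; apply: H.
- by move=> i a; apply: H.
Qed.

Section FamExc.
Variables (n m l : nat) (o : 'I_(m + n + l).+2 -> bool).
Hypothesis n1 : (0 < n)%N.
Hypotheses (ob : o (inord m)) (oa1 : ~~ o (inord m.+1)) (oan : ~~ o (inord (m + n)))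
  (oc : ~~ o (inord (m + n).+1)).
Notation D := (excD o).
Variables (tb : tbl) (tc : nat) (la : 'I_3 -> nat) (s s' : 'I_3 -> 'I_3).
Hypotheses (ck : tcheck tb) (sp : spec1 tb tc) (tu0 : (0 < tu tb)%N)
  (ss' : cancel s s') (s's : cancel s' s) (hla : forall r, al D (s r) = (la r).+1).

Section Fld.
Variable K : fieldType.

Definition Fobj h (Theta : 'M[K]_h) lb : mobj K := ex D s (tabO tb 1%:M Theta lb).
Notation C Theta lb := (tabO tb 1%:M Theta lb).

Lemma RF_ex (O : mobj K) : RF O -> RF (ex D s O).
Proof.
move=> rf r c hr hc; apply: (rf (s' r)) => // t ne; apply: hr => /= e.
by apply: ne; rewrite -e ss'.
Qed.

Lemma tab_mul h h' h'' (p : 'M[K]_(h, h')) (p' : 'M[K]_(h', h''))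
   (psi : 'I_(tu tb) * 'I_h -> 'I_(tu tb) * 'I_h' -> K) psi' :
  (forall u i u' j, psi (u, i) (u', j) = if u == u' then p i j else 0) ->
  (forall u i u' j, psi' (u, i) (u', j) = if u == u' then p' i j else 0) ->
  forall u i u' j, fm_mul psi psi' (u, i) (u', j) = if u == u' then (p *m p') i j else 0.
Proof.
move=> e e' u i u' j; rewrite /fm_mul.
transitivity (\sum_(v < tu tb) \sum_(k < h') psi (u, i) (v, k) * psi' (v, k) (u', j)).
  by rewrite pair_bigA; apply: eq_bigr => [[]].
rewrite (bigD1 u) //= [X in _ + X]big1 ?addr0; last first.
  by move=> v vu; rewrite big1 // => k _; rewrite e eq_sym (negPf vu) mul0r.
case: ifP => uu.
  by rewrite mxE; apply: eq_bigr => k _; rewrite e e' eqxx uu.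
by rewrite big1 // => k _; rewrite e' uu mulr0.
Qed.

Lemma F_phom h h' (Theta : 'M[K]_h) (Theta' : 'M[K]_h') lb lb' phi psi :
  mok (starD la) (C Theta lb) -> mok (starD la) (C Theta' lb') -> lbok tb lb lb' ->
  phom (okl D) (O:=Fobj Theta lb) (O':=Fobj Theta' lb') phi psi ->
  exists p : 'M_(h, h'), [/\ forall u i u' j, psi (u, i) (u', j) = if u == u' then p i j else 0,
    Theta *m p = p *m Theta' & forall i j, p i j != 0 -> (lb tc i <= lb' tc j)%N].
Proof.
move=> h1 h2 hl H; apply: (sp hl (phi := phi)).
have /(ex_phom ss' hla _ _ h1 h2) [H1 H2] := H.
by split=> // t t' /H1 [a]; rewrite star_okl.
Qed.

Lemma F_iso h h' (Theta : 'M[K]_h) (Theta' : 'M[K]_h') lb lb' :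
  mok (starD la) (C Theta lb) -> mok (starD la) (C Theta' lb') -> lbok tb lb lb' -> lbok tb lb' lb ->
  rep_iso (att D (Fobj Theta lb)) (att D (Fobj Theta' lb')) ->
  exists (p : 'M_(h, h')) (p' : 'M_(h', h)), [/\ p *m p' = 1%:M, p' *m p = 1%:M, Theta *m p = p *m Theta',
    forall i j, p i j != 0 -> (lb tc i <= lb' tc j)%N & forall i j, p' i j != 0 -> (lb' tc i <= lb tc j)%N].
Proof.
move=> h1 h2 l1 l2 iso.
have m1 := ex_mok hla h1; have m2 := ex_mok hla h2.
have [phi [psi [phi' [psi' [H H' e e']]]]] := exc_iso_psi n1 ob oa1 oan oc m1 m2
  (RF_ex (@tab_RF _ ck _ _ _ _ _)) (RF_ex (@tab_RF _ ck _ _ _ _ _)) iso.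
have [p [d t b]] := F_phom h1 h2 l1 H; have [p' [d' t' b']] := F_phom h2 h1 l2 H'.
exists p, p'; split=> //.
  apply/matrixP => i j; have := tab_mul d d' (Ordinal tu0) i (Ordinal tu0) j.
  by rewrite eqxx e /fdel => <-; rewrite mxE xpair_eqE eqxx.
apply/matrixP => i j; have := tab_mul d' d (Ordinal tu0) i (Ordinal tu0) j.
by rewrite eqxx e' /fdel => <-; rewrite mxE xpair_eqE eqxx.
Qed.

Lemma F_indec h (Theta : 'M[K]_h) lb : (0 < h)%N ->
  mok (starD la) (C Theta lb) -> lbok tb lb lb ->
  (forall p : 'M_h, p *m p = p -> Theta *m p = p *m Theta ->
     (forall i j, p i j != 0 -> (lb tc i <= lb tc j)%N) -> p = 0 \/ p = 1%:M) ->
  indec (att D (Fobj Theta lb)).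
Proof.
move=> h0 h1 l1 H; apply: (exc_indec n1 ob oa1 oan oc).
- by have := ex_mok hla h1.
- by apply: RF_ex; apply: tab_RF.
- by split; exact: (Ordinal tu0, Ordinal h0).
move=> phi psi ph e; have [p [d t b]] := F_phom h1 h1 l1 ph.
have pp : p *m p = p.
  apply/matrixP => i j; have := tab_mul d d (Ordinal tu0) i (Ordinal tu0) j.
  by rewrite eqxx e d eqxx => <-.
case: (H p pp t b) => [p0|p1].
  by left=> [[u i] [u' j]]; rewrite d p0 mxE if_same.
right=> [[u i] [u' j]]; rewrite d.
by rewrite p1 mxE /fdel xpair_eqE; case: (u == u').
Qed.

End Fld.
End FamExc.

(** * Wildness *)

Section NCFunctor.
Variables (K : fieldType) (Q : bquiver) (D : attq Q).
Variables (O : mobj K) (G : mT O -> mU O -> ncexpr K).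

Definition ncX (a : qA Q) (x y : ix O) : ncexpr K :=
  match x, y with
  | inl _, _ => NCc 0
  | inr c, inl u => if (tagged c == 0 :> nat) && (aat D (marm (tag c)) == a) then G (tag c) u else NCc 0
  | inr c, inr c' => NCc (cstep D a c c')
  end.
Definition ncPe v (i j : 'I_#|{: ix O}|) : ncexpr K := NCc (atte D (R := K) v (enum_val i) (enum_val j)).
Definition ncPX a (i j : 'I_#|{: ix O}|) : ncexpr K := ncX a (enum_val i) (enum_val j).

Variables (s : nat) (X Y : 'M[K]_s).

(** Evaluation at (X, Y) replaces each basis element by s copies; [bto] and [bof] translate between
    these indices and the block numbering of [mxblock]. *)
Definition blk : mobj K := @MObj K (mU O * 'I_s)%type (mT O * 'I_s)%type
  (fun t => marm t.1) (fun t => mn t.1) (fun t u => nceval X Y (G t.1 u.1) t.2 u.2).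

Definition bpr (x : ix blk) : ix O * 'I_s :=
  match x with inl (u, i) => (inl u, i) | inr (existT (t, i) k) => (@mkc _ O t k, i) end.
Definition bin (p : ix O * 'I_s) : ix blk :=
  match p.1 with inl u => inl (u, p.2) | inr (existT t k) => @mkc _ blk (t, p.2) k end.

Lemma bprK : cancel bpr bin. Proof. by case=> [[u i]|[[t i] k]]. Qed.
Lemma binK : cancel bin bpr. Proof. by case=> [[u|[t k]] i]. Qed.

Definition sm : 'I_#|{: ix O}| -> nat := fun _ => s.
Definition bto (x : ix blk) : 'I_(\sum_(i < #|{: ix O}|) s) :=
  @tagnat.Rank _ sm (enum_rank (bpr x).1) (bpr x).2.
Definition bof (k : 'I_(\sum_(i < #|{: ix O}|) s)) : ix blk :=
  bin (enum_val (tag (@tagnat.sig _ sm k)), tagged (@tagnat.sig _ sm k)).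

Lemma btoK : cancel bto bof.
Proof.
move=> x; rewrite /bof /bto /tagnat.Rank tagnat.rankK /= enum_rankK.
by rewrite -[RHS]bprK; case: (bpr x).
Qed.

Lemma bofK : cancel bof bto.
Proof.
move=> k; rewrite /bof /bto binK /= enum_valK.
by rewrite -[RHS](@tagnat.sigK _ sm) tagnat.rankE.
Qed.

Lemma nc_entry P x y : ncsubst P X Y (bto x) (bto y) =
  nceval X Y (P (enum_rank (bpr x).1) (enum_rank (bpr y).1)) (bpr x).2 (bpr y).2.
Proof.
rewrite /ncsubst /mxblock mxE /tagnat.sig1 /tagnat.sig2.
by rewrite (@tagnat.rankK _ sm) (@tagnat.rankK _ sm).
Qed.

Lemma nc_iso : rep_iso (nc_functor ncPe ncPX X Y) (att D blk).
Proof.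
apply: (@rep_reindex Q K (nc_functor ncPe ncPX X Y) (ix blk) bto bof
  (fun v => atte D v) (fun a => attX D a) btoK bofK) => [v x y|a x y].
- rewrite /= nc_entry /= !enum_rankK mxE /atte -(can_eq bprK).
  have -> : ixgr D (bpr x).1 = ixgr D x by case: x => [[u i]|[[t i] k]].
  rewrite [in RHS](surjective_pairing (bpr x)) (surjective_pairing (bpr y)) xpair_eqE.
  by case: (_ == _); case: (_ == _ :> 'I_s); case: (_ == _); rewrite ?mulr1n ?mulr0n.
- rewrite /= nc_entry /ncPX !enum_rankK.
  case: x => [[u i]|[[t i] k]]; first by rewrite /= !mxE mul0rn.
  case: y => [[u j]|[[t' j] k']] /=.
    by case: ifP => _; rewrite ?mul1r // mxE !mul0r mul0rn.
  rewrite mxE /cstep /= -![_ == _ :> mT O * 'I_s]/((_ == _) && (_ == _)) /=.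
  by case: (i == j); rewrite ?mulr1n ?mulr0n ?andbT // ?andbF /= addr0.
Qed.

Lemma nc_rep : attq_ok D -> mok D O -> is_rep (nc_functor ncPe ncPX X Y).
Proof.
by move=> okD h; apply: iso_rep (iso_sym nc_iso) _; apply: (att_rep okD) => t; apply: h.
Qed.

End NCFunctor.

Section WildExc.
Variables (n m l : nat) (o : 'I_(m + n + l).+2 -> bool).
Hypothesis n1 : (0 < n)%N.
Hypotheses (ob : o (inord m)) (oa1 : ~~ o (inord m.+1)) (oan : ~~ o (inord (m + n)))
  (oc : ~~ o (inord (m + n).+1)).
Notation D := (excD o).
Variables (tb : tbl) (tc : nat) (la : 'I_3 -> nat) (s s' : 'I_3 -> 'I_3).
Hypotheses (ck : tcheck tb) (sp : spec1 tb tc) (tu0 : (0 < tu tb)%N)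
  (ss' : cancel s s') (s's : cancel s' s) (hla : forall r, al D (s r) = (la r).+1).
Hypothesis top : forall t, tarm tb t = tarm tb tc -> (tlab tb t <= tlab tb tc)%N.
Hypothesis fit : forall t, (t < tt tb)%N ->
  (0 < tlab tb t)%N && (tlab tb t + (t == tc) <= (la (inord (tarm tb t))).+1)%N.
Let okD := exc_ok n1 ob oa1 oan oc.
Variable K : fieldType.

(** Of the two halves of each block, only the first one receives a larger label, and only at the
    vector tc; this marks the first half of V as the subspace on the added vertex. *)
Definition wlb (t : nat) (e : bool) : nat := (tlab tb t + ((t == tc) && e))%N.
Definition wO : mobj K := ex D s (@MObj K ('I_(tu tb) * bool)%type ('I_(tt tb) * bool)%type
  (fun t => inord (tarm tb t.1)) (fun t => wlb t.1 t.2) (fun _ _ => 0)).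
(** Theta is the 2 x 2 matrix with rows (x, 1) and (y, 0) over the free algebra, and Phi is the
    identity. *)
Definition wG (t : mT wO) (u : mU wO) : ncexpr K :=
  match tG tb t.1 u.1 with
  | 0 => NCc 0 | 1 => NCc (t.2 == u.2)%:R | 2 => NCc (t.2 == u.2)%:R
  | _ => if t.2 then (if u.2 then NCx K else NCc 1) else (if u.2 then NCy K else NCc 0) end.

Definition wle q (t : nat) (k : 'I_(q + q)) : nat := wlb t (k < q)%N.
Arguments wle : clear implicits.
Definition wTh q (X Y : 'M[K]_q) : 'M[K]_(q + q) := block_mx X 1%:M Y 0.

Definition wk q (e : bool) (i : 'I_q) : 'I_(q + q) := if e then lshift q i else rshift q i.
Definition wki q (k : 'I_(q + q)) : bool * 'I_q :=
  match split k with inl i => (true, i) | inr i => (false, i) end.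
Lemma wkK q e (i : 'I_q) : wki (wk e i) = (e, i).
Proof. by case: e; rewrite /wki /wk -?[lshift _ _]/(unsplit (inl _)) -?[rshift _ _]/(unsplit (inr _)) unsplitK. Qed.
Lemma wkiK q (k : 'I_(q + q)) : wk (wki k).1 (wki k).2 = k.
Proof. by rewrite /wki -[RHS]splitK; case: split. Qed.

Lemma wlb_ok q q' : lbok tb (wle q) (wle q').
Proof.
move=> t i t' i' e; rewrite /wle /wlb; have [e1|_] := eqVneq t' tc; last first.
  by rewrite addn0; apply: leq_trans; apply: leq_addr.
by move=> _; rewrite e1; apply: top; rewrite e e1.
Qed.

Lemma wstar_mok h (Theta : 'M[K]_h) (lb : nat -> 'I_h -> nat) :
  (forall t i, exists e, lb t i = wlb t e) -> mok (starD la) (tabO tb 1%:M Theta lb).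
Proof.
move=> hl [t i]; rewrite /=; have [e ->] := hl t i; have /andP [f1 f2] := fit (ltn_ord t).
rewrite /wlb (leq_trans f1) ?leq_addr //=; apply: leq_trans f2.
by rewrite leq_add2l; case: (_ == tc); case: e.
Qed.

Lemma w_mok q (X Y : 'M[K]_q) : mok (starD la) (tabO tb 1%:M (wTh X Y) (wle q)).
Proof. by apply: wstar_mok => t i; exists (i < q)%N. Qed.

Lemma wO_mok : mok D wO.
Proof.
apply: (ex_mok hla) => [[t e]] /=; have /andP [f1 f2] := fit (ltn_ord t).
rewrite /wlb (leq_trans f1) ?leq_addr //=; apply: leq_trans f2.
by rewrite leq_add2l; case: (_ == tc); case: e.
Qed.

Lemma w_iso q (X Y : 'M[K]_q) :
  rep_iso (nc_functor (ncPe D (O:=wO)) (ncPX D wG) X Y)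
          (att D (Fobj o tb s (wTh X Y) (wle q))).
Proof.
have m1 : mok D (blk wG X Y) by move=> t; apply: wO_mok.
have m2 : mok D (Fobj o tb s (wTh X Y) (wle q)) by have := ex_mok hla (@w_mok q X Y).
refine (iso_trans (nc_iso D wG X Y) (piso_att m1 m2 _)).
pose f I (x : (I * bool) * 'I_q) : I * 'I_(q + q) := (x.1.1, wk x.1.2 x.2).
pose g I (x : I * 'I_(q + q)) : (I * bool) * 'I_q := ((x.1, (wki x.2).1), (wki x.2).2).
have fg I : cancel (@f I) (@g I) by move=> [[u e] i]; rewrite /f /g /= wkK.
have gf I : cancel (@g I) (@f I) by move=> [u k]; rewrite /f /g /= wkiK.
apply: (@piso_reindex K _ (blk wG X Y) (Fobj o tb s (wTh X Y) (wle q)) (@f _) (@g _) (@f _) (@g _)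
  (okl_refl D) (fg _) (gf _) (fg _) (gf _)) => //.
- move=> [[t e] i] /=; congr (lab _ _ _); rewrite /wle; congr wlb.
  by case: e => /=; [rewrite ltn_ord | apply/negbTE; rewrite -leqNgt leq_addr].
move=> [[t e] i] [[u e'] j] /=; rewrite /wG /=.
have W : (1%:M : 'M[K]_(q + q)) (wk e i) (wk e' j) = ((e == e')%:R)%:M i j.
  by rewrite /wk !mxE; case: e; case: e'; rewrite ?eq_lshift ?eq_rshift ?eq_lrshift ?eq_rlshift /= ?mul0rn.
case: (tG tb t u) => [|[|[|c]]] /=; rewrite /wTh /wk.
- by rewrite !mxE mul0rn.
- exact: W.
- exact: W.
- by clear W; case: e; case: e'; rewrite ?block_mxEul ?block_mxEur ?block_mxEdl ?block_mxEdr /= ?raddf0.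
Qed.

(** The raised labels force the upper right block of p to vanish. Comparing the second block columns
    of the commutation relation then gives equal diagonal blocks a and a zero lower left block; the
    first columns say that a intertwines (X, Y) with (X', Y'). *)
Lemma w_hom q q' (X Y : 'M[K]_q) (X' Y' : 'M[K]_q') (p : 'M_(q + q, q' + q')) :
  wTh X Y *m p = p *m wTh X' Y' ->
  (forall i j, p i j != 0 -> (wle q tc i <= wle q' tc j)%N) ->
  exists a : 'M_(q, q'), [/\ p = block_mx a 0 0 a, X *m a = a *m X' & Y *m a = a *m Y'].
Proof.
move=> e hp; have u0 : ursubmx p = 0.
  apply/matrixP => i j; rewrite !mxE; apply/eqP; apply: contraT => /hp.
  by rewrite /wle /wlb eqxx /= ltn_ord ltnNge leq_addr /= addn1 addn0 ltnn.
move: e; rewrite -(submxK p) u0 /wTh !mulmx_block !(mul1mx, mulmx1, mul0mx, mulmx0, addr0, add0r).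
move=> /eq_block_mx [e1 e2 e3 e4]; exists (ulsubmx p).
by move: e1 e3; rewrite -e4 -e2 mul0mx addr0 add0r.
Qed.

Lemma wild_exc : wild K (exc_alg o).
Proof.
exists #|{: ix wO}|, (ncPe D (O:=wO)), (ncPX D wG); split=> [q X Y|q X Y [q0 hi]|q X Y q' X' Y' iso].
- by apply: nc_rep; [exact: okD | exact: wO_mok].
- apply: iso_indec (iso_sym (w_iso X Y)) _.
  apply: (F_indec n1 ob oa1 oan oc ck sp tu0 ss' hla).
  + by rewrite addn_gt0 q0.
  + exact: w_mok.
  + exact: wlb_ok.
  move=> p pp e hp; have [a [pa e1 e2]] := w_hom e hp.
  have aa : a *m a = a.
    move: pp; rewrite pa mulmx_block !(mul0mx, mulmx0, addr0, add0r).
    by case/eq_block_mx.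
  have ha : hom (kxy_mod X Y) (kxy_mod X Y) a.
    by split=> [v|[]] //=; rewrite ?mul1mx ?mulmx1.
  case: (hi a ha aa) => a1; [left|right]; rewrite pa a1; first by rewrite block_mx0.
  by rewrite -scalar_mx_block.
have := iso_trans (iso_sym (w_iso X Y)) (iso_trans iso (w_iso X' Y')).
move/(F_iso n1 ob oa1 oan oc ck sp tu0 ss' hla (@w_mok q X Y) (@w_mok q' X' Y') (@wlb_ok q q') (@wlb_ok q' q)).
move=> [p [p' [e1 e2 t h h']]]; have [a [pa e3 e4]] := w_hom t h.
have t' : wTh X' Y' *m p' = p' *m wTh X Y.
  by rewrite -[LHS]mul1mx -e2 -mulmxA [X in _ *m X]mulmxA -t -!mulmxA e1 mulmx1.
have [b [pb e5 e6]] := w_hom t' h'.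
exists a, b; split.
- by split=> [v|[]] //=; rewrite ?mul1mx ?mulmx1.
- by move: e1; rewrite pa pb mulmx_block !(mul0mx, mulmx0, addr0, add0r) scalar_mx_block => /eq_block_mx [].
- by move: e2; rewrite pa pb mulmx_block !(mul0mx, mulmx0, addr0, add0r) scalar_mx_block => /eq_block_mx [].
Qed.

(** The members with Phi = 1 and Theta a scalar x are indecomposable and pairwise nonisomorphic. *)
Lemma infinite_exc : mok (starD la) (tabO tb 1%:M (0 : 'M[K]_1) (fun t _ => tlab tb t)) ->
  (forall k, exists s : seq K, uniq s && (size s == k)) -> ~ rep_finite K (exc_alg o).
Proof.
move=> mk inf [k [F [Fr FP]]].
have mk' x : mok (starD la) (tabO tb 1%:M (x%:M : 'M[K]_1) (fun t _ => tlab tb t)) by [].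
have lo : lbok tb (fun t (_ : 'I_1) => tlab tb t) (fun t (_ : 'I_1) => tlab tb t) by [].
pose M x := att D (Fobj o tb s (x%:M : 'M[K]_1) (fun t _ => tlab tb t)).
have ind x : indec (M x).
  apply: (F_indec n1 ob oa1 oan oc ck sp tu0 ss' hla) => // p pp _ _.
  have : p 0 0 * p 0 0 = p 0 0 by move/matrixP/(_ 0 0): pp; rewrite !mxE big_ord1.
  move/eqP; rewrite -subr_eq0 -{3}(mulr1 (p 0 0)) -mulrBr mulf_eq0 subr_eq0.
  by case/orP => /eqP e; [left|right]; apply/matrixP => i j; rewrite !ord1 e mxE.
have rp x : is_rep (M x) by apply: (att_rep okD); apply: (ex_mok hla (mk' x)).
have ch x : exists i, rep_iso (M x) (F i) by apply: FP.
pose f x := wit (ch x).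
have fP x : rep_iso (M x) (F (f x)) := witP (ch x).
have [q /andP [uq /eqP sq]] := inf k.+1.
have inj : {in q &, injective f}.
  move=> x y _ _ e; have := fP x; rewrite e => /iso_trans /(_ (iso_sym (fP y))).
  move/(F_iso n1 ob oa1 oan oc ck sp tu0 ss' hla (mk' x) (mk' y) lo lo) => [p [p' [e1 e2 t _ _]]].
  have p0 : p <> 0 by move=> p0; move: e1; rewrite p0 mul0mx => /matrixP /(_ 0 0) /eqP; rewrite !mxE eq_sym oner_eq0.
  have : (x - y) *: p = 0 by rewrite scalerBl -mul_scalar_mx t -mul_mx_scalar subrr.
  by move/eqP; rewrite scaler_eq0 subr_eq0; clear -p0 => /orP [] /eqP // /p0.
have := uniq_leq_size (s2 := enum 'I_k) (s1 := map f q).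
rewrite map_inj_in_uniq // uq size_map sq size_enum_ord => /(_ isT) H.
by have := H (fun x _ => mem_enum _ x); rewrite ltnn.
Qed.

End WildExc.

(** * Tubes *)

Lemma sum_undup (V : eqType) (s : seq V) (F : V -> int) :
  \sum_(y <- s) F y = \sum_(y <- undup s) F y * (count_mem y s)%:Z.
Proof.
rewrite -(@big_undup_iterop_count _ _ (+%R : Monoid.com_law 0) V s xpredT F).
by apply: eq_bigr => y _; rewrite Monoid.iteropE iter_addr_0 -mulr_natr natz.
Qed.

Fact int_aux1 (a S : int) : 0 <= a + S -> S <= 0 -> a <= 0 -> a = 0 /\ 0 <= S.
Proof. lia. Qed.

Fact int_aux2 (a S : int) (b m0 : nat) : m0%:Z + (a * b%:Z + S) = 0 -> S <= 0 -> a <> 0 -> a <= 0 ->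
  (m0 <= b)%N -> (0 < m0)%N -> [/\ a = -1, b = m0 & S = 0].
Proof.
move=> E s0 a0 al h1 h2; have a1 : a <= -1 by lia.
have h : a * b%:Z <= - b%:Z by nia.
have bm : b = m0 by lia.
by subst b; have : a * m0%:Z = - m0%:Z by [lia]; move=> e; split=> //; [nia | lia].
Qed.

Lemma seq_le0_eq0 (V : eqType) (s : seq V) (F : V -> int) : (forall y, y \in s -> F y <= 0) ->
  0 <= \sum_(y <- s) F y -> forall y, y \in s -> F y = 0.
Proof.
elim: s => // a s IH h; rewrite big_cons => p.
have s0 : \sum_(y <- s) F y <= 0.
  by rewrite big_seq; apply: sumr_le0 => y ys; apply: h; rewrite inE ys orbT.
have [a0 s1] := int_aux1 p s0 (h a (mem_head _ _)).
move=> y; rewrite inE => /orP [/eqP ->|ys] //.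
by apply: IH => // z zs; apply: h; rewrite inE zs orbT.
Qed.

Section Cycle.
Variables (V : eqType) (e : V -> V -> int) (s : seq V).
Hypotheses (e1 : forall x, x \in s -> e x x = 1)
  (en : forall x y, x \in s -> y \in s -> x != y -> e x y <= 0)
  (er : forall x, x \in s -> \sum_(y <- s) e x y = 0)
  (ecl : forall t, uniq t -> {subset t <= s} -> t != [::] ->
     \sum_(x <- t) \sum_(y <- t) e x y = 0 -> {subset s <= t}).

Let m (y : V) := count_mem y s.

(** Row x of e, weighted by multiplicities, sums to zero. The diagonal contributes the least
    multiplicity m0, so a single negative term, with entry -1 and multiplicity m0, uses up the whole
    sum. *)
Lemma min_succ m0 x : x \in s -> m x = m0 -> (forall y, y \in s -> (m0 <= m y)%N) ->
  exists y, [/\ y \in s, y != x, e x y = -1, m y = m0 & forall z, z \in s -> z != x -> z != y -> e x z = 0].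
Proof.
move=> xs mx mn; have xu : x \in undup s by rewrite mem_undup.
have m0p : (0 < m0)%N by rewrite -mx -has_count has_pred1.
have := er xs; rewrite sum_undup (big_rem x) //= e1 // mul1r -/(m x) mx => E.
have [y yr ny] : exists2 y, y \in rem x (undup s) & e x y != 0.
  apply: NNPP => no; move: E; rewrite big_seq big1 ?addr0; first by lia.
  by move=> y yr; apply/eqP; apply: contraT => n; case: no; exists y => //; apply: contraNneq n => ->; rewrite mul0r.
have remE z : (z \in rem x (undup s)) = (z != x) && (z \in s).
  by rewrite mem_rem_uniq ?undup_uniq // !inE mem_undup.
have /andP [yx ys] : (y != x) && (y \in s) by rewrite -remE.
have yn : e x y <= 0 by apply: en => //; rewrite eq_sym.
move: E; rewrite (big_rem y) //= -/(m y) => E; have my := mn y ys.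
have h z : z \in rem y (rem x (undup s)) -> e x z * (m z)%:Z <= 0.
  rewrite mem_rem_uniq ?rem_uniq ?undup_uniq // !inE remE => /andP [_ /andP [zx zs]].
  by rewrite mulr_le0_ge0 // en // eq_sym.
have s0 : \sum_(z <- rem y (rem x (undup s))) e x z * (m z)%:Z <= 0.
  by rewrite big_seq; apply: sumr_le0 => z /h.
have [ey mE S0] := int_aux2 E s0 (elimN eqP ny) yn my m0p.
exists y; split=> // z zs zx zy.
have zr : z \in rem y (rem x (undup s)).
  by rewrite mem_rem_uniq ?rem_uniq ?undup_uniq // !inE zy remE zx zs.
have := seq_le0_eq0 h _ zr; rewrite S0.
by move=> /(_ (lexx _)) /eqP; rewrite mulf_eq0 => /orP [/eqP //|/eqP []] /eqP; rewrite /m -leqn0 leqNgt -has_count has_pred1 zs.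
Qed.

(** The elements of least multiplicity are closed under taking successors, hence form a set with
    total form zero; by [ecl] this set is everything, and [min_succ] applies to each element. *)
Lemma cyc_succ x : x \in s -> exists y, [/\ y \in s, y != x, e x y = -1 &
  forall z, z \in s -> z != x -> z != y -> e x z = 0].
Proof.
move=> xs; have [m0 [x0 [x0s mx0]] mn] : exists2 m0, exists x0, x0 \in s /\ m x0 = m0 & forall y, y \in s -> (m0 <= m y)%N.
  have [|m0 h1 h2] := @nat_min (fun k => exists x0, x0 \in s /\ m x0 = k).
    by exists (m x), x.
  by exists m0 => // y ys; apply: h2; exists y.
pose t := [seq y <- undup s | m y == m0].
have tE y : (y \in t) = (m y == m0) && (y \in s) by rewrite mem_filter mem_undup.
have ts : {subset s <= t}.
  apply: ecl; rewrite ?filter_uniq ?undup_uniq //.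
  - by move=> y; rewrite tE => /andP [].
  - by apply/eqP => t0; have := tE x0; rewrite t0 mx0 eqxx x0s.
  rewrite big_seq big1 // => y; rewrite tE => /andP [/eqP my ys].
  have [z [zs zy ez mz rest]] := min_succ ys my mn.
  have yt : y \in t by rewrite tE my eqxx.
  have zt : z \in rem y t.
    by rewrite mem_rem_uniq ?filter_uniq ?undup_uniq // !inE zy tE mz eqxx.
  rewrite (big_rem y) //= (big_rem z) //= e1 // ez addrA subrr add0r big_seq big1 // => w.
  rewrite mem_rem_uniq ?rem_uniq ?filter_uniq ?undup_uniq // !inE.
  rewrite mem_rem_uniq ?filter_uniq ?undup_uniq // !inE tE => /andP [wz /andP [wy /andP [_ ws]]].
  exact: rest.
have := ts x xs; rewrite tE => /andP [/eqP mx _].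
by have [y [h1 h2 h3 _ h4]] := min_succ xs mx mn; exists y; split.
Qed.

End Cycle.

Lemma sub_sum (V : eqType) (t s : seq V) (F : V -> nat) : uniq t -> {subset t <= s} ->
  (\sum_(x <- t) F x <= \sum_(x <- s) F x)%N.
Proof.
elim: t s => [|a t IH] s; first by rewrite big_nil.
move=> /= /andP [at_ ut] ts; have as_ : a \in s by apply: ts; rewrite mem_head.
rewrite big_cons (big_rem a as_) /= leq_add2l; apply: IH => // x xt.
have := ts x; rewrite inE xt orbT => /(_ isT).
rewrite (perm_mem (perm_to_rem as_)) inE => /orP [/eqP xa|//].
by rewrite -xa xt in at_.
Qed.

(** * Successors of simple regular objects and strings over them *)

Section Tubes.
Variables (Q : bquiver) (K : closedFieldType).
Hypothesis freeQ : forall a b, @qrel Q a b = false.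
Variables (delta : qV Q -> int) (S : K -> rep Q K) (So : rep Q K).
Implicit Types L M N X Y Z R : rep Q K.
Hypothesis S_rep : forall t, is_rep (S t).
Hypothesis S_dim : forall t, dz (S t) =1 delta.
Hypothesis S_orth : forall t u P, t <> u -> hom (S t) (S u) P -> P = 0.
Hypothesis rad : forall x, eul x delta = - eul delta x.
Hypothesis psd : forall x : qV Q -> nat, 0 <= eul (fun v => (x v)%:Z) (fun v => (x v)%:Z).
Hypothesis psd0 : forall x : qV Q -> nat,
  eul (fun v => (x v)%:Z) (fun v => (x v)%:Z) = 0 ->
  exists k : nat, forall v, (x v)%:Z = k%:Z * delta v.
Hypotheses (So_rep : is_rep So) (So_dim : dz So =1 delta)
  (So_orthl : forall t P, hom (S t) So P -> P = 0)
  (So_orthr : forall t P, hom So (S t) P -> P = 0).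
Notation dfc := (dfc delta).
Notation semi := (semi delta).
Notation simp := (simp delta).
Hypothesis pencil : forall X, simp X -> eul (dz X) (dz X) = 0 ->
  (exists t f, hom (S t) X f /\ f <> 0) \/ (exists f, hom So X f /\ f <> 0).
Hypothesis span : forall x : qV Q -> int, eul delta x = 0 ->
  (forall M Z N k c, is_rep M -> dz M =1 delta -> semi M -> @exact Q K Z M N k c -> dfc Z = 0 ->
     eul x (dz Z) = 0) -> eul x x = 0.

Lemma dd0 : eul delta delta = 0.
Proof. have := rad delta; lia. Qed.

(** If S(t) has no nonzero map to M, the same holds for each subobject, whose defect is then minus
    the dimension of an Ext. *)
Lemma semi_by t M : is_rep M -> (forall P, hom (S t) M P -> P = 0) -> semi M.
Proof.
move=> hM h Z k hk fk; have hZ := rep_inj hk fk hM.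
have h0 : hd (S t) Z = 0%N.
  apply/hd0P => // P hP; have := h _ (hom_comp hP hk).
  by move/eqP; rewrite -(mul0mx _ k) => /eqP /(row_free_inj fk).
by have := hd_S S_rep S_dim t hZ; rewrite h0; lia.
Qed.

Lemma S_semi t : semi (S t).
Proof.
have [u] := avoid [:: t]; rewrite inE => /eqP ut.
by apply: (@semi_by u) => // P; apply: S_orth.
Qed.

Lemma So_semi : semi So.
Proof. by apply: (@semi_by 0) => // P; apply: So_orthl. Qed.

Lemma dfc_delta M k : (forall v, dz M v = k * delta v) -> dfc M = 0.
Proof.
move=> h; rewrite /dfc (@eq_eul _ _ delta (dz M) (fun v => k * delta v)) //.
by rewrite eul_scaler dd0 mulr0.
Qed.

Notation V := {ffun qV Q -> nat}.
Definition zv (x : V) : qV Q -> int := fun v => (x v)%:Z.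
Definition ev (x y : V) : int := eul (zv x) (zv y).
Definition dv M : V := [ffun v => dm M v].

Lemma dvE M v : zv (dv M) v = dz M v. Proof. by rewrite /zv ffunE. Qed.
Lemma evE M N : ev (dv M) (dv N) = eul (dz M) (dz N).
Proof. by apply: eq_eul => v; rewrite dvE. Qed.

Lemma eul_sumr (x : qV Q -> int) (s : seq V) :
  eul x (fun v => \sum_(y <- s) zv y v) = \sum_(y <- s) eul x (zv y).
Proof.
elim: s => [|a s IH].
  rewrite big_nil (@eq_eul _ x x (fun v => \sum_(y <- [::]) zv y v) (fun v => 0 * 0)) //.
    by rewrite eul_scaler mul0r.
  by move=> v; rewrite big_nil mul0r.
rewrite big_cons -IH -eul_addr; apply: eq_eul => // v; by rewrite big_cons.
Qed.

Lemma eul_suml (x : qV Q -> int) (s : seq V) :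
  eul (fun v => \sum_(y <- s) zv y v) x = \sum_(y <- s) eul (zv y) x.
Proof.
elim: s => [|a s IH].
  rewrite big_nil (@eq_eul _ (fun v => \sum_(y <- [::]) zv y v) (fun v => 0 * 0) x x) //.
    by rewrite eul_scalel mul0r.
  by move=> v; rewrite big_nil mul0r.
rewrite big_cons -IH -eul_addl; apply: eq_eul => // v; by rewrite big_cons.
Qed.

Definition sd (x : V) := exists2 X, simp X & dv X = x.

Lemma comp_list M : is_rep M -> semi M -> dfc M = 0 ->
  exists2 s : seq V, (forall x, x \in s -> sd x) & forall v, dz M v = \sum_(x <- s) zv x v.
Proof.
have [n] := ubnP (rdim M); elim: n M => // n IH M; rewrite ltnS => Mn hM sM dM.
have [M0|M0] := posnP (rdim M).
  exists [::] => // v; rewrite big_nil /dz /dm.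
  suff -> : \rank (re M v) = 0%N by [].
  by apply/eqP; rewrite -leqn0; apply: leq_trans (rank_leq_row _) (eq_leq M0).
have [R [N [k [c [ex sN sR dR]]]]] := simp_top hM sM dM M0.
have [hk hc fk fc _] := ex; have hR := rep_inj hk fk hM; have [_ _ _ N0 _] := sN.
have RM := rdim_exact hM ex.
have [s hs es] := IH R ltac:(lia) hR sR dR.
exists (dv N :: s) => [x|v]; last by rewrite big_cons (exact_dz v hM ex) es dvE addrC.
by rewrite inE => /orP [/eqP ->|/hs //]; exists N.
Qed.

Lemma sd_rad x : sd x -> eul delta (zv x) = 0 /\ eul (zv x) delta = 0.
Proof.
move=> [X [hX _ dX _ _] <-]; have e : eul delta (zv (dv X)) = 0.
  by rewrite -dX; apply: eq_eul => // v; rewrite dvE.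
by rewrite rad e.
Qed.

Lemma simp_dv X Y : simp X -> simp Y -> ev (dv X) (dv X) = 1 -> dv X = dv Y -> rep_iso X Y.
Proof.
move=> sX sY q1 e; have [hX _ _ _ _] := sX; have [hY _ _ _ _] := sY.
have [EX _] : Ext0 X X /\ eul (dz X) (dz X) = 1.
  by apply: brick_rigid => //; [exact: simp_brick sX | rewrite -evE q1].
have [EY _] : Ext0 Y Y /\ eul (dz Y) (dz Y) = 1.
  by apply: brick_rigid => //; [exact: simp_brick sY | rewrite -evE -e q1].
by apply: (rigid_unique freeQ) => // v; have /ffunP /(_ v) := e; rewrite !ffunE.
Qed.

Lemma simp_hd X Y : simp X -> simp Y -> ~ rep_iso X Y -> hd X Y = 0%N.
Proof.
move=> sX sY n; have [hX _ _ _ _] := sX; have [hY _ _ _ _] := sY.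
apply/hd0P => // f hf; apply: NNPP => f0; apply: n; exact: simp_hom_iso sX sY hf f0.
Qed.

Lemma sd_le x y : sd x -> sd y -> x != y -> ev x y <= 0.
Proof.
move=> [X sX <-] [Y sY <-] xy; have [hX _ _ _ _] := sX; have [hY _ _ _ _] := sY.
rewrite evE -eulE // simp_hd //; first by lia.
by move=> /iso_dm e; move/eqP: xy; apply; apply/ffunP => v; rewrite !ffunE e.
Qed.

Lemma sd_q x : sd x -> ev x x = 0 \/ ev x x = 1.
Proof.
move=> [X sX <-]; have [hX _ _ _ _] := sX; have bX := simp_brick sX.
rewrite evE; have h1 := brick_eul hX bX (fun P => @brick_scalar Q K X P bX).
have p : 0 <= eul (dz X) (dz X) by exact: psd.
by move: p; rewrite -eulE // h1; lia.
Qed.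

Lemma sd_nz x : sd x -> exists v, (0 < x v)%N.
Proof.
move=> [X [hX _ _ X0 _] <-]; apply: NNPP => no; move: X0; rewrite rdim_sum // big1 // => v _.
by apply/eqP; rewrite -leqn0 leqNgt; apply/negP => h; apply: no; exists v; rewrite ffunE.
Qed.

Lemma delta_ge0 v : 0 <= delta v. Proof. by rewrite -(S_dim 0). Qed.

Lemma ev0 x : sd x -> ev x x = 0 -> exists2 k : nat, (0 < k)%N & forall v, (x v)%:Z = k%:Z * delta v.
Proof.
move=> sx /(psd0 (x := x)) [k hk]; exists k => //.
have [v xv] := sd_nz sx; have := hk v; case: (k) => // e; move: e; rewrite mul0r; lia.
Qed.

(** The multiset of dimension vectors of the composition factors of a regular object of dimension
    delta, as provided by [comp_list]. *)
Definition total (s : seq V) := (forall y, y \in s -> sd y) /\ forall v, \sum_(y <- s) zv y v = delta v.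
Definition good x := exists2 s, total s & x \in s.

Lemma sum_zv (s : seq V) v : \sum_(y <- s) zv y v = (\sum_(y <- s) y v)%N%:Z.
Proof. by rewrite (big_morph Posz PoszD (erefl (Posz 0))). Qed.

(** A member with vanishing form is a positive multiple of delta and leaves no room for x. *)
Lemma total_real s x : total s -> x \in s -> ev x x = 1 -> forall y, y \in s -> ev y y = 1.
Proof.
move=> [hs es] xs qx y ys; case: (sd_q (hs y ys)) => // qy.
have [k k0 hk] := ev0 (hs y ys) qy; have [v xv] := sd_nz (hs x xs).
have xy : x != y by apply: contraTneq isT => e; move: qx; rewrite e qy.
have := @sub_sum _ [:: x; y] s (fun z : V => z v); rewrite /= inE xy => /(_ isT).
have sub : {subset [:: x; y] <= s} by move=> z; rewrite !inE => /orP [/eqP ->|/eqP ->].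
move=> /(_ sub); rewrite !big_cons big_nil; have := es v; rewrite sum_zv => e.
have := hk v; have := delta_ge0 v; rewrite -e; move: (\sum_(z <- s) _)%N k0 xv => A; clear; nia.
Qed.

(** A nonempty part on which the form vanishes sums to a positive multiple of delta, so it already
    exhausts delta. *)
Lemma total_close s t : total s -> uniq t -> {subset t <= s} -> t != [::] ->
  \sum_(x <- t) \sum_(y <- t) ev x y = 0 -> {subset s <= t}.
Proof.
move=> [hs es] ut ts t0 q0 y ys; apply: contraT => yt.
pose w v := (\sum_(x <- t) x v)%N.
have [k hk] : exists k : nat, forall v, (w v)%:Z = k%:Z * delta v.
  apply: psd0; rewrite -[RHS]q0 -(@eq_eul _ (fun v => \sum_(x <- t) zv x v) (fun v => (w v)%:Z)
     (fun v => \sum_(x <- t) zv x v) (fun v => (w v)%:Z)); try by move=> v; rewrite sum_zv.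
  by rewrite eul_suml; apply: eq_bigr => x _; rewrite eul_sumr.
have [v yv] := sd_nz (hs y ys).
have := @sub_sum _ (y :: t) s (fun z : V => z v); rewrite /= yt ut => /(_ isT).
have sub : {subset y :: t <= s} by move=> z; rewrite inE => /orP [/eqP ->|/ts].
move=> /(_ sub); rewrite big_cons => le; have := es v; rewrite sum_zv => e.
rewrite /w in hk; clear w; case: t t0 ts hk le {ut q0 sub yt} => // a t _ ts hk le.
have [u au] := sd_nz (hs a (ts a (mem_head _ _))).
have k0 : (0 < k)%N.
  case: k hk => // /(_ u); rewrite mul0r big_cons; move: au; clear.
  by move: (a u) (\sum_(j <- t) _)%N => p q; lia.
have := hk v; move: le; rewrite -e; move: (\sum_(j <- a :: t) _)%N (\sum_(z <- s) _)%N k0 yv => A B.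
by clear; nia.
Qed.

(** Inside the list the successor comes from [cyc_succ]. A simple z outside pairs to zero with the
    sum delta of the list and to nonpositive numbers with its members, hence to zero with each of
    them. *)
Lemma total_next s x : total s -> x \in s -> ev x x = 1 ->
  exists y, [/\ y \in s, ev x y = -1 & forall z, sd z -> z != x -> z != y -> ev x z = 0].
Proof.
move=> ts xs qx; have [hs es] := ts; have real := total_real ts xs qx.
have col z : sd z -> \sum_(y <- s) ev z y = 0.
  move=> /sd_rad [_ h]; rewrite -(eul_sumr (zv z) s) -[RHS]h; exact: eq_eul.
have row z : sd z -> \sum_(y <- s) ev y z = 0.
  move=> /sd_rad [h _]; rewrite -(eul_suml (zv z) s) -[RHS]h; exact: eq_eul.
have [y [ys yx ey ny]] := cyc_succ real (fun a b h1 h2 => sd_le (hs a h1) (hs b h2))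
  (fun z zs => col z (hs z zs)) (fun t => @total_close s t ts) xs.
exists y; split=> // z sz zx zy; have [zs|zs] := boolP (z \in s); first exact: ny.
have := seq_le0_eq0 (s := s) (F := fun y => ev y z) _ _ xs; apply; last by rewrite row.
by move=> u us; apply: sd_le => //; [exact: hs | apply: contraNneq zs => <-].
Qed.

Lemma total_prev s x : total s -> x \in s -> ev x x = 1 ->
  exists y, [/\ y \in s, ev y x = -1 & forall z, sd z -> z != x -> z != y -> ev z x = 0].
Proof.
move=> ts xs qx; have [hs es] := ts; have real := total_real ts xs qx.
have col z : sd z -> \sum_(y <- s) ev z y = 0.
  move=> /sd_rad [_ h]; rewrite -(eul_sumr (zv z) s) -[RHS]h; exact: eq_eul.
have row z : sd z -> \sum_(y <- s) ev y z = 0.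
  move=> /sd_rad [h _]; rewrite -(eul_suml (zv z) s) -[RHS]h; exact: eq_eul.
have [||||y [ys yx ey ny]] := @cyc_succ _ (fun x y => ev y x) s _ _ _ _ x xs.
- exact: real.
- by move=> a b h1 h2 ab; apply: sd_le; [exact: hs|exact: hs|rewrite eq_sym].
- by move=> z zs; apply: row; apply: hs.
- move=> t ut tS t0 q0; apply: total_close ut tS t0 _ => //.
  by rewrite exchange_big.
exists y; split=> // z sz zx zy; have [zs|zs] := boolP (z \in s); first exact: ny.
have := seq_le0_eq0 (s := s) (F := fun y => ev z y) _ _ xs; apply; last by rewrite col.
by move=> u us; apply: sd_le => //; [exact: hs | apply: contraNneq zs => ->].
Qed.

(** A simple x that occurs in no regular object of dimension delta is orthogonal to all composition
    factors of such objects, and [span] then forces the form to vanish at x. *)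
Lemma all_good x : sd x -> ev x x = 1 -> good x.
Proof.
move=> sx qx; apply: NNPP => ng; suff : ev x x = 0 by rewrite qx.
apply: span; first by have [] := sd_rad sx.
move=> M Z N k c hM dM sM ex dZ; have [hk hc fk fc _] := ex.
have dM0 : dfc M = 0 by apply: (@dfc_delta _ 1) => v; rewrite mul1r dM.
have dN : dfc N = 0 by have := dfc_exact delta hM ex; lia.
have hZ := rep_inj hk fk hM; have hN := rep_surj hc fc hM.
have sZ := semi_sub hk fk sM; have sN := semi_quo hM sM ex dZ.
have [s hs es] := comp_list hZ sZ dZ; have [s' hs' es'] := comp_list hN (@sN) dN.
have ts : total (s ++ s').
  split=> [y|v]; first by rewrite mem_cat => /orP [/hs|/hs'].
  by rewrite big_cat /= -es -es' -(exact_dz v hM ex) dM.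
have xs : x \notin s ++ s' by apply/negP => xs; apply: ng; exists (s ++ s').
have col : \sum_(y <- s ++ s') ev x y = 0.
  have [_ h] := sd_rad sx; rewrite -(eul_sumr (zv x) _) -[RHS]h; apply: eq_eul => //.
  by move=> v; have [_ ->] := ts.
rewrite (@eq_eul _ (zv x) (zv x) (dz Z) (fun v => \sum_(y <- s) zv y v)) // eul_sumr.
rewrite big_seq big1 // => y ys.
have := seq_le0_eq0 (s := s ++ s') (F := fun y => ev x y) _ _ _; apply; last by rewrite mem_cat ys.
  move=> u us; apply: sd_le => //; last by apply: contraNneq xs => ->.
  by have [h _] := ts; apply: h.
by rewrite col.
Qed.

Definition real x := sd x /\ ev x x = 1.

Lemma ex_T x : exists Z, [/\ is_rep Z, real x -> simp Z /\ dv Z = x & ~ real x -> rdim Z = 0%N].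
Proof.
have [r|r] := classic (real x).
  by have [[X sX eX] _] := r; exists X; split=> //; have [] := sX.
exists (@Rep Q K 0 (fun _ => 0) (fun _ => 0)); split=> //; exact: zero_rep.
Qed.
Definition TV x := wit (ex_T x).

Lemma ex_nx x : exists y, real x ->
  [/\ real y, ev x y = -1, forall z, sd z -> z != x -> z != y -> ev x z = 0 &
      forall z, sd z -> z != y -> z != x -> ev z y = 0].
Proof.
have [[sx qx]|r] := classic (real x); last by exists x.
have [s ts xs] := all_good sx qx; have [y [ys exy ny]] := total_next ts xs qx.
have real_s := total_real ts xs qx; have [hs _] := ts.
exists y => _; split=> //; first by split; [exact: hs | exact: real_s].
have [w [ws ew nw]] := total_prev ts ys (real_s y ys).
have xy : x != y by apply/eqP => e; move: exy; rewrite -e qx.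
have -> : x = w by apply: NNPP => /eqP xw; have := nw x sx xy xw; rewrite exy.
by move=> z sz zy zw; apply: nw.
Qed.
Definition nx x := wit (ex_nx x).
Lemma nxP x : real x -> [/\ real (nx x), ev x (nx x) = -1,
  forall z, sd z -> z != x -> z != nx x -> ev x z = 0 &
  forall z, sd z -> z != nx x -> z != x -> ev z (nx x) = 0].
Proof. exact: (witP (ex_nx x)). Qed.

(** Indices of the simple regular objects: dimension vectors for those with form 1, points of the
    projective line for dimension delta. The counter makes [sgi] a total injective map: it is
    incremented wherever no genuine successor exists, and positive counters stand for the zero
    object, which is not simple. *)
Definition idx_t := ((V * nat) + option K)%type.
Definition zr : rep Q K := @Rep Q K 0 (fun _ => 0) (fun _ => 0).
Definition Ti (i : idx_t) : rep Q K :=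
  match i with
  | inl (x, 0) => TV x | inl (_, _.+1) => zr | inr (Some t) => S t | inr None => So end.
Definition sgi (i : idx_t) : idx_t :=
  match i with
  | inl (x, k) => if (k == 0%N) && (if excluded_middle_informative (real x) then true else false)
                  then inl (nx x, 0%N) else inl (x, k.+1)
  | inr o => inr o end.

Lemma sgi_real x : real x -> sgi (inl (x, 0%N)) = inl (nx x, 0%N).
Proof. by move=> r /=; case: excluded_middle_informative. Qed.

Lemma nx_inj x y : real x -> real y -> nx x = nx y -> x = y.
Proof.
move=> rx ry e; have [[sx qx] [sy qy]] := (rx, ry).
have [rn ex _ px] := nxP rx; have [_ ey _ _] := nxP ry.
apply: NNPP => /eqP xy; have yn : y != nx x.
  by apply/eqP => e'; move: ey; rewrite -e -e' qy.
have := px y sy yn; rewrite eq_sym xy => /(_ isT) h.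
by move: ey; rewrite -e h.
Qed.

Lemma sgi_inj : injective sgi.
Proof.
case=> [[x k]|o] [[y k']|o'] //=; try by case: ifP.
case: (k =P 0%N) => [->|k0]; case: (k' =P 0%N) => [->|k0'] /=;
  repeat destruct excluded_middle_informative; move=> //=.
- by case=> /nx_inj ->.
- by case=> ->.
- by case=> -> [->].
- by case=> -> [->].
- by case=> -> [->].
Qed.

Lemma Ti_rep i : is_rep (Ti i).
Proof.
case: i => [[x [|k]]|[t|]] //=; last exact: zero_rep.
by rewrite /TV /wit; case: constructive_indefinite_description => Z [].
Qed.

Lemma Ti_real x k : simp (Ti (inl (x, k))) -> [/\ k = 0%N, real x & dv (Ti (inl (x, 0%N))) = x].
Proof.
case: k => [|k] [_ _ _ Z0 _] //; split=> //; move: Z0;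
  rewrite /= /TV /wit; case: constructive_indefinite_description => Z /= [_ h1 h2] Z0.
  by apply: NNPP => /h2 e; rewrite e in Z0.
apply: (h1 _).2; by apply: NNPP => /h2 e; rewrite e in Z0.
Qed.

Lemma TV_real x : real x -> simp (TV x) /\ dv (TV x) = x.
Proof. by rewrite /TV /wit; case: constructive_indefinite_description => Z /= [_ h _] /h. Qed.

Lemma iso_q X Y : rep_iso X Y -> eul (dz X) (dz X) = eul (dz Y) (dz Y).
Proof. by move=> /iso_dz e; apply: eq_eul. Qed.

Lemma dim_delta X k : is_rep X -> (forall v, dz X v = k%:Z * delta v) ->
  rdim X = (k * rdim (S 0))%N.
Proof.
move=> hX h; rewrite !rdim_sum // big_distrr /=; apply: eq_bigr => v _.
by have := h v; rewrite -(S_dim 0) /dz => e; lia.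
Qed.

Lemma delta_onto X Y f : is_rep Y -> dz Y =1 delta -> semi Y -> simp X -> eul (dz X) (dz X) = 0 ->
  hom Y X f -> f <> 0 -> rep_iso X Y.
Proof.
move=> hY dY sY sX qX hf f0; have [hX _ _ X0 _] := sX.
have dY0 : dfc Y = 0 by apply: (@dfc_delta _ 1) => v; rewrite mul1r dY.
have ff := simp_full sX hY sY dY0 hf f0.
have [k hk] := psd0 qX.
have eX := dim_delta hX hk; have eY : rdim Y = (1 * rdim (S 0))%N.
  by apply: dim_delta => // v; rewrite dY mul1r.
apply: iso_sym; apply: (iso_full hf ff); have := rdim_full hf ff.
by move: X0; rewrite eX eY; case: (k) => [|k'] //; rewrite !mulSn; clear; move: (rdim (S 0)) => r; nia.
Qed.

Lemma simp_Ti X : simp X -> exists2 i, simp (Ti i) & rep_iso X (Ti i).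
Proof.
move=> sX; have [hX _ _ _ _] := sX.
have sx : sd (dv X) by exists X.
have [q|q] := sd_q sx; last first.
  have [sT dT] := TV_real (conj sx q); exists (inl (dv X, 0%N)) => //=.
  exact: simp_dv.
rewrite evE in q; case: (pencil sX q) => [[t [f [hf f0]]]|[f [hf f0]]].
  have iso := delta_onto (S_rep t) (S_dim t) (@S_semi t) sX q hf f0.
  by exists (inr (Some t)) => //=; apply: simp_iso iso sX.
have iso := delta_onto So_rep So_dim (@So_semi) sX q hf f0.
by exists (inr None) => //=; apply: simp_iso iso sX.
Qed.

Lemma hom_rdim_pos X Y (P : 'M[K]_(rdim X, rdim Y)) P' : (0 < rdim X)%N -> P *m P' = 1%:M -> P <> 0.
Proof.
move=> X0 e P0; move: e; rewrite P0 mul0mx => /(congr1 (@mxrank _ _ _)).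
by rewrite mxrank0 mxrank1; lia.
Qed.

Definition Tdz (o : option K) : dz (Ti (inr o)) =1 delta.
Proof. by case: o => [t|]; [exact: S_dim | exact: So_dim]. Qed.

Lemma T_noiso (o o' : option K) : simp (Ti (inr o)) -> o <> o' -> ~ rep_iso (Ti (inr o)) (Ti (inr o')).
Proof.
move=> [_ _ _ X0 _] ne [P [P' [hP e _]]]; have := hom_rdim_pos X0 e; apply.
case: o o' ne X0 P P' hP {e} => [t|] [t'|] // ne _ P P' hP.
- by apply: S_orth hP => e; apply: ne; rewrite e.
- exact: So_orthl hP.
- exact: So_orthr hP.
Qed.

(** Hom vanishes between nonisomorphic simples, so dim Ext is minus the Euler form. For a simple
    with form 1 this is decided by the successor; dimension delta pairs to zero with everything
    regular; a brick with form 0 has a one-dimensional self-extension space. *)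
Lemma T_ed i j : simp (Ti i) -> simp (Ti j) -> (ed (Ti i) (Ti j) <= 1)%N /\
  (j <> sgi i -> ed (Ti i) (Ti j) = 0%N).
Proof.
move=> si sj; have E := eulE (Ti_rep i) (Ti_rep j).
have mixed (x : V) k (o : option K) : simp (Ti (inl (x, k))) -> ~ rep_iso (Ti (inl (x, k))) (Ti (inr o)).
  move=> /Ti_real [-> [_ q1] ex] /iso_q; rewrite -evE ex q1 (@eq_eul _ _ delta _ delta) ?dd0 //; exact: Tdz.
case: i si E => [[x k]|o] si; case: j sj => [[y k']|o'] sj E.
- have [? rx ex] := Ti_real si; have [? ry ey] := Ti_real sj; subst k k'.
  have [[sx qx] [sy qy]] := (rx, ry); have [rn en nn _] := nxP rx.
  rewrite sgi_real //; rewrite -evE ex ey in E.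
  have [xy|xy] := eqVneq y x.
    subst y; have h1 := brick_eul (Ti_rep _) (simp_brick si) (fun P => @brick_scalar Q K _ P (simp_brick si)).
    by move: E; rewrite qx h1; lia.
  rewrite simp_hd // in E; last first.
    by move=> /iso_dm e; move/eqP: xy; apply; rewrite -ex -ey; apply/ffunP => v; rewrite !ffunE e.
  have [yn|yn] := eqVneq y (nx x); first by move: E; rewrite yn en; split; [lia | case].
  by move: E; rewrite nn //; lia.
- rewrite simp_hd // in E; last exact: mixed.
  rewrite (@eq_eul _ (dz (Ti (inl (x, k)))) (dz (Ti (inl (x, k)))) _ delta) in E; first last.
  + exact: Tdz.
  + by [].
  have [_ _ d0 _ _] := si; have := rad (dz (Ti (inl (x, k)))); rewrite -/(dfc _) d0; lia.
- rewrite simp_hd // in E; last by move/iso_sym; apply: mixed.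
  rewrite (@eq_eul _ _ delta (dz (Ti (inl (y, k')))) (dz (Ti (inl (y, k'))))) in E; first last.
  + by [].
  + exact: Tdz.
  have [_ _ d0 _ _] := sj; move: E; rewrite -/(dfc _) d0; lia.
rewrite (@eq_eul _ _ delta _ delta) ?dd0 in E; try exact: Tdz.
have [oo|oo] := eqVneq o o'; last first.
  have h0 : hd (Ti (inr o)) (Ti (inr o')) = 0%N.
    by apply: simp_hd => //; apply: T_noiso => //; apply/eqP.
  by move: E; rewrite h0; lia.
subst o'; have -> : ed (Ti (inr o)) (Ti (inr o)) = 1%N.
  apply: brick_eul0; [exact: Ti_rep | exact: simp_brick si |].
  by rewrite (@eq_eul _ _ delta _ delta) ?dd0 //; exact: Tdz.
by split=> // ne; case: ne.
Qed.

Lemma ex_eps i j : exists e0 : qA Q -> 'M[K]_(rdim (Ti i), rdim (Ti j)), cocyc e0 /\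
  ((ed (Ti i) (Ti j) <= 1)%N -> forall h, @cocyc Q K (Ti i) (Ti j) h ->
    exists x P, grad P /\ forall a, h a = x *: e0 a + cobd P a).
Proof.
case: (leqP (ed (Ti i) (Ti j)) 1) => [le|lt].
  by have [e0 c0 h] := ed1P (Ti_rep i) (Ti_rep j) le; exists e0.
exists (fun _ => 0); split=> [a|]; first by rewrite mulmx0 mul0mx.
by [].
Qed.
Definition epsi i j := wit (ex_eps i j).

Lemma epsi_coc i j : @cocyc Q K (Ti i) (Ti j) (epsi i j).
Proof. by rewrite /epsi /wit; case: constructive_indefinite_description => e0 []. Qed.

Lemma ext_Ti i j h : simp (Ti i) -> simp (Ti j) -> @cocyc Q K (Ti i) (Ti j) h ->
  exists x P, [/\ @grad Q K (Ti i) (Ti j) P, forall a, h a = x *: epsi i j a + cobd P a &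
    (x <> 0 -> j = sgi i)].
Proof.
move=> si sj ch; have [e1 e0] := T_ed si sj.
have [js|js] := classic (j = sgi i).
  rewrite /epsi /wit; case: constructive_indefinite_description => c [_ /(_ e1 h ch)] /= [x [P [gP eP]]].
  by exists x, P.
have /ed0P E0 := e0 js; have [P gP eP] := E0 (Ti_rep i) (Ti_rep j) h ch.
by exists 0, P; split=> // a; rewrite scale0r add0r.
Qed.

Notation strframe := (strframe delta sgi epsi).

Lemma strframe_rdim M i h : strframe M i h -> rdim M = (\sum_(s < h) rdim (Ti (iter s sgi i)))%N.
Proof.
move=> [j [p [_ _ _ jp pj]]].
have e1 : \mxrow_k p k *m \mxcol_k j k = 1%:M by rewrite mul_mxrow_mxcol.
have e2 : \mxcol_k j k *m \mxrow_k p k = 1%:M.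
  rewrite mul_mxcol_mxrow -mxdiagZ; apply/eq_mxblockP => k l; rewrite jp.
  case: (k =P l) => [e|_]; last by rewrite scale0r.
  by subst l; rewrite scale1r II1 conform_mx_id.
by apply/eqP; rewrite eqn_leq (mulmx1_min e1) (mulmx1_min e2).
Qed.

(** The component at the first factor where f does not vanish is a homomorphism, because the
    extension terms reach it only from earlier factors. *)
Lemma strframe_hom M i h X f : strframe M i h -> hom X M f -> f <> 0 ->
  exists2 s, (s < h)%N & exists g, hom X (Ti (iter s sgi i)) g /\ g <> 0.
Proof.
move=> [j [p fr]] hf f0; have [_ _ _ _ pj] := fr.
have [|n [s [sn ns]] mn] := @nat_min (fun n => exists s : 'I_h, s = n :> nat /\ f *m p s <> 0).
  apply: NNPP => no; apply: f0; rewrite -[f]mulmx1 -pj mulmx_sumr big1 // => s _.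
  by rewrite mulmxA; have -> : f *m p s = 0 by [apply: NNPP => ns; apply: no; exists s, s]; rewrite mul0mx.
exists s; first exact: ltn_ord.
exists (f *m p s); split=> //; split=> [v|a].
  by rewrite mulmxA hf.1 -!mulmxA (frame_re v s fr).
rewrite mulmxA hf.2 -!mulmxA (frame_rX a s fr) mulmxDr mulmx_sumr [X in _ + X]big1 ?addr0 // => l _.
rewrite mxE; case: eqP => [ls|_]; last by rewrite scale0r mulmx0.
have fl : f *m p l = 0.
  by apply: NNPP => nl; have := mn l (ex_intro _ l (conj erefl nl)); rewrite -sn -ls ltnn.
by rewrite -scalemxAr mulmxA fl mul0mx scaler0.
Qed.

Lemma iter_inl p s : exists p', iter s sgi (inl p) = inl p'.
Proof.
elim: s => [|s [[x k] IH]]; first by exists p.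
by rewrite /= IH /=; case: ifP => _; eexists.
Qed.

Lemma iter_inr o s : iter s sgi (inr o) = inr o.
Proof. by elim: s => //= s ->. Qed.

Variable SJ : nat -> K -> rep Q K.
Hypotheses (SJ_rep : forall h t, is_rep (SJ h t))
  (SJ_dim : forall h t v, dz (SJ h t) v = h%:Z * delta v)
  (SJ_indec : forall h t, (0 < h)%N -> indec (SJ h t))
  (SJ_semi : forall h t, semi (SJ h t))
  (SJ_hom : forall h t, (0 < h)%N -> exists f, hom (S t) (SJ h t) f /\ f <> 0).

(** [SJ h t] is some string. A nonzero map from S(t) shows that a factor is S(t), hence all are, as
    [sgi] fixes homogeneous indices; the dimension gives the length h. *)
Lemma SJ_string h t : (0 < h)%N -> simp (S t) -> strframe (SJ h t) (inr (Some t)) h.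
Proof.
move=> h0 sS; have dJ : dfc (SJ h t) = 0 by apply: dfc_delta; exact: SJ_dim.
have [i [h' [hb si fr]]] := regular_string sgi_inj simp_Ti epsi_coc ext_Ti
  (SJ_rep h t) (SJ_indec t h0) (@SJ_semi h t) dJ.
have [f [hf f0]] := SJ_hom t h0.
have [s sh [g [hg g0]]] := strframe_hom fr hf f0.
have iso := simp_hom_iso sS (si s sh) hg g0.
have et : i = inr (Some t).
  case: i si fr iso {hg g0 g} => [p|o] si fr iso.
    have [[x k] e] := iter_inl p s; have := si s sh; rewrite e => /Ti_real [k0 [_ q1] ex].
    move: iso; rewrite e k0 => /iso_q; rewrite -[in RHS]evE ex q1 (@eq_eul _ _ delta _ delta) ?dd0 //.
  rewrite iter_inr in iso; apply: NNPP => ne.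
  by apply: (@T_noiso (Some t) o sS _ iso) => e; apply: ne; rewrite e.
have eh : h' = h.
  have := strframe_rdim fr; rewrite et (dim_delta (SJ_rep h t) (@SJ_dim h t)).
  rewrite (eq_bigr (fun _ => rdim (S 0))) => [|k _]; last first.
    by rewrite iter_inr (@dim_delta _ 1 (S_rep t)) ?mul1n // => v; rewrite S_dim mul1r.
  rewrite sum_nat_const card_ord => /eqP; rewrite eqn_mul2r => /orP [/eqP d0|/eqP //].
  have [_ _ _ X0 _] := sS; move: X0; rewrite (@dim_delta _ 1 (S_rep t)) ?d0 //.
  by move=> v; rewrite S_dim mul1r.
by move: fr; rewrite et eh.
Qed.

(** In dimension at most d there remain the rigid objects, the strings starting at one of finitely
    many dimension vectors, and the strings over the point at infinity; strings over S(t) are the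
    [SJ h t]. *)
Lemma tube_finite d : fin_many (fun M : rep Q K =>
  [/\ is_rep M, indec M, (rdim M <= d)%N & forall h t, ~ rep_iso M (SJ h t)]).
Proof.
pose T0 := (({ffun qV Q -> 'I_d.+1} + unit) * 'I_d.+1)%type.
pose key (k : {ffun qV Q -> 'I_d.+1} + unit) : idx_t :=
  match k with inl f => inl ([ffun v => (f v : nat)], 0%N) | inr _ => inr None end.
have F : fin_many (fun M : rep Q K => is_rep M /\ exists t : T0, strframe M (key t.1) t.2).
  apply: (@fin_by Q K T0 (fun M t => strframe M (key t.1) t.2)) => [M []|M []|M N t _ _] //.
  exact: strframe_iso.
have G := fin_many_or (@fin_many_rigid Q K freeQ d.+1) F.
refine (fin_many_sub _ G) => M [hM iM Md nJ].
have [E|[sM dM]] := indec_rigid_or_regular S_rep S_dim S_orth rad psd psd0 hM iM.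
  by left; split=> // v; rewrite ltnS; apply: leq_trans Md; apply: rank_leq_row.
right; split=> //.
have [i [h [/andP [h0 hb] si fr]]] := regular_string sgi_inj simp_Ti epsi_coc ext_Ti hM iM sM dM.
have hd1 : (h < d.+1)%N by rewrite ltnS; apply: leq_trans hb Md.
have s0 := si 0%N h0.
case: i si fr s0 => [[x k]|[t|]] si fr s0.
- have [k0 rx ex] := Ti_real s0; subst k.
  exists (inl [ffun v => inord (x v)], Ordinal hd1) => /=.
  rewrite (_ : [ffun _ => _] = x) //; apply/ffunP => v; rewrite !ffunE inordK // ltnS.
  apply: leq_trans Md; apply: (@leq_trans (rdim (Ti (inl (x, 0%N))))).
    by rewrite -{1}ex ffunE; apply: rank_leq_row.
  by rewrite (strframe_rdim fr); rewrite (bigD1 (Ordinal h0)) //= leq_addr.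
- case: (nJ h t); apply: strframe_iso fr _; exact: SJ_string.
- by exists (inr Datatypes.tt, Ordinal hd1).
Qed.

End Tubes.

(** * The homogeneous family *)

(** A pencil of matrices with at least as many rows as columns is singular at a point of the
    projective line: either B has a kernel, or A B^-1 has an eigenvalue. *)
Lemma pencil_kernel (K : closedFieldType) p d (A B : 'M[K]_(p, d)) : (0 < p)%N -> (d <= p)%N ->
  (exists t (v : 'rV_p), v != 0 /\ v *m (A + t *: B) = 0) \/
  (exists v : 'rV_p, v != 0 /\ v *m B = 0).
Proof.
move=> p0 dp; have [fB|nB] := boolP (row_free B); last first.
  right; move: nB; rewrite -kermx_eq0 => /rowV0Pn [v /sub_kermxP vB v0].
  by exists v.
have pd : p = d.
  by apply/eqP; rewrite eqn_leq dp andbT -(eqP (fB : \rank B == p)) rank_leq_col.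
subst d; left; have uB : B \in unitmx by rewrite -row_free_unit.
have [a ra] : exists a, root (char_poly (A *m invmx B)) a.
  by apply: closed_rootP; rewrite size_char_poly -lt0n.
move: ra; rewrite -eigenvalue_root_char => /eigenvalueP [v ev v0].
exists (- a), v; split=> //.
have e : v *m A = a *: (v *m B).
  by rewrite -[A](mulmxKV uB) mulmxA ev scalemxAl.
by rewrite mulmxDr e -scalemxAr scaleNr addrN.
Qed.

Section Pencil.
Variables (Q : bquiver) (K : closedFieldType).
Implicit Types X Y T : rep Q K.

Lemma cls_limg Y T h : is_rep Y -> is_rep T -> @cocyc Q K Y T h ->
  cls h \in limg (linfun (@Dif Q K Y T)) -> exists P, grad P /\ forall a, h a = cobd P a.
Proof.
move=> hY hT ch /memv_imgP [f _]; rewrite lfunE /= -cls_cobd // => ec.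
exists (Phi0 f); split; first exact: Phi0_grad.
suff z a : h a - cobd (Phi0 f) a = 0 by move=> a; apply/eqP; rewrite -subr_eq0 z.
refine (cls_inj (h := fun a => h a - cobd (Phi0 f) a) _ _ a).
  by apply: cocyc_sub => //; apply: cobd_cocyc => //; apply: Phi0_grad.
by rewrite cls_sub ec subrr.
Qed.

(** Pushing an extension class out along f maps Hom(X, T) to Ext(Y, T), linearly in the class. As
    Ext is no larger than Hom, the pencil through xi1 and xi2 has a kernel, and a kernel element f
    extends to the corresponding extension. *)
Lemma pencil_hom X Y T (xi1 xi2 : qA Q -> 'M[K]_(rdim Y, rdim X)) :
  is_rep X -> is_rep Y -> is_rep T -> cocyc xi1 -> cocyc xi2 ->
  (0 < hd X T)%N -> (ed Y T <= hd X T)%N ->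
  (exists t f P, [/\ hom X T f, f <> 0, @grad Q K Y T P &
     forall a, (xi1 a + t *: xi2 a) *m f = cobd P a]) \/
  (exists f P, [/\ hom X T f, f <> 0, @grad Q K Y T P & forall a, xi2 a *m f = cobd P a]).
Proof.
move=> hX hY hT c1 c2 h0 le.
pose W0 := limg (linfun (@Dif Q K Y T)); pose C := (W0^C)%VS.
have dC : \dim C = ed Y T by rewrite dimv_compl dimvf /dim /= muln1.
pose pr (w : {ffun S1 Y T -> K^o}) := w - projv W0 w.
have prL : linear pr.
  by move=> a u w; rewrite /pr linearP /= scalerBr opprD addrACA.
have prC w : pr w \in C.
  rewrite /C -lker_proj memv_ker /pr linearB /= subr_eq0; apply/eqP.
  by rewrite [RHS]projv_id // memv_proj.
have pr0 w : pr w = 0 -> w \in W0 by move=> /subr0_eq ->; apply: memv_proj.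
pose G (xi : qA Q -> 'M[K]_(rdim Y, rdim X)) (f : 'M[K]_(rdim X, rdim T)) : {ffun S1 Y T -> K^o} :=
  cls (fun a => xi a *m f).
pose fb (k : 'I_(hd X T)) := (vbasis (hsp X T))`_k.
pose F (v : 'rV[K]_(hd X T)) := \sum_k v 0 k *: fb k.
pose Am xi : 'M[K]_(hd X T, \dim C) := \matrix_(k, j) coord (vbasis C) j (pr (G xi (fb k))).
have GL xi v : G xi (F v) = \sum_k v 0 k *: G xi (fb k).
  apply/ffunP => s; rewrite sum_ffunE !ffunE /F mulmx_sumr mulmx_sumr mulmx_suml summxE.
  by apply: eq_bigr => k _; rewrite !ffunE -!scalemxAr -scalemxAl mxE.
have prs xi v : pr (G xi (F v)) = \sum_k v 0 k *: pr (G xi (fb k)).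
  rewrite GL; have pD u w : pr (u + w) = pr u + pr w by have := prL 1 u w; rewrite !scale1r.
  have pZ a w : pr (a *: w) = a *: pr w.
    by rewrite /pr linearZ /= scalerBr.
  have p0 : pr 0 = 0 by rewrite /pr linear0 subrr.
  by rewrite (big_morph pr pD p0); apply: eq_bigr => k _; rewrite pZ.
have hF v : hom X T (F v).
  apply/(hspP hX hT); apply: memv_suml => k _; apply: memvZ; apply: vbasis_mem.
  by apply: mem_nth; rewrite size_tuple.
have F0 v : v != 0 -> F v <> 0.
  move=> /eqP v0 e; apply: v0; have /freeP fr := basis_free (vbasisP (hsp X T)).
  by apply/rowP => k; rewrite mxE; apply: (fr (fun k => v 0 k)).
have key xi v : cocyc xi -> v *m Am xi = 0 -> exists P, grad P /\ forall a, xi a *m F v = cobd P a.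
  move=> cx e; apply: (cls_limg hY hT (h := fun a => xi a *m F v)).
    move=> a; have [hf1 hf2] := hF v; by rewrite {1}(cx a) -!mulmxA hf1.
  apply: pr0; rewrite -/(G xi (F v)) (coord_vbasis (prC _)) big1 // => j _.
  rewrite prs linear_sum /= (_ : \sum_k _ = (v *m Am xi) 0 j); first by rewrite e mxE scale0r.
  by rewrite mxE; apply: eq_bigr => k _; rewrite linearZ /= mxE.
have AmL t : Am (fun a => xi1 a + t *: xi2 a) = Am xi1 + t *: Am xi2.
  apply/matrixP => k j; rewrite !mxE -linearZ -linearD /=; congr (coord _ _ _).
  have e : G (fun a => xi1 a + t *: xi2 a) (fb k) = t *: G xi2 (fb k) + G xi1 (fb k).
    apply/ffunP => s; rewrite !ffunE mulmxDl mulmxDr mulmxDl addrC mxE; congr (_ + _).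
    by rewrite -!scalemxAl -scalemxAr -scalemxAl mxE.
  by rewrite e prL addrC.
have dle : (\dim C <= hd X T)%N by rewrite dC.
case: (pencil_kernel (Am xi1) (Am xi2) h0 dle) => [[t [v [v0 e]]]|[v [v0 e]]].
  left; rewrite -AmL in e; have [|P [gP eP]] := key _ _ _ e.
    by move=> a; rewrite mulmxDr mulmxDl -scalemxAr -scalemxAl -c1 -c2.
  by exists t, (F v), P; split=> //; apply: F0.
right; have [P [gP eP]] := key _ _ c2 e.
by exists (F v), P; split=> //; apply: F0.
Qed.

(** Z is the extension of Y by X with cocycle zeta, given by a splitting as graded spaces. *)
Record splits X Y Z (zeta : qA Q -> 'M[K]_(rdim Y, rdim X)) (iX : 'M[K]_(rdim X, rdim Z))
  (iY : 'M[K]_(rdim Y, rdim Z)) (pX : 'M[K]_(rdim Z, rdim X)) (pY : 'M[K]_(rdim Z, rdim Y)) : Prop :=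
  Splits { sp_iX : hom X Z iX; sp_pY : hom Z Y pY; sp_gX : grad pX;
    sp_XX : iX *m pX = 1%:M; sp_YY : iY *m pY = 1%:M;
    sp_1 : pX *m iX + pY *m iY = 1%:M; sp_z : forall a, iY *m rX Z a *m pX = zeta a }.

Lemma splits_hom X Y Z T zeta iX iY pX pY f P : @splits X Y Z zeta iX iY pX pY ->
  hom X T f -> @grad Q K Y T P -> (forall a, zeta a *m f = cobd P a) ->
  hom Z T (pX *m f - pY *m P) /\ iX *m (pX *m f - pY *m P) = f.
Proof.
move=> [hi hp gX eXX eYY e1 ez] hf gP eP.
have XY : iX *m pY = 0.
  have := congr1 (mulmx iX) e1; rewrite mulmxDr !mulmxA eXX mul1mx mulmx1 -[RHS]addr0 => /addrI h.
  by rewrite -[pY]mulmx1 -eYY !mulmxA h !mul0mx.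
split; last by rewrite mulmxBr !mulmxA eXX XY mul1mx mul0mx subr0.
split=> [v|a].
  by rewrite mulmxBr mulmxBl !mulmxA gX hp.1 -!mulmxA hf.1 gP.
have e : rX Z a *m pX = pX *m rX X a + pY *m zeta a.
  rewrite -[LHS]mul1mx -e1 mulmxDl -ez !mulmxA; congr (_ + _).
  by rewrite -!mulmxA [iX *m (_ *m _)]mulmxA -hi.2 -mulmxA eXX mulmx1.
rewrite mulmxBr mulmxBl !mulmxA e hp.2 mulmxDl -!mulmxA hf.2 eP /cobd mulmxBr.
by rewrite addrA addrAC addrK.
Qed.

Lemma splits_pencil X Y T (xi1 xi2 : qA Q -> 'M[K]_(rdim Y, rdim X)) (Sf : K -> rep Q K) Sinf :
  is_rep X -> is_rep Y -> is_rep T -> cocyc xi1 -> cocyc xi2 ->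
  (forall t, exists iX iY pX pY, @splits X Y (Sf t) (fun a => xi1 a + t *: xi2 a) iX iY pX pY) ->
  (exists iX iY pX pY, @splits X Y Sinf xi2 iX iY pX pY) ->
  (0 < hd X T)%N -> (ed Y T <= hd X T)%N ->
  (exists t f, hom (Sf t) T f /\ f <> 0) \/ (exists f, hom Sinf T f /\ f <> 0).
Proof.
move=> hX hY hT c1 c2 hf [iX [iY [pX [pY sI]]]] h0 le.
case: (pencil_hom hX hY hT c1 c2 h0 le) => [[t [f [P [h1 f0 gP eP]]]]|[f [P [h1 f0 gP eP]]]].
  have [jX [jY [qX [qY sp]]]] := hf t; have [H e] := splits_hom sp h1 gP eP.
  by left; exists t, (qX *m f - qY *m P); split=> // z; apply: f0; rewrite -e z mulmx0.
have [H e] := splits_hom sI h1 gP eP.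
by right; exists (pX *m f - pY *m P); split=> // z; apply: f0; rewrite -e z mulmx0.
Qed.

End Pencil.

Lemma rank_diag (K : fieldType) (J : finType) (b : pred J) :
  \rank (fmx (fun x y => ((x == y) && b x)%:R : K)) = #|b|.
Proof.
pose C : 'M[K]_(#|J|, #|{: {x | b x}}|) := fmx (fun (x : J) (s : {x | b x}) => (x == val s)%:R).
pose R : 'M[K]_(#|{: {x | b x}}|, #|J|) := fmx (fun (s : {x | b x}) (x : J) => (val s == x)%:R).
have RC : R *m C = 1%:M.
  rewrite fmx_mul -fmx1; apply: eq_fmx => s s'; rewrite (bigD1 (val s)) //= eqxx mul1r big1 ?addr0.
    by rewrite (inj_eq val_inj).
  by move=> x xs; rewrite eq_sym (negPf xs) mul0r.
have CR : C *m R = fmx (fun x y => ((x == y) && b x)%:R).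
  rewrite fmx_mul; apply: eq_fmx => x y; have [bx|nb] := boolP (b x); last first.
    rewrite andbF big1 // => s _; case: (x =P val s) => [e|_]; last by rewrite mul0r.
    by move: nb; rewrite e (valP s).
  rewrite andbT (bigD1 (Sub x bx)) //= eqxx mul1r big1 ?addr0 // => s sx.
  case: (x =P val s) => [e|_]; last by rewrite mul0r.
  by case/eqP: sx; apply: val_inj; rewrite /= -e.
rewrite -CR; have cE : #|{: {x | b x}}| = #|b| by rewrite card_sig.
apply/eqP; rewrite eqn_leq -{1}cE -cE (leq_trans (mxrankM_maxl _ _) (rank_leq_col _)) /=.
rewrite -{1}(mxrank1 K #|{: {x | b x}}|) -(mul1mx 1%:M) -{1}RC -{1}RC.
by rewrite mulmxA -(mulmxA R) (leq_trans (mxrankM_maxl _ _)) // (leq_trans (mxrankM_maxr _ _)).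
Qed.

Section CardIx.
Variables (la : nat -> nat) (K : closedFieldType).
Notation lf := (fun r : 'I_3 => la r).
Notation SD := (starD lf).
Variables (O : mobj K) (bU : pred (mU O)) (bT : pred (mT O)).
Definition ixp (x : ix O) := match x with inl u => bU u | inr c => bT (tag c) end.

Lemma card_ix v : mok SD O -> #|[pred x : ix O | ixp x && (ixgr SD x == v)]| =
  match v with None => #|bU|
  | Some c => #|[pred t : mT O | bT t && ((marm t == tag c) && (tagged c < mn t)%N)]| end.
Proof.
move=> hO.
transitivity (\sum_(x : mU O + cell O) (if ixp x && (ixgr SD x == v) then 1 else 0))%N.
  by rewrite -sum1_card big_mkcond; apply: eq_bigr.
rewrite big_sumType /=; case: v => [[r k]|] /=; last first.
  rewrite [X in (_ + X)%N]big1 ?addn0; last by move=> c _; rewrite andbF.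
  by rewrite -sum1_card [RHS]big_mkcond; apply: eq_bigr => u _; rewrite andbT.
rewrite big1 ?add0n; last by move=> u _; rewrite andbF.
rewrite (eq_bigr (fun c : cell O => (fun t (j : 'I_(mn t)) => if bT t && ((marm t == r) && (j == k :> nat)) then 1%N else 0%N) (tag c) (tagged c))); last first.
  move=> [t j] _ /=.
  have jl : (j < al SD (marm t))%N by apply: leq_trans (ltn_ord j) _; have /andP [] := hO t.
  have e1 : Some (Tagged (fun r : 'I_3 => 'I_(la r).+1) k) = agr SD r k by rewrite /= inord_val.
  change (Some (existT (fun i : 'I_3 => 'I_(la i).+1) r k)) with (Some (Tagged (fun r : 'I_3 => 'I_(la r).+1) k)).
  rewrite e1 -[X in X == _]/(agr SD (marm t) j); case: (bT t) => //=.
  case: (agr SD (marm t) j =P agr SD r k) => [/star_agr_inj [//||-> ->]|ne]; rewrite ?eqxx //.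
  by case: ifP => // /andP [/eqP e2 /eqP e3]; case: ne; rewrite e2 e3.
rewrite -(sig_big_dep xpredT (fun _ => xpredT) (fun (t : mT O) (j : 'I_(mn t)) =>
  if bT t && ((marm t == r) && (j == k :> nat)) then 1%N else 0%N)) /= -sum1_card [RHS]big_mkcond /=.
apply: eq_bigr => t _; rewrite inE; case: (bT t); case: (marm t == r) => /=; try by rewrite big1.
case: ltnP => kn; last first.
  by rewrite big1 // => j _; have := ltn_ord j; case: eqP => // -> /leq_trans /(_ kn); rewrite ltnn.
rewrite (bigD1 (Ordinal kn)) //= eqxx big1 ?addn0 // => j /eqP jk.
by case: eqP => // ee; case: jk; apply: val_inj.
Qed.

End CardIx.

(** * The homogeneous families as star representations *)

Section StarRep.
Variables (la : nat -> nat) (K : closedFieldType).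
Notation lf := (fun r : 'I_3 => la r).
Notation Q := (starQ lf).
Notation SD := (starD lf).
Implicit Types O : mobj K.

Definition dl O (v : qV Q) : nat :=
  match v with None => #|mU O|
  | Some c => #|[pred t : mT O | (marm t == tag c) && (tagged c < mn t)%N]| end.

Lemma dm_att O v : mok SD O -> dm (att SD O) v = dl O v.
Proof.
move=> hO; rewrite /dm /= (rank_diag K (fun x : ix O => ixgr SD x == v)).
have := @card_ix la K O predT predT v hO; rewrite (_ : #|[pred x | _]| = #|[pred x : ix O | ixgr SD x == v]|).
  by case: v => [[r k]|].
by apply: eq_card => x; rewrite !inE; case: x.
Qed.

Definition vx (x : qV Q -> int) (r k : nat) : int :=
  x (Some (@Tagged _ (inord r : 'I_3) (fun r : 'I_3 => 'I_(la r).+1) (inord k))).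

Lemma eul_star_nat (x z : qV Q -> int) : eul x z = x None * z None +
  \sum_(r < 3) \sum_(k < (la r).+1)
    vx x r k * (vx z r k - (if k == 0%N :> nat then z None else vx z r k.-1)).
Proof.
rewrite /eul sum_option -addrA -sumrB; congr (_ + _).
rewrite (eq_bigr (fun a : {r : 'I_3 & 'I_(la r).+1} => (fun (r : 'I_3) (k : 'I_(la r).+1) =>
   vx x r k * (vx z r k - (if k == 0%N :> nat then z None else vx z r k.-1))) (tag a) (tagged a))).
  by rewrite -(sig_big_dep xpredT (fun _ => xpredT) (fun (r : 'I_3) (k : 'I_(la r).+1) =>
   vx x r k * (vx z r k - (if k == 0%N :> nat then z None else vx z r k.-1)))).
move=> [r k] _ /=; rewrite /vx !inord_val mulrBr; congr (_ - _ * _).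
by case: ifP.
Qed.

Section Table.
Variables (tb : tbl) (tc e6 : nat).
Hypotheses (ck : tcheck tb) (tu0 : (0 < tu tb)%N).
Definition specG := forall (K : fieldType) h h' (Phi Theta : 'M[K]_h) (Phi' Theta' : 'M[K]_h')
  lb lb' (phi : mT (tabO tb Phi Theta lb) -> mT (tabO tb Phi' Theta' lb') -> K) psi,
  lbok tb lb lb' -> phom ole phi psi ->
  exists p p6, [/\ @isdiag K h h' (tu tb) e6 psi p p6, Phi *m p = p6 *m Phi', Theta *m p = p6 *m Theta' &
    Pt phi tc tc = p].
Hypothesis sp : specG.
Hypothesis fit : all (fun t => (0 < tlab tb t <= (la (tarm tb t)).+1)%N) (iota 0 (tt tb)).

Definition lb0 h (t : nat) (_ : 'I_h) := tlab tb t.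
Notation TO Phi Theta := (tabO tb Phi Theta (@lb0 _)).

Lemma lb0_ok h h' : lbok tb (@lb0 h) (@lb0 h').
Proof. by []. Qed.

Lemma TO_mok h (Phi Theta : 'M[K]_h) : mok SD (TO Phi Theta).
Proof.
move=> [t i] /=; have /allP /(_ (t : nat)) := fit; rewrite mem_iota /= => /(_ (ltn_ord t)).
by have [a _ _ _] := tck ck (ltn_ord t); rewrite /lb0 inordK.
Qed.

Lemma TO_rep h (Phi Theta : 'M[K]_h) : is_rep (att SD (TO Phi Theta)).
Proof. by apply: (att_rep (star_ok lf)); apply: TO_mok. Qed.

Definition tdl (v : qV Q) : nat := match v with None => tu tb
  | Some c => count (fun t => (tarm tb t == tag c) && (tagged c < tlab tb t)%N) (iota 0 (tt tb)) end.

Lemma TO_dl h (Phi Theta : 'M[K]_h) v : dm (att SD (TO Phi Theta)) v = (h * tdl v)%N.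
Proof.
rewrite dm_att; last exact: TO_mok.
case: v => [[r k]|] /=; last by rewrite card_prod !card_ord mulnC.
rewrite (_ : #|_| = #|[predX [pred t : 'I_(tt tb) | (tarm tb t == r) && (k < tlab tb t)%N] & 'I_h]|).
  rewrite cardX card_ord mulnC; congr (_ * _)%N.
  rewrite -sum1_card -(big_mkord (fun t => (tarm tb t == r) && (k < tlab tb t)%N) (fun _ => 1%N)).
  by rewrite /index_iota subn0 sum1_count.
apply: eq_card => [[t i]]; rewrite !inE /= andbT; congr (_ && _).
have [a _ _ _] := tck ck (ltn_ord t).
by rewrite -(inj_eq val_inj) /= inordK.
Qed.

Lemma star_hom O O' P : mok SD O -> mok SD O' -> hom (att SD O) (att SD O') P ->
  exists phi psi, phom ole (O:=O) (O':=O') phi psi /\ P = fmx (atth phi psi).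
Proof.
move=> h h'; rewrite -(unfmxK P) => hP; have m := phiP_mhom (star_ok lf) h h' hP.
exists (phiP (unfmx P)), (psiP (unfmx P)); split.
  by have [m1 m2] := m; split=> // t t' /m1 [a]; rewrite star_okl.
apply: eq_fmx; apply: (free_atth (star_ok lf)) => //; exact: star_agr_inj.
Qed.

Lemma tab_hom0 h h' (Phi Theta : 'M[K]_h) (Phi' Theta' : 'M[K]_h') P :
  (forall p p6 : 'M_(h, h'), Phi *m p = p6 *m Phi' -> Theta *m p = p6 *m Theta' -> p = 0 /\ p6 = 0) ->
  hom (att SD (TO Phi Theta)) (att SD (TO Phi' Theta')) P -> P = 0.
Proof.
move=> H hP; have [phi [psi [ph PE]]] := star_hom (@TO_mok _ Phi Theta) (@TO_mok _ Phi' Theta') hP.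
rewrite {}PE.
have [p [p6 [d e1 e2 _]]] := sp (@lb0_ok _ _) ph; have [p0 p60] := H _ _ e1 e2.
have psi0 : psi =2 (fun _ _ => 0).
  by move=> [u i] [u' j]; rewrite d p0 p60 !mxE !if_same.
have phi0 := RF_phi (@tab_RF _ ck _ _ _ _ _) ph psi0.
rewrite -[RHS]fmx0; apply: eq_fmx; case=> [x|x]; case=> [y|y] //=.
by rewrite phi0 if_same.
Qed.

Lemma tab_hom_ex h h' (Phi Theta : 'M[K]_h) (Phi' Theta' : 'M[K]_h') (p : 'M_(h, h')) :
  Phi *m p = p *m Phi' -> Theta *m p = p *m Theta' -> p <> 0 ->
  exists P, hom (att SD (TO Phi Theta)) (att SD (TO Phi' Theta')) P /\ P <> 0.
Proof.
move=> e1 e2 p0.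
pose phi (t : mT (TO Phi Theta)) (t' : mT (TO Phi' Theta')) : K := if t.1 == t'.1 then p t.2 t'.2 else 0.
pose psi (t : mU (TO Phi Theta)) (t' : mU (TO Phi' Theta')) : K := if t.1 == t'.1 then p t.2 t'.2 else 0.
exists (fmx (atth phi psi)); split.
  apply: att_hom; [exact: TO_mok | exact: TO_mok |].
  split=> [[t i] [t' j]|[t i] [u j]] /=.
    rewrite /phi /=; case: (t =P t') => [<- _|_]; last by rewrite eqxx.
    by split=> //; rewrite star_okl /lb0.
  transitivity ((p *m sv Phi' Theta' (tG tb t u)) i j).
    rewrite mxE -(pair_bigA _ (fun (t' : 'I_(tt tb)) (k : 'I_h') => phi (t, i) (t', k) * sv Phi' Theta' (tG tb t' u) k j)) /=.
    rewrite (bigD1 t) //= [X in _ + X]big1 ?addr0.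
      by apply: eq_bigr => k _; rewrite /phi /= eqxx.
    by move=> t' tt'; rewrite big1 // => k _; rewrite /phi /= eq_sym (negPf tt') mul0r.
  transitivity ((sv Phi Theta (tG tb t u) *m p) i j).
    by case: (tG tb t u) => [|[|[|c]]] /=; rewrite ?mulmx0 ?mul0mx ?mulmx1 ?mul1mx ?e1 ?e2.
  rewrite mxE -(pair_bigA _ (fun (u' : 'I_(tu tb)) (k : 'I_h) => sv Phi Theta (tG tb t u') i k * psi (u', k) (u, j))) /=.
  rewrite (bigD1 u) //= [X in _ + X]big1 ?addr0.
    by apply: eq_bigr => k _; rewrite /psi /= eqxx.
  by move=> u' uu'; rewrite big1 // => k _; rewrite /psi /= (negPf uu') mulr0.
move=> P0; apply: p0; apply/matrixP => i j.
have := fmx_inj (etrans P0 (esym (fmx0 K _ _))) (inl (Ordinal tu0, i)) (inl (Ordinal tu0, j)).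
by rewrite mxE => <- /=; rewrite /psi /= ?eqxx.
Qed.

(** The members for the Kronecker modules (1, t), (0, 1) and (1, t + Jordan block): finite points,
    the point at infinity, and the strings over finite points. *)
Definition Sfam (t : K) := att SD (TO 1%:M (t%:M : 'M[K]_1)).
Definition Sinf := att SD (TO (0 : 'M[K]_1) 1%:M).
Definition SJ h (t : K) := att SD (TO 1%:M (t%:M + shift K h)).
Definition dlt (v : qV Q) : int := (tdl v)%:Z.

Lemma Sfam_dim t : dz (Sfam t) =1 dlt.
Proof. by move=> v; rewrite /dz TO_dl mul1n. Qed.
Lemma Sinf_dim : dz Sinf =1 dlt.
Proof. by move=> v; rewrite /dz TO_dl mul1n. Qed.
Lemma SJ_dim h t v : dz (SJ h t) v = h%:Z * dlt v.
Proof. by rewrite /dz TO_dl PoszM. Qed.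

Lemma scal_inj h (t u : K) (p : 'M[K]_(1, h)) : t <> u -> t%:M *m p = p *m u%:M -> p = 0.
Proof.
move=> tu; rewrite mul_scalar_mx mul_mx_scalar => /eqP; rewrite -subr_eq0 -scalerBl scaler_eq0 subr_eq0.
by case/orP => /eqP.
Qed.

Lemma S_orth t u P : t <> u -> hom (Sfam t) (Sfam u) P -> P = 0.
Proof.
move=> tu; apply: tab_hom0 => p p6; rewrite mul1mx mulmx1 => <- e.
by rewrite (scal_inj tu e).
Qed.

Lemma Sinf_orthl t P : hom (Sfam t) Sinf P -> P = 0.
Proof. by apply: tab_hom0 => p p6; rewrite mul1mx !mulmx0 mulmx1 => -> <-; rewrite mulmx0. Qed.

Lemma Sinf_orthr t P : hom Sinf (Sfam t) P -> P = 0.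
Proof. by apply: tab_hom0 => p p6; rewrite !mul0mx mul1mx mulmx1 => <- ->; rewrite mul0mx. Qed.

Lemma shift_col h (p : 'M[K]_(1, h)) (j : 'I_h) :
  (p *m shift K h) 0 j = \sum_s p 0 s * (s.+1 == j)%:R.
Proof. by rewrite mxE; apply: eq_bigr => s _; rewrite mxE. Qed.

Lemma SJ_orth h t u P : t <> u -> hom (Sfam u) (SJ h t) P -> P = 0.
Proof.
move=> tu; apply: tab_hom0 => p p6; rewrite mul1mx mulmx1 => <- e; suff p0 : p = 0 by []; move: e; clear p6.
rewrite mulmxDr mul_scalar_mx mul_mx_scalar => e.
have H n (j : 'I_h) : (j < n)%N -> p 0 j = 0.
  elim: n j => // n IH j jn; have /matrixP /(_ 0 j) := e; rewrite mxE [RHS]mxE mxE shift_col big1 ?addr0.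
    move=> /eqP; rewrite -subr_eq0 -mulrBl mulf_eq0 subr_eq0 => /orP [/eqP ut|/eqP //].
    by case: tu.
  move=> s _; case: eqP => [es|_]; last by rewrite mulr0.
  by rewrite IH ?mul0r //; move: jn; rewrite -es ltnS.
by apply/matrixP => i j; rewrite ord1 (H j.+1) // mxE.
Qed.

Lemma SJ_sub h t : (0 < h)%N -> exists f, hom (Sfam t) (SJ h t) f /\ f <> 0.
Proof.
case: h => // h _; pose p : 'rV[K]_h.+1 := delta_mx 0 ord_max.
apply: (tab_hom_ex (p := p)).
- by rewrite mul1mx mulmx1.
- rewrite mulmxDr mul_scalar_mx mul_mx_scalar (_ : p *m _ = 0) ?addr0 //.
  apply/matrixP => i j; rewrite ord1 shift_col mxE big1 // => s _; rewrite !mxE eqxx /=.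
  case: eqP => [->|_]; last by rewrite mul0r.
  by rewrite (_ : (_ == _) = false) ?mulr0 //; apply/eqP => e; have := ltn_ord j; rewrite -e ltnn.
move=> /matrixP /(_ 0 ord_max); rewrite !mxE !eqxx /= => /eqP; by rewrite oner_eq0.
Qed.

(** A matrix commuting with a nilpotent Jordan block is upper triangular with constant diagonal. An
    idempotent one has diagonal 0 or 1, and p or 1 - p is then a strictly triangular idempotent,
    that is zero. *)
Lemma jordan_idem h (p : 'M[K]_h) : shift K h *m p = p *m shift K h -> p *m p = p -> p = 0 \/ p = 1%:M.
Proof.
move=> c pp.
have row_ (i j : 'I_h) (hi : (i.+1 < h)%N) : p (Ordinal hi) j = \sum_s p i s * (s.+1 == j)%:R.
  have /matrixP /(_ i j) := c; rewrite !mxE (bigD1 (Ordinal hi)) //= mxE eqxx mul1r big1 ?addr0.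
    by move=> ->; apply: eq_bigr => s _; rewrite mxE.
  move=> s sh; rewrite mxE (_ : (_ == _) = false) ?mul0r //.
  by apply/eqP => e; case/eqP: sh; apply: val_inj; rewrite /= e.
have toep (i j : 'I_h) (hi : (i.+1 < h)%N) (hj : (j.+1 < h)%N) : p (Ordinal hi) (Ordinal hj) = p i j.
  rewrite row_ (bigD1 j) //= eqxx mulr1 big1 ?addr0 // => s sj.
  by rewrite eqSS (inj_eq val_inj) (negPf sj) mulr0.
have up n (i j : 'I_h) : (i < n)%N -> (j < i)%N -> p i j = 0.
  elim: n i j => // n IH [i hi] j; case: i hi => // i hi ni ji.
  have hi' : (i < h)%N by apply: ltnW.
  rewrite (_ : Ordinal hi = @Ordinal h (Ordinal hi').+1 hi); last by apply: val_inj.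
  rewrite row_ big1 // => s _; case: eqP => [es|_]; last by rewrite mulr0.
  by rewrite IH ?mul0r //=; move: ji; rewrite -es.
case: h p c pp row_ toep up => [|h] p c pp row_ toep up; first by left; apply/matrixP => [[]].
have dg n (i : 'I_h.+1) : (i < n)%N -> p i i = p 0 0.
  elim: n i => // n IH [i hi]; case: i hi => [|i] hi ni.
    by rewrite (_ : Ordinal hi = 0) //; apply: val_inj.
  have hi' : (i < h.+1)%N by apply: ltnW.
  by have := toep (Ordinal hi') (Ordinal hi') hi hi => ->; apply: IH.
have c0 : p 0 0 * p 0 0 = p 0 0.
  have /matrixP /(_ 0 0) := pp; rewrite mxE (bigD1 0) //= big1 ?addr0 // => s s0.
  by rewrite (up s.+1 s 0) ?mulr0 // lt0n; apply: contra s0 => /eqP e; apply/eqP; apply: val_inj.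
suff key (q : 'M[K]_h.+1) : (forall n (i j : 'I_h.+1), (i < n)%N -> (j < i)%N -> q i j = 0) ->
    (forall i, q i i = 0) -> q *m q = q -> q = 0.
  move/eqP: c0; rewrite -subr_eq0 -{3}(mulr1 (p 0 0)) -mulrBr mulf_eq0 subr_eq0.
  case/orP => /eqP d0; [left|right]; first by apply: key => // i; rewrite (dg i.+1).
  apply/eqP; rewrite eq_sym -subr_eq0; apply/eqP; apply: key => [n i j ni ji|i|].
  - by rewrite !mxE (up n) // subr0 (_ : (i == j) = false) //; apply/eqP => e; rewrite e ltnn in ji.
  - by rewrite !mxE eqxx (dg i.+1) // d0 subrr.
  - by rewrite mulmxBl mul1mx mulmxBr mulmx1 pp subrr subr0.
move=> uq dq qq; have H n (i j : 'I_h.+1) : (j < i + n)%N -> q i j = 0.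
  elim: n i j => [|n IH] i j; first by rewrite addn0; apply: uq.
  rewrite addnS ltnS => jn; rewrite -qq mxE big1 // => s _.
  have [si|is_] := leqP s i.
    move: si; rewrite leq_eqVlt => /orP [/eqP e|lt]; last by rewrite (uq i.+1) ?mul0r.
    by rewrite (_ : s = i) ?dq ?mul0r //; apply: val_inj.
  by rewrite [q s j]IH ?mulr0 //; apply: leq_ltn_trans jn _; rewrite ltn_add2r.
by apply/matrixP => i j; rewrite mxE (H h.+1) // ltn_addl.
Qed.

Lemma SJ_indec h t : (0 < h)%N -> indec (SJ h t).
Proof.
move=> h0; apply: (pindec_indec (star_ok lf)); [exact: star_agr_inj | by [] | exact: TO_mok |].
split; first by split; left; exact: (Ordinal tu0, Ordinal h0).
move=> phi psi ph ee e.
have ph' : phom ole phi psi by have [h1 h2] := ph; split=> // x y /h1 [a]; rewrite star_okl.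
have [p [p6 [d e1 e2 _]]] := sp (@lb0_ok _ _) ph'; rewrite mul1mx mulmx1 in e1; subst p6.
have d' u i u' j : psi (u, i) (u', j) = if u == u' then p i j else 0 by rewrite d if_same.
have pp : p *m p = p.
  apply/matrixP => i j; have := tab_mul d' d' (Ordinal tu0) i (Ordinal tu0) j.
  by rewrite eqxx e d' eqxx => <-.
have c : shift K h *m p = p *m shift K h.
  move: e2; rewrite mulmxDl mulmxDr mul_scalar_mx mul_mx_scalar; exact: addrI.
have rf := @tab_RF _ ck _ _ (1%:M : 'M[K]_h) (t%:M + shift K h) (@lb0 h).
case: (jordan_idem c pp) => p0; [left|right].
  have psi0 : psi =2 (fun _ _ => 0) by move=> [u i] [u' j]; rewrite d' p0 mxE if_same.
  by split=> //; apply: RF_phi rf ph' psi0.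
have psi1 : psi =2 @fdel K _.
  by move=> [u i] [u' j]; rewrite d' p0 mxE /fdel xpair_eqE; case: (u == u').
split=> // x y; apply/eqP; rewrite -subr_eq0; apply/eqP.
pose phi' x y := phi x y - fdel K x y; pose psi' x y := psi x y - fdel K x y.
have ph0 : phom ole phi' psi'.
  have [h1 h2] := ph'; split=> [a b|a u].
    rewrite /phi' /fdel; case: (a =P b) => [<- _|_]; first by rewrite /ole.
    by rewrite subr0; apply: h1.
  rewrite /phi' /psi' (eq_bigr (fun b => phi a b * mg b u - fdel K a b * mg b u)); last first.
    by move=> b _; rewrite mulrBl.
  rewrite sumrB h2 [RHS](eq_bigr (fun b => mg a b * psi b u - mg a b * fdel K b u)); last first.
    by move=> b _; rewrite mulrBr.
  rewrite sumrB; congr (_ - _).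
  rewrite (bigD1 a) //= /fdel eqxx mul1r big1 ?addr0; last first.
    by move=> b ba; rewrite eq_sym (negPf ba) mul0r.
  by rewrite (bigD1 u) //= eqxx mulr1 big1 ?addr0 // => b bu; rewrite (negPf bu) mulr0.
by apply: (RF_phi rf ph0) => u u'; rewrite /psi' psi1 subrr.
Qed.

End Table.
End StarRep.

(** * Block triangular representations as extensions *)

Section Split.
Variables (Q : bquiver) (K : closedFieldType) (J : finType) (yp : pred J).
Variables (e : qV Q -> J -> J -> K) (A A0 : qA Q -> J -> J -> K).
Hypotheses (eD : forall v x y, x <> y -> e v x y = 0)
  (AXY : forall a x y, ~~ yp x -> yp y -> A a x y = 0)
  (AXX : forall a x y, ~~ yp x -> ~~ yp y -> A a x y = A0 a x y)
  (AYY : forall a x y, yp x -> yp y -> A a x y = A0 a x y).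

Definition sel (b : pred J) : finType := {x | b x}.
Definition incl b : 'M[K]_(#|sel b|, #|J|) := fmx (fun (s : sel b) x => (val s == x)%:R).
Definition proj b : 'M[K]_(#|J|, #|sel b|) := fmx (fun x (s : sel b) => (x == val s)%:R).
Definition restr b : rep Q K := @Rep Q K #|sel b| (fun v => fmx (fun x y : sel b => e v (val x) (val y)))
  (fun a => fmx (fun x y : sel b => A0 a (val x) (val y))).
Definition total_rep : rep Q K := @Rep Q K #|J| (fun v => fmx (e v)) (fun a => fmx (A a)).
Definition mixed a : 'M[K]_(#|sel yp|, #|sel (predC yp)|) :=
  fmx (fun (y : sel yp) (x : sel (predC yp)) => A a (val y) (val x)).

Lemma sum_r (b : pred J) (s : sel b) (F : J -> K) : \sum_x F x * (x == val s)%:R = F (val s).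
Proof.
rewrite (bigD1 (val s)) //= eqxx mulr1 big1 ?addr0 // => x xs.
by rewrite (negPf xs) mulr0.
Qed.
Lemma sum_l (b : pred J) (s : sel b) (F : J -> K) : \sum_x (val s == x)%:R * F x = F (val s).
Proof.
rewrite (bigD1 (val s)) //= eqxx mul1r big1 ?addr0 // => x xs.
by rewrite eq_sym (negPf xs) mul0r.
Qed.
Lemma sum_sr (b : pred J) (y : J) (F : J -> K) :
  \sum_(s : sel b) F (val s) * (val s == y)%:R = if b y then F y else 0.
Proof.
case: (boolP (b y)) => [by_|nb].
  rewrite (bigD1 (Sub y by_)) //= eqxx mulr1 big1 ?addr0 // => s sy.
  case: (val s =P y) => [es|_]; last by rewrite mulr0.
  by case/eqP: sy; apply: val_inj.
rewrite big1 // => s _; case: (val s =P y) => [es|_]; last by rewrite mulr0.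
by rewrite -es (valP s) in nb.
Qed.
Lemma sum_sl (b : pred J) (y : J) (F : J -> K) :
  \sum_(s : sel b) (y == val s)%:R * F (val s) = if b y then F y else 0.
Proof. by rewrite -sum_sr; apply: eq_bigr => s _; rewrite mulrC eq_sym. Qed.

Lemma incl_proj b : incl b *m proj b = 1%:M.
Proof.
rewrite fmx_mul -fmx1; apply: eq_fmx => s s'; rewrite (sum_l s (fun x => (x == val s')%:R)).
by rewrite (inj_eq val_inj).
Qed.

Lemma grad_proj b : @grad Q K total_rep (restr b) (proj b).
Proof.
move=> v /=; rewrite !fmx_mul; apply: eq_fmx => x s.
rewrite sum_r (sum_sl b x (fun z => e v z (val s))).
case: (boolP (b x)) => // nb; apply: eD => xs; by rewrite xs (valP s) in nb.
Qed.

Lemma grad_incl b : @grad Q K (restr b) total_rep (incl b).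
Proof.
move=> v /=; rewrite !fmx_mul; apply: eq_fmx => s x.
rewrite sum_l (sum_sr b x (fun z => e v (val s) z)).
case: (boolP (b x)) => // nb; apply/esym; apply: eD => xs; by rewrite -xs (valP s) in nb.
Qed.

Lemma split_splits : splits (X := restr (predC yp)) (Y := restr yp) (Z := total_rep) mixed
  (incl (predC yp)) (incl yp) (proj (predC yp)) (proj yp).
Proof.
split.
- split; first exact: grad_incl.
  move=> a /=; rewrite !fmx_mul; apply: eq_fmx => s x.
  rewrite sum_l (sum_sr (predC yp) x (fun z => A0 a (val s) z)) /=.
  by case: (boolP (yp x)) => yx /=; [rewrite AXY //; exact: (valP s) | rewrite AXX //; exact: (valP s)].
- split; first exact: grad_proj.
  move=> a /=; rewrite !fmx_mul; apply: eq_fmx => x s.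
  rewrite sum_r (sum_sl yp x (fun z => A0 a z (val s))).
  by case: (boolP (yp x)) => yx; [rewrite AYY //; exact: (valP s) | rewrite AXY //; exact: (valP s)].
- exact: grad_proj.
- exact: incl_proj.
- exact: incl_proj.
- rewrite !fmx_mul -fmx1; apply/matrixP => i j; rewrite !mxE.
  rewrite (sum_sl (predC yp) _ (fun z => (z == enum_val j)%:R)) (sum_sl yp _ (fun z => (z == enum_val j)%:R)) /=.
  by case: (yp _); rewrite /= ?addr0 ?add0r.
- move=> a /=; rewrite !fmx_mul; apply: eq_fmx => s s'.
  by rewrite sum_r sum_l.
Qed.

Lemma mixed_cocyc : is_rep total_rep -> @cocyc Q K (restr yp) (restr (predC yp)) mixed.
Proof.
move=> [_ _ _ h _] a; have := sp_z split_splits a => <-.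
rewrite {1}(h a) !mulmxA grad_incl -!mulmxA; congr (_ *m _).
by rewrite (@grad_proj (predC yp) (qt a)).
Qed.

Lemma split_exact : @exact Q K (restr (predC yp)) total_rep (restr yp) (incl (predC yp)) (proj yp).
Proof.
have sp := split_splits; split; [exact: sp_iX sp | exact: sp_pY sp | | |].
- by apply/row_freeP; exists (proj (predC yp)); exact: incl_proj.
- by apply/row_fullP; exists (incl yp); exact: incl_proj.
have z : incl (predC yp) *m proj yp = 0.
  rewrite fmx_mul -[RHS]fmx0; apply: eq_fmx => s s'; rewrite sum_l.
  case: eqP => // es; have := valP s; have := valP s'; rewrite /= -es => ->.
  by [].
apply/eqmxP/andP; split; last by apply/sub_kermxP.
rewrite -[X in (X <= _)%MS]mulmx1 -(sp_1 sp) mulmxDr !mulmxA mulmx_ker mul0mx addr0.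
exact: submxMl.
Qed.

End Split.

(** Sums as folds over [iota], which [vm_compute] can evaluate. *)
Definition isum n (f : nat -> int) : int := foldr (fun i s => f i + s) 0 (iota 0 n).
Lemma isumE (n : nat) (f : nat -> int) : \sum_(i < n) f i = isum n f.
Proof.
rewrite -(big_mkord xpredT f) /index_iota subn0 /isum.
by elim: (iota 0 n) => [|i s IH]; rewrite ?big_nil ?big_cons //= IH.
Qed.

Section Num.
Variables (la : nat -> nat).
Notation lf := (fun r : 'I_3 => la r).
Notation Q := (starQ lf).

Definition enum_eul (xN zN : int) (xf zf : nat -> nat -> int) : int :=
  xN * zN + isum 3 (fun r => isum (la r).+1 (fun k =>
    xf r k * (zf r k - (if k == 0%N then zN else zf r k.-1)))).

Definition numd (x : qV Q -> int) xN xf := x None = xN /\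
  forall r k, (r < 3)%N -> (k < (la r).+1)%N -> vx x r k = xf r k.

Lemma eul_num x z xN zN xf zf : numd x xN xf -> numd z zN zf -> eul x z = enum_eul xN zN xf zf.
Proof.
move=> [xe xh] [ze zh]; rewrite eul_star_nat xe ze /enum_eul -isumE; congr (_ + _).
apply: eq_bigr => r _; rewrite -isumE; apply: eq_bigr => k _.
rewrite xh ?ltn_ord // (zh r k) ?ltn_ord //; congr (_ * (_ - _)); case: ifP => // _.
by rewrite zh ?ltn_ord //; apply: leq_ltn_trans (leq_pred _) (ltn_ord k).
Qed.

Lemma numd_vx x : numd x (x None) (vx x). Proof. by []. Qed.

End Num.

Definition tdn tb (r k : nat) : nat := count (fun t => (tarm tb t == r) && (k < tlab tb t)%N) (iota 0 (tt tb)).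
Definition ydn tb pv (r k : nat) : nat :=
  count (fun t => (tG tb t pv != 0%N) && ((tarm tb t == r) && (k < tlab tb t)%N)) (iota 0 (tt tb)).
(** Vectors involving the coordinate pv carry parameters or 0 in all other coordinates, and the
    remaining vectors carry none. Every member is thus an extension of a fixed Y, spanned by the
    part at pv, by a fixed X, with cocycle linear in (Phi, Theta). *)
Definition ychk tb pv : bool :=
  all (fun t => if tG tb t pv != 0%N
     then (tG tb t pv == 1%N) && all (fun u => (u != pv) ==> (tG tb t u \in [:: 0; 2; 3]%N)) (iota 0 (tu tb))
     else all (fun u => tG tb t u \in [:: 0; 1]%N) (iota 0 (tu tb))) (iota 0 (tt tb)).
(** w r is the entry of delta at the tip of arm r; delta grows linearly from there to the centre.
    Its value 1 on arm 2 makes each null vector an integral multiple of delta. *)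
Definition wchk la tb w : bool := (tu tb == (la 2 + 2)%N) && (w 2%N == 1%N) &&
  all (fun r => (w r * (la r + 2) == tu tb)%N &&
    all (fun k => tdn tb r k == ((la r).+1 - k) * w r)%N (iota 0 (la r).+1)) (iota 0 3).

(** * The classification hypotheses for E7~ and E8~ *)

Section TameStar.
Variables (la : nat -> nat) (K : closedFieldType) (tb : tbl) (tc pv : nat) (w : nat -> nat).
Notation lf := (fun r : 'I_3 => la r).
Notation Q := (starQ lf).
Notation SD := (starD lf).
Hypotheses (ck : tcheck tb) (tu0 : (0 < tu tb)%N) (sp : specG tb tc pv)
  (fit : all (fun t => (0 < tlab tb t <= (la (tarm tb t)).+1)%N) (iota 0 (tt tb)))
  (cst0 : cst lf = 0) (hw : wchk la tb w) (pv0 : (pv < tu tb)%N) (hy : ychk tb pv)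
  (ey : enum_eul la 1 (tu tb)%:Z (fun r k => (ydn tb pv r k)%:Z) (fun r k => (tdn tb r k)%:Z) = -1).
Notation delta := (@dlt la tb).

Lemma delta_num : @numd la delta (tu tb)%:Z (fun r k => (tdn tb r k)%:Z).
Proof.
split=> // r k r3 kl; rewrite /vx /dlt /tdl /=; congr (Posz _).
by apply: eq_count => t; rewrite !inordK.
Qed.

Lemma w_facts : [/\ tu tb = (la 2 + 2)%N, w 2 = 1%N,
  forall r, (r < 3)%N -> (w r * (la r + 2) = tu tb)%N &
  forall r k, (r < 3)%N -> (k < (la r).+1)%N -> tdn tb r k = (((la r).+1 - k) * w r)%N].
Proof.
have /andP [/andP [/eqP h1 /eqP h2] /allP h3] := hw; split=> // [r r3|r k r3 kl].
  by have := h3 r; rewrite mem_iota r3 => /(_ isT) /andP [/eqP].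
have := h3 r; rewrite mem_iota r3 => /(_ isT) /andP [_ /allP /(_ k)].
by rewrite mem_iota add0n kl => /(_ isT) /eqP.
Qed.

Lemma cst_ge0 : 0 <= cst lf. Proof. by rewrite cst0. Qed.

Lemma psd_star (x : qV Q -> nat) : 0 <= eul (fun v => (x v)%:Z) (fun v => (x v)%:Z).
Proof. exact: star_psd _ cst_ge0. Qed.

Lemma psd0_star (x : qV Q -> nat) : eul (fun v => (x v)%:Z) (fun v => (x v)%:Z) = 0 ->
  exists k : nat, forall v, (x v)%:Z = k%:Z * delta v.
Proof.
move=> q0; have [tuE w2 wE dE] := w_facts.
have arm (r : 'I_3) := star_zero_arm (r := r) cst_ge0 q0.
have aN (r : 'I_3) : (la r + 2)%:Z * ya (fun v : qV Q => (x v)%:Z) r 1 = (x None)%:Z.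
  by have := arm r (la r).+1 (leqnn _); rewrite {2}/ya ltnn andbF => <-; rewrite addn2.
pose r2 : 'I_3 := inord 2; have r2E : r2 = 2%N :> nat by rewrite inordK.
have y0 : 0 <= ya (fun v : qV Q => (x v)%:Z) r2 1 by rewrite /ya; case: (_ && _).
have [k kE] : exists k : nat, ya (fun v : qV Q => (x v)%:Z) r2 1 = k%:Z.
  by exists (absz (ya (fun v : qV Q => (x v)%:Z) r2 1)); rewrite gez0_abs.
have xN : (x None)%:Z = k%:Z * (tu tb)%:Z.
  by have := aN r2; rewrite kE r2E => <-; rewrite tuE mulrC.
have yE (r : 'I_3) : ya (fun v : qV Q => (x v)%:Z) r 1 = k%:Z * (w r)%:Z.
  have := aN r; rewrite xN -(wE r (ltn_ord r)) PoszM.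
  set y := ya _ _ _ => e; have l0 : (la r + 2)%:Z != 0 by rewrite addn2.
  apply: (mulfI l0); rewrite e; ring.
exists k; case=> [[r k0]|] //=; have kl := ltn_ord k0.
have := arm r (la r - k0)%N; rewrite yE => /(_ (leq_trans (leq_subr _ _) (leqnSn _))).
rewrite /ya (_ : (0 < (la r - k0).+1 <= (la r).+1)%N) => [e|]; last by rewrite /= ltnS leq_subr.
have i0 : inord ((la r).+1 - (la r - k0).+1) = k0 :> 'I_(la r).+1.
  by apply: val_inj; rewrite /= subSS subKn // inordK.
rewrite i0 in e; change (existT (fun i : 'I_3 => 'I_(la i).+1) r k0) with (Tagged (fun r : 'I_3 => 'I_(la r).+1) k0).
rewrite -e; have [_ dn] := delta_num; have := dn r k0 (ltn_ord r) kl.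
rewrite /vx !inord_val => ->; rewrite dE // PoszM.
have -> : ((la r).+1 - k0 = (la r - k0).+1)%N by rewrite subSn.
ring.
Qed.

Lemma dd_star : eul delta delta = 0.
Proof.
have [tuE w2 wE dE] := w_facts; have [dN dn] := delta_num.
have F := star_form delta; rewrite cst0 mul0r add0r big1 in F; last first.
  move=> r _; rewrite big1 // => i _.
  have yE j : (0 < j <= (la r).+2)%N -> ya delta r j = j%:Z * (w r)%:Z.
    move=> /andP [j0 jl]; rewrite /ya j0 /=; case: leqP => jl'.
      have := dn r ((la r).+1 - j)%N (ltn_ord r); rewrite /vx inord_val => ->; last by lia.
      by rewrite dE ?ltn_ord //; [rewrite subKn // PoszM | lia].
    have -> : j = (la r + 2)%N by lia.
    by rewrite dN -(wE r (ltn_ord r)) PoszM mulrC.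
  have il := ltn_ord i; rewrite !yE; [|by lia..].
  rewrite !intrM -!pmulrn (_ : _ - _ = 0) ?expr0n ?mulr0 //.
  by rewrite mulrA divfK ?pnatr_eq0 // subrr.
by apply: (@intr_inj rat); rewrite F.
Qed.

Lemma rad_star (x : qV Q -> int) : eul x delta = - eul delta x.
Proof. by apply: eul_sym_zero; [exact: cst_ge0 | exact: dd_star]. Qed.

Notation TO Phi Theta := (tabO tb Phi Theta (@lb0 tb _)).
Definition O0 : mobj K := TO (0 : 'M[K]_1) 0.
Definition yU : pred (mU O0) := fun u => u.1 == pv :> nat.
Definition yT : pred (mT O0) := fun t => tG tb t.1 pv != 0%N.
Definition AA (Phi Theta : 'M[K]_1) (a : qA Q) (x y : ix O0) : K := @attX Q SD K (TO Phi Theta) a x y.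

Lemma ychkP t : (t < tt tb)%N -> if tG tb t pv != 0%N
  then tG tb t pv = 1%N /\ forall u, (u < tu tb)%N -> u != pv -> tG tb t u \in [:: 0; 2; 3]%N
  else forall u, (u < tu tb)%N -> tG tb t u \in [:: 0; 1]%N.
Proof.
move=> ht; have /allP /(_ t) := hy; rewrite mem_iota add0n ht => /(_ isT).
case: ifP => _; last by move=> /allP h u hu; apply: h; rewrite mem_iota.
by move=> /andP [/eqP e /allP h]; split=> // u hu ne; have := h u; rewrite mem_iota add0n hu ne => /(_ isT).
Qed.

Notation yp := (ixp yU yT).

Lemma cstep_tag (Phi Theta : 'M[K]_1) a (c c' : cell O0) : tag c <> tag c' -> @cstep Q SD K (TO Phi Theta) a c c' = 0.
Proof. by move=> /eqP /negPf ne; rewrite /cstep ne /= addr0. Qed.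

Lemma AA_XY Phi Theta a x y : ~~ yp x -> yp y -> AA Phi Theta a x y = 0.
Proof.
case: x => [u|c] nx; first by [].
have lt := ltn_ord (tag c).1; have := ychkP lt; move: nx; rewrite /= /yT => /negPf nx; rewrite nx => h.
case: y => [u|c'] /=.
  by rewrite /yU => /eqP eu; move/negbFE/eqP: nx; rewrite eu => -> /=; rewrite mxE mulr0.
move=> yc'; apply: cstep_tag => e; move: yc'; rewrite /yT -e nx; by [].
Qed.

Lemma AA_XX Phi Theta a x y : ~~ yp x -> ~~ yp y -> AA Phi Theta a x y = AA 0 0 a x y.
Proof.
case: x => [u|c] nx; first by [].
have lt := ltn_ord (tag c).1; have := ychkP lt; move: nx; rewrite /= /yT => /negPf nx; rewrite nx => h.
case: y => [u|c'] //= _.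
by have := h u.1 (ltn_ord _); rewrite !inE => /orP [] /eqP ->.
Qed.

Lemma AA_YY Phi Theta a x y : yp x -> yp y -> AA Phi Theta a x y = AA 0 0 a x y.
Proof.
case: x => [u|c] yx; first by [].
have lt := ltn_ord (tag c).1; have := ychkP lt; move: yx; rewrite /= /yT => yx; rewrite yx => [[h _]].
by case: y => [u|c'] //=; rewrite /yU => /eqP ->; rewrite h.
Qed.

Lemma atte_D v (x y : ix O0) : x <> y -> @atte Q SD K O0 v x y = 0.
Proof. by move=> /eqP /negPf ne; rewrite /atte ne. Qed.

Definition XR := restr (fun v => @atte Q SD K O0 v) (AA 0 0) (predC yp).
Definition YR := restr (fun v => @atte Q SD K O0 v) (AA 0 0) yp.
Definition zt Phi Theta := mixed yp (AA Phi Theta).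

Lemma star_splits Phi Theta : @splits Q K XR YR (att SD (TO Phi Theta)) (zt Phi Theta)
  (incl K (predC yp)) (incl K yp) (proj K (predC yp)) (proj K yp).
Proof.
exact: (split_splits atte_D (@AA_XY Phi Theta) (@AA_XX Phi Theta) (@AA_YY Phi Theta)).
Qed.

Lemma star_exact : @exact Q K XR (Sfam la tb (0 : K)) YR (incl K (predC yp)) (proj K yp).
Proof.
exact: (split_exact atte_D (@AA_XY _ _) (@AA_XX _ _) (@AA_YY _ _)).
Qed.

Lemma zt_cocyc Phi Theta : @cocyc Q K YR XR (zt Phi Theta).
Proof.
apply: (mixed_cocyc atte_D (@AA_XY Phi Theta) (@AA_XX Phi Theta) (@AA_YY Phi Theta)).
exact: (@TO_rep la K tb ck fit 1 Phi Theta).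
Qed.

Lemma zt_lin t a : zt 1%:M t%:M a = zt 1%:M (0 : K)%:M a + t *: zt 0 1%:M a.
Proof.
apply/matrixP => i j; rewrite !mxE; case: (enum_val i) => y yy; case: (enum_val j) => x xx /=.
case: y yy => [u|c] yy; first by rewrite /= mulr0 addr0.
have lt := ltn_ord (tag c).1; have := ychkP lt; move: yy; rewrite /= /yT => yy; rewrite yy => [[_ h]].
case: x xx => [u|c'] xx /=.
  have un : (u.1 : nat) != pv by [].
  have := h _ (ltn_ord _) un; rewrite !inE => /or3P [] /eqP -> /=.
  - by rewrite mxE !mulr0 addr0.
  - by rewrite !mxE !mulr0 addr0.
  - by rewrite [(tag c).2]ord1 [u.2]ord1 !mxE eqxx !mulr1n mulr0 add0r mulr1 mulrC.
have ne : tag c <> tag c' by move=> e; move: xx; rewrite /= /yT -e yy.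
by rewrite !cstep_tag // mulr0 addr0.
Qed.

Lemma YR_num : @numd la (dz YR) 1 (fun r k => (ydn tb pv r k)%:Z).
Proof.
have D v : dm YR v = #|[pred x : ix O0 | ixp yU yT x && (ixgr SD x == v)]|.
  rewrite /dm /= (@eq_fmx _ _ _ _ (fun s s' : sel yp => ((s == s') && (ixgr SD (val s) == v))%:R)).
    rewrite (rank_diag K (fun s : sel yp => ixgr SD (val s) == v)).
    rewrite -(card_imset _ val_inj); apply: eq_card => x; rewrite inE; apply/imsetP/andP.
      by move=> [s vs ->]; split; [exact: valP s | exact: vs].
    by move=> [yx vx]; exists (Sub x yx).
  by move=> s s'; rewrite /atte (inj_eq val_inj).
have mk : mok SD O0 by apply: TO_mok.
split; rewrite /dz.
  rewrite D (card_ix _ _ _ mk) (_ : #|yU| = 1%N) //.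
  rewrite -(card1 (Ordinal pv0, ord0 : 'I_1)); apply: eq_card => [[u i]]; rewrite !inE /yU unfold_in /=.
  by rewrite xpair_eqE -(inj_eq val_inj) /= (ord1 i) eqxx andbT.
move=> r k r3 kl; rewrite /vx D (card_ix _ _ _ mk) /=; congr (Posz _).
rewrite (_ : #|_| = #|[predX [pred t : 'I_(tt tb) | (tG tb t pv != 0%N) && ((tarm tb t == r) && (k < tlab tb t)%N)] & 'I_1]|).
  rewrite cardX card_ord muln1 -sum1_card.
  rewrite -(big_mkord (fun t => (tG tb t pv != 0%N) && ((tarm tb t == r) && (k < tlab tb t)%N)) (fun _ => 1%N)).
  by rewrite /index_iota subn0 sum1_count.
apply: eq_card => [[t i]]; rewrite !inE /= andbT /yT /=; congr (_ && (_ && _)).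
  have [a _ _ _] := tck ck (ltn_ord t).
  by rewrite -(inj_eq val_inj) /= !inordK.
have kl' : (k < (la (inord r : 'I_3)).+1)%N by rewrite inordK.
by rewrite /lb0 inordK.
Qed.

(** T has dimension k delta, and (Y, delta) pairs to -1 by [ey], so T pairs to -k with Y and to k
    with X. A nonzero map from Y to T is composed with the projection from S(0). If there is none,
    dim Ext(Y, T) = k is at most dim Hom(X, T) and the pencil argument applies. *)
Lemma pencil_star T : simp delta T -> eul (dz T) (dz T) = 0 ->
  (exists t f, hom (Sfam la tb t) T f /\ f <> 0) \/ (exists f, hom (Sinf la K tb) T f /\ f <> 0).
Proof.
move=> [hT _ _ T0 _] q0; have [k hk] := psd0_star q0.
have k0 : (0 < k)%N.
  rewrite lt0n; apply/eqP => k0; move: T0; rewrite rdim_sum // big1 // => v _.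
  by have := hk v; rewrite k0 mul0r; lia.
have hS (t : K) : is_rep (Sfam la tb t) by apply: TO_rep.
have ex := star_exact; have [hX1 hY1 fX fY _] := ex.
have hX : is_rep XR by apply: rep_inj hX1 fX (hS 0).
have hY : is_rep YR by apply: rep_surj hY1 fY (hS 0).
have dY : eul (dz YR) (dz T) = - k%:Z.
  rewrite (@eq_eul _ _ (dz YR) _ (fun v => k%:Z * delta v)) // eul_scaler.
  by rewrite (eul_num YR_num delta_num) ey mulrN1.
have dX : eul (dz XR) (dz T) = k%:Z.
  have E : eul (dz (Sfam la tb (0 : K))) (dz T) = 0.
    rewrite (@eq_eul _ _ delta _ (fun v => k%:Z * delta v)) ?eul_scaler ?dd_star ?mulr0 //.
    exact: Sfam_dim.
  have : eul (dz (Sfam la tb (0 : K))) (dz T) = eul (dz XR) (dz T) + eul (dz YR) (dz T).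
    rewrite -eul_addl; apply: eq_eul => // v; exact: (exact_dz v (hS 0) ex).
  by rewrite E dY; lia.
have EY := eulE hY hT; have EX := eulE hX hT; rewrite dY in EY; rewrite dX in EX.
have [h0|h0] := posnP (hd YR T); last first.
  have [g hg g0] := nz_hom hY hT h0; left; exists 0, (proj K yp *m g); split.
    exact: hom_comp hY1 hg.
  by move=> z; apply: g0; rewrite -[g]mul1mx -(incl_proj K yp) -mulmxA z mulmx0.
apply: (@splits_pencil Q K XR YR T (zt 1%:M (0 : K)%:M) (zt 0 1%:M) _ _ hX hY hT).
- exact: zt_cocyc.
- exact: zt_cocyc.
- move=> t; exists (incl K (predC yp)), (incl K yp), (proj K (predC yp)), (proj K yp).
  have [s1 s2 s3 s4 s5 s6 s7] := star_splits 1%:M t%:M; split=> // a.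
  by rewrite -zt_lin; apply: s7.
- by exists (incl K (predC yp)), (incl K yp), (proj K (predC yp)), (proj K yp); exact: star_splits.
- by lia.
- by lia.
Qed.

Hypothesis span : forall x : qV Q -> int, eul delta x = 0 ->
  (forall M Z N k c, is_rep M -> dz M =1 delta -> semi (K:=K) delta M -> @exact Q K Z M N k c ->
     dfc delta Z = 0 -> eul x (dz Z) = 0) -> eul x x = 0.

Lemma star_tame d : fin_many (fun M : rep Q K =>
  [/\ is_rep M, indec M, (rdim M <= d)%N & forall h t, ~ rep_iso M (SJ la tb h t)]).
Proof.
apply: (@tube_finite Q K (fun _ _ => erefl) delta (Sfam la tb) (Sinf la K tb)).
- by move=> t; apply: TO_rep.
- by move=> t; apply: Sfam_dim.
- by move=> t u P; apply: (S_orth ck sp fit).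
- exact: rad_star.
- exact: psd_star.
- exact: psd0_star.
- exact: TO_rep.
- exact: Sinf_dim.
- by move=> t P; apply: (Sinf_orthl ck sp fit).
- by move=> t P; apply: (Sinf_orthr ck sp fit).
- exact: pencil_star.
- exact: span.
- by move=> h t; apply: TO_rep.
- by move=> h t v; apply: SJ_dim.
- by move=> h t; apply: (SJ_indec ck tu0 sp fit).
- move=> h t; have [u] := avoid [:: t]; rewrite inE => /eqP ut.
  apply: (@semi_by Q K delta (Sfam la tb) _ _ u) => [x|x|| P].
  + by apply: TO_rep.
  + by apply: Sfam_dim.
  + by apply: TO_rep.
  by apply: (SJ_orth ck sp fit) => e; apply: ut.
- by move=> h t; apply: (SJ_sub ck tu0 fit).
Qed.

End TameStar.

(** * Regular subobjects of special members *)

(* Certificates: (phi, psi) embeds a regular object in the special member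
   (mu : lambda); (phi', psi') is a right inverse.  Missing entries are 0. *)
Record ztbl := Ztbl { zmu : int; zla : int; zarm : seq nat; zlab : seq nat;
  zg : seq (seq int); zpsi : seq (seq int); zphi : seq (seq int);
  zpsi' : seq (seq int); zphi' : seq (seq int); zdim : seq (seq nat) }.

Definition uv (k : nat) : seq int := rcons (nseq k 0) 1.

(** The parameters (1 : 0), (1 : 1) and (0 : 1) are those of the exceptional tubes, of ranks 3, 4
    and 2. For a tube of rank p there are p - 1 entries, with dimension vectors independent modulo
    delta; six in all. *)
Definition z7 : seq ztbl := [::
  @Ztbl (1) (0) [:: 0; 1; 2]%N [:: 1; 1; 1]%N
    [:: [:: 1]; [:: 1]; [:: 1]]%Z
    [:: [:: 0; 1; 1]]%Z
    [:: [:: 0; 1]; [:: 0; 0; 0; 1; 1]; [:: 0; 0; 0; 0; 0; 0; 1; 1]]%Z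
    [:: [::]; [:: 1]; [::]; [::]]%Z
    [:: [::]; [:: 1]; [::]; [:: 0; 1]; [::]; [::]; uv 2; [::]]%Z
    [:: [:: 1]; [:: 1]; [:: 1]]%N;
  @Ztbl (1) (0) [:: 0; 1; 1; 2; 2]%N [:: 1; 2; 1; 2; 1]%N
    [:: [:: 1; 1]; [:: 0; 1]; [:: 1]; [:: 1]; [:: 0; 1]]%Z
    [:: [:: 0; 1]; uv 2]%Z
    [:: [:: 0; 1]; uv 3; uv 4; uv 6; uv 7]%Z
    [:: [::]; [:: 1]; [:: 0; 1]; [::]]%Z
    [:: [::]; [:: 1]; [::]; [:: 0; 1]; uv 2; [::]; uv 3; uv 4]%Z
    [:: [:: 1]; [:: 2; 1]; [:: 2; 1]]%N;
  @Ztbl (1) (1) [:: 0; 2]%N [:: 1; 2]%N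
    [:: [:: 1]; [:: 1]]%Z
    [:: [:: 1; -1]]%Z
    [:: [:: 1; -1]; [:: 0; 0; 0; 0; 0; 1; -1]]%Z
    [:: [:: 1]; [::]; [::]; [::]]%Z
    [:: [:: 1]; [::]; [::]; [::]; [::]; [:: 0; 1]; [::]; [::]]%Z
    [:: [:: 1]; [:: 0]; [:: 1; 1]]%N;
  @Ztbl (1) (1) [:: 0; 1; 2; 2]%N [:: 1; 1; 3; 2]%N
    [:: [:: -1; 1]; [:: 0; 1]; [:: 1]; [:: 0; 1]]%Z
    [:: [:: 1]; [:: 0; 1]]%Z
    [:: [:: -1; 1]; uv 4; uv 5; uv 6]%Z
    [:: [:: 1]; [:: 0; 1]; [::]; [::]]%Z
    [:: [:: -1]; [::]; [::]; [::]; [:: 0; 1]; uv 2; uv 3; [::]]%Z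
    [:: [:: 1]; [:: 1]; [:: 2; 2; 1]]%N;
  @Ztbl (1) (1) [:: 0; 0; 1; 1; 2; 2]%N [:: 1; 1; 2; 1; 3; 2]%N
    [:: [:: -1; 1]; [:: 1; 0; 1]; uv 2; [:: 0; 1]; [:: 1]; [:: 0; 1]]%Z
    [:: [:: 1]; [:: 0; 1]; [:: 0; 0; 1; 1]]%Z
    [:: [:: -1; 1]; [:: 1]; [:: 0; 0; 1; 1]; uv 4; uv 5; uv 6]%Z
    [:: [:: 1]; [:: 0; 1]; uv 2; [::]]%Z
    [:: [:: 0; 1]; [:: 1; 1]; uv 2; [::]; uv 3; uv 4; uv 5; [::]]%Z
    [:: [:: 2]; [:: 2; 1]; [:: 2; 2; 1]]%N;
  @Ztbl (0) (1) [:: 0; 1; 1; 2]%N [:: 1; 3; 1; 2]%N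
    [:: [:: 1; 1]; [:: 0; 1]; [:: 1]; [:: 1]]%Z
    [:: [:: 0; 1]; uv 3]%Z
    [:: [:: 0; 1]; uv 2; uv 4; uv 6]%Z
    [:: [::]; [:: 1]; [::]; [:: 0; 1]]%Z
    [:: [::]; [:: 1]; [:: 0; 1]; [::]; uv 2; [::]; uv 3; [::]]%Z
    [:: [:: 1]; [:: 2; 1; 1]; [:: 1; 1]]%N].

(** The same for the tubes of ranks 5, 2 and 3 at (1 : 0), (1 : 1) and (0 : 1); seven entries. *)
Definition z8 : seq ztbl := [::
  @Ztbl (1) (0) [:: 0; 1; 2]%N [:: 1; 2; 5]%N
    [:: [:: 1; 1]; [:: 0; 1]; [:: 1]]%Z
    [:: [:: 1]; uv 5]%Z
    [:: uv 2; uv 4; uv 7]%Z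
    [:: [:: 1]; [::]; [::]; [::]; [::]; [:: 0; 1]]%Z
    [:: [::]; [::]; [:: 1]; [::]; [:: 0; 1]; [::]; [::]; uv 2; [::]; [::]; [::]; [::]]%Z
    [:: [:: 1]; [:: 1; 1]; [:: 1; 1; 1; 1; 1]]%N;
  @Ztbl (1) (0) [:: 0; 0; 1; 1; 2; 2]%N [:: 1; 1; 2; 1; 5; 1]%N
    [:: [:: 1; 1]; [:: 1; 0; 1]; uv 2; [:: 0; 1]; [:: 1]; [:: 0; 1]]%Z
    [:: [:: 1]; [:: 0; 0; 0; 1; 1]; uv 5]%Z
    [:: [:: 0; 1]; uv 2; uv 4; [:: 0; 0; 0; 1; 0; 0; 1]; uv 7; [:: 0; 0; 0; 0; 0; 0; 0; 0; 0; 0; 1; 1]]%Z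
    [:: [:: 1]; [::]; [::]; [:: 0; 1]; [::]; uv 2]%Z
    [:: [::]; [:: 1]; [:: 0; 1]; uv 3; uv 2; [::]; [::]; uv 4; [::]; [::]; uv 5; [::]]%Z
    [:: [:: 2]; [:: 2; 1]; [:: 2; 1; 1; 1; 1]]%N;
  @Ztbl (1) (0) [:: 0; 0; 1; 1; 1; 2; 2; 2]%N [:: 1; 1; 2; 2; 1; 5; 2; 1]%N
    [:: [:: 1; 1; 1]; [:: 1; 0; 0; 1]; uv 2; uv 3; [:: 0; 1]; [:: 1]; [:: 0; 1]; uv 2]%Z
    [:: [:: 1]; uv 3; uv 4; uv 5]%Z
    [:: [:: 0; 1]; uv 2; uv 3; uv 4; uv 6; uv 7; uv 10; uv 11]%Z
    [:: [:: 1]; [::]; [::]; [:: 0; 1]; uv 2; uv 3]%Z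
    [:: [::]; [:: 1]; [:: 0; 1]; uv 2; uv 3; [::]; uv 4; uv 5; [::]; [::]; uv 6; uv 7]%Z
    [:: [:: 2]; [:: 3; 2]; [:: 3; 2; 1; 1; 1]]%N;
  @Ztbl (1) (0) [:: 0; 0; 0; 1; 1; 1; 2; 2; 2; 2]%N [:: 1; 1; 1; 2; 2; 1; 5; 3; 2; 1]%N
    [:: [:: 1; -1; 1]; [:: 0; 1; 0; 1]; [:: 1; 0; 0; 0; 1]; uv 3; uv 4; uv 2; [:: 1]; [:: 0; 1]; uv 2; uv 3]%Z
    [:: [:: 1]; [:: 0; 1; 1]; uv 3; uv 4; uv 5]%Z
    [:: [:: -1; 1]; [:: 1]; uv 2; uv 3; uv 4; uv 6; uv 7; [:: 0; 0; 0; 0; 0; 0; 0; 0; 1; 1]; uv 10; uv 11]%Z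
    [:: [:: 1]; [:: 0; 1]; [::]; uv 2; uv 3; uv 4]%Z
    [:: [:: 0; 1]; [:: 1; 1]; uv 2; uv 3; uv 4; [::]; uv 5; uv 6; uv 7; [::]; uv 8; uv 9]%Z
    [:: [:: 3]; [:: 3; 2]; [:: 4; 3; 2; 1; 1]]%N;
  @Ztbl (1) (1) [:: 0; 0; 1; 1; 2; 2]%N [:: 1; 1; 2; 1; 4; 2]%N
    [:: [:: -1; 1]; [:: -1; 0; 1]; uv 2; [:: 0; 1]; [:: 1]; [:: 0; 1]]%Z
    [:: [:: 1; -1]; [:: 0; 0; 1; -1]; [:: 0; 0; 0; 0; 1; -1]]%Z
    [:: [:: 1; -1]; [:: 1; 0; -1]; [:: 0; 0; 0; 1; -1]; [:: 0; 0; 0; 0; 0; 1; -1]; [:: 0; 0; 0; 0; 0; 0; 0; 1; -1]; [:: 0; 0; 0; 0; 0; 0; 0; 0; 0; 1; -1]]%Z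
    [:: [:: 1]; [::]; [:: 0; 1]; [::]; uv 2; [::]]%Z
    [:: [:: 0; 1]; [:: -1; 1]; [::]; uv 2; [::]; uv 3; [::]; uv 4; [::]; uv 5; [::]; [::]]%Z
    [:: [:: 2]; [:: 2; 1]; [:: 2; 2; 1; 1]]%N;
  @Ztbl (0) (1) [:: 0; 1; 1; 2]%N [:: 1; 2; 1; 3]%N
    [:: [:: 1; 1]; [:: 0; 1]; [:: 1]; [:: 1]]%Z
    [:: uv 2; uv 5]%Z
    [:: uv 2; uv 4; uv 5; uv 9]%Z
    [:: [::]; [::]; [:: 1]; [::]; [::]; [:: 0; 1]]%Z
    [:: [::]; [::]; [:: 1]; [::]; [:: 0; 1]; uv 2; [::]; [::]; [::]; uv 3; [::]; [::]]%Z
    [:: [:: 1]; [:: 2; 1]; [:: 1; 1; 1]]%N;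
  @Ztbl (0) (1) [:: 0; 0; 1; 1; 1; 2; 2; 2]%N [:: 1; 1; 2; 2; 1; 4; 3; 1]%N
    [:: [:: 1; 1; 1]; [:: 0; 1; 0; 1]; uv 2; uv 3; [:: 0; 1]; [:: 1]; [:: 0; 1]; uv 2]%Z
    [:: [:: 0; 1]; uv 2; uv 4; uv 5]%Z
    [:: [:: 1]; uv 2; uv 3; uv 4; uv 5; uv 8; uv 9; uv 11]%Z
    [:: [::]; [:: 1]; [:: 0; 1]; [::]; uv 2; uv 3]%Z
    [:: [:: 1]; [::]; [:: 0; 1]; uv 2; uv 3; uv 4; [::]; [::]; uv 5; uv 6; [::]; uv 7]%Z
    [:: [:: 2]; [:: 3; 2]; [:: 3; 2; 2; 1]]%N].

Definition ent (M : seq (seq int)) (i j : nat) : int := nth 0 (nth [::] M i) j.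
Definition ival (mu la : int) (c : nat) : int := match c with 0 => 0 | 1 => 1 | 2 => mu | _ => la end.
Definition zu z := size (zpsi z).
Definition zth z := size (zarm z).
Definition zdn z (r k : nat) : nat := nth 0%N (nth [::] (zdim z) r) k.

(** Labels fit the arms, phi respects the order, (phi, psi) commutes with the attaching vectors,
    both have integral right inverses, and the dimensions are those of [zdim]. The identities are
    over the integers, so injectivity holds in every characteristic. *)
Definition zcheck (la : nat -> nat) (tb : tbl) (z : ztbl) : bool :=
  [&& all (fun t => (nth 0%N (zarm z) t < 3)%N && (0 < nth 0%N (zlab z) t <= (la (nth 0%N (zarm z) t)).+1)%N) (iota 0 (zth z)),
   all (fun t => all (fun t' => (ent (zphi z) t t' != 0) ==>
     (nth 0%N (zarm z) t == tarm tb t') && (nth 0%N (zlab z) t <= tlab tb t')%N) (iota 0 (tt tb))) (iota 0 (zth z)),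
   all (fun t => all (fun u => isum (tt tb) (fun t' => ent (zphi z) t t' * ival (zmu z) (zla z) (tG tb t' u)) ==
     isum (zu z) (fun v => ent (zg z) t v * ent (zpsi z) v u)) (iota 0 (tu tb))) (iota 0 (zth z)),
   all (fun u => all (fun u' => isum (tu tb) (fun v => ent (zpsi z) u v * ent (zpsi' z) v u') == (u == u')%:Z)
     (iota 0 (zu z))) (iota 0 (zu z)),
   all (fun t => all (fun t' => isum (tt tb) (fun v => ent (zphi z) t v * ent (zphi' z) v t') == (t == t')%:Z)
     (iota 0 (zth z))) (iota 0 (zth z)) &
   all (fun r => all (fun k => count (fun t => (nth 0%N (zarm z) t == r) && (k < nth 0%N (zlab z) t)%N) (iota 0 (zth z)) == zdn z r k)
     (iota 0 (la r).+1)) (iota 0 3)].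

(** Only (phi, psi) is a morphism; (phi', psi') is just a right inverse of matrices. The condition
    on labels ensures that every position of a source interval exists in the targets that occur. *)
Lemma atth_rinv (K : fieldType) (O O' : mobj K) phi psi phi' psi' :
  (forall (t : mT O) (t' : mT O'), phi t t' != 0 -> (mn t <= mn t')%N) ->
  fm_mul phi phi' =2 @fdel K _ -> fm_mul psi psi' =2 @fdel K _ ->
  fmx (@atth K O O' phi psi) *m fmx (@atth K O' O phi' psi') = 1%:M.
Proof.
move=> hl e1 e2; rewrite fmx_mul -fmx1; apply: eq_fmx => x z.
rewrite big_sumType /=; case: x => [u|[t k]]; case: z => [u''|[t'' k'']] /=.
- rewrite [X in _ + X]big1 ?addr0; last by move=> c _; rewrite mul0r.
  exact: e2.
- by rewrite !big1 ?addr0 // => c _; rewrite ?mulr0 ?mul0r.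
- by rewrite !big1 ?addr0 // => c _; rewrite ?mulr0 ?mul0r.
rewrite big1 ?add0r; last by move=> c _; rewrite mul0r.
rewrite sum_cell /=.
have kt t' : phi t t' != 0 -> (k < mn t')%N by move=> /hl; apply: leq_trans.
transitivity ((k == k'' :> nat)%:R * fm_mul phi phi' t t'').
  rewrite /fm_mul mulr_sumr; apply: eq_bigr => t' _.
  have [->|nz] := eqVneq (phi t t') 0; first by rewrite mul0r mulr0 big1 // => k' _; rewrite if_same mul0r.
  rewrite (bigD1 (Ordinal (kt t' nz))) //= eqxx big1 ?addr0; first by case: eqP; rewrite ?mul1r ?mul0r ?mulr0.
  move=> k' /eqP nk; case: eqP => [ek|_]; last by rewrite mul0r.
  by case: nk; apply: val_inj.
rewrite e1 /fdel; have [e|ne] := eqVneq t t''.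
  subst t''; rewrite mulr1; congr (_%:R); congr nat_of_bool; apply/eqP/eqP => [e|].
    by congr (inr (existT _ t _)); apply: val_inj.
  by move=> e; have := f_equal (fun x : ix O => match x with inl _ => 0%N | inr c => tagged c : nat end) e.
rewrite mulr0; case: eqP => // /(f_equal (fun x : ix O => match x with inl _ => t | inr c => tag c end)) /= e.
by rewrite e eqxx in ne.
Qed.

Section Zemb.
Variables (la : nat -> nat) (K : closedFieldType) (tb : tbl) (z : ztbl).
Notation lf := (fun r : 'I_3 => la r).
Notation SD := (starD lf).
Hypotheses (ck : tcheck tb) (zc : zcheck la tb z)
  (fit : all (fun t => (0 < tlab tb t <= (la (tarm tb t)).+1)%N) (iota 0 (tt tb))).
Variables (Phi Theta : 'M[K]_1).
Hypotheses (hPhi : Phi 0 0 = (zmu z)%:~R) (hTheta : Theta 0 0 = (zla z)%:~R).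
Notation TO := (tabO tb Phi Theta (@lb0 tb _)).

Definition zobj : mobj K := @MObj K 'I_(zu z) 'I_(zth z) (fun t => inord (nth 0%N (zarm z) t))
  (fun t => nth 0%N (zlab z) t) (fun t u => (ent (zg z) t u)%:~R).

Lemma all2P (n m : nat) (p : nat -> nat -> bool) : all (fun t => all (fun u => p t u) (iota 0 m)) (iota 0 n) ->
  forall t u, (t < n)%N -> (u < m)%N -> p t u.
Proof.
move=> /allP h t u tn um; have := h t; rewrite mem_iota add0n tn => /(_ isT) /allP /(_ u).
by rewrite mem_iota add0n um; apply.
Qed.

Lemma zarmP t : (t < zth z)%N -> (nth 0%N (zarm z) t < 3)%N /\ (0 < nth 0%N (zlab z) t <= (la (nth 0%N (zarm z) t)).+1)%N.
Proof.
move=> tz; have /and5P [/allP h _ _ _ _] := zc; have := h t; rewrite mem_iota tz => /(_ isT).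
by case/andP.
Qed.

Lemma zobj_mok : mok SD zobj.
Proof. by move=> t; have [a b] := zarmP (ltn_ord t); rewrite /= inordK. Qed.

Lemma zobj_num : @numd la (dz (att SD zobj)) (zu z)%:Z (fun r k => (zdn z r k)%:Z).
Proof.
split; first by rewrite /dz (dm_att _ zobj_mok) /= card_ord.
move=> r k r3 kl; rewrite /vx /dz (dm_att _ zobj_mok) /=.
have /and5P [_ _ _ _ /andP [_ /allP h]] := zc; have := h r; rewrite mem_iota r3 => /(_ isT) /allP /(_ k).
rewrite mem_iota add0n kl => /(_ isT) /eqP <-; congr (Posz _).
rewrite -[RHS]sum1_count -[iota 0 (zth z)]/(iota 0 (zth z)) -[in RHS](subn0 (zth z)) -/(index_iota 0 (zth z)) big_mkord -sum1_card.
apply: eq_bigl => t; have [a _] := zarmP (ltn_ord t); rewrite inE /= -(inj_eq val_inj) /= !inordK //.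
Qed.

Lemma sum_pair1 n (F : 'I_n * 'I_1 -> K) : \sum_p F p = \sum_t F (t, ord0).
Proof.
rewrite (eq_bigr (fun p => F (p.1, p.2))); last by case.
by rewrite -(pair_bigA _ (fun t i => F (t, i))) /=; apply: eq_bigr => t _; rewrite big_ord1.
Qed.

Lemma sum_intr n (f : nat -> int) : \sum_(i < n) (f i)%:~R = (isum n f)%:~R :> K.
Proof. by rewrite -isumE rmorph_sum. Qed.

Lemma svE c (i j : 'I_1) : sv Phi Theta c i j = (ival (zmu z) (zla z) c)%:~R.
Proof.
by rewrite !ord1; case: c => [|[|[|c]]] /=; rewrite ?mxE ?eqxx // hPhi.
Qed.

Lemma z_emb : exists P, hom (att SD zobj) (att SD TO) P /\ row_free P.
Proof.
have /and5P [_ c1 c2 c3 /andP [c4 _]] := zc.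
pose phi (t : mT zobj) (p : mT TO) : K := (ent (zphi z) t p.1)%:~R.
pose psi (u : mU zobj) (p : mU TO) : K := (ent (zpsi z) u p.1)%:~R.
pose phi' (p : mT TO) (t : mT zobj) : K := (ent (zphi' z) p.1 t)%:~R.
pose psi' (p : mU TO) (u : mU zobj) : K := (ent (zpsi' z) p.1 u)%:~R.
have lab (t : mT zobj) (p : mT TO) : phi t p != 0 -> nth 0%N (zarm z) t = tarm tb p.1 /\ (nth 0%N (zlab z) t <= tlab tb p.1)%N.
  move=> nz; have := all2P c1 (ltn_ord t) (ltn_ord p.1).
  have -> /= : ent (zphi z) t p.1 != 0 by apply: contraNneq nz => e; rewrite /phi e mulr0z.
  by move=> /andP [/eqP].
exists (fmx (atth phi psi)); split.
  apply: att_hom; [exact: zobj_mok | exact: TO_mok |].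
  split=> [t p /lab [e1 e2]|t [u j]]; first by rewrite /= e1 star_okl.
  rewrite sum_pair1 (eq_bigr (fun t' : 'I_(tt tb) => (ent (zphi z) t t' * ival (zmu z) (zla z) (tG tb t' u))%:~R)).
    rewrite (sum_intr _ (fun t' => ent (zphi z) t t' * ival (zmu z) (zla z) (tG tb t' u))).
    rewrite (eqP (all2P c2 (ltn_ord t) (ltn_ord u))) -sum_intr.
    by apply: eq_bigr => v _; rewrite intrM.
  by move=> t' _; rewrite /phi /= svE intrM.
apply/row_freeP; exists (fmx (atth phi' psi')); apply: atth_rinv => [t p /lab []|t t'|u u'] //.
- rewrite /fm_mul sum_pair1 (eq_bigr (fun v : 'I_(tt tb) => (ent (zphi z) t v * ent (zphi' z) v t')%:~R)).
    by rewrite (sum_intr _ (fun v => ent (zphi z) t v * ent (zphi' z) v t')) (eqP (all2P c4 (ltn_ord t) (ltn_ord t'))).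
  by move=> v _; rewrite intrM.
- rewrite /fm_mul sum_pair1 (eq_bigr (fun v : 'I_(tu tb) => (ent (zpsi z) u v * ent (zpsi' z) v u')%:~R)).
    by rewrite (sum_intr _ (fun v => ent (zpsi z) u v * ent (zpsi' z) v u')) (eqP (all2P c3 (ltn_ord u) (ltn_ord u'))).
  by move=> v _; rewrite intrM.
Qed.

End Zemb.

Section Zspan.
Variables (la : nat -> nat) (K : closedFieldType) (tb : tbl) (tc pv : nat) (w : nat -> nat).
Notation lf := (fun r : 'I_3 => la r).
Notation Q := (starQ lf).
Notation delta := (@dlt la tb).
Hypotheses (ck : tcheck tb) (tu0 : (0 < tu tb)%N) (sp : specG tb tc pv)
  (fit : all (fun t => (0 < tlab tb t <= (la (tarm tb t)).+1)%N) (iota 0 (tt tb))).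

Variable x : qV Q -> int.
Hypothesis H : forall M Z N k c, is_rep M -> dz M =1 delta -> semi (K:=K) delta M -> @exact Q K Z M N k c ->
     dfc delta Z = 0 -> eul x (dz Z) = 0.

Lemma z_orth z : zcheck la tb z -> ((zmu z, zla z) \in [:: (1, 0); (1, 1); (0, 1)]) ->
  enum_eul la (tu tb)%:Z (zu z)%:Z (fun r k => (tdn tb r k)%:Z) (fun r k => (zdn z r k)%:Z) = 0 ->
  enum_eul la (x None) (zu z)%:Z (vx x) (fun r k => (zdn z r k)%:Z) = 0.
Proof.
move=> zc zp ez; rewrite -(eul_num (numd_vx x) (zobj_num K zc)).
have dz0 : dfc delta (att (starD lf) (zobj K z)) = 0.
  by rewrite /dfc (eul_num (delta_num la tb) (zobj_num K zc)).
have sS t : semi (K:=K) delta (Sfam la tb t).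
  have [u] := avoid [:: t]; rewrite inE => /eqP ut.
  apply: (@semi_by Q K delta (Sfam la tb) _ _ u) => [y|y|| P].
  - by apply: TO_rep.
  - by apply: Sfam_dim.
  - by apply: TO_rep.
  by apply: (S_orth ck sp fit).
have sI : semi (K:=K) delta (Sinf la K tb).
  apply: (@semi_by Q K delta (Sfam la tb) _ _ 0) => [y|y|| P].
  - by apply: TO_rep.
  - by apply: Sfam_dim.
  - by apply: TO_rep.
  by apply: (Sinf_orthl ck sp fit).
move: zp; rewrite !inE => /or3P [] /eqP [e1 e2].
- have [||P [hP fP]] := @z_emb la K tb z ck zc fit 1%:M (0%:M) _ _.
  + by rewrite mxE eqxx e1.
  + by rewrite mxE eqxx e2.
  have [N [c ex]] := exact_sub hP fP; apply: (H _ _ (sS 0) ex dz0); [exact: TO_rep | exact: Sfam_dim].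
- have [||P [hP fP]] := @z_emb la K tb z ck zc fit 1%:M (1%:M) _ _.
  + by rewrite mxE eqxx e1.
  + by rewrite mxE eqxx e2.
  have [N [c ex]] := exact_sub hP fP; apply: (H _ _ (sS 1) ex dz0); [exact: TO_rep | exact: Sfam_dim].
- have [||P [hP fP]] := @z_emb la K tb z ck zc fit 0 (1%:M) _ _.
  + by rewrite mxE e1.
  + by rewrite mxE eqxx e2.
  have [N [c ex]] := exact_sub hP fP; apply: (H _ _ _ ex) => //; [exact: TO_rep | exact: Sinf_dim].
Qed.

End Zspan.

Definition la8 (r : nat) : nat := nth 0%N [:: 0; 1; 4]%N r.
Definition la7 (r : nat) : nat := nth 0%N [:: 0; 2; 2]%N r.
Definition w8 (r : nat) : nat := nth 0%N [:: 3; 2; 1]%N r.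
Definition w7 (r : nat) : nat := nth 0%N [:: 2; 1; 1]%N r.

Lemma spec8G : specG tE8 7 5. Proof. by move=> K h h' *; apply: spec8. Qed.
Lemma spec7G : specG tE7 5 1. Proof. by move=> K h h' *; apply: spec7. Qed.

Lemma cst8 : cst (fun r : 'I_3 => la8 r) = 0.
Proof. by apply/eqP; rewrite /cst !big_ord_recr big_ord0; vm_compute. Qed.
Lemma cst7 : cst (fun r : 'I_3 => la7 r) = 0.
Proof. by apply/eqP; rewrite /cst !big_ord_recr big_ord0; vm_compute. Qed.

Lemma fit8 : all (fun t => (0 < tlab tE8 t <= (la8 (tarm tE8 t)).+1)%N) (iota 0 (tt tE8)).
Proof. by vm_compute. Qed.
Lemma fit7 : all (fun t => (0 < tlab tE7 t <= (la7 (tarm tE7 t)).+1)%N) (iota 0 (tt tE7)).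
Proof. by vm_compute. Qed.
Lemma wchk8 : wchk la8 tE8 w8. Proof. by vm_compute. Qed.
Lemma wchk7 : wchk la7 tE7 w7. Proof. by vm_compute. Qed.
Lemma ychk8 : ychk tE8 5. Proof. by vm_compute. Qed.
Lemma ychk7 : ychk tE7 1. Proof. by vm_compute. Qed.
Lemma ey8 : enum_eul la8 1 (tu tE8)%:Z (fun r k => (ydn tE8 5 r k)%:Z) (fun r k => (tdn tE8 r k)%:Z) = -1.
Proof. by apply/eqP; vm_compute. Qed.
Lemma ey7 : enum_eul la7 1 (tu tE7)%:Z (fun r k => (ydn tE7 1 r k)%:Z) (fun r k => (tdn tE7 r k)%:Z) = -1.
Proof. by apply/eqP; vm_compute. Qed.

Definition zgood la tb z := [&& zcheck la tb z, (zmu z, zla z) \in [:: (1, 0); (1, 1); (0, 1)] &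
  enum_eul la (tu tb)%:Z (zu z)%:Z (fun r k => (tdn tb r k)%:Z) (fun r k => (zdn z r k)%:Z) == 0].
Lemma zgood8 : all (zgood la8 tE8) z8. Proof. by vm_compute. Qed.
Lemma zgood7 : all (zgood la7 tE7) z7. Proof. by vm_compute. Qed.

Section Concrete.
Variable K : closedFieldType.

(** The seven equations and the vanishing of the defect cut the nine coordinates down to the line of
    delta, on which the form is zero. *)
Lemma span8 (x : qV (starQ (fun r : 'I_3 => la8 r)) -> int) : eul (@dlt la8 tE8) x = 0 ->
  (forall M Z N k c, is_rep M -> dz M =1 @dlt la8 tE8 -> semi (K:=K) (@dlt la8 tE8) M -> @exact _ K Z M N k c ->
     dfc (@dlt la8 tE8) Z = 0 -> eul x (dz Z) = 0) -> eul x x = 0.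
Proof.
move=> dx H.
pose z0 := @Ztbl 0 0 [::] [::] [::] [::] [::] [::] [::] [::].
have Z i : (i < size z8)%N -> let z := nth z0 z8 i in
    enum_eul la8 (x None) (zu z)%:Z (vx x) (fun r k => (zdn z r k)%:Z) = 0.
  move=> iz z; have /(all_nthP z0) /(_ i iz) /and3P [z1 z2 /eqP z3] := zgood8.
  exact: (z_orth ck8 spec8G fit8 H z1 z2 z3).
have E0 : enum_eul la8 (x None) 6 (vx x) (fun r k => (tdn tE8 r k)%:Z) = 0.
  by rewrite -(eul_num (numd_vx x) (delta_num la8 tE8)) (rad_star ck8 isT fit8 cst8 wchk8 (isT : (5 < tu tE8)%N) ychk8 ey8) dx oppr0.
have := Z 0%N isT; have := Z 1%N isT; have := Z 2%N isT; have := Z 3%N isT.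
have := Z 4%N isT; have := Z 5%N isT; have := Z 6%N isT; move: E0.
rewrite (eul_num (numd_vx x) (numd_vx x)) /enum_eul /isum /zdn /zu /tdn /=.
move: (x None) (vx x 0 0) (vx x 1 0) (vx x 1 1) (vx x 2 0) (vx x 2 1) (vx x 2 2) (vx x 2 3) (vx x 2 4).
move=> u a b0 b1 c0 c1 c2 c3 c *.
have -> : u = 6 * c by lia.
have -> : a = 3 * c by lia.
have -> : b0 = 4 * c by lia.
have -> : b1 = 2 * c by lia.
have -> : c0 = 5 * c by lia.
have -> : c1 = 4 * c by lia.
have -> : c2 = 3 * c by lia.
have -> : c3 = 2 * c by lia.
ring.
Qed.

Lemma span7 (x : qV (starQ (fun r : 'I_3 => la7 r)) -> int) : eul (@dlt la7 tE7) x = 0 ->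
  (forall M Z N k c, is_rep M -> dz M =1 @dlt la7 tE7 -> semi (K:=K) (@dlt la7 tE7) M -> @exact _ K Z M N k c ->
     dfc (@dlt la7 tE7) Z = 0 -> eul x (dz Z) = 0) -> eul x x = 0.
Proof.
move=> dx H.
pose z0 := @Ztbl 0 0 [::] [::] [::] [::] [::] [::] [::] [::].
have Z i : (i < size z7)%N -> let z := nth z0 z7 i in
    enum_eul la7 (x None) (zu z)%:Z (vx x) (fun r k => (zdn z r k)%:Z) = 0.
  move=> iz z; have /(all_nthP z0) /(_ i iz) /and3P [z1 z2 /eqP z3] := zgood7.
  exact: (z_orth ck7 spec7G fit7 H z1 z2 z3).
have E0 : enum_eul la7 (x None) 4 (vx x) (fun r k => (tdn tE7 r k)%:Z) = 0.
  by rewrite -(eul_num (numd_vx x) (delta_num la7 tE7)) (rad_star ck7 isT fit7 cst7 wchk7 (isT : (1 < tu tE7)%N) ychk7 ey7) dx oppr0.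
have := Z 0%N isT; have := Z 1%N isT; have := Z 2%N isT; have := Z 3%N isT.
have := Z 4%N isT; have := Z 5%N isT; move: E0.
rewrite (eul_num (numd_vx x) (numd_vx x)) /enum_eul /isum /zdn /zu /tdn /=.
move: (x None) (vx x 0 0) (vx x 1 0) (vx x 1 1) (vx x 1 2) (vx x 2 0) (vx x 2 1) (vx x 2 2).
move=> u a b0 b1 b2 c0 c1 c *.
have -> : u = 4 * c by lia.
have -> : a = 2 * c by lia.
have -> : b0 = 3 * c by lia.
have -> : b1 = 2 * c by lia.
have -> : b2 = c by lia.
have -> : c0 = 3 * c by lia.
have -> : c1 = 2 * c by lia.
ring.
Qed.

Lemma tame8 d : fin_many (fun M : rep (starQ (fun r : 'I_3 => la8 r)) K =>
  [/\ is_rep M, indec M, (rdim M <= d)%N & forall h t, ~ rep_iso M (SJ la8 tE8 h t)]).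
Proof.
exact: (star_tame ck8 isT spec8G fit8 cst8 wchk8 isT ychk8 ey8 span8).
Qed.

Lemma tame7 d : fin_many (fun M : rep (starQ (fun r : 'I_3 => la7 r)) K =>
  [/\ is_rep M, indec M, (rdim M <= d)%N & forall h t, ~ rep_iso M (SJ la7 tE7 h t)]).
Proof.
exact: (star_tame ck7 isT spec7G fit7 cst7 wchk7 isT ychk7 ey7 span7).
Qed.

End Concrete.

(** * Tameness *)

Section TameExc.
Variables (n m l : nat) (o : 'I_(m + n + l).+2 -> bool).
Hypothesis n1 : (0 < n)%N.
Hypotheses (ob : o (inord m)) (oa1 : ~~ o (inord m.+1)) (oan : ~~ o (inord (m + n)))
  (oc : ~~ o (inord (m + n).+1)).
Notation D := (excD o).
Notation E := (exc_alg o).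
Variables (la : nat -> nat) (tb : tbl) (s s' : 'I_3 -> 'I_3).
Notation lf := (fun r : 'I_3 => la r).
Hypotheses (ck : tcheck tb) (tu0 : (0 < tu tb)%N)
  (ss' : cancel s s') (s's : cancel s' s) (hla : forall r, al D (s r) = (la r).+1).
Hypothesis fit : all (fun t => (0 < tlab tb t <= (la (tarm tb t)).+1)%N) (iota 0 (tt tb)).
Variable K : closedFieldType.
Hypothesis starT : forall d, fin_many (fun M : rep (starQ lf) K =>
  [/\ is_rep M, indec M, (rdim M <= d)%N & forall h t, ~ rep_iso M (SJ la tb h t)]).
Let okD := exc_ok n1 ob oa1 oan oc.

Definition TOg (R : nzRingType) h (Theta : 'M[R]_h) : mobj R :=
  relabS s (fun r k => lab D (s r) k) (tabO tb 1%:M Theta (@lb0 tb h)).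

Lemma TOg_mok (R : nzRingType) h (Theta : 'M[R]_h) : mok D (TOg Theta).
Proof.
have := ex_mok hla (@TO_mok la K tb ck fit h 1%:M 0).
by [].
Qed.

(** The Jordan block with indeterminate eigenvalue, so that all [SJ h t] with fixed h form one
    family over K[x]. *)
Definition Pth h : 'M[{poly K}]_h := 'X%:M + map_mx polyC (shift K h).

Lemma Pth_eval h (t : K) : map_mx (fun p : {poly K} => p.[t]) (Pth h) = t%:M + shift K h.
Proof.
apply/matrixP => i j; rewrite !mxE hornerD hornerC; congr (_ + _).
by case: (i == j); rewrite ?mulr1n ?mulr0n ?hornerX ?horner0.
Qed.

Lemma horner_natb (b : bool) (t : K) : (b%:R : {poly K}).[t] = b%:R.
Proof. by case: b; rewrite ?hornerE. Qed.

Lemma TOg_spec h (t : K) : rep_iso (att D (TOg (t%:M + shift K h)))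
  (spec_rep (fun v => fmx (@atte E D {poly K} (TOg (Pth h)) v))
            (fun a => fmx (@attX E D {poly K} (TOg (Pth h)) a)) t).
Proof.
have e1 v : re (att D (TOg (t%:M + shift K h))) v =
    map_mx (fun p : {poly K} => p.[t]) (fmx (@atte E D {poly K} (TOg (Pth h)) v)).
  by rewrite map_fmx /=; apply: eq_fmx => x y; rewrite /atte horner_natb.
have e2 a : rX (att D (TOg (t%:M + shift K h))) a =
    map_mx (fun p : {poly K} => p.[t]) (fmx (@attX E D {poly K} (TOg (Pth h)) a)).
  rewrite map_fmx /=; apply: eq_fmx => x y.
  case: x => [u|c]; first by rewrite /= horner0.
  case: y => [u|c'].
    rewrite /= hornerM horner_natb -Pth_eval; congr (_ * _).
    case: (tG tb (tag c).1 u.1) => [|[|[|k]]] /=; rewrite ?[in RHS]mxE ?mxE //.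
    - by rewrite horner0.
    - by rewrite horner_natb.
    - by rewrite horner_natb.
  by rewrite /= /cstep hornerD !horner_natb.
exists (1%:M : 'M_(#|{: ix (TOg (t%:M + shift K h))}|)), 1%:M; split; [|by rewrite mul1mx|by rewrite mul1mx].
by split=> [v|a]; rewrite mul1mx mulmx1; [exact: e1 | exact: e2].
Qed.

Lemma trivial_ax (R : nzRingType) d : rep_ax (Q := E) (fun v => if v == None then (1%:M : 'M[R]_d) else 0) (fun _ => 0).
Proof.
split=> [v|v v' vv|| a|a b _]; rewrite ?mulmx0 ?mul0mx //.
- by case: eqP; rewrite ?mulmx1 ?mulmx0.
- have [e|_] := v =P None; last by rewrite mul0mx.
  by move: vv; rewrite e eq_sym => /negPf ->; rewrite mulmx0.
- by rewrite (bigD1 None) //= big1 ?addr0 // => v /negPf ->.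
Qed.

(** Tameness asks for families of rank exactly d. If the family of the h-th strings has another
    rank, a constant one takes its place. *)
Lemma family_ex d h : exists (Pe : qV E -> 'M[{poly K}]_d) (PX : qA E -> 'M[{poly K}]_d),
  rep_ax Pe PX /\ (#|{: ix (TOg (Pth h))}| = d -> forall t : K,
    rep_iso (att D (TOg (t%:M + shift K h))) (spec_rep Pe PX t)).
Proof.
have [e|ne] := classic (#|{: ix (TOg (Pth h))}| = d).
  subst d; exists (fun v => fmx (@atte E D {poly K} (TOg (Pth h)) v)), (fun a => fmx (@attX E D {poly K} (TOg (Pth h)) a)).
  split; first by apply: (att_rep_ax okD); apply: TOg_mok.
  by move=> _ t; apply: TOg_spec.
by exists (fun v => if v == None then 1%:M else 0), (fun _ => 0); split=> //; apply: trivial_ax.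
Qed.

Lemma card_ix_le (O : mobj K) L : (forall t : mT O, (mn t <= L)%N) ->
  (#|{: ix O}| <= #|mU O| + #|mT O| * L)%N.
Proof.
move=> h; rewrite card_sum leq_add2l card_tagged sumnE big_map big_enum /=.
rewrite -sum_nat_const; apply: leq_sum => t _; by rewrite card_ord.
Qed.

Lemma card_ix_ge (O : mobj K) : mok D O -> (#|mU O| + #|mT O| <= #|{: ix O}|)%N.
Proof.
move=> h; rewrite card_sum leq_add2l card_tagged sumnE big_map big_enum /=.
rewrite -sum1_card; apply: leq_sum => t _; rewrite card_ord.
by have /andP [] := h t.
Qed.

Lemma tame_exc : tame K E.
Proof.
move=> d; pose L := (\max_(r : 'I_3) (la r).+1)%N.
have fam h := family_ex d h.
pose Pe (h : 'I_d.+1) := wit (fam h).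
have PeP (h : 'I_d.+1) := witP (fam h).
pose PX (h : 'I_d.+1) := wit (PeP h).
have PXP (h : 'I_d.+1) := witP (PeP h).
(* A module of dimension d has at most d basis vectors of U and labelled vectors together, and ranks
   are at most L, so its star representation has dimension at most d + d L. *)
have F := fin_transfer okD s's hla (starT (d + d * L)).
have [T [F0 [Fr FP]]] := fin_many_or (ethin_many n1 ob oa1 oan oc K) F.
exists d.+1, Pe, PX, #|T|, (fun i => F0 (enum_val i)); split=> [h|M hM iM Md]; first by have [] := PXP h.
have fin : (exists t, rep_iso M (F0 t)) -> exists i : 'I_#|T|, rep_iso M (F0 (enum_val i)).
  by move=> [t it]; exists (enum_rank t); rewrite enum_rankK.
case: (exc_dec n1 ob oa1 oan oc hM iM) => [h|[O [h i]]]; first by left; apply: fin; apply: FP; left.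
have mk := cv_mok s's hla h.
have Od : #|{: ix O}| = d by have := iso_dim i; rewrite Md /= => <-.
have UT := card_ix_ge h.
have bnd : (rdim (att (starD lf) (cv D s' O)) <= d + d * L)%N.
  apply: (@leq_trans (#|mU O| + #|mT O| * L)).
    apply: (@card_ix_le (cv D s' O) L) => t; have /andP [_ le] := mk t.
    by apply: leq_trans le _; apply: (@leq_bigmax _ (fun r : 'I_3 => (la r).+1)).
  apply: leq_add; first by rewrite -Od; apply: leq_trans (leq_addr _ _) UT.
  by rewrite leq_mul2r -Od (leq_trans (leq_addl _ _) UT) orbT.
have [[h0 [t0 it]]|no] := classic (exists h t, rep_iso (att (starD lf) (cv D s' O)) (SJ la tb h t)); last first.
  left; apply: fin; apply: FP; right; exists O; split=> //; split=> //.
  - by apply: (att_rep (star_ok _)).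
  - exact: (cv_indec s's hla h (iso_indec i iM)).
  by move=> h0 t0 it; apply: no; exists h0, t0.
right.
have it2 := ex_transfer ss' s's hla h (@TO_mok la K tb ck fit h0 1%:M (t0%:M + shift K h0)) it.
have it3 : rep_iso M (att D (TOg (t0%:M + shift K h0))) by apply: iso_trans i it2.
have cd : #|{: ix (TOg (Pth h0))}| = d by have := iso_dim it3; rewrite Md /= => <-.
have hd : (h0 < d.+1)%N.
  rewrite ltnS -cd card_sum; apply: leq_trans (leq_addr _ _).
  by rewrite card_prod !card_ord leq_pmull.
exists (Ordinal hd), t0; apply: iso_trans it3 _.
by have [_ H] := PXP (Ordinal hd); apply: H.
Qed.

End TameExc.

(** * Duality *)

(** Leibniz equality of representations, which lets double duals be rewritten away, needs functional
    extensionality. *)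
Lemma rep_eq (Q : bquiver) (K : fieldType) d (e e' : qV Q -> 'M[K]_d) (X X' : qA Q -> 'M[K]_d) :
  e =1 e' -> X =1 X' -> Rep (Q := Q) e X = Rep (Q := Q) e' X'.
Proof. by move=> /functional_extensionality -> /functional_extensionality ->. Qed.

Section Dual.
Variables (V A : finType) (s t : A -> V) (r : A -> A -> bool).
Notation Q := (@BQuiver V A s t r).
Notation Q' := (@BQuiver V A t s (fun a b => r b a)).

Definition dual (K : fieldType) (M : rep Q K) : rep Q' K :=
  @Rep Q' K (rdim M) (fun v => (re M v)^T) (fun a => (rX M a)^T).

Lemma rep_ax_dual (R : comNzRingType) N (e : V -> 'M[R]_N) (X : A -> 'M[R]_N) :
  rep_ax (Q := Q) e X -> rep_ax (Q := Q') (fun v => (e v)^T) (fun a => (X a)^T).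
Proof.
move=> [h1 h2 h3 h4 h5]; split=> [v|v w vw||a|a b ab].
- by rewrite -trmx_mul h1.
- by rewrite -trmx_mul h2 ?trmx0 // eq_sym.
- by rewrite -trmx1 -h3 raddf_sum.
- by rewrite {1}h4 !trmx_mul mulmxA.
- by rewrite -trmx_mul h5 ?trmx0.
Qed.

Lemma rep_dual (K : fieldType) (M : rep Q K) : is_rep M -> is_rep (dual M).
Proof. exact: rep_ax_dual. Qed.

Lemma hom_dual (K : fieldType) (M N : rep Q K) P : hom M N P -> hom (dual N) (dual M) P^T.
Proof. by move=> [h1 h2]; split=> i; rewrite /= -!trmx_mul ?h1 ?h2. Qed.

End Dual.

Section DualTransfer.
Variables (V A : finType) (s t : A -> V) (r : A -> A -> bool) (K : fieldType).
Notation Q := (@BQuiver V A s t r).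

Lemma dualK (M : rep Q K) : dual (dual M) = M.
Proof. by case: M => d e X; apply: (@rep_eq Q) => v; rewrite /= trmxK. Qed.

Lemma iso_dual (M N : rep Q K) : rep_iso M N -> rep_iso (dual M) (dual N).
Proof.
move=> [P [P' [h e1 e2]]]; exists P'^T, P^T; split.
- exact: (hom_dual (hom_inv h e1 e2)).
- by rewrite -trmx_mul e1 trmx1.
- by rewrite -trmx_mul e2 trmx1.
Qed.

Lemma indec_dual (M : rep Q K) : indec M -> indec (dual M).
Proof.
move=> [d h]; split=> // P hP PP.
have hP' : hom M M P^T.
  case: hP => h1 h2; split=> i; apply: trmx_inj; rewrite !trmx_mul trmxK; symmetry; [exact: h1 | exact: h2].
have := h _ hP'; rewrite -trmx_mul PP => /(_ erefl) [e|e].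
  by left; rewrite -[P]trmxK e trmx0.
by right; rewrite -[P]trmxK e trmx1.
Qed.

End DualTransfer.

Section DualTypes.
Variables (V A : finType) (s t : A -> V) (r : A -> A -> bool) (K : fieldType).
Notation Q := (@BQuiver V A s t r).
Notation Q' := (@BQuiver V A t s (fun a b => r b a)).

Lemma iso_dual' (M : rep Q' K) (N : rep Q K) : rep_iso (dual M) N -> rep_iso M (dual N).
Proof. by move/iso_dual; rewrite (@dualK V A t s (fun a b => r b a) K M). Qed.

Lemma finite_dual : rep_finite K Q -> rep_finite K Q'.
Proof.
move=> [k [F [rF h]]]; exists k, (fun i => dual (F i)); split=> [i|M hM iM]; first exact: rep_dual.
by have [i hi] := h (dual M) (rep_dual hM) (indec_dual iM); exists i; apply: iso_dual'.
Qed.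

Lemma tame_dual : tame K Q -> tame K Q'.
Proof.
move=> h d; have [k [Pe [PX [k' [G [ax hG]]]]]] := h d.
exists k, (fun i v => (Pe i v)^T), (fun i a => (PX i a)^T), k', (fun i => dual (G i)).
split=> [i|M hM iM Md]; first exact: rep_ax_dual.
have [[i hi]|[i [lam hi]]] := hG (dual M) (rep_dual hM) (indec_dual iM) Md.
  by left; exists i; apply: iso_dual'.
right; exists i, lam.
have -> : spec_rep (Q := Q') (fun v => (Pe i v)^T) (fun a => (PX i a)^T) lam = dual (spec_rep (Q := Q) (Pe i) (PX i) lam).
  by apply: (@rep_eq Q') => v; rewrite /= map_trmx.
exact: iso_dual'.
Qed.

(** The anti-automorphism of K<x, y> fixing x and y; transposition of matrices reverses products. *)
Fixpoint ncrev (p : ncexpr K) : ncexpr K :=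
  match p with
  | NCadd p q => NCadd (ncrev p) (ncrev q)
  | NCmul p q => NCmul (ncrev q) (ncrev p)
  | p => p
  end.

Lemma nceval_rev n (X Y : 'M[K]_n) p : nceval X Y (ncrev p) = (nceval X^T Y^T p)^T.
Proof.
elim: p => [c|||p IH q IH'|p IH q IH'] /=; rewrite ?trmxK ?tr_scalar_mx //.
  by rewrite IH IH' raddfD.
by rewrite IH IH' trmx_mul.
Qed.

Lemma functor_dual k (Pe : V -> 'I_k -> 'I_k -> ncexpr K) (PX : A -> 'I_k -> 'I_k -> ncexpr K)
    n (X Y : 'M[K]_n) :
  nc_functor (Q := Q') (fun v i j => ncrev (Pe v j i)) (fun a i j => ncrev (PX a j i)) X Y =
  dual (nc_functor (Q := Q) Pe PX X^T Y^T).
Proof.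
apply: (@rep_eq Q') => v; rewrite /= /ncsubst tr_mxblock;
  by apply: eq_mxblock => i j; apply: nceval_rev.
Qed.

Lemma kxy_dual n (X Y : 'M[K]_n) : dual (kxy_mod X Y : rep (@BQuiver unit bool _ _ _) K) = kxy_mod X^T Y^T.
Proof. by apply: (@rep_eq loop2) => -[]; rewrite /= ?trmx1. Qed.

(** The embedding for the opposite quiver is the given one, conjugated by duality on both sides;
    transposed modules over the free algebra are again such modules. *)
Lemma wild_dual : wild K Q -> wild K Q'.
Proof.
move=> [k [Pe [PX [h1 h2 h3]]]].
exists k, (fun v i j => ncrev (Pe v j i)), (fun a i j => ncrev (PX a j i)).
split=> [n X Y|n X Y iX|n X Y n' X' Y'].
- by rewrite functor_dual; apply: rep_dual; apply: h1.
- rewrite functor_dual; apply: indec_dual; apply: h2.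
  by rewrite -kxy_dual; apply: indec_dual.
- rewrite !functor_dual => /(@iso_dual _ _ _ _ _ K).
  rewrite (@dualK V A s t r K) (@dualK V A s t r K) => /h3 /(@iso_dual _ _ _ _ _ K).
  by rewrite !kxy_dual !trmxK.
Qed.

End DualTypes.

Lemma BQuiver_eq (V A : finType) (s t s' t' : A -> V) r r' :
  s =1 s' -> t =1 t' -> r =2 r' -> @BQuiver V A s t r = @BQuiver V A s' t' r'.
Proof.
move=> /functional_extensionality -> /functional_extensionality -> h; congr BQuiver.
by apply: functional_extensionality => a; apply: functional_extensionality => b; apply: h.
Qed.

(** Reversing all arrows is negating o; the relations added by gluing are symmetric under exchanging
    i with j and the two arrows. *)
Lemma exc_alg_opp n m l (o : 'I_(m + n + l).+2 -> bool) (Q := exc_alg o) :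
  @BQuiver (qV Q) (qA Q) (@qt Q) (@qs Q) (fun a b => qrel b a) = exc_alg (fun k => ~~ o k).
Proof.
apply: BQuiver_eq => [a|a|a b] /=; rewrite ?if_neg //.
by rewrite orbC; congr (_ || _); rewrite andbC.
Qed.

(** * The classification *)

Lemma arms_perm (s0 s1 s2 : nat) : perm_eq [:: s0; s1; s2] [:: 0; 1; 2]%N ->
  exists s s' : 'I_3 -> 'I_3, [/\ cancel s s', cancel s' s &
    forall r, s r = nth 0%N [:: s0; s1; s2] r :> nat].
Proof.
move=> p; have lt r : (nth 0%N [:: s0; s1; s2] r < 3)%N.
  have [h|h] := ltnP r 3; last by rewrite nth_default.
  by have := mem_nth 0%N (h : (r < size [:: s0; s1; s2])%N); rewrite (perm_mem p) !inE; case/or3P => /eqP ->.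
pose s (r : 'I_3) : 'I_3 := Ordinal (lt r).
have [s' k1 k2] : bijective s.
  apply: injF_bij => r r' /(congr1 val) /= /eqP.
  by rewrite nth_uniq ?(perm_uniq p) // => /eqP /val_inj.
by exists s, s'.
Qed.

Lemma uniq_seqs (K : closedFieldType) k : exists s : seq K, uniq s && (size s == k).
Proof.
elim: k => [|k [s /andP [us /eqP es]]]; first by exists [::].
by have [t ts] := @avoid K s; exists (t :: s); rewrite /= ts us es eqxx.
Qed.

Section Cases.
Variables (K : closedFieldType) (n m l : nat) (o : 'I_(m + n + l).+2 -> bool).
Hypothesis n1 : (0 < n)%N.
Hypotheses (ob : o (inord m)) (oa1 : ~~ o (inord m.+1)) (oan : ~~ o (inord (m + n)))
  (oc : ~~ o (inord (m + n).+1)).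
Notation E := (exc_alg o).

(** The arms, in some order, have a + 1, b + 1 and c + 1 vertices. *)
Definition arms (a b c : nat) := exists s s' : 'I_3 -> 'I_3, [/\ cancel s s', cancel s' s &
  forall r : 'I_3, al (excD o) (s r) = (nth 0 [:: a; b; c] r).+1]%N.

Lemma armsP : [/\ arms m l (n + l), arms m (n + l) l, arms l m (n + l),
  arms l (n + l) m & arms (n + l) m l /\ arms (n + l) l m].
Proof.
have e s0 s1 s2 (p : perm_eq [:: s0; s1; s2] [:: 0; 1; 2]%N) a b c :
    exl n m l s0 = a.+1 -> exl n m l s1 = b.+1 -> exl n m l s2 = c.+1 -> arms a b c.
  move=> e0 e1 e2; have [s [s' [k1 k2 h]]] := arms_perm p; exists s, s'; split=> // r.
  by rewrite /= h; case: r => [[|[|[|r]]] hr].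
split; [exact: (e 0 1 2)%N | exact: (e 0 2 1)%N | exact: (e 1 0 2)%N | exact: (e 1 2 0)%N |].
by split; [exact: (e 2 0 1)%N | exact: (e 2 1 0)%N].
Qed.

(** Labels beyond the table are zero, so maximality of the label of tc on its arm can be required
    for all natural numbers; the summand [t == tc] asks for room for one further vertex. *)
Lemma wild_arms tb tc a b c : tcheck tb -> spec1 tb tc -> (0 < tu tb)%N ->
  all (fun t => (tarm tb t == tarm tb tc) ==> (tlab tb t <= tlab tb tc)%N) (iota 0 (tt tb)) ->
  all (fun t => (0 < tlab tb t)%N) (iota 0 (tt tb)) ->
  (forall r, (r < 3)%N -> all (fun t => (tarm tb t == r) ==>
     (tlab tb t + (t == tc) <= (nth 0 [:: a; b; c] r).+1)%N) (iota 0 (tt tb))) ->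
  (forall t, (tt tb <= t)%N -> tlab tb t = 0%N) ->
  arms a b c -> wild K E.
Proof.
move=> ck sp tu0 /allP top /allP pos fit def [s [s' [k1 k2 h]]].
apply: (wild_exc n1 ob oa1 oan oc ck sp tu0 k1 h) => [t ta|t lt].
  have [lt|ge] := ltnP t (tt tb); last by rewrite def.
  by have := top t; rewrite mem_iota ta eqxx; apply.
rewrite pos ?mem_iota //=; have [a3 _ _ _] := tck ck lt.
by have /allP /(_ t) := fit _ a3; rewrite mem_iota eqxx inordK //; apply.
Qed.

(** The extended diagram E6~ has arms (1, 1, 1) in this counting; the arm c must be longer by one.
    Likewise E7~ is (0, 2, 2) and E8~ is (0, 1, 4) in the next two lemmas. *)
Lemma wild6 a b c : (1 <= a)%N -> (1 <= b)%N -> (2 <= c)%N -> arms a b c -> wild K E.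
Proof.
move=> ha hb hc; apply: (wild_arms ck6 spec1_6) => //; last first.
- by move=> t h; rewrite /tlab /= nth_default.
- by case=> [|[|[|r]]] // _; rewrite /= /tlab /tarm /=; lia.
Qed.

Lemma wild7 a b c : a = 0%N -> (2 <= b)%N -> (3 <= c)%N -> arms a b c -> wild K E.
Proof.
move=> -> hb hc; apply: (wild_arms ck7 spec1_7) => //; last first.
- by move=> t h; rewrite /tlab /= nth_default.
- by case=> [|[|[|r]]] // _; rewrite /= /tlab /tarm /=; lia.
Qed.

Lemma wild8 a b c : a = 0%N -> (1 <= b)%N -> (5 <= c)%N -> arms a b c -> wild K E.
Proof.
move=> -> hb hc; apply: (wild_arms ck8 spec1_8) => //; last first.
- by move=> t h; rewrite /tlab /= nth_default.
- by case=> [|[|[|r]]] // _; rewrite /= /tlab /tarm /=; lia.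
Qed.

Lemma tame_arms8 a b c : a = 0%N -> b = 1%N -> c = 4%N -> arms a b c -> tame K E /\ ~ rep_finite K E.
Proof.
move=> -> -> -> [s [s' [k1 k2 h]]]; split.
  exact: (tame_exc n1 ob oa1 oan oc ck8 isT k1 k2 h fit8 (@tame8 K)).
apply: (infinite_exc n1 ob oa1 oan oc ck8 spec1_8 isT k1 h _ (@uniq_seqs K)).
exact: (@TO_mok la8 K tE8 ck8 fit8 1 1%:M 0).
Qed.

Lemma tame_arms7 a b c : a = 0%N -> b = 2%N -> c = 2%N -> arms a b c -> tame K E /\ ~ rep_finite K E.
Proof.
move=> -> -> -> [s [s' [k1 k2 h]]]; split.
  exact: (tame_exc n1 ob oa1 oan oc ck7 isT k1 k2 h fit7 (@tame7 K)).
apply: (infinite_exc n1 ob oa1 oan oc ck7 spec1_7 isT k1 h _ (@uniq_seqs K)).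
exact: (@TO_mok la7 K tE7 ck7 fit7 1 1%:M 0).
Qed.

Lemma finite_arms : (0 < (m.+2%:R^-1 + l.+2%:R^-1 + (n + l).+2%:R^-1 - 1) / 2 :> rat) -> rep_finite K E.
Proof.
by move=> h; apply: (exc_finite n1 ob oa1 oan oc); rewrite /cst !big_ord_recr big_ord0 /= add0r.
Qed.

Lemma theorem4p2_inward :
  [/\ ((m == 0) && (l == 0)) || ((l == 0) && (m == 1) && (n <= 3)) ||
      ((l == 0) && (2 <= m <= 3) && (n == 1)) || ((m == 0) && (l == 1) && (n <= 2)) ->
        rep_finite K (exc_alg o),
      ((l == 0) && (m == 1) && (n == 4)) || ((l == 0) && (m == 2) && (n == 2)) ||
      ((l == 0) && (m == 4) && (n == 1)) || ((m == 0) && (l == 1) && (n == 3)) ->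
        tame K (exc_alg o) /\ ~ rep_finite K (exc_alg o)
    & ~~ (((m == 0) && (l == 0)) || ((l == 0) && (m == 1) && (n <= 3)) ||
          ((l == 0) && (2 <= m <= 3) && (n == 1)) || ((m == 0) && (l == 1) && (n <= 2))) ->
      ~~ (((l == 0) && (m == 1) && (n == 4)) || ((l == 0) && (m == 2) && (n == 2)) ||
          ((l == 0) && (m == 4) && (n == 1)) || ((m == 0) && (l == 1) && (n == 3))) ->
        wild K (exc_alg o)]%N.
Proof.
have [s012 s021 s102 s120 [s201 s210]] := armsP.
split.
- move=> H; apply: finite_arms.
  have p : (0 < n.+2%:R^-1 :> rat) by rewrite invr_gt0 ltr0n.
  (* For m = l = 0 the star is of type D and 1/2 + 1/2 already makes 1, for all n; the remaining
     finite cases are seven triples. *)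
  have [/andP [/eqP -> /eqP ->]|]: (m == 0) && (l == 0) \/
      (m, l, n) \in [:: (1, 0, 1); (1, 0, 2); (1, 0, 3); (2, 0, 1); (3, 0, 1); (0, 1, 1); (0, 1, 2)]%N.
    by rewrite !inE !xpair_eqE; lia.
  + rewrite addn0 (_ : 0.+2%:R^-1 + 0.+2%:R^-1 = 1 :> rat); last by vm_compute.
    by rewrite addrAC subrr add0r divr_gt0 // ltr0n.
  + by rewrite !inE !xpair_eqE => H'; do !case/orP: H' => H';
      case/andP: H' => /andP [/eqP -> /eqP ->] /eqP ->; vm_compute.
- move=> H.
  have : [|| [&& l == 0, m == 1 & n == 4], [&& l == 0, m == 2 & n == 2], [&& l == 0, m == 4 & n == 1] |
     [&& l == 1, m == 0 & n == 3]]%N by lia.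
  case/or4P => /and3P [/eqP el /eqP em /eqP en].
  + by apply: tame_arms8 s102; lia.
  + by apply: tame_arms7 s102; lia.
  + by apply: tame_arms8 s120; lia.
  + by apply: tame_arms8 s012; lia.
- move=> F T.
  (* If m and l are positive, the third arm has n + l >= 2 and E6~ is exceeded. If one of them is
     zero, the sizes of the other two arms decide between E7~ and E8~. *)
  have [m0|m1] := posnP m; last have [l0|l1] := posnP l.
  + have [l1|l2] : l = 1%N \/ (2 <= l)%N by lia.
      by apply: wild8 s012; lia.
    by apply: wild7 s012; lia.
  + have [[em|en]|[em en]] : (m = 1%N \/ n = 1%N) \/ (2 <= m)%N /\ (2 <= n)%N by lia.
    * by apply: wild8 s102; lia.
    * by apply: wild8 s120; lia.
    * have [e2|e2] : (m = 2 \/ 2 < m)%N by lia.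
        by apply: wild7 s102; lia.
      by apply: wild7 s120; lia.
  + by apply: wild6 s012; lia.
Qed.

End Cases.

Lemma wild_dual_opp K n m l (o : 'I_(m + n + l).+2 -> bool) :
  [/\ rep_finite K (exc_alg (fun k => ~~ o k)) <-> rep_finite K (exc_alg o),
      tame K (exc_alg (fun k => ~~ o k)) -> tame K (exc_alg o) &
      wild K (exc_alg (fun k => ~~ o k)) -> wild K (exc_alg o)].
Proof.
rewrite -exc_alg_opp; case: (exc_alg o) => V A s t r /=.
by split; [split; exact: finite_dual | exact: tame_dual | exact: wild_dual].
Qed.
Local Close Scope ring_scope.

Theorem theorem4p2 (K : closedFieldType) (n m l : nat)
  (o : 'I_(m + n + l).+2 -> bool) :
  (1 <= n)%N -> exc_orientation o ->
  [/\ ((m == 0) && (l == 0)) || ((l == 0) && (m == 1) && (n <= 3)) ||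
      ((l == 0) && (2 <= m <= 3) && (n == 1)) || ((m == 0) && (l == 1) && (n <= 2)) ->
        rep_finite K (exc_alg o),
      ((l == 0) && (m == 1) && (n == 4)) || ((l == 0) && (m == 2) && (n == 2)) ||
      ((l == 0) && (m == 4) && (n == 1)) || ((m == 0) && (l == 1) && (n == 3)) ->
        tame K (exc_alg o) /\ ~ rep_finite K (exc_alg o)
    & ~~ (((m == 0) && (l == 0)) || ((l == 0) && (m == 1) && (n <= 3)) ||
          ((l == 0) && (2 <= m <= 3) && (n == 1)) || ((m == 0) && (l == 1) && (n <= 2))) ->
      ~~ (((l == 0) && (m == 1) && (n == 4)) || ((l == 0) && (m == 2) && (n == 2)) ||
          ((l == 0) && (m == 4) && (n == 1)) || ((m == 0) && (l == 1) && (n == 3))) ->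
        wild K (exc_alg o)].

Proof.
move=> n1 [/andP [/andP [/andP [h1 h2] h3] h4]|/andP [/andP [/andP [h1 h2] h3] h4]].
  exact: theorem4p2_inward.
have [F T W] := @wild_dual_opp K n m l o.
have [] := @theorem4p2_inward K n m l (fun k => ~~ o k) n1 h1 _ _ _; rewrite ?negbK // => f t w.
split=> [/f /F //|/t [/T ? nf]|a b]; last by apply: W; apply: w.
by split=> // /F.
Qed.
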